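(* Let $M\subset\mathbb{C}^N$ and $M'\subset\mathbb{C}^{N'}$ be connected real ($C^\infty$) hypersurfaces, $p_0\in M$, and $M$ of finite type at $p_0$. Let $H:M\to M'$ and $H':M\to M'$ be $C^\infty$-CR mappings which are constantly $(k_0,s)$-degenerate at $p_0$ with $j^{2k_0}_{p_0}H=j^{2k_0}_{p_0}H'$. Write $p_0'=H(p_0)$ and assume that at least one of the following holds: (P1) $M'$ is strictly pseudoconvex at $p_0'$; (P2) $N'=N+1$, $M$ and $M'$ are Levi-nondegenerate at $p_0$ and $p_0'$, respectively, and $H$ is transversal at $p_0$. Then $j^l_{p_0}H=j^l_{p_0}H'$ for all $l$.
   Context: $M$ is of finite type at $p$ (Kohn–Bloom–Graham) if the CR and anti-CR vector fields tangent to $M$ together with their commutators of all lengths span the complexified tangent space of $M$ at $p$. $j^k_{p_0}f$ denotes the $k$-jet of $f$ at $p_0$. Degeneracy: let $H:M\to M'$ be a $C^\infty$-CR map, $\rho'$ a defining function for $M'$ near $H(p_0)$, $\rho'_{Z'}=(\partial\rho'/\partial Z'_1,\dots,\partial\rho'/\partial Z'_{N'})$ its complex gradient, $n=N-1$, and $L_1,\dots,L_n$ a local basis of the CR-vector fields on $M$ (type $(0,1)$) near $p_0$. For $\alpha\in\mathbb{N}^n$ put $L^\alpha=L_1^{\alpha_1}\cdots L_n^{\alpha_n}$, and for $p\in M$ near $p_0$ set $$E'_k(p)=\operatorname{span}_{\mathbb{C}}\{L^\alpha\rho'_{Z'}(H(Z),\overline{H(Z)})|_{Z=p}:|\alpha|\le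 k\}\subset\mathbb{C}^{N'},\qquad s(p)=N'-\max_k\dim_{\mathbb{C}}E'_k(p).$$ $H$ is $(k_0,s)$-degenerate at $p_0$ if $s=s(p_0)$ and $k_0$ is the least integer with $E'_k(p_0)=E'_{k_0}(p_0)$ for all $k\ge k_0$; it is constantly $(k_0,s)$-degenerate at $p_0$ if in addition $s(p)=s$ for all $p$ in a neighbourhood of $p_0$ in $M$. (These notions do not depend on the choices made.) Transversality: put $p_0=0$, $p_0'=0$, replace $H$ by its formal holomorphic power series at $p_0$ (the formal power series $H(Z)$ whose restriction to $M$ has the same Taylor series at $p_0$ as $H$), and identify defining functions $\rho,\rho'$ with their Taylor series $\rho(Z,\zeta),\rho'(Z',\zeta')$ ($\bar Z$ replaced by $\zeta$, $\bar Z'$ by $\zeta'$). $H$ is transversal at $p_0$ if $\rho'(H(Z),\bar H(\zeta))$ generates the ideal $(\rho)\subset\mathbb{C}[[Z,\zeta]]$. *)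

(* Defs.v *)
(* C^N is 'rV[R[i]]_N for R : realType, with its library topology; partial
   derivatives are real ones, taken along real lines. *)
From HB Require Import structures.
From mathcomp Require Import all_boot all_order all_algebra.
From mathcomp Require Import complex.
From mathcomp Require Import all_classical all_reals all_analysis.

Set Implicit Arguments.
Unset Strict Implicit.
Unset Printing Implicit Defensive.

Import Order.TTheory GRing.Theory Num.Theory numFieldNormedType.Exports.

Local Open Scope ring_scope.
Local Open Scope classical_set_scope.
Local Open Scope complex_scope.

HB.instance Definition _ (R : realType) :=
  NormedModule.copy R[i] (R[i] : numFieldType)^o.

Definition mindex (m : nat) := {ffun 'I_m -> nat}.

Definition mdeg m (a : mindex m) : nat := (\sum_i a i)%N.

Definition mfact m (a : mindex m) : nat := (\prod_i (a i)`!)%N.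

(* The duplicate-free list of all multi-indices of degree at most d. *)
Definition mindices (m d : nat) : seq (mindex m) :=
  [seq a <- [seq [ffun i => val (b i)] | b : {ffun 'I_m -> 'I_d.+1}]
     | (mdeg a <= d)%N].

(* D^a f = D_0^(a_0) (D_1^(a_1) (... f)) *)
Definition miter m T (D : 'I_m -> T -> T) (a : mindex m) (f : T) : T :=
  foldr (fun i g => iter (a i) (D i) g) f (enum 'I_m).

Section Smooth.
Context {R : realType}.
Local Notation C := R[i].

Definition cderive1 (g : R -> C) (t : R) : C :=
  (fun u => complex.Re (g u))^`() t +i* (fun u => complex.Im (g u))^`() t.

Definition cderivable1 (g : R -> C) (t : R) : Prop :=
  derivable (fun u => complex.Re (g u)) t 1 /\
  derivable (fun u => complex.Im (g u)) t 1.

Definition smooth_curve N (gam : R -> 'rV[C]_N) : Prop :=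
  forall (n : nat) (j : 'I_N) (t : R),
    cderivable1 (iter n cderive1 (fun u => gam u 0 j)) t.

Definition cline N (f : 'rV[C]_N -> C) (p v : 'rV[C]_N) : R -> C :=
  fun t => f (p + t%:C *: v).

Definition dirD N (v : 'rV[C]_N) (f : 'rV[C]_N -> C) : 'rV[C]_N -> C :=
  fun p => cderive1 (cline f p v) 0.

(* C^infty on the open set U: all iterated real directional derivatives exist
   and are continuous. *)
Definition smooth_on N (U : set 'rV[C]_N) (f : 'rV[C]_N -> C) : Prop :=
  forall (vs : seq 'rV[C]_N) (p : 'rV[C]_N), U p ->
    let g := foldr (@dirD N) f vs in
    {for p, continuous g} /\ (forall v, cderivable1 (cline g p v) 0).

Definition smooth_map_on N N' (U : set 'rV[C]_N) (G : 'rV[C]_N -> 'rV[C]_N') :=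
  forall j, smooth_on U (fun z => G z 0 j).

Definition open_nbhd N (p : 'rV[C]_N) (U : set 'rV[C]_N) : Prop :=
  open U /\ U p.

Definition baseC N (j : 'I_N) : 'rV[C]_N := delta_mx 0 j.

(* The Wirtinger derivatives d/dZ_j and d/d(conj Z_j). *)
Definition dZ N (j : 'I_N) (f : 'rV[C]_N -> C) : 'rV[C]_N -> C :=
  fun p => (dirD (baseC j) f p - 'i%C * dirD ('i%C *: baseC j) f p) / 2%:R.

Definition dZb N (j : 'I_N) (f : 'rV[C]_N -> C) : 'rV[C]_N -> C :=
  fun p => (dirD (baseC j) f p + 'i%C * dirD ('i%C *: baseC j) f p) / 2%:R.

Definition toC N (rho : 'rV[C]_N -> R) : 'rV[C]_N -> C := fun z => (rho z)%:C.

(* For real-valued rho, d(rho) <> 0 iff the complex gradient is nonzero. *)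
Definition defining N (M : set 'rV[C]_N) (p : 'rV[C]_N) (U : set 'rV[C]_N)
    (rho : 'rV[C]_N -> R) : Prop :=
  [/\ open_nbhd p U,
      smooth_on U (toC rho),
      (forall q, U q -> \row_j dZ j (toC rho) q != 0) &
      (forall q, U q -> (M q <-> rho q = 0))].

Definition real_hypersurface N (M : set 'rV[C]_N) : Prop :=
  forall p, M p -> exists U rho, defining M p U rho.

(* The pair (a, b) stands for the complex tangent vector
   sum_j a_j d/dZ_j + b_j d/d(conj Z_j). *)
Definition cvect N := ('rV[C]_N * 'rV[C]_N)%type.

Definition vact N (v : cvect N) (f : 'rV[C]_N -> C) (p : 'rV[C]_N) : C :=
  \sum_j (v.1 0 j * dZ j f p + v.2 0 j * dZb j f p).

Definition ctangent N (M : set 'rV[C]_N) (p : 'rV[C]_N) (v : cvect N) : Prop :=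
  exists U rho, defining M p U rho /\ vact v (toC rho) p = 0.

Definition vfield N := 'rV[C]_N -> cvect N.

Definition vfapp N (X : vfield N) (f : 'rV[C]_N -> C) : 'rV[C]_N -> C :=
  fun p => vact (X p) f p.

Definition smooth_vfield N (U : set 'rV[C]_N) (X : vfield N) : Prop :=
  smooth_map_on U (fun z => (X z).1) /\ smooth_map_on U (fun z => (X z).2).

Definition bracket N (X Y : vfield N) : vfield N := fun p =>
  (\row_j (vfapp X (fun z => (Y z).1 0 j) p - vfapp Y (fun z => (X z).1 0 j) p),
   \row_j (vfapp X (fun z => (Y z).2 0 j) p - vfapp Y (fun z => (X z).2 0 j) p)).

(* Vector fields on M are given by smooth extensions to U; only their values on
   M matter. *)
Definition CR_field N (M U : set 'rV[C]_N) (X : vfield N) : Prop :=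
  smooth_vfield U X /\
  forall q, M q -> U q -> (X q).1 = 0 /\ ctangent M q (X q).

Definition antiCR_field N (M U : set 'rV[C]_N) (X : vfield N) : Prop :=
  smooth_vfield U X /\
  forall q, M q -> U q -> (X q).2 = 0 /\ ctangent M q (X q).

Inductive CR_commutator N (M U : set 'rV[C]_N) : vfield N -> Prop :=
| CR_commutator_CR X : CR_field M U X -> CR_commutator M U X
| CR_commutator_antiCR X : antiCR_field M U X -> CR_commutator M U X
| CR_commutator_bracket X Y :
    CR_commutator M U X -> CR_commutator M U Y ->
    CR_commutator M U (bracket X Y).

Definition finite_type N (M : set 'rV[C]_N) (p : 'rV[C]_N) : Prop :=
  exists2 U, open_nbhd p U &
    forall v, ctangent M p v ->
      exists n (X : 'I_n -> vfield N) (c : 'I_n -> C),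
        (forall i, CR_commutator M U (X i)) /\ v = \sum_i c i *: X i p.

(* H is a total function of which only the restriction to M is relevant; G is a
   smooth extension of that restriction near p. *)
Definition local_ext N N' (M : set 'rV[C]_N) (p : 'rV[C]_N)
    (H : 'rV[C]_N -> 'rV[C]_N') (U : set 'rV[C]_N)
    (G : 'rV[C]_N -> 'rV[C]_N') : Prop :=
  [/\ open_nbhd p U, smooth_map_on U G & forall q, U q -> M q -> G q = H q].

Definition CR_map N N' (M : set 'rV[C]_N) (M' : set 'rV[C]_N')
    (H : 'rV[C]_N -> 'rV[C]_N') : Prop :=
  (forall p, M p -> M' (H p)) /\
  (forall p, M p -> exists U G, local_ext M p H U G /\
     forall v : cvect N, v.1 = 0 -> ctangent M p v ->
       forall j, vact v (fun z => G z 0 j) p = 0).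

(* Equality of k-jets at p of maps on M: along every smooth curve in M through
   p the two maps have contact of order k. *)
Definition same_jet N N' (M : set 'rV[C]_N) (p : 'rV[C]_N) (k : nat)
    (H H' : 'rV[C]_N -> 'rV[C]_N') : Prop :=
  forall gam : R -> 'rV[C]_N, smooth_curve gam -> gam 0 = p ->
    (forall t, M (gam t)) ->
    forall (l : nat) (j : 'I_N'), (l <= k)%N ->
      iter l cderive1 (fun t => H (gam t) 0 j) 0 =
      iter l cderive1 (fun t => H' (gam t) 0 j) 0.

Definition CR_basis N (M : set 'rV[C]_N) (U : set 'rV[C]_N)
    (L : 'I_N.-1 -> vfield N) : Prop :=
  (forall i, CR_field M U (L i)) /\
  (forall q, M q -> U q -> row_free (\matrix_(i < N.-1) (L i q).2)).

(* The choices (extension of H, defining function of M', CR basis) entering the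
   definition of the spaces E'_k. *)
Definition degeneracy_data N N' (M : set 'rV[C]_N) (M' : set 'rV[C]_N')
    (H : 'rV[C]_N -> 'rV[C]_N') (p0 : 'rV[C]_N) (U : set 'rV[C]_N)
    (G : 'rV[C]_N -> 'rV[C]_N') (U' : set 'rV[C]_N') (rho' : 'rV[C]_N' -> R)
    (L : 'I_N.-1 -> vfield N) : Prop :=
  [/\ local_ext M p0 H U G,
      defining M' (H p0) U' rho',
      (forall z, U z -> U' (G z)) &
      CR_basis M U L].

Definition Espace N N' (G : 'rV[C]_N -> 'rV[C]_N') (rho' : 'rV[C]_N' -> R)
    (L : 'I_N.-1 -> vfield N) (k : nat) (p : 'rV[C]_N) : {vspace 'rV[C]_N'} :=
  <<[seq \row_j miter (fun i => vfapp (L i)) a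
                  (fun z => dZ j (toC rho') (G z)) p
       | a <- mindices N.-1 k]>>%VS.

Definition degeneracy N N' (G : 'rV[C]_N -> 'rV[C]_N') (rho' : 'rV[C]_N' -> R)
    (L : 'I_N.-1 -> vfield N) (p : 'rV[C]_N) : nat :=
  (N' - \max_(d < N'.+1 | `[< exists k, \dim (Espace G rho' L k p) = d >]) d)%N.

Definition degenerate_for N N' (G : 'rV[C]_N -> 'rV[C]_N')
    (rho' : 'rV[C]_N' -> R) (L : 'I_N.-1 -> vfield N) (p0 : 'rV[C]_N)
    (k0 s : nat) : Prop :=
  let stable j :=
    forall k, (j <= k)%N -> Espace G rho' L k p0 = Espace G rho' L j p0 in
  [/\ s = degeneracy G rho' L p0, stable k0 &
      forall j, stable j -> (k0 <= j)%N].

Definition constantly_degenerate N N' (M : set 'rV[C]_N) (M' : set 'rV[C]_N')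
    (H : 'rV[C]_N -> 'rV[C]_N') (p0 : 'rV[C]_N) (k0 s : nat) : Prop :=
  exists U G U' rho' L,
    [/\ degeneracy_data M M' H p0 U G U' rho' L,
        degenerate_for G rho' L p0 k0 s &
        \forall p \near p0, M p -> degeneracy G rho' L p = s].

(* v, w are the coefficients of (1,0)-vectors at p. *)
Definition levi N (rho : 'rV[C]_N -> R) (p v w : 'rV[C]_N) : C :=
  \sum_j \sum_k dZ j (dZb k (toC rho)) p * v 0 j * Num.conj (w 0 k).

Definition holo_tangent N (rho : 'rV[C]_N -> R) (p v : 'rV[C]_N) : Prop :=
  \sum_j v 0 j * dZ j (toC rho) p = 0.

(* The sign of the defining function is free: strict pseudoconvexity means that
   the Levi form is definite. *)
Definition strictly_pseudoconvex N (M : set 'rV[C]_N) (p : 'rV[C]_N) : Prop :=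
  exists U rho, defining M p U rho /\
    forall v, v != 0 -> holo_tangent rho p v -> 0 < levi rho p v v.

Definition levi_nondegenerate N (M : set 'rV[C]_N) (p : 'rV[C]_N) : Prop :=
  exists U rho, defining M p U rho /\
    forall v, holo_tangent rho p v ->
      (forall w, holo_tangent rho p w -> levi rho p v w = 0) -> v = 0.

(* C[[x_0, ..., x_(m-1)]], by coefficients. *)
Definition fps (m : nat) := mindex m -> C.

Definition fps_one m : fps m := fun c => (mdeg c == 0)%N%:R.

Definition fps_mul m (f g : fps m) : fps m := fun c =>
  \sum_(a <- mindices m (mdeg c) | [forall i, (a i <= c i)%N])
     f a * g [ffun i => (c i - a i)%N].

(* F(G_0, ..., G_(m'-1)); meaningful when each G_i has zero constant term, so
   that only the monomials of F of degree at most |c| contribute at c. *)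
Definition fps_subst m m' (F : fps m') (G : 'I_m' -> fps m) : fps m := fun c =>
  \sum_(b <- mindices m' (mdeg c))
     F b * (\big[@fps_mul m/@fps_one m]_(i < m')
              iter (b i) (fps_mul (G i)) (@fps_one m)) c.

Definition fps_ideal m (f : fps m) : set (fps m) :=
  [set g | exists a, g = fps_mul a f].

(* Formal series in (Z, zeta): the variables Z_j and zeta_j have indices
   lshift N j and rshift N j. *)
Definition fps_Z N (h : fps N) : fps (N + N) := fun c =>
  if [forall j, c (rshift N j) == 0%N] then h [ffun j => c (lshift N j)] else 0.

Definition fps_zeta N (h : fps N) : fps (N + N) := fun c =>
  if [forall j, c (lshift N j) == 0%N] then h [ffun j => c (rshift N j)] else 0.

Definition fps_conj m (h : fps m) : fps m := fun c => Num.conj (h c).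

(* Taylor series of f at p in the variables (Z - p, conj (Z - p)), written as a
   formal series in (Z, zeta). *)
Definition taylor N (f : 'rV[C]_N -> C) (p : 'rV[C]_N) : fps (N + N) := fun c =>
  miter (fun i => match fintype.split i with inl j => dZ j | inr j => dZb j end) c f p
    / (mfact c)%:R.

(* p0 + Z |-> H p0 + h(Z) is the formal holomorphic power series of H at p0: its
   restriction to M has the same jets at p0 as H. *)
Definition formal_map N N' (M : set 'rV[C]_N) (p0 : 'rV[C]_N)
    (H : 'rV[C]_N -> 'rV[C]_N') (h : 'I_N' -> fps N) : Prop :=
  (forall j, h j [ffun=> 0%N] = 0) /\
  (forall k, same_jet M p0 k H (fun z => H p0 +
     \row_j \sum_(a <- mindices N k)
       h j a * \prod_i (z 0 i - p0 0 i) ^+ a i)).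

(* rho'(H(Z), conj H(zeta)), in coordinates centered at p0 and H p0. *)
Definition fps_pullback N N' (rho' : 'rV[C]_N' -> R) (p0' : 'rV[C]_N')
    (h : 'I_N' -> fps N) : fps (N + N) :=
  fps_subst (taylor (toC rho') p0')
    (fun i => match fintype.split i with
              | inl j => fps_Z (h j)
              | inr j => fps_zeta (fps_conj (h j))
              end).

Definition CR_transversal N N' (M : set 'rV[C]_N) (M' : set 'rV[C]_N')
    (H : 'rV[C]_N -> 'rV[C]_N') (p0 : 'rV[C]_N) : Prop :=
  exists U rho U' rho' h,
    [/\ defining M p0 U rho, defining M' (H p0) U' rho', formal_map M p0 H h &
        fps_ideal (fps_pullback rho' (H p0) h) =
        fps_ideal (taylor (toC rho) p0)].

End Smooth.

(* Main.v *)
(* Let A be the ring of germs at p0 of smooth functions on M, with the tangential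
   fields P_k = d/dZ_k + ..., the CR fields L_k, and the conjugates Lb_k of the
   latter; let D be the components of H - H'.  The derivatives L^a rho'_Z'(H) span
   a bundle of constant rank over M.  Differentiating rho'(H, conj H) = 0 along it,
   Taylor expansion of rho' expresses D through the L-derivatives of conj D of order
   at most k0: this determines D outside the kernel of the span, and inside the
   kernel because the Levi form of M' is anisotropic there.  Under (P1) that is
   definiteness; under (P2) the kernel is Levi-orthogonal to the image of dH, which
   by transversality is a nondegenerate subspace of codimension one.  Applying the
   reflection identity twice, the agreement of the 2 k0-jets at p0 propagates to the
   first and then to the second Segre set: L^a Lb^g D = 0 at p0 for all a, g.  If M
   is of finite type, this set is so large that a CR function annihilated in this
   way is flat: otherwise the germs f with L^a Lb^g f = 0 at p0 would form an ideal
   containing theta(X) = sum_k lam_k X(Z_k) for every commutator X of CR and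
   conjugate CR fields, which would make all of them tangent at p0 to the kernel of
   theta. *)
Require Import Defs.
From HB Require Import structures.
From mathcomp Require Import all_boot all_order all_algebra.
From mathcomp Require Import complex.
From mathcomp Require Import all_classical all_reals all_analysis.
From mathcomp Require Import ring lra zify.
From mathcomp Require Import generic_quotient ring_quotient.
Import Order.TTheory GRing.Theory Num.Theory numFieldNormedType.Exports.
Set Implicit Arguments.
Unset Strict Implicit.
Unset Printing Implicit Defensive.
Local Open Scope ring_scope.
Local Open Scope classical_set_scope.

(** * Words of derivations *)

(** In the smooth category there are no Segre sets, and rho' is not the sum of its Taylor series.
    Vanishing on the first or second Segre set therefore means vanishing at p0 of all words in the
    Lb, or in the L and the Lb, and identities are used modulo germs flat to a finite but arbitrary
    order. The frame is chosen so that its fields commute; words then behave like the coefficients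
    of a formal power series, products become convolutions, and a nonzero series is not a zero
    divisor. This fact lets transverse derivatives of a CR function inherit its vanishing. The
    kernel of the span of the L^a rho'_Z' is the obstacle, as the differentiated equations do not
    determine the part of D inside it. Since the rank is constant, the kernel has a frame V that can
    be normalized to consist of CR germs. Conjugating rho'_Z' V = 0 gives a second system, whose
    linear part in D is the Levi form, at the price of the new unknowns V - V'. These lose k0 orders
    of flatness but enter the reflection without derivatives; this balance is what makes 2 k0
    suffice. *)

Section Words.
Variables (A : comNzRingType) (I : eqType).

Definition derivation (X : A -> A) : Prop :=
  (forall f g, X (f + g) = X f + X g) /\
  (forall f g, X (f * g) = X f * g + f * X g).

Definition word (X : I -> A -> A) (w : seq I) (f : A) : A := foldr X f w.

Lemma derivation0 X : derivation X -> X 0 = 0.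
Proof. by case=> XD _; apply: (addIr (X 0)); rewrite -XD !add0r. Qed.

Lemma derivationN X f : derivation X -> X (- f) = - X f.
Proof.
move=> dX; apply: (addIr (X f)); case: (dX) => XD _.
by rewrite -XD !addNr derivation0.
Qed.

Lemma derivationB X f g : derivation X -> X (f - g) = X f - X g.
Proof. by move=> dX; rewrite dX.1 derivationN. Qed.

Lemma derivation_sum X (T : Type) (r : seq T) (P : pred T) (F : T -> A) :
  derivation X -> X (\sum_(i <- r | P i) F i) = \sum_(i <- r | P i) X (F i).
Proof.
move=> dX; elim/big_rec2: _ => [|i y1 y2 _ <-]; first exact: derivation0.
exact: dX.1.
Qed.

Lemma derivation1 X : derivation X -> X 1 = 0.
Proof.
move=> [_ XM]; have := XM 1 1; rewrite !mulr1 mul1r => h.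
by apply: (addIr (X 1)); rewrite add0r -h.
Qed.

Variable X : I -> A -> A.
Hypothesis dX : forall i, derivation (X i).

Lemma wordD w f g : word X w (f + g) = word X w f + word X w g.
Proof. by elim: w => //= i w ->; rewrite (dX i).1. Qed.

Lemma word0 w : word X w 0 = 0.
Proof. by elim: w => //= i w ->; exact: derivation0. Qed.

Lemma wordN w f : word X w (- f) = - word X w f.
Proof. by elim: w => //= i w ->; rewrite derivationN. Qed.

Lemma wordB w f g : word X w (f - g) = word X w f - word X w g.
Proof. by rewrite wordD wordN. Qed.

Lemma word_sum w (T : Type) (r : seq T) (P : pred T) (F : T -> A) :
  word X w (\sum_(i <- r | P i) F i) = \sum_(i <- r | P i) word X w (F i).
Proof. by elim/big_rec2: _ => [|i y1 y2 _ <-]; [exact: word0|exact: wordD]. Qed.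

Lemma word_cat w1 w2 f : word X (w1 ++ w2) f = word X w1 (word X w2 f).
Proof. by rewrite /word foldr_cat. Qed.

Lemma word_commr (Y : A -> A) w f : (forall i g, Y (X i g) = X i (Y g)) ->
  Y (word X w f) = word X w (Y f).
Proof. by move=> YX; elim: w => //= i w <-; rewrite YX. Qed.

Lemma word_perm w1 w2 f : (forall i j g, X i (X j g) = X j (X i g)) ->
  perm_eq w1 w2 -> word X w1 f = word X w2 f.
Proof.
move=> XX pw; apply: (catCA_perm_ind (P := fun w => word X w1 f = word X w f) _ pw) => //.
move=> s1 s2 s3 ->; rewrite !word_cat; elim: s1 => //= i s1 ->.
exact: word_commr.
Qed.

(* The coefficient-wise product of word-indexed families: the sum over all
   ways to distribute the letters of w over the two factors. *)
Fixpoint conv (B : comNzRingType) (w : seq I) (u v : seq I -> B) : B :=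
  if w is i :: w' then
    conv w' (fun d => u (i :: d)) v + conv w' u (fun d => v (i :: d))
  else u [::] * v [::].

Lemma eq_conv (B : comNzRingType) w (u u' v v' : seq I -> B) :
  (forall d, (size d <= size w)%N -> u d = u' d) ->
  (forall d, (size d <= size w)%N -> v d = v' d) -> conv w u v = conv w u' v'.
Proof.
elim: w u u' v v' => [|i w IH] u u' v v' /= uu' vv'; first by rewrite uu' ?vv'.
by congr (_ + _); apply: IH => d dw;
  rewrite ?uu' ?vv' //= ?ltnS // ltnW // ltnS.
Qed.

Lemma convDl (B : comNzRingType) w (u u' v : seq I -> B) :
  conv w (fun d => u d + u' d) v = conv w u v + conv w u' v.
Proof.
elim: w u u' v => [|i w IH] u u' v /=; first by rewrite mulrDl.
by rewrite !IH; ring.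
Qed.

Lemma convDr (B : comNzRingType) w (u v v' : seq I -> B) :
  conv w u (fun d => v d + v' d) = conv w u v + conv w u v'.
Proof.
elim: w u v v' => [|i w IH] u v v' /=; first by rewrite mulrDr.
by rewrite !IH; ring.
Qed.

Lemma convC (B : comNzRingType) w (u v : seq I -> B) : conv w u v = conv w v u.
Proof.
elim: w u v => [|i w IH] u v /=; first by rewrite mulrC.
by rewrite addrC; congr (_ + _); exact: IH.
Qed.

Lemma convA (B : comNzRingType) w (a b c : seq I -> B) :
  conv w (fun d => conv d a b) c = conv w a (fun d => conv d b c).
Proof.
elim: w a b c => [|i w IH] a b c /=; first by rewrite mulrA.
by rewrite convDl convDr !IH !addrA.
Qed.

Lemma conv_deriv (Y : A -> A) w (u v : seq I -> A) : derivation Y ->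
  Y (conv w u v) = conv w (Y \o u) v + conv w u (Y \o v).
Proof.
move=> dY; elim: w u v => [|i w IH] u v /=; first by rewrite dY.2.
by rewrite dY.1 !IH; rewrite addrACA.
Qed.

Lemma wordM w f g :
  word X w (f * g) = conv w (fun d => word X d f) (fun d => word X d g).
Proof.
elim: w => //= i w ->; rewrite conv_deriv //.
Qed.

Lemma conv_ideal (F : comNzRingType) (ev : {rmorphism A -> F}) w (u v : seq I -> A) :
  (forall d, (size d <= size w)%N -> ev (u d) = 0) -> ev (conv w u v) = 0.
Proof.
elim: w u v => [|i w IH] u v /= u0; first by rewrite rmorphM u0 ?mul0r.
by rewrite rmorphD !IH ?addr0 // => d dw; rewrite u0 //= leqW.
Qed.

End Words.

(** * Formal power series over a field have no zero divisors *)

Section ConvDomain.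
Variables (F : numFieldType) (I : finType).

(** All nonzero terms equal c, so they cannot cancel, and k counts them. The hypothesis covers every
    rearrangement of w because the induction moves the first letter into either factor. *)
Lemma conv_const w (P : seq I -> seq I -> bool) (u v : seq I -> F) (c : F) :
  (forall w1 w2, perm_eq (w1 ++ w2) w ->
     u w1 * v w2 = if P w1 w2 then c else 0) ->
  exists2 k, conv w u v = c *+ k &
    forall w1 w2, w = w1 ++ w2 -> P w1 w2 -> (0 < k)%N.
Proof.
elim: w P u v => [|i w IH] P u v uv /=.
  exists (P [::] [::] : nat); first by rewrite uv //; case: (P _ _).
  by case=> [|? ?] [|? ?] //= _ ->.
have [d|k1 -> k1P] := IH (fun a b => P (i :: a) b) (fun d => u (i :: d)) v.
  by move=> w2 pw; rewrite uv //= perm_cons.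
have [d|k2 -> k2P] := IH (fun a b => P a (i :: b)) u (fun d => v (i :: d)).
  move=> w2 pw; rewrite uv //.
  by rewrite -cat1s perm_catCA /= perm_cons.
exists (k1 + k2)%N; first by rewrite mulrnDr.
case=> [|a w1] w2 /=.
  by move=> <- Pw; rewrite addn_gt0 (k2P [::] w) ?orbT.
by case=> <- wE Pw; rewrite addn_gt0 (k1P w1 w2).
Qed.

(** Breaks ties between monomials of equal length. For words shorter than B it is the base-B number
    whose digits are the multiplicities of the letters, so it is additive and determines a word up
    to order. *)
Definition weight (B : nat) (w : seq I) : nat := (\sum_(i <- w) B ^ enum_rank i)%N.

Lemma weight_cat B w1 w2 : weight B (w1 ++ w2) = (weight B w1 + weight B w2)%N.
Proof. exact: big_cat. Qed.

Lemma digits_inj B n (c c' : 'I_n -> nat) :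
  (forall i, (c i < B)%N) -> (forall i, (c' i < B)%N) ->
  (\sum_i c i * B ^ i)%N = (\sum_i c' i * B ^ i)%N -> c =1 c'.
Proof.
elim: n c c' => [|n IH] c c' cB c'B; first by move=> _ [].
rewrite !big_ord_recl /= expn0 !muln1.
have E (d : 'I_n.+1 -> nat) : (\sum_(i < n) d (lift ord0 i) * B ^ bump 0 i)%N
    = ((\sum_(i < n) d (lift ord0 i) * B ^ i) * B)%N.
  rewrite big_distrl /=; apply: eq_bigr => i _.
  by rewrite /bump /= add1n expnSr mulnA.
rewrite !E => h.
have h0 : c ord0 = c' ord0.
  by have := congr1 (modn^~ B) h; rewrite /= ![(_ + _ * B)%N]addnC !modnMDl !modn_small.
have B0 : (0 < B)%N by apply: leq_ltn_trans (cB ord0).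
move: h; rewrite h0 => /addnI/eqP; rewrite eqn_pmul2r // => /eqP h.
have hl := IH (fun i => c (lift ord0 i)) (fun i => c' (lift ord0 i))
  (fun i => cB _) (fun i => c'B _) h.
by move=> i; case: (unliftP ord0 i) => [j ->|->].
Qed.

Lemma weightE B w :
  weight B w = (\sum_(i < #|I|) count_mem (enum_val i) w * B ^ i)%N.
Proof.
rewrite /weight; elim: w => [|a w IH].
  by rewrite big_nil big1.
rewrite big_cons IH (bigD1 (enum_rank a)) //= [RHS](bigD1 (enum_rank a)) //=.
rewrite enum_rankK eqxx mulnDl mul1n addnA; congr (_ + _)%N.
apply: eq_bigr => i ia; congr (_ * _)%N.
by rewrite (introF eqP) // => aE; rewrite aE enum_valK eqxx in ia.
Qed.

Lemma weight_inj B w w' : (size w < B)%N -> (size w' < B)%N ->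
  weight B w = weight B w' -> perm_eq w w'.
Proof.
move=> wB w'B; rewrite !weightE => h.
apply/allP => a _ /=; apply/eqP.
have := digits_inj _ _ h.
move=> /(_ (fun i => leq_ltn_trans (count_size _ _) wB)
            (fun i => leq_ltn_trans (count_size _ _) w'B) (enum_rank a)).
by rewrite enum_rankK.
Qed.

Lemma ex_min (P : nat -> Prop) : (exists n, P n) ->
  exists2 n, P n & forall m, P m -> (n <= m)%N.
Proof.
move=> [n0 Pn0]; have exP : exists n, `[< P n >] by exists n0; apply/asboolP.
case: (ex_minnP exP) => n /asboolP Pn nmin.
by exists n => // m Pm; apply: nmin; apply/asboolP.
Qed.

(** The length d is fixed before B because [conv_domain] can choose B only after the minimal lengths
    of both families are known. *)
Lemma min_word (u : seq I -> F) w0 : u w0 != 0 -> exists d,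
  (forall w, u w != 0 -> (d <= size w)%N) /\
  forall B, exists w, [/\ u w != 0, size w = d &
    forall w', u w' != 0 -> size w' = d -> (weight B w <= weight B w')%N].
Proof.
move=> uw0.
have [|d [w [uw <-]] dmin] :=
  ex_min (P := fun d => exists w, u w != 0 /\ size w = d).
  by exists (size w0), w0.
exists (size w); split=> [w' uw'|B]; first by apply: dmin; exists w'.
have [|k [w' [uw' sw' <-]] kmin] := ex_min (P := fun k => exists w',
   [/\ u w' != 0, size w' = size w & weight B w' = k]).
  by exists (weight B w), w.
by exists w'; split=> // w'' uw'' sw''; apply: kmin; exists w''.
Qed.

(* The lowest terms cannot cancel: among the words of minimal length carrying a
   nonzero value take those of minimal weight. *)
Lemma conv_domain (u v : seq I -> F) :
  (forall w w', perm_eq w w' -> u w = u w') ->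
  (forall w w', perm_eq w w' -> v w = v w') ->
  (forall w, conv w u v = 0) ->
  forall w1 w2, u w1 != 0 -> v w2 = 0.
Proof.
move=> us vs uv w1 w2 uw1; apply: contrapT => /eqP vw2.
have [d [dmin dB]] := min_word uw1; have [e [emin eB]] := min_word vw2.
set B := (d + e).+1.
have [mu [umu smu mumin]] := dB B; have [nu [vnu snu numin]] := eB B.
have [] := @conv_const (mu ++ nu) (fun a b => perm_eq a mu && perm_eq b nu)
  u v (u mu * v nu).
  move=> a b pab; case: ifP => [/andP[pa pb]|npab]; first by rewrite (us a mu) ?(vs b nu).
  (* In a nonvanishing product both factors are at least minimal in length and in weight. Their
     totals are those of mu ++ nu, so both are exactly minimal. *)
  apply/eqP; rewrite mulf_eq0; apply: contraFT npab; rewrite negb_or => /andP[ua vb].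
  have := perm_size pab; rewrite !size_cat smu snu => sab.
  have sa := dmin _ ua; have sb := emin _ vb.
  have sad : size a = d.
    by apply/eqP; rewrite eqn_leq sa andbT -(leq_add2r e) -sab leq_add2l.
  have sbe : size b = e by move/eqP: sab; rewrite sad eqn_add2l => /eqP.
  have wa := mumin _ ua sad; have wb := numin _ vb sbe.
  have wab : (weight B a + weight B b = weight B mu + weight B nu)%N.
    by rewrite -!weight_cat; apply: perm_big.
  have wae : weight B a = weight B mu.
    by apply/eqP; rewrite eqn_leq wa andbT -(leq_add2r (weight B nu)) -wab leq_add2l.
  have wbe : weight B b = weight B nu by move/eqP: wab; rewrite wae eqn_add2l => /eqP.
  by apply/andP; split; apply: (@weight_inj B); rewrite ?sad ?sbe ?smu ?snu //
     ltnS ?leq_addr ?leq_addl.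
move=> k; rewrite uv => /esym/eqP; rewrite mulrn_eq0 mulf_eq0 (negbTE umu) (negbTE vnu) !orbF.
by move=> /eqP -> /(_ mu nu erefl); rewrite !perm_refl => /(_ isT).
Qed.

End ConvDomain.

(** * Functions vanishing on the second Segre set *)

Section Segre.
Variables (F : numFieldType) (A : comNzRingType) (ev : {rmorphism A -> F}).
Variables (n : nat) (m : 'I_n).
(* Model: A is the ring of germs at p0 of smooth functions on M, L_k and Lb_k are
   CR and conjugate CR fields with d/dZbar_m, resp. d/dZ_m, as the only transverse
   component (L_m = Lb_m = 0), and P_k = d/dZ_k + (...) d/dZbar_m is tangent to M. *)
Variables (P L Lb : 'I_n -> A -> A) (lam : 'I_n -> A) (Z Zb : 'I_n -> A).
Hypothesis dP : forall k, derivation (P k).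
Hypothesis dL : forall k, derivation (L k).
Hypothesis dLb : forall k, derivation (Lb k).
Hypothesis PP : forall j k f, P j (P k f) = P k (P j f).
Hypothesis LL : forall j k f, L j (L k f) = L k (L j f).
Hypothesis PL : forall j k f, L j (P k f) = P k (L j f).
Hypothesis LbLb : forall j k f, Lb j (Lb k f) = Lb k (Lb j f).
Hypothesis LbE : forall k f, Lb k f = P k f + lam k * P m f.
Hypothesis PZ : forall j k, P j (Z k) = (j == k)%:R.
Hypothesis LZ : forall j k, L j (Z k) = 0.
Hypothesis lam_m : lam m = -1.

Lemma deriv_nat X k : derivation X -> X k%:R = 0 :> A.
Proof.
by move=> dX; elim: k => [|k IH]; rewrite ?derivation0 // -natr1 dX.1 IH derivation1 ?addr0.
Qed.

Lemma LbZ k : Lb k (Z m) = lam k + (k == m)%:R.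
Proof. by rewrite LbE !PZ eqxx mulr1 addrC. Qed.

Lemma Lblam_sym j k : Lb j (lam k) = Lb k (lam j).
Proof.
have E l : lam l = Lb l (Z m) - (l == m)%:R by rewrite LbZ addrK.
by rewrite !E !derivationB // !deriv_nat // LbLb.
Qed.

Lemma LLb j k f : L j (Lb k f) = Lb k (L j f) + P m f * L j (lam k).
Proof. by rewrite !LbE (dL j).1 (dL j).2 !PL; ring. Qed.

Lemma PmLb k f : P m (Lb k f) = Lb k (P m f) + P m f * P m (lam k).
Proof. by rewrite !LbE (dP m).1 (dP m).2 (PP m k); ring. Qed.

(* The chain rule along the flow of the Lb: it moves Z_m only, apart from
   constant translations of the other coordinates. *)
Lemma L_wordLb j w f : L j (word Lb w f) = word Lb w (L j f) +
  conv w (fun d => word Lb d (P m f)) (fun d => L j (word Lb d (Z m))).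
Proof.
(* Induction on the length, since [EB] below needs the formula for [lam i] along every d that is no
   longer than w. *)
have [k] := ubnP (size w); elim: k w f => // k IH [|i w] f /= wk.
  by rewrite LZ mulr0 addr0.
rewrite ltnS in wk; rewrite !(word_commr _ _ (LbLb i)) IH //.
pose u d := word Lb d (P m f); pose v d := L j (word Lb d (Z m)).
(* [q] stems from the commutator of [P m] with [Lb i], [r] from that of [L j] with [Lb i]. The terms
   in [q] occur on both sides of the goal; those in [r] match by the Leibniz rule. *)
pose q d := word Lb d (P m (lam i)); pose r d := word Lb d (L j (lam i)).
have EA : conv w (fun d => word Lb d (P m (Lb i f))) v =
    conv w (fun d => Lb i (u d)) v + conv w u (fun d => conv d q v).
  rewrite -convA -convDl; apply: eq_conv => // d _.
  by rewrite PmLb wordD // wordM // /u (word_commr _ _ (LbLb i)).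
have EB : conv w u (fun d => L j (Lb i (word Lb d (Z m)))) =
    conv w u r + conv w u (fun d => conv d q v).
  rewrite -convDr; apply: eq_conv => // d dw.
  rewrite (word_commr _ _ (LbLb i)) LbZ wordD // (dL j).1 IH ?(leq_ltn_trans dw) //.
  suff -> : L j (word Lb d (i == m)%:R) = 0 by rewrite addr0.
  case: d dw => [_|a d _] /=; first exact: deriv_nat.
  by rewrite (word_commr _ _ (LbLb a)) deriv_nat // word0 // derivation0.
rewrite EA EB LLb wordD // wordM // -/u -/r.
by rewrite -!addrA; congr (_ + _); rewrite addrCA.
Qed.

Definition segre_null (f : A) : Prop :=
  forall a g, ev (word L a (word Lb g f)) = 0.

(** Flow from p0 along the L for time s, then along the Lb for time t. The condition says that the
    derivative in s of [Z m] at the end point has zero Taylor series at s = t = 0. *)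
Definition segre_degenerate : Prop :=
  forall j a g, ev (word L a (L j (word Lb g (Z m)))) = 0.

(** Tagged letters turn a Taylor series in the two sets of parameters, those of L and those of Lb,
    into one family of coefficients, to which [conv_domain] applies. *)
Definition lword (w : seq ('I_n + 'I_n)) : seq 'I_n :=
  pmap (fun s => if s is inl i then Some i else None) w.
Definition rword (w : seq ('I_n + 'I_n)) : seq 'I_n :=
  pmap (fun s => if s is inr i then Some i else None) w.

Lemma lword_rword_cat a g :
  lword (map inl a ++ map inr g) = a /\ rword (map inl a ++ map inr g) = g.
Proof.
elim: a => [|i a [la ra]]; last by split; rewrite /= ?la.
by rewrite cat0s /lword /rword; split; elim: g => //= i g ->.
Qed.

Lemma conv_word w (u v : seq 'I_n -> A) :
  conv w (fun d => ev (word L (lword d) (u (rword d))))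
         (fun d => ev (word L (lword d) (v (rword d)))) =
  ev (word L (lword w) (conv (rword w) u v)).
Proof.
elim: w u v => [|[i|i] w IH] u v /=; first by rewrite rmorphM.
  rewrite (word_commr _ _ (LL i)) (conv_deriv _ _ _ (dL i)) wordD // rmorphD -!IH.
  by congr (_ + _); apply: eq_conv => //= d _; rewrite (word_commr _ _ (LL i)).
by rewrite wordD // rmorphD -!IH.
Qed.

(** For a CR germ f, [L_wordLb] exhibits the series of L_j f along the Lb-flow as the product of the
    series of [P m f] with that of the derivative of [Z m]. The product vanishes and, for a suitable
    j, the second factor does not, so the first one does. *)
Lemma segre_nullP f : (forall j, L j f = 0) -> ~ segre_degenerate ->
  segre_null f -> segre_null (P m f).
Proof.
move=> Lf ndeg f0 a0 g0.
have [j [a1 [g1 c0]]] : exists j a g, ev (word L a (L j (word Lb g (Z m)))) != 0.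
  apply: contrapT => H; apply: ndeg => j a g; apply: contrapT => H'.
  by apply: H; exists j, a, g; apply/eqP.
pose u (w : seq ('I_n + 'I_n)) := ev (word L (lword w) (L j (word Lb (rword w) (Z m)))).
pose v (w : seq ('I_n + 'I_n)) := ev (word L (lword w) (word Lb (rword w) (P m f))).
have symP w w' : perm_eq w w' -> perm_eq (lword w) (lword w') /\
    perm_eq (rword w) (rword w') by move=> ww'; split; apply: perm_pmap.
have uv w : conv w u v = 0.
  rewrite (conv_word w (fun d => L j (word Lb d (Z m))) (fun d => word Lb d (P m f))).
  rewrite convC; have := L_wordLb j (rword w) f; rewrite Lf word0 // add0r => <-.
  by rewrite -(word_commr _ _ (LL j)); have := f0 (j :: lword w) (rword w).
have lr a g : lword (map inl a ++ map inr g) = a /\ rword (map inl a ++ map inr g) = g.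
  exact: lword_rword_cat.
have := @conv_domain _ _ u v _ _ uv (map inl a1 ++ map inr g1) (map inl a0 ++ map inr g0).
rewrite /u /v; have [-> ->] := lr a1 g1; have [-> ->] := lr a0 g0; apply=> //.
  by move=> w w' /symP[pl pr]; rewrite (word_perm _ LL pl) (word_perm _ LbLb pr).
by move=> w w' /symP[pl pr]; rewrite (word_perm _ LL pl) (word_perm _ LbLb pr).
Qed.

Lemma segre_ideal f g : segre_null f -> segre_null (g * f).
Proof.
move=> f0 a w; rewrite wordM //.
have -> : word L a (conv w (fun d => word Lb d g) (fun d => word Lb d f)) =
  word L (lword (map inl a ++ map inr w)) (conv (rword (map inl a ++ map inr w))
     (fun d => word Lb d g) (fun d => word Lb d f)).
  by have [-> ->] := lword_rword_cat a w.
rewrite -conv_word convC.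
by apply: (@conv_ideal F _ F idfun) => d _; apply: f0.
Qed.

Lemma segre_nullD f g : segre_null f -> segre_null g -> segre_null (f + g).
Proof. by move=> f0 g0 a w; rewrite !wordD // rmorphD f0 g0 addr0. Qed.

Lemma segre_nullN f : segre_null f -> segre_null (- f).
Proof. by move=> f0 a w; rewrite !wordN // rmorphN f0 oppr0. Qed.

Lemma segre_null_sum (T : Type) (r : seq T) (Q : pred T) (G : T -> A) :
  (forall i, Q i -> segre_null (G i)) -> segre_null (\sum_(i <- r | Q i) G i).
Proof.
move=> H; apply: big_ind => //; last exact: segre_nullD.
by move=> a g; rewrite !word0 // rmorph0.
Qed.

Lemma segre_nullLb k f : segre_null f -> segre_null (Lb k f).
Proof.
move=> f0 a w; rewrite -(word_commr _ _ (LbLb k)); exact: (f0 a (k :: w)).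
Qed.

(* For CR functions the vanishing on the second Segre set is a statement about
   all derivatives, unless that set is degenerate. *)
Lemma segre_flat f : (forall j, L j f = 0) -> ~ segre_degenerate ->
  segre_null f -> forall w, ev (word P w f) = 0.
Proof.
move=> Lf ndeg f0 w.
suff [] : (forall j, L j (word P w f) = 0) /\ segre_null (word P w f).
  by move=> _ /(_ [::] [::]).
elim: w => //= k w [Lg g0]; split; first by move=> j; rewrite PL Lg derivation0.
have -> : P k (word P w f) = Lb k (word P w f) - lam k * P m (word P w f).
  by rewrite LbE addrK.
apply: segre_nullD; first exact: segre_nullLb.
by apply/segre_nullN/segre_ideal/segre_nullP.
Qed.

Section Degenerate.
Hypothesis deg : segre_degenerate.

Lemma degenerate_conv a w u j :
  ev (word L a (conv w u (fun d => L j (word Lb d (Z m))))) = 0.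
Proof.
suff H v : (forall b d, ev (word L b (v d)) = 0) -> ev (word L a (conv w u v)) = 0.
  by apply: H => b d; exact: deg.
elim: w u v => [|i w IH] u v v0 /=.
  rewrite wordM // convC; apply: conv_ideal => d _; exact: v0.
by rewrite wordD // rmorphD !IH ?addr0 // => b d; exact: (v0 b (i :: d)).
Qed.

(** Degeneracy kills the correction term of [L_wordLb]: at p0, under words in the L, each [L j] may
    be moved past words in the Lb. *)
Lemma segre_nullL j f : segre_null f -> segre_null (L j f).
Proof.
move=> f0 a w; have := L_wordLb j w f => /(congr1 (fun g => ev (word L a g))).
have -> : ev (word L a (L j (word Lb w f))) = 0.
  by rewrite -(word_commr _ _ (LL j)); exact: (f0 (j :: a) w).
rewrite wordD // rmorphD.
suff -> : ev (word L a (conv w (fun d => word Lb d (P m f))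
    (fun d => L j (word Lb d (Z m))))) = 0 by rewrite addr0.
exact: degenerate_conv.
Qed.

Lemma segre_nullLlam j k : segre_null (L j (lam k)).
Proof.
have -> : lam k = Lb k (Z m) - (k == m)%:R by rewrite LbZ addrK.
rewrite derivationB // deriv_nat // subr0 => a w.
have := L_wordLb j w (Lb k (Z m)) => /(congr1 (fun g => ev (word L a g))).
rewrite -(word_commr _ _ (LbLb k)).
have /= -> := deg j a (k :: w).
rewrite wordD // rmorphD.
suff -> : ev (word L a (conv w (fun d => word Lb d (P m (Lb k (Z m))))
    (fun d => L j (word Lb d (Z m))))) = 0 by rewrite addr0.
exact: degenerate_conv.
Qed.

(** In the geometric frame [lam k] is - rho_k / rho_m, and this is the (1,0)-part of d rho divided
    by - rho_m. On fields tangent to M its kernel is spanned by the CR and the conjugate CR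
    fields. *)
Definition theta (X : A -> A) : A := \sum_k lam k * X (Z k).

Definition tangent_expansion (X : A -> A) : Prop := derivation X /\
  forall f, X f = \sum_k X (Z k) * P k f + \sum_k X (Zb k) * L k f.

Lemma theta_null X f : tangent_expansion X -> segre_null (theta X) ->
  segre_null (X f - \sum_k X (Z k) * Lb k f - \sum_k X (Zb k) * L k f).
Proof.
move=> [_ ->] X0.
have -> : \sum_k X (Z k) * Lb k f = \sum_k X (Z k) * P k f + P m f * theta X.
  rewrite /theta mulr_sumr -big_split /=; apply: eq_bigr => k _.
  by rewrite LbE; ring.
have -> : forall a b c : A, a + b - (a + c) - b = - c by move=> *; ring.
exact/segre_nullN/segre_ideal.
Qed.

Lemma theta_stable X f : tangent_expansion X -> segre_null (theta X) ->
  segre_null f -> segre_null (X f).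
Proof.
move=> tX X0 f0.
rewrite -[X f](subrK (\sum_k X (Z k) * Lb k f)) -[X f - _](subrK (\sum_k X (Zb k) * L k f)).
apply: segre_nullD; last first.
  by apply: segre_null_sum => k _; apply/segre_ideal/segre_nullLb.
apply: segre_nullD; first exact: theta_null.
by apply: segre_null_sum => k _; apply/segre_ideal/segre_nullL.
Qed.

(** Cartan's formula expresses theta([X, Y]) through X theta(Y), Y theta(X) and d theta(X, Y). In d
    theta the part along the Lb cancels by the symmetry [Lblam_sym], and the part along the L is
    null by [segre_nullLlam]. *)
Lemma theta_bracket X Y : tangent_expansion X -> tangent_expansion Y ->
  segre_null (theta X) -> segre_null (theta Y) ->
  segre_null (theta (fun f => X (Y f) - Y (X f))).
Proof.
move=> tX tY X0 Y0; have [dX _] := tX; have [dY _] := tY.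
pose q X k := X (lam k) - \sum_l X (Z l) * Lb l (lam k).
have q0 W k : tangent_expansion W -> segre_null (theta W) -> segre_null (q W k).
  move=> tW W0; rewrite /q -[W (lam k) - _](subrK (\sum_l W (Zb l) * L l (lam k))).
  apply: segre_nullD; first exact: theta_null.
  by apply: segre_null_sum => l _; apply/segre_ideal/segre_nullLlam.
have -> : theta (fun f => X (Y f) - Y (X f)) = X (theta Y) - Y (theta X)
    - \sum_k Y (Z k) * q X k + \sum_k X (Z k) * q Y k.
  rewrite /theta (derivation_sum _ _ _ dX) (derivation_sum _ _ _ dY).
  have -> : \sum_k Y (Z k) * q X k = \sum_k Y (Z k) * X (lam k)
      - \sum_k \sum_l Y (Z k) * X (Z l) * Lb l (lam k).
    rewrite -sumrB; apply: eq_bigr => k _; rewrite mulrBr mulr_sumr.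
    by congr (_ - _); apply: eq_bigr => l _; rewrite mulrA.
  have -> : \sum_k X (Z k) * q Y k = \sum_k X (Z k) * Y (lam k)
      - \sum_k \sum_l Y (Z k) * X (Z l) * Lb l (lam k).
    rewrite exchange_big -sumrB; apply: eq_bigr => k _; rewrite mulrBr mulr_sumr.
    congr (_ - _); apply: eq_bigr => l _.
    by rewrite Lblam_sym mulrA [X _ * _]mulrC.
  set s := \sum_k \sum_l _.
  rewrite (eq_bigr (fun k => X (lam k * Y (Z k)) - Y (lam k * X (Z k))
    - Y (Z k) * X (lam k) + X (Z k) * Y (lam k))); last first.
    by move=> k _; rewrite dX.2 dY.2; ring.
  by rewrite !big_split /= !sumrN; ring.
apply: segre_nullD; last first.
  by apply: segre_null_sum => k _; apply/segre_ideal/q0.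
apply: segre_nullD; last first.
  by apply/segre_nullN/segre_null_sum => k _; apply/segre_ideal/q0.
by apply: segre_nullD; [|apply: segre_nullN]; apply: theta_stable.
Qed.

End Degenerate.
End Segre.

(** * Ideals and vanishing to finite order *)

Section Span.
Variable A : comNzRingType.

Inductive span (G : A -> Prop) : A -> Prop :=
| span0 : span G 0
| spanS a g f : G g -> span G f -> span G (a * g + f).

Lemma spanD G f g : span G f -> span G g -> span G (f + g).
Proof.
by move=> + Gg; elim=> [|a h f' Gh _ IH]; rewrite ?add0r // -addrA; constructor.
Qed.

Lemma spanM G a f : span G f -> span G (a * f).
Proof.
elim=> [|b h f' Gh _ IH]; first by rewrite mulr0; constructor.
by rewrite mulrDr mulrA; constructor.
Qed.

Lemma span_gen (G : A -> Prop) g : G g -> span G g.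
Proof. by move=> Gg; have := spanS 1 Gg (span0 G); rewrite mul1r addr0. Qed.

Lemma span_sum G (T : Type) (r : seq T) (Q : pred T) (h : T -> A) :
  (forall i, Q i -> span G (h i)) -> span G (\sum_(i <- r | Q i) h i).
Proof. by move=> H; apply: big_ind => //; [constructor|exact: spanD]. Qed.

Lemma span_ind_ideal (G N : A -> Prop) f : N 0 ->
  (forall a b, N a -> N b -> N (a + b)) -> (forall a b, N b -> N (a * b)) ->
  (forall g, G g -> N g) -> span G f -> N f.
Proof. by move=> N0 ND NM GN; elim=> // a g h /GN Ng _ Nh; apply/ND/Nh/NM. Qed.

Lemma span_trans (G G' : A -> Prop) f :
  (forall g, G g -> span G' g) -> span G f -> span G' f.
Proof.
move=> GG'; apply: span_ind_ideal => //; first exact: span0.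
  exact: spanD.
exact: spanM.
Qed.

End Span.

Section Flat.
Variables (A : comNzRingType) (J : finType) (T : J -> A -> A).
Hypothesis dT : forall j, derivation (T j).
Variable N : A -> Prop.
Hypothesis N0 : N 0.
Hypothesis ND : forall a b, N a -> N b -> N (a + b).
Hypothesis NM : forall a b, N b -> N (a * b).

(** Vanishing to order K, that is, of the (K-1)-jet: a k-jet that vanishes gives [dflat k.+1]. The
    ideal N is the kernel of evaluation at p0 in [flat], and the germs vanishing on the first Segre
    set in [sflat]. *)
Fixpoint dflat (K : nat) (f : A) : Prop :=
  if K is K'.+1 then N f /\ forall j, dflat K' (T j f) else True.

Lemma dflat0 K : dflat K 0.
Proof. by elim: K => //= K IH; split=> // j; rewrite derivation0. Qed.

Lemma dflatD K f g : dflat K f -> dflat K g -> dflat K (f + g).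
Proof.
elim: K f g => //= K IH f g [Nf Tf] [Ng Tg]; split; first exact: ND.
by move=> j; rewrite (dT j).1; apply: IH.
Qed.

Lemma dflatS K f : dflat K.+1 f -> dflat K f.
Proof.
elim: K f => //= K IH f [Nf Tf]; split=> // j; apply: IH; exact: Tf.
Qed.

Lemma dflat_le K K' f : (K' <= K)%N -> dflat K f -> dflat K' f.
Proof.
by move=> /subnK <-; elim: (K - K')%N => // d IH; rewrite addSn => /dflatS.
Qed.

Lemma dflatM K a f : dflat K f -> dflat K (a * f).
Proof.
elim: K a f => //= K IH a f [Nf Tf]; split; first exact: NM.
move=> j; rewrite (dT j).2; apply: dflatD; apply: IH => //.
exact: (@dflatS K f (conj Nf Tf)).
Qed.

Lemma dflat_sum K (S : Type) (r : seq S) (Q : pred S) (h : S -> A) :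
  (forall i, Q i -> dflat K (h i)) -> dflat K (\sum_(i <- r | Q i) h i).
Proof. by move=> H; apply: big_ind => //; [exact: dflat0|exact: dflatD]. Qed.

Lemma dflatN K f : dflat K f -> dflat K (- f).
Proof. by rewrite -mulN1r; exact: dflatM. Qed.

Lemma dflatB K f g : dflat K f -> dflat K g -> dflat K (f - g).
Proof. by move=> Ff Fg; apply/dflatD/dflatN. Qed.

Lemma dflat_span K (G : A -> Prop) f :
  (forall g, G g -> dflat K g) -> span G f -> dflat K f.
Proof.
apply: span_ind_ideal; first exact: dflat0.
  by move=> a b; exact: dflatD.
by move=> a b; exact: dflatM.
Qed.

Lemma dflat_word K w f : dflat (K + size w) f -> dflat K (word T w f).
Proof.
elim: w K => [|j w IH] K /=; first by rewrite addn0.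
by rewrite addnS -addSn => /IH [_]; apply.
Qed.

Lemma dflatP K f :
  dflat K f <-> (forall w, (size w < K)%N -> N (word T w f)).
Proof.
split=> [Ff w wK|]; first by have [] : dflat 1 (word T w f) by
  apply: dflat_word; apply: dflat_le Ff; rewrite add1n.
elim: K f => //= K IH f H; split; first exact: (H [::]).
move=> j; apply: IH => w wK; have := H (rcons w j).
by rewrite size_rcons ltnS /word foldr_rcons => /(_ wK).
Qed.

Definition combination (X : A -> A) : Prop :=
  exists a, forall f, X f = \sum_j a j * T j f.

Lemma dflat_comb K X f : combination X -> dflat K.+1 f -> dflat K (X f).
Proof.
move=> [a aE] [_ Tf]; rewrite aE; apply: dflat_sum => j _; apply: dflatM; exact: Tf.
Qed.

Lemma dflat_comb_word K (S : eqType) (X : S -> A -> A) w f :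
  (forall s, combination (X s)) -> dflat (K + size w) f -> dflat K (word X w f).
Proof.
move=> cX; elim: w K => [|j w IH] K /=; first by rewrite addn0.
by rewrite addnS -addSn => /IH; exact: dflat_comb (cX j).
Qed.

End Flat.

Lemma word_mulr (A : comNzRingType) (S : eqType) (X : S -> A -> A) w f g :
  (forall s, derivation (X s)) -> (forall s, X s g = 0) ->
  word X w (f * g) = word X w f * g.
Proof. by move=> dX Xg; elim: w => //= s w ->; rewrite (dX s).2 Xg mulr0 addr0. Qed.

(** * Transport of vanishing along the Segre sets *)

Section Propagation.
Variables (F : numFieldType) (A : comNzRingType) (ev : {rmorphism A -> F}).
Variables (n : nat) (m : 'I_n).
Variables (P L Lb S : 'I_n -> A -> A) (lam : 'I_n -> A).
Variables (c : {rmorphism A -> A}) (cF : {rmorphism F -> F}).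
Hypothesis dP : forall k, derivation (P k).
Hypothesis dL : forall k, derivation (L k).
Hypothesis dLb : forall k, derivation (Lb k).
Hypothesis PL : forall j k f, L j (P k f) = P k (L j f).
Hypothesis LbE : forall k f, Lb k f = P k f + lam k * P m f.
Hypothesis cK : involutive c.
Hypothesis evc : forall a, ev (c a) = cF (ev a).
Hypothesis LbcL : forall k f, Lb k f = c (L k (c f)).
Hypothesis ScP : forall k f, S k f = c (P k (c f)).

Definition tang (j : 'I_n + 'I_n) : A -> A :=
  match j with inl k => P k | inr k => L k end.

Hypothesis combS : forall k, combination tang (S k).

Lemma d_tang j : derivation (tang j). Proof. by case: j. Qed.

Definition flat := dflat tang (fun f => ev f = 0).

Lemma ev0D a b : ev a = 0 -> ev b = 0 -> ev (a + b) = 0.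
Proof. by move=> a0 b0; rewrite rmorphD a0 b0 addr0. Qed.
Lemma ev0M a b : ev b = 0 -> ev (a * b) = 0.
Proof. by move=> b0; rewrite rmorphM b0 mulr0. Qed.
Local Notation ev0 := (rmorph0 ev).

Lemma combP k : combination tang (P k).
Proof.
exists (fun j => if j is inl l then (l == k)%:R else 0) => f.
rewrite big_sumType /= [X in _ + X]big1 ?addr0; last by move=> i _; rewrite mul0r.
rewrite (bigD1 k) //= eqxx mul1r big1 ?addr0 // => i /negbTE ->.
by rewrite mul0r.
Qed.

Lemma combL k : combination tang (L k).
Proof.
exists (fun j => if j is inr l then (l == k)%:R else 0) => f.
rewrite big_sumType /= big1 ?add0r; last by move=> i _; rewrite mul0r.
rewrite (bigD1 k) //= eqxx mul1r big1 ?addr0 // => i /negbTE ->.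
by rewrite mul0r.
Qed.

Lemma combLb k : combination tang (Lb k).
Proof.
have [a aP] := combP k; have [b bP] := combP m.
exists (fun j => a j + lam k * b j) => f; rewrite LbE aP bP mulr_sumr -big_split /=.
by apply: eq_bigr => j _; rewrite mulrDl mulrA.
Qed.

(** Conjugation exchanges P with S and Lb with L, and the S and Lb are combinations of the frame P,
    L. *)
Lemma flat_conj K f : flat K f -> flat K (c f).
Proof.
elim: K f => // K IH f Ff; split; first by case: Ff => f0 _; rewrite evc f0 rmorph0.
move=> [k|k] /=.
  have -> : P k (c f) = c (S k f) by rewrite ScP cK.
  apply: IH; apply: dflat_comb Ff => //; [exact: d_tang|exact: ev0|exact: ev0D|exact: ev0M].
have -> : L k (c f) = c (Lb k f) by rewrite LbcL cK.
apply: IH; apply: dflat_comb Ff; [exact: d_tang|exact: ev0|exact: ev0D|exact: ev0M|].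
exact: combLb.
Qed.

Lemma tang_conj j : exists a b, forall f,
  tang j f = \sum_k a k * S k f + \sum_k b k * Lb k f.
Proof.
have ES k f : P k f = c (S k (c f)) by rewrite ScP !cK.
case: j => k /=.
  have [a aP] := combS k.
  exists (fun l => c (a (inl l))), (fun l => c (a (inr l))) => f.
  rewrite ES aP big_sumType rmorphD !rmorph_sum /=.
  by congr (_ + _); apply: eq_bigr => l _; rewrite rmorphM ?ScP ?LbcL.
exists (fun l => (l == k)%:R + c (lam k) * (l == m)%:R), (fun=> 0) => f.
rewrite [X in _ + X]big1 ?addr0; last by move=> l _; rewrite mul0r.
have -> : L k f = c (Lb k (c f)) by rewrite LbcL !cK.
rewrite LbE rmorphD rmorphM -!ScP.
under eq_bigr do rewrite mulrDl; rewrite big_split /=; congr (_ + _).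
  by rewrite (bigD1 k) //= eqxx mul1r big1 ?addr0 // => i /negbTE ->; rewrite mul0r.
rewrite (bigD1 m) //= eqxx mulr1 big1 ?addr0 // => i /negbTE ->.
by rewrite mulr0 mul0r.
Qed.

Lemma SLb j k f : Lb j (S k f) = S k (Lb j f).
Proof. by rewrite !ScP !LbcL !cK PL. Qed.

(** Formal vanishing on the first Segre set: these are the Taylor coefficients of f along the flow
    of the Lb from p0. *)
Definition lbnull (f : A) : Prop := forall g, ev (word Lb g f) = 0.

Lemma lbnull0 : lbnull 0. Proof. by move=> g; rewrite word0 // rmorph0. Qed.
Lemma lbnullD a b : lbnull a -> lbnull b -> lbnull (a + b).
Proof. by move=> a0 b0 g; rewrite wordD // rmorphD a0 b0 addr0. Qed.
Lemma lbnullM a b : lbnull b -> lbnull (a * b).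
Proof.
by move=> b0 g; rewrite wordM // convC; apply: conv_ideal => d _; exact: b0.
Qed.

Definition sflat := dflat tang lbnull.

Lemma sflat_span K (G : A -> Prop) f :
  (forall g, G g -> sflat K g) -> span G f -> sflat K f.
Proof.
by apply: dflat_span; [exact: d_tang|exact: lbnull0|exact: lbnullD|exact: lbnullM].
Qed.

Lemma combS_word K w f : flat (K + size w) f -> flat K (word S w f).
Proof.
by apply: dflat_comb_word combS; [exact: d_tang|exact: ev0|exact: ev0D|exact: ev0M].
Qed.

Lemma lb_word_S j w f : (forall j, Lb j f = 0) -> Lb j (word S w f) = 0.
Proof.
move=> Lbf; elim: w => //= k w IH; rewrite SLb IH ScP rmorph0 derivation0 //.
by rewrite rmorph0.
Qed.

Lemma lbnull_killed f : (forall j, Lb j f = 0) -> ev f = 0 -> lbnull f.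
Proof.
move=> Lbf f0 g; case/lastP: g => [|g j] //.
by rewrite /word foldr_rcons Lbf -/(word Lb g 0) word0 // rmorph0.
Qed.

(** A germ killed by the Lb is constant along their flow, so what vanishes at p0 vanishes on the
    first Segre set. The same holds for its derivatives: they are combinations of S-words of f,
    which the Lb kill because they commute with the S. *)
Lemma sflat_flat k f : (forall j, Lb j f = 0) -> flat k f -> sflat k f.
Proof.
move=> Lbf fk; pose G i g := exists2 d, (size d <= i)%N & g = word S d f.
suff H k' i h : (k' + i <= k)%N -> span (G i) h -> sflat k' h.
  by apply: (H k 0%N); rewrite ?addn0 //; apply: span_gen; exists [::].
elim: k' i h => // k' IH i h ki Gh; split.
  apply: span_ind_ideal Gh; [exact: lbnull0|exact: lbnullD|exact: lbnullM|].
  move=> _ [d di ->]; apply: lbnull_killed => [j|]; first exact: lb_word_S.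
  suff [] : flat 1 (word S d f) by [].
  apply: combS_word; apply: (@dflat_le _ _ _ _ k) => //; lia.
move=> j; apply: (IH i.+1); first by rewrite addnS -addSn.
elim: Gh => [|a _ f' [d di ->] _ IHf]; first by rewrite derivation0; [constructor|exact: d_tang].
rewrite (d_tang j).1 (d_tang j).2 -addrA.
apply: spanS; first by exists d => //; apply: leqW.
apply: spanD IHf; apply: spanM; have [b [b' ->]] := tang_conj j.
rewrite [X in _ + X]big1 ?addr0; last by move=> k0 _; rewrite lb_word_S // mulr0.
by apply: span_sum => k0 _; apply/spanM/span_gen; exists (k0 :: d).
Qed.

Lemma sflat_wordL k w f : sflat (k + size w) f -> sflat k (word L w f).
Proof.
have -> : word L w f = word tang (map inr w) f by elim: w => //= i w ->.
by move=> H; apply: dflat_word; rewrite size_map.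
Qed.

(** Membership in the ideal generated by G up to errors of arbitrarily high order at p0. The
    combination s may depend on K, as it comes from a truncated Taylor expansion. *)
Definition approx (G : A -> Prop) (f : A) : Prop :=
  forall K, exists s r, [/\ span G s, flat K r & f = s + r].

Lemma sflat_approx k (G : A -> Prop) f :
  (forall g, G g -> sflat k g) -> approx G f -> sflat k f.
Proof.
move=> Gk Gf; apply/dflatP => w wk g.
(* Each letter of g and w costs the error one order of flatness, and one order is left to evaluate
   it at p0. *)
have [s [r [Gs rK ->]]] := Gf (1 + size g + size w)%N.
rewrite !wordD //; last exact: d_tang.
rewrite rmorphD.
have /(dflatP tang lbnull) -> // := sflat_span Gk Gs; rewrite add0r.
have : flat (1 + size g) (word tang w r) by exact: dflat_word.
move=> /(@dflat_comb_word _ _ _ d_tang _ ev0 ev0D ev0M 1 _ Lb g _ combLb).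
by case.
Qed.

Variables (I1 I2 : Type) (D1 : I1 -> A) (D2 : I2 -> A) (k0 : nat).
Hypothesis LD1 : forall i j, L j (D1 i) = 0.
Hypothesis LD2 : forall i j, L j (D2 i) = 0.
Hypothesis fD1 : forall i, flat (k0 + k0).+1 (D1 i).
Hypothesis fD2 : forall i, flat k0.+1 (D2 i).

(** Up to k0 derivatives fall on the conjugates of the D1, none on those of the D2. This is why the
    D1 start flat to order 2 k0 + 1 and the D2 only to order k0 + 1. *)
Definition reflected (g : A) : Prop :=
  (exists i w, (size w <= k0)%N /\ g = word L w (c (D1 i))) \/
  (exists i, g = c (D2 i)).

Hypothesis rD1 : forall i, approx reflected (D1 i).
Hypothesis rD2 : forall i, approx reflected (D2 i).

Lemma LbcD f : (forall j, L j f = 0) -> forall j, Lb j (c f) = 0.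
Proof. by move=> Lf j; rewrite LbcL cK Lf rmorph0. Qed.

Lemma reflected_sflat g : reflected g -> sflat k0.+1 g.
Proof.
case=> [[i [w [wk ->]]]|[i ->]].
  apply: sflat_wordL; apply: (@dflat_le _ _ _ _ (k0 + k0).+1).
    by rewrite addSn ltnS leq_add2l.
  exact (sflat_flat (LbcD (LD1 i)) (flat_conj (fD1 i))).
exact (sflat_flat (LbcD (LD2 i)) (flat_conj (fD2 i))).
Qed.

(* One reflection transports the k0-jet at p0 along the first Segre set. *)
Lemma segre1 i : sflat k0.+1 (D1 i).
Proof. exact: sflat_approx reflected_sflat (rD1 i). Qed.

Lemma segre1' i : sflat k0.+1 (D2 i).
Proof. exact: sflat_approx reflected_sflat (rD2 i). Qed.

Definition lnull (f : A) : Prop := forall a, ev (word L a f) = 0.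

Lemma lnull0 : lnull 0. Proof. by move=> g; rewrite word0 // rmorph0. Qed.
Lemma lnullD a b : lnull a -> lnull b -> lnull (a + b).
Proof. by move=> a0 b0 g; rewrite wordD // rmorphD a0 b0 addr0. Qed.
Lemma lnullM a b : lnull b -> lnull (a * b).
Proof.
by move=> b0 g; rewrite wordM // convC; apply: conv_ideal => d _; exact: b0.
Qed.

Lemma lnull_conj f w : (size w <= k0)%N -> sflat k0.+1 f -> lnull (word S w (c f)).
Proof.
move=> wk fk a.
have -> : word L a (word S w (c f)) = c (word Lb a (word P w f)).
  have -> : word S w (c f) = c (word P w f).
    by elim: w {wk} => //= k w ->; rewrite ScP cK.
  by elim: a => //= k a ->; rewrite LbcL cK.
rewrite evc; have -> : word P w f = word tang (map inl w) f by elim: w {wk} => //= k w ->.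
have /(dflatP tang lbnull) -> := fk; first by rewrite rmorph0.
by rewrite size_map.
Qed.

(** Conjugating [segre1], the S-words of length at most k0 in the conjugate of D1, and the conjugate
    of D2 itself, vanish under all words in the L; they are also killed by the Lb. By the reflection
    identity D1 is a combination of them up to flat errors. *)
Lemma segre2 i : segre_null ev L Lb (D1 i).
Proof.
pose G g := (forall j, Lb j g = 0) /\ lnull g.
have G0 w f : (size w <= k0)%N -> (forall j, L j f = 0) -> sflat k0.+1 f ->
    G (word S w (c f)).
  move=> wk Lf fk; split; last exact: lnull_conj.
  by move=> j; apply/lb_word_S/LbcD.
have RG g : reflected g -> span G g.
  case=> [[l [w [wk ->]]]|[l ->]]; last first.
    by apply: span_gen; apply: (G0 [::]) => //; exact: segre1'.
  pose H q g := exists2 d, (size d <= q)%N & g = word S d (c (D1 l)).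
  suff: span (H (size w)) (word L w (c (D1 l))).
    apply: span_trans => _ [d dw ->]; apply/span_gen/G0 => //; last exact: segre1.
    exact: leq_trans wk.
  elim: w {wk} => [|j w IH] /=; first by apply: span_gen; exists [::].
  elim: IH => [|a _ f' [d di ->] _ IHf]; first by rewrite derivation0 //; constructor.
  rewrite (dL j).1 (dL j).2 -addrA.
  apply: spanS; first by exists d => //; apply: leqW.
  apply: spanD IHf; apply: spanM; have [b [b' E]] := tang_conj (inr j).
  rewrite [L j _]E [X in _ + X]big1 ?addr0; last first.
    by move=> k _; rewrite lb_word_S ?mulr0 //; exact/LbcD.
  by apply: span_sum => k _; apply/spanM/span_gen; exists (k :: d).
move=> a g; have [s [r [Gs rK ->]]] := rD1 i (1 + size a + size g)%N.
rewrite !wordD // rmorphD.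
have -> : ev (word L a (word Lb g r)) = 0.
  have : flat (1 + size a) (word Lb g r).
    apply: dflat_comb_word combLb _ => //;
      [exact: d_tang|exact: ev0|exact: ev0D|exact: ev0M].
  move=> /(@dflat_comb_word _ _ _ d_tang _ ev0 ev0D ev0M 1 _ L a _ combL).
  by case.
rewrite addr0; have {Gs} Gs : span G s by exact: span_trans Gs.
(* The generators are killed by the Lb, so words in the Lb act on the coefficients only and do not
   leave the ideal. *)
suff Gg : span G (word Lb g s).
  suff : lnull (word Lb g s) by apply.
  by apply: span_ind_ideal Gg; [exact: lnull0|exact: lnullD|exact: lnullM|move=> ? []].
elim: g {rK} => //= j g IH; elim: IH => [|x h f' Gh _ IHf].
  by rewrite derivation0 //; constructor.
rewrite (dLb j).1 (dLb j).2 (Gh.1 j) mulr0 addr0.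
exact: spanS.
Qed.

End Propagation.

(** * Reflection in a ring of germs *)

Section Taylor.
Variables (F : numFieldType) (A : comNzRingType) (ev : {rmorphism A -> F}).
Variables (J : finType) (T : J -> A -> A) (cst : {rmorphism F -> A}).
Hypothesis dT : forall j, derivation (T j).
Hypothesis Tcst : forall j x, T j (cst x) = 0.
Variables (B : comNzRingType) (J' : finType) (del : J' -> B -> B).
Variables (e e' : {rmorphism B -> A}) (h h' : J' -> A).
Hypothesis delC : forall i j f, del i (del j f) = del j (del i f).
Hypothesis chain : forall j f, T j (e f) = \sum_i e (del i f) * T j (h i).
Hypothesis chain' : forall j f, T j (e' f) = \sum_i e' (del i f) * T j (h' i).
Hypothesis eve : forall f, ev (e f) = ev (e' f).
Hypothesis evh : forall i, ev (h i) = ev (h' i).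

Local Notation flat := (dflat T (fun f => ev f = 0)).
Local Notation ev0D := (@ev0D _ _ ev).
Local Notation ev0M := (@ev0M _ _ ev).
Let ev0 := rmorph0 ev.
Let d i := h i - h' i.

(** The homogeneous term of degree k in the Taylor expansion of f at h' with increment d. The
    recursion, with its factor 1 / k, is Euler's identity. *)
Fixpoint texp (k : nat) (f : B) : A :=
  if k is k'.+1 then cst (k'.+1%:R^-1) * \sum_i texp k' (del i f) * d i else e' f.

Lemma evd i : ev (d i) = 0. Proof. by rewrite rmorphB evh subrr. Qed.

Lemma flatMd k x i : flat k x -> flat k.+1 (x * d i).
Proof.
elim: k x => [|k IH] x xk; first by split=> //; rewrite rmorphM evd mulr0.
split=> [|j]; first by rewrite rmorphM evd mulr0.
rewrite (dT j).2; apply: dflatD => //; first exact: ev0D.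
  by apply: IH; case: xk => _; apply.
by rewrite mulrC; apply: dflatM => //; [exact: ev0D|exact: ev0M].
Qed.

Lemma texp_flat k f : flat k (texp k f).
Proof.
elim: k f => //= k IH f; apply: (@dflatM _ _ _ _ _ _ _ k.+1) => //;
  [exact: ev0D|exact: ev0M|].
apply: (@dflat_sum _ _ _ _ _ _ _ k.+1) => //; first exact: ev0D.
by move=> i _; apply: flatMd.
Qed.

(** The first sum comes from moving the base point h', the second from moving the increment d. Added
    over all degrees they combine to the derivative of h' + d = h. *)
Lemma texp_deriv k j f : T j (texp k f) =
  \sum_i texp k (del i f) * T j (h' i) +
  (if k is k'.+1 then \sum_i texp k' (del i f) * T j (d i) else 0).
Proof.
elim: k f => [|k IH] f; first by rewrite addr0 /= chain'.
rewrite /= (dT j).2 Tcst mul0r add0r (derivation_sum _ _ _ (dT j)).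
under [X in _ * X = _]eq_bigr do rewrite (dT j).2 IH mulrDl -addrA.
rewrite big_split mulrDr; congr (_ + _).
  under [RHS]eq_bigr do rewrite -mulrA.
  rewrite -mulr_sumr; congr (_ * _).
  under [RHS]eq_bigr do rewrite mulr_suml.
  rewrite exchange_big; apply: eq_bigr => i _; rewrite mulr_suml.
  by apply: eq_bigr => l _; rewrite delC mulrAC.
set s := (X in _ = X); rewrite big_split /=.
have -> : \sum_i (if k is k'.+1 then \sum_l texp k' (del l (del i f)) * T j (d l)
    else 0) * d i = k%:R * s.
  rewrite /s; case: (k) => [|k1]; first by rewrite mul0r big1 // => i _; rewrite mul0r.
  rewrite mulr_sumr; under eq_bigr do rewrite mulr_suml.
  rewrite exchange_big; apply: eq_bigr => i _ /=.
  rewrite mulrA mulrA -(rmorph_nat cst k1.+1) -rmorphM.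
  rewrite divff ?pnatr_eq0 // rmorph1 mul1r mulr_suml.
  by apply: eq_bigr => l _; rewrite delC mulrAC.
rewrite -/s -[X in _ * (_ + X)]mul1r -mulrDl natr1 mulrA.
by rewrite -(rmorph_nat cst k.+1) -rmorphM mulVf ?pnatr_eq0 // rmorph1 mul1r.
Qed.

(** Differentiation turns the remainder of order K + 1 of f into remainders of order K of its
    partial derivatives, up to a term [texp K], which is flat to order K because it has degree K in
    d. *)
Lemma texp_rem K f : flat K (e f - \sum_(k < K) texp k f).
Proof.
elim: K f => // K IH f; split.
  rewrite rmorphB big_ord_recl /= rmorphD eve rmorph_sum big1 ?addr0 ?subrr // => k _.
  rewrite rmorphM rmorph_sum big1 ?mulr0 // => i _.
  by rewrite rmorphM evd mulr0.
move=> j; rewrite derivationB // chain (derivation_sum _ _ _ (dT j)).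
have -> : \sum_(k < K.+1) T j (texp k f) =
    \sum_i (\sum_(k < K) texp k (del i f)) * T j (h i) +
    \sum_i texp K (del i f) * T j (h' i).
  under eq_bigr do rewrite texp_deriv; rewrite big_split /=.
  rewrite [X in _ + X]big_ord_recl add0r.
  rewrite [X in _ + X](_ : _ =
    \sum_(k < K) \sum_i texp k (del i f) * T j (d i)) //.
  rewrite [X in X + _]big_ord_recr /= addrAC; congr (_ + _).
  under [RHS]eq_bigr do rewrite mulr_suml.
  rewrite [RHS]exchange_big -big_split /=; apply: eq_bigr => k _.
  rewrite -big_split; apply: eq_bigr => i _ /=.
  by rewrite -mulrDr -(dT j).1 /d addrC subrK.
rewrite opprD addrA; apply: dflatB => //; [exact: ev0D|exact: ev0M| |].
  rewrite -sumrB; apply: dflat_sum => //; [exact: ev0D|] => i _.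
  by rewrite -mulrBl mulrC; apply: dflatM => //; [exact: ev0D|exact: ev0M].
apply: dflat_sum => //; [exact: ev0D|] => i _.
by rewrite mulrC; apply: dflatM; [|exact: ev0D|exact: ev0M|exact: texp_flat].
Qed.

(** One factor [d i] is split off every term of positive degree. The coefficient [a i] starts with
    the first derivative at h', and its other terms still contain a factor d. *)
Lemma taylor_ideal K f : exists a r, [/\ flat K r,
  e f - e' f = \sum_i a i * d i + r &
  forall i, span (fun g => exists l, g = d l) (a i - e' (del i f))].
Proof.
exists (fun i => \sum_(k < K.+1) cst (k.+1%:R^-1) * texp k (del i f)).
exists (e f - \sum_(k < K.+2) texp k f); split.
- apply: (@dflat_le _ _ _ _ K.+2); last exact: texp_rem.
  by rewrite !leqW.
- suff -> : \sum_(k < K.+2) texp k f = e' f + \sum_i (\sum_(k < K.+1)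
      cst (k.+1%:R^-1) * texp k (del i f)) * d i.
    by set s := \sum_i _; ring.
  rewrite big_ord_recl; congr (_ + _); under [RHS]eq_bigr do rewrite mulr_suml.
  rewrite exchange_big; apply: eq_bigr => k _ /=; rewrite mulr_sumr.
  by apply: eq_bigr => i _; rewrite mulrA.
- move=> i; rewrite big_ord_recl /= invr1 rmorph1 mul1r addrAC subrr add0r.
  apply: span_sum => k _ /=; do 2 apply: spanM.
  by apply: span_sum => l _; apply/spanM/span_gen; exists l.
Qed.

End Taylor.

Section MxDeriv.
Variable (A : comNzRingType).

Lemma map_mx_deriv (X : A -> A) p q r (M : 'M[A]_(p, q)) (M' : 'M[A]_(q, r)) :
  derivation X ->
  map_mx X (M *m M') = map_mx X M *m M' + M *m map_mx X M'.
Proof.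
move=> dX; apply/matrixP => i j; rewrite !mxE derivation_sum // -big_split /=.
by apply: eq_bigr => k _; rewrite dX.2 !mxE.
Qed.

Lemma map_mxB_deriv (X : A -> A) p q (M M' : 'M[A]_(p, q)) :
  derivation X -> map_mx X (M - M') = map_mx X M - map_mx X M'.
Proof. by move=> dX; apply/matrixP => i j; rewrite !mxE derivationB. Qed.

Lemma local_invmx (F : fieldType) (ev : {rmorphism A -> F}) p (M : 'M[A]_p) :
  (forall a, ev a != 0 -> exists b, a * b = 1) -> map_mx ev M \in unitmx ->
  exists M', M *m M' = 1%:M /\ M' *m M = 1%:M.
Proof.
move=> loc M1; have [|b Mb] := loc (\det M); first by rewrite -det_map_mx -unitfE -unitmxE.
exists (b *: \adj M); rewrite -scalemxAr -scalemxAl mul_mx_adj mul_adj_mx.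
by rewrite scale_scalar_mx mulrC Mb.
Qed.

End MxDeriv.

Section Reflection.
Variables (F : numFieldType) (A : comNzRingType) (ev : {rmorphism A -> F}).
Variables (cst : {rmorphism F -> A}) (n : nat) (m : 'I_n).
Variables (P L Lb S : 'I_n -> A -> A) (lam : 'I_n -> A).
Variables (c : {rmorphism A -> A}) (cF : {rmorphism F -> F}).
Hypothesis dP : forall k, derivation (P k).
Hypothesis dL : forall k, derivation (L k).
Hypothesis dLb : forall k, derivation (Lb k).
Hypothesis PL : forall j k f, L j (P k f) = P k (L j f).
Hypothesis LbE : forall k f, Lb k f = P k f + lam k * P m f.
Hypothesis cK : involutive c.
Hypothesis evc : forall a, ev (c a) = cF (ev a).
Hypothesis LbcL : forall k f, Lb k f = c (L k (c f)).
Hypothesis ScP : forall k f, S k f = c (P k (c f)).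
Hypothesis combS : forall k, combination (tang P L) (S k).
Hypothesis evcst : forall x, ev (cst x) = x.
Hypothesis Tcst : forall j x, tang P L j (cst x) = 0.
Hypothesis local : forall a, ev a != 0 -> exists b, a * b = 1.

Variables (p : nat) (B : comNzRingType) (del : ('I_p + 'I_p)%type -> B -> B).
Variables (e e' : {rmorphism B -> A}) (H H' : 'I_p -> A).
Let h i := match i with inl k => H k | inr k => c (H k) end.
Let h' i := match i with inl k => H' k | inr k => c (H' k) end.
Hypothesis delC : forall i j f, del i (del j f) = del j (del i f).
Hypothesis chain : forall j f,
  tang P L j (e f) = \sum_i e (del i f) * tang P L j (h i).
Hypothesis chain' : forall j f,
  tang P L j (e' f) = \sum_i e' (del i f) * tang P L j (h' i).
Hypothesis eve : forall f, ev (e f) = ev (e' f).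
Variable rho : B.
Hypothesis erho : e rho = 0.
Hypothesis e'rho : e' rho = 0.
Hypothesis ce : forall i, c (e (del (inl i) rho)) = e (del (inr i) rho).
Hypothesis ce' : forall i, c (e' (del (inl i) rho)) = e' (del (inr i) rho).
Variable k0 : nat.
Let D i := H i - H' i.
Hypothesis LH : forall i j, L j (H i) = 0.
Hypothesis LH' : forall i j, L j (H' i) = 0.
Hypothesis fD : forall i, flat ev P L (k0 + k0).+1 (D i).
Variables (r : nat) (al : 'I_r -> seq 'I_n).
Hypothesis al_size : forall t, (size (al t) <= k0)%N.
Definition rowsmx (E : B -> A) : 'M[A]_(r, p) :=
  \matrix_(t, i) word L (al t) (E (del (inl i) rho)).
Hypothesis rows_free : row_free (map_mx ev (rowsmx e)).
(** Constant rank in the form in which it is used: a vector killed by the chosen rows is killed by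
    all derivatives L^w rho'_Z'. *)
Definition annihilating (E : B -> A) : Prop := forall y : 'cV[A]_p,
  rowsmx E *m y = 0 ->
  forall w, \sum_i word L w (E (del (inl i) rho)) * y i 0 = 0.
Hypothesis ann : annihilating e.
Hypothesis ann' : annihilating e'.
Hypothesis levi_aniso : forall x : 'cV[F]_p, map_mx ev (rowsmx e) *m x = 0 ->
  \sum_i \sum_l ev (e (del (inl i) (del (inr l) rho))) * x i 0 * cF (x l 0) = 0 ->
  x = 0.

Local Notation flat := (flat ev P L).
Let dT := d_tang dP dL.
Let ev0 := rmorph0 ev.
Local Notation ev0D := (@ev0D _ _ ev).
Local Notation ev0M := (@ev0M _ _ ev).

Definition hyperideal (f : A) : Prop := (exists i, f = D i) \/
  exists i w, (size w <= k0)%N /\ f = word L w (c (D i)).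

Definition rapprox (G : A -> Prop) K f :=
  exists s q, [/\ span G s, flat K q & f = s + q].

Lemma rapproxD G K f g : rapprox G K f -> rapprox G K g -> rapprox G K (f + g).
Proof.
move=> [s [q [Gs qK ->]]] [s' [q' [Gs' qK' ->]]].
exists (s + s'), (q + q'); rewrite addrACA; split=> //; first exact: spanD.
by apply: dflatD => //; exact: ev0D.
Qed.

Lemma rapproxM G K a f : rapprox G K f -> rapprox G K (a * f).
Proof.
move=> [s [q [Gs qK ->]]]; exists (a * s), (a * q); rewrite mulrDr.
split=> //; first exact: spanM.
by apply: dflatM => //; [exact: ev0D|exact: ev0M].
Qed.

Lemma rapproxN G K f : rapprox G K f -> rapprox G K (- f).
Proof. by rewrite -mulN1r; exact: rapproxM. Qed.

Lemma rapprox_sum G K (I : Type) (s : seq I) (Q : pred I) (f : I -> A) :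
  (forall i, Q i -> rapprox G K (f i)) -> rapprox G K (\sum_(i <- s | Q i) f i).
Proof.
move=> Hf; apply: big_ind => //; last exact: rapproxD.
by exists 0, 0; rewrite addr0; split=> //; [constructor|apply: dflat0].
Qed.

Lemma rapprox_gen (G : A -> Prop) K f : G f -> rapprox G K f.
Proof.
by move=> Gf; exists f, 0; rewrite addr0; split=> //; [exact: span_gen|apply: dflat0].
Qed.

Lemma rapprox_trans (G G' : A -> Prop) K f :
  (forall g, G g -> rapprox G' K g) -> rapprox G K f -> rapprox G' K f.
Proof.
move=> GG' [s [q [Gs qK ->]]]; apply: rapproxD; last first.
  by exists 0, q; rewrite add0r; split=> //; constructor.
elim: Gs => [|a g f' Gg _ IH]; last by apply: rapproxD IH; apply/rapproxM/GG'.
by exists 0, 0; rewrite addr0; split=> //; [constructor|apply: dflat0].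
Qed.

Lemma rapprox_flat K k G f : (forall g, G g -> flat k g) -> (k <= K)%N ->
  rapprox G K f -> flat k f.
Proof.
move=> Gk kK [s [q [Gs qK ->]]]; apply: dflatD => //; first exact: ev0D.
  by apply: dflat_span Gs => //; [exact: ev0D|exact: ev0M].
exact: dflat_le qK.
Qed.

Lemma LD i j : L j (D i) = 0. Proof. by rewrite derivationB // LH LH' subrr. Qed.

Lemma fcD i : flat (k0 + k0).+1 (c (D i)).
Proof. by apply: (flat_conj dP dL LbE cK evc LbcL ScP combS). Qed.

Lemma ediff K f : exists a q, [/\ flat K q,
  e f - e' f = \sum_i a (inl i) * D i + \sum_i a (inr i) * c (D i) + q &
  forall i, flat (k0 + k0).+1 (a i - e' (del i f))].
Proof.
have dh i : h i - h' i = if i is inl k then D k else if i is inr k then c (D k) else 0.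
  by case: i => k //=; rewrite rmorphB.
have fd i : flat (k0 + k0).+1 (h i - h' i) by rewrite dh; case: i => k; [exact: fD|exact: fcD].
have [i|a [q [qK E aE]]] := taylor_ideal dT Tcst delC chain chain' eve _ K f.
  by apply/eqP; rewrite -subr_eq0 -rmorphB; have [/= ->] := fd i.
exists a, q; split=> //.
  by rewrite E big_sumType; congr (_ + _ + _); apply: eq_bigr => i _; rewrite dh.
move=> i; apply: dflat_span (aE i) => //; [exact: ev0D|exact: ev0M|].
by move=> _ [l ->]; exact: fd.
Qed.

Lemma ediff_flat f : flat (k0 + k0).+1 (e f - e' f).
Proof.
have [a [q [qK -> _]]] := ediff (k0 + k0).+1 f.
apply: dflatD qK => //; first exact: ev0D.
apply: dflatD => //; first exact: ev0D.
  apply: dflat_sum => //; [exact: ev0D|] => i _.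
  by apply: dflatM => //; [exact: ev0D|exact: ev0M|exact: fD].
apply: dflat_sum => //; [exact: ev0D|] => i _.
by apply: dflatM => //; [exact: ev0D|exact: ev0M|exact: fcD].
Qed.

Lemma flat_wordL K w f : flat (K + size w) f -> flat K (word L w f).
Proof.
by apply: dflat_comb_word => //; [exact: ev0D|exact: ev0M|exact: combL].
Qed.

Lemma ev_wordL w f : (size w <= k0)%N -> flat (k0 + k0).+1 f -> ev (word L w f) = 0.
Proof.
move=> wk fk; suff [] : flat 1 (word L w f) by [].
by apply: flat_wordL; apply: dflat_le fk; lia.
Qed.

Lemma span_conv w (u v : seq 'I_n -> A) :
  span (fun g => exists2 d, (size d <= size w)%N & g = v d) (conv w u v).
Proof.
elim: w u v => [|i w IH] u v /=; first by apply/spanM/span_gen; exists [::].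
apply: spanD; first by apply: span_trans (IH _ _) => _ [d dw ->];
  apply: span_gen; exists d => //; exact: leqW.
by apply: span_trans (IH _ _) => _ [d dw ->]; apply: span_gen; exists (i :: d).
Qed.

Definition conj_words (g : A) : Prop :=
  exists i w, (size w <= k0)%N /\ g = word L w (c (D i)).

Lemma word_conj_rapprox K w a i : (size w <= k0)%N ->
  rapprox conj_words K (word L w (a * c (D i))).
Proof.
move=> wk; rewrite wordM //; exists (conv w (fun d => word L d a) (fun d => word L d (c (D i)))), 0.
split; rewrite ?addr0 //; last by apply: dflat0.
apply: span_trans (span_conv _ _ _) => _ [d dw ->]; apply: span_gen.
by exists i, d; split=> //; exact: leq_trans wk.
Qed.

(** As the L kill D, they act only on the coefficients of D and create no derivatives of it; on the
    conjugate of D at most k0 derivatives arise. *)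
Lemma word_ediff K w f : (size w <= k0)%N -> exists a,
  rapprox conj_words K (word L w (e f - e' f) - \sum_i word L w (a i) * D i) /\
  forall i, flat (k0 + k0).+1 (a i - e' (del (inl i) f)).
Proof.
move=> wk; have [a [q [qK -> aE]]] := ediff (K + size w) f.
exists (fun i => a (inl i)); split=> [|i]; last exact: aE.
rewrite !wordD // word_sum //.
have -> : \sum_i word L w (a (inl i) * D i) = \sum_i word L w (a (inl i)) * D i.
  by apply: eq_bigr => i _; rewrite word_mulr // => j; exact: LD.
set t := \sum_i word L w (a (inl i)) * D i.
have -> : forall x y : A, t + x + y - t = x + y by move=> x y; ring.
apply: rapproxD; last by exists 0, (word L w q); rewrite add0r; split=> //;
  [constructor|exact: flat_wordL].
by rewrite word_sum //; apply: rapprox_sum => i _; exact: word_conj_rapprox.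
Qed.

Lemma ev_rows : map_mx ev (rowsmx e') = map_mx ev (rowsmx e).
Proof.
apply/matrixP => t i; rewrite !mxE; apply/eqP; rewrite eq_sym -subr_eq0 -rmorphB.
by rewrite -wordB //; apply/eqP/ev_wordL; [exact: al_size|exact: ediff_flat].
Qed.

Let Q := (kermx (map_mx ev (rowsmx e))^T)^T.

Lemma rowsQ : map_mx ev (rowsmx e) *m Q = 0.
Proof. by apply: trmx_inj; rewrite trmx_mul trmxK mulmx_ker trmx0. Qed.

Lemma kerQ (x : 'cV[F]_p) : map_mx ev (rowsmx e) *m x = 0 -> exists y, x = Q *m y.
Proof.
move=> /(congr1 trmx); rewrite trmx_mul trmx0 => /sub_kermxP /submxP[y xE].
by exists y^T; apply: trmx_inj; rewrite trmx_mul !trmxK.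
Qed.

(** V is the frame of the kernel that differs from the constant matrix Q by something in the image
    of Pm. Its L-derivatives lie in that image, and also in the kernel since all L^w rho'_Z'
    annihilate V. Because [rowsmx E] is invertible on the image of Pm, they vanish. *)
Lemma frame (Pm : 'M[F]_(p, r)) (E : B -> A) :
  map_mx ev (rowsmx e) *m Pm = 1%:M ->
  map_mx ev (rowsmx E) = map_mx ev (rowsmx e) -> annihilating E ->
  exists V Y G, [/\ rowsmx E *m V = 0, V = map_mx cst Q - map_mx cst Pm *m Y,
    forall j, map_mx (L j) V = 0,
    forall w q, \sum_i word L w (E (del (inl i) rho)) * V i q = 0 &
    map_mx ev V = Q] /\ G *m (rowsmx E *m map_mx cst Pm) = 1%:M.
Proof.
move=> BP evE annE.
have evc' s t (M : 'M[F]_(s, t)) : map_mx ev (map_mx cst M) = M.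
  by apply/matrixP => i j; rewrite !mxE evcst.
have Lc s t (M : 'M[F]_(s, t)) j : map_mx (L j) (map_mx cst M) = 0.
  by apply/matrixP => i k; rewrite !mxE; exact: (Tcst (inr j)).
have [|G [MG GM]] := @local_invmx A F ev r (rowsmx E *m map_mx cst Pm) local.
  by rewrite map_mxM evE evc' BP unitmx1.
pose Y := G *m (rowsmx E *m map_mx cst Q).
pose V := map_mx cst Q - map_mx cst Pm *m Y.
have EV : rowsmx E *m V = 0 by rewrite mulmxBr /Y !mulmxA MG mul1mx subrr.
have Vann w q : \sum_i word L w (E (del (inl i) rho)) * V i q = 0.
  have := annE (col q V); rewrite {1}colE mulmxA EV mul0mx => /(_ erefl w) H0.
  by rewrite -[RHS]H0; apply: eq_bigr => i _; rewrite [in RHS]mxE.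
exists V, Y, G; split=> //; split=> //.
  move=> j.
  have LV : map_mx (L j) V = - (map_mx cst Pm *m map_mx (L j) Y).
    by rewrite map_mxB_deriv // Lc map_mx_deriv // Lc mul0mx !add0r.
  have : rowsmx E *m map_mx (L j) V = 0.
    have := map_mx_deriv (rowsmx E) V (dL j); rewrite EV.
    have -> : map_mx (L j) (rowsmx E) *m V = 0.
      apply/matrixP => t q; rewrite !mxE -[RHS](Vann (j :: al t) q).
      by apply: eq_bigr => i _; rewrite !mxE.
    rewrite add0r => <-; apply/matrixP => i k; rewrite !mxE derivation0 //.
  rewrite LV mulmxN mulmxA => /eqP; rewrite oppr_eq0 => /eqP /(congr1 (mulmx G)).
  by rewrite mulmxA GM mul1mx mulmx0 => ->; rewrite mulmx0 oppr0.
rewrite map_mxB evc' map_mxM /Y !map_mxM evE !evc' rowsQ !mulmx0.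
by rewrite subr0.
Qed.

(** Two linear systems for D are stacked: one from L^a rho'(H, conj H) = 0, one from the conjugate
    of rho'_Z' V = 0. Their right-hand sides involve only conjugates of D and of V - V', and the
    coefficient matrix has full column rank at p0. *)
Theorem reflection i : segre_null ev L Lb (D i).
Proof.
have /row_freeP [Pm BP] := rows_free.
have [V [Y [G [[BV VE LV Vann evV] GB]]]] := frame BP erefl ann.
have [V' [Y' [G' [[BV' VE' LV' Vann' evV'] _]]]] := frame BP ev_rows ann'.
pose DV (lq : 'I_p * 'I_p) := V lq.1 lq.2 - V' lq.1 lq.2.
pose D1 := D.
have LDV lq j : L j (DV lq) = 0.
  have /matrixP/(_ lq.1 lq.2) := LV j; have /matrixP/(_ lq.1 lq.2) := LV' j.
  by rewrite !mxE derivationB // => -> ->; rewrite subrr.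
have DVr K lq : rapprox hyperideal K (DV lq).
  (* Since V - V' lies in the image of Pm, it is recovered from its product with the rows, which
     equals (rows of e - rows of e') V' up to sign. *)
  have E : V - V' = - (map_mx cst Pm *m (G *m ((rowsmx e - rowsmx e') *m V'))).
    have E1 : V - V' = - (map_mx cst Pm *m (Y - Y')).
      by rewrite VE VE' mulmxBr; apply/matrixP => s t; rewrite !mxE; ring.
    rewrite E1; congr (- (_ *m _)).
    rewrite -[LHS]mul1mx -GB -!mulmxA; congr (_ *m _).
    rewrite -[LHS]opprK -mulmxN -E1 mulmxBr BV sub0r opprK mulmxBl BV' subr0.
    by [].
  have -> : DV lq = (V - V') lq.1 lq.2 by rewrite !mxE.
  rewrite E mxE; apply: rapproxN; rewrite mxE; apply: rapprox_sum => s _.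
  apply: rapproxM; rewrite mxE; apply: rapprox_sum => t _.
  apply: rapproxM; rewrite mxE; apply: rapprox_sum => u _.
  rewrite mulrC; apply: rapproxM; rewrite !mxE -wordB //.
  have [a [Ha _]] := word_ediff K (del (inl u) rho) (al_size t).
  rewrite -[word _ _ _](subrK (\sum_i word L (al t) (a i) * D i)).
  apply: rapproxD.
    by apply: rapprox_trans Ha => g Gg; apply: rapprox_gen; right.
  by apply: rapprox_sum => v _; apply/rapproxM/rapprox_gen; left; exists v.
(* Passing from D to the frame costs at most k0 derivatives, so k0 + 1 of the 2 k0 + 1 orders
   remain. *)
have fDV lq : flat k0.+1 (DV lq).
  apply: (rapprox_flat (K := k0.+1)) (DVr _ lq) => // _ [[v ->]|[v [w [wk ->]]]].
    by apply: dflat_le (fD v); rewrite ltnS leq_addr.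
  by apply: flat_wordL; apply: dflat_le (fcD v); rewrite addSn ltnS leq_add2l.
pose refl := reflected L c D DV k0.
have rD K v : rapprox refl K (D v).
  have [a aP] := choice (fun t => word_ediff K rho (al_size t)).
  have [b bP] := choice (fun l => @word_ediff K [::] (del (inr l) rho) (leq0n k0)).
  pose A1 : 'M[A]_(r, p) := \matrix_(t, i) word L (al t) (a t i).
  pose A2 : 'M[A]_p := \matrix_(q, i) \sum_l c (V' l q) * b l i.
  pose AA := col_mx A1 A2; pose Dv : 'cV[A]_p := \col_i D i.
  have conj_refl g : conj_words g -> rapprox refl K g.
    by move=> [l [w [wk ->]]]; apply: rapprox_gen; left; exists l, w.
  have AAD s : rapprox refl K ((AA *m Dv) s 0).
    rewrite mul_col_mx; case: (split_ordP s) => t ->; rewrite ?col_mxEu ?col_mxEd mxE.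
      have [+ _] := aP t; rewrite erho e'rho subrr word0 // sub0r => /rapproxN.
      rewrite opprK => /(rapprox_trans conj_refl).
      by congr (rapprox _ _ _); apply: eq_bigr => u _; rewrite !mxE.
    have -> : \sum_j A2 t j * Dv j 0 =
      - (\sum_l e (del (inr l) rho) * c (DV (l, t))) -
      \sum_l c (V' l t) * (e (del (inr l) rho) - e' (del (inr l) rho)
         - \sum_u b l u * D u).
      have cV : \sum_l e (del (inr l) rho) * c (V l t) = 0.
        rewrite -[RHS](rmorph0 c) -[X in _ = c X](Vann [::] t) rmorph_sum.
        by apply: eq_bigr => l _; rewrite rmorphM ce.
      have cV' : \sum_l e' (del (inr l) rho) * c (V' l t) = 0.
        rewrite -[RHS](rmorph0 c) -[X in _ = c X](Vann' [::] t) rmorph_sum.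
        by apply: eq_bigr => l _; rewrite rmorphM ce'.
      transitivity (\sum_l (c (V' l t) * (\sum_u b l u * D u)
          - e (del (inr l) rho) * c (V l t) + e' (del (inr l) rho) * c (V' l t))).
        rewrite !big_split /= sumrN cV cV' subr0 addr0.
        under eq_bigr do rewrite !mxE mulr_suml; rewrite exchange_big.
        by apply: eq_bigr => l _; rewrite mulr_sumr; apply: eq_bigr => u _; rewrite mulrA.
      rewrite -sumrN -sumrB; apply: eq_bigr => l _.
      by rewrite /DV rmorphB /=; set x := \sum_u _; ring.
    apply: rapproxD; apply: rapproxN; apply: rapprox_sum => l _; apply: rapproxM.
      by apply: rapprox_gen; right; exists (l, t).
    by have [H0 _] := bP l; exact: rapprox_trans H0.
  (* A vector x killed by the first block at p0 has the form Q y. Pairing the second block with conj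
     y then gives the Levi form at (x, x), so x = 0. *)
  have evAA : row_full (map_mx ev AA).
    rewrite /row_full -mxrank_tr -/(row_free _) -kermx_eq0; apply/eqP/row_matrixP => s; rewrite row0.
    have := mulmx_ker (map_mx ev AA)^T; move: (kermx _) => K0 /(congr1 (row s)).
    rewrite row_mul row0 => /(congr1 trmx); rewrite trmx_mul trmxK trmx0.
    set x := (row s K0)^T => x0.
    suff : x = 0 by move=> /(congr1 trmx); rewrite trmxK trmx0.
    clearbody x; move: x0; rewrite map_col_mx mul_col_mx => /eqP.
    rewrite col_mx_eq0 => /andP[/eqP x1 /eqP x2].
    have evA1 : map_mx ev A1 = map_mx ev (rowsmx e).
      rewrite -ev_rows; apply/matrixP => t i0; rewrite !mxE; apply/eqP.
      rewrite -subr_eq0 -rmorphB -wordB //; apply/eqP/ev_wordL; first exact: al_size.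
      by have [_] := aP t; apply.
    rewrite evA1 in x1; apply: levi_aniso => //; have [y xE] := kerQ x1.
    have evA2 q i0 : ev (A2 q i0) =
        \sum_l cF (Q l q) * ev (e (del (inl i0) (del (inr l) rho))).
      rewrite mxE rmorph_sum; apply: eq_bigr => l _; rewrite rmorphM evc.
      have /matrixP/(_ l q) := evV'; rewrite mxE => ->; congr (_ * _).
      apply/eqP; rewrite eve -subr_eq0 -rmorphB; apply/eqP.
      by have [_ /(_ i0)] := bP l; case.
    transitivity (\sum_q cF (y q 0) * \sum_i0 ev (A2 q i0) * x i0 0).
      under [RHS]eq_bigr do rewrite mulr_sumr.
      rewrite [RHS]exchange_big; apply: eq_bigr => i0 _ /=.
      under [RHS]eq_bigr do rewrite evA2 mulr_suml mulr_sumr.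
      rewrite [RHS]exchange_big; apply: eq_bigr => l _ /=.
      rewrite {2}xE mxE rmorph_sum mulr_sumr; apply: eq_bigr => q _.
      by rewrite rmorphM; ring.
    apply: big1 => q _; have /matrixP/(_ q 0) := x2; rewrite mxE [RHS]mxE => H0.
    rewrite [X in _ * X](_ : _ = 0) ?mulr0 // -[RHS]H0.
    by apply: eq_bigr => i0 _; rewrite [in RHS]mxE.
  (* A left inverse at p0, extended by constants, multiplies AA to a matrix that is invertible over
     the local ring. *)
  have /row_fullP[C CA] := evAA.
  have [|W [_ WC]] := @local_invmx A F ev p (map_mx cst C *m AA) local.
    rewrite (_ : map_mx ev _ = 1%:M) ?unitmx1 // map_mxM -CA; congr (_ *m _).
    by apply/matrixP => s t; rewrite !mxE evcst.
  have -> : D v = (W *m (map_mx cst C *m (AA *m Dv))) v 0.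
    by rewrite !mulmxA -[W *m _ *m _]mulmxA WC mul1mx mxE.
  rewrite mxE; apply: rapprox_sum => s _; apply: rapproxM; rewrite mxE.
  by apply: rapprox_sum => t _; apply: rapproxM.
(* The unknowns without derivatives in the reflection are the differences of the two kernel
   frames. *)
apply: (segre2 dP dL dLb PL LbE cK evc LbcL ScP combS (D1 := D) (D2 := DV) LD LDV fD fDV).
  by move=> l K; exact: rD.
move=> lq K; apply: rapprox_trans (DVr K lq) => g [[l ->]|[l [w [wk ->]]]]; first exact: rD.
by apply: rapprox_gen; left; exists l, w.
Qed.

End Reflection.

(** * Derivatives along lines *)

Section Derivative1.
Context {R : realType}.
Implicit Types (f g : R -> R) (t l : R).

Definition drv g t l : Prop := forall e, 0 < e -> exists2 d, 0 < d &
  forall h, `|h| < d -> `|g (t + h) - g t - h * l| <= e * `|h|.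

Lemma drvP g t l : drv g t l <-> is_derive t 1 g l.
Proof.
split=> [H|[dg <-] e e0].
  have cv : h^-1 *: ((g \o shift t) (h *: 1) - g t) @[h --> 0^'] --> l.
    apply/cvgrPdist_le => e /H[d d0 dP]; exists d => //= h /=.
    rewrite sub0r normrN => hd h0; rewrite /= [h *: 1]mulr1 [h + t]addrC.
    have hn : 0 < `|h| by rewrite normr_gt0.
    rewrite -(ler_pM2r hn) -normrM mulrBl.
    have -> : h^-1 *: (g (t + h) - g t) * h = g (t + h) - g t.
      by rewrite /GRing.scale /= mulrAC mulVf // mul1r.
    by rewrite distrC [l * h]mulrC; exact: dP.
  by apply: DeriveDef; [apply/cvg_ex; exists l|apply: cvg_lim].
move: dg => /cvgrPdist_le/(_ e e0) [d d0 dP]; exists d => // h hd.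
have [->|h0] := eqVneq h 0; first by rewrite addr0 subrr mul0r subrr normr0 mulr0.
have := dP h; rewrite /= sub0r normrN => /(_ hd h0).
rewrite -/('D_1 g t) [h *: 1]mulr1 [h + t]addrC.
have hn : 0 < `|h| by rewrite normr_gt0.
rewrite -(ler_pM2r hn) -normrM mulrBl distrC.
have -> : h^-1 *: (g (t + h) - g t) * h = g (t + h) - g t.
  by rewrite /GRing.scale /= mulrAC mulVf // mul1r.
by rewrite [_ * h]mulrC.
Qed.

Lemma drv_unique g t l l' : drv g t l -> drv g t l' -> l = l'.
Proof. by move=> /drvP[_ <-] /drvP[_ <-]. Qed.

Lemma drv_cont g t l : drv g t l -> forall e, 0 < e -> exists2 d, 0 < d &
  forall h, `|h| < d -> `|g (t + h) - g t| < e.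
Proof.
move=> H e e0; have [d d0 dP] := H 1 ltr01.
have c0 : 0 < 1 + `|l| by rewrite ltr_wpDr.
exists (Num.min d (e / (1 + `|l|))); first by rewrite lt_min d0 divr_gt0.
move=> h; rewrite lt_min => /andP[/dP + hl]; rewrite mul1r => hd.
rewrite -(subrK (h * l) (g (t + h) - g t)).
apply: le_lt_trans (ler_normD _ _) _; rewrite normrM.
apply: (@le_lt_trans _ _ (`|h| * (1 + `|l|))); last by rewrite -ltr_pdivlMr.
by rewrite mulrDr mulr1 lerD2r.
Qed.

Lemma drv_mvt g g' a b : (forall x, Num.min a b <= x <= Num.max a b -> drv g x (g' x)) ->
  exists2 c, Num.min a b <= c <= Num.max a b & g b - g a = g' c * (b - a).
Proof.
wlog ab : a b / a < b => [H Hg|].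
  have [ab|/lt_total/orP[ab|ba]] := eqVneq a b; last 2 first.
  - exact: H.
  - have [|c cab E] := H b a ba; first by move=> x; rewrite minC maxC; exact: Hg.
    by exists c; [rewrite minC maxC|rewrite -opprB E -mulrN opprB].
  by exists a; rewrite -ab ?minxx ?maxxx ?lexx // !subrr mulr0.
rewrite (min_idPl (ltW ab)) (max_idPr (ltW ab)) => Hg.
have [x xab|//|c cab E] := @MVT R g g' a b ab.
- by apply/drvP/Hg; move: xab; rewrite in_itv /= => /andP[/ltW -> /ltW ->].
- apply: derivable_within_continuous => x; rewrite in_itv /= => xab.
  by have /drvP[] := Hg _ xab.
by exists c => //; move: cab; rewrite in_itv /= => /andP[/ltW -> /ltW ->].
Qed.

Lemma drv_ext f g t l d : 0 < d -> (forall h, `|h| < d -> f (t + h) = g (t + h)) ->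
  drv f t l -> drv g t l.
Proof.
move=> d0 fg H e /H[d' d'0 dP]; exists (Num.min d d'); first by rewrite lt_min d0.
move=> h; rewrite lt_min => /andP[hd hd']; have := fg 0; rewrite normr0 addr0 => /(_ d0) <-.
by rewrite -fg //; exact: dP.
Qed.

Lemma drv_cst k t : drv (fun=> k) t 0.
Proof. by apply/drvP; exact: is_derive_cst. Qed.
Lemma drv_id t : drv id t 1.
Proof. by apply/drvP; exact: is_derive_id. Qed.
Lemma drvD f g t l l' : drv f t l -> drv g t l' -> drv (fun u => f u + g u) t (l + l').
Proof. by move=> /drvP ? /drvP ?; apply/drvP; exact: is_deriveD. Qed.
Lemma drvN f t l : drv f t l -> drv (fun u => - f u) t (- l).
Proof. by move=> /drvP ?; apply/drvP; exact: is_deriveN. Qed.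
Lemma drvB f g t l l' : drv f t l -> drv g t l' -> drv (fun u => f u - g u) t (l - l').
Proof. by move=> ? ?; apply/drvD/drvN. Qed.
Lemma drvM f g t l l' : drv f t l -> drv g t l' ->
  drv (fun u => f u * g u) t (f t * l' + g t * l).
Proof. by move=> /drvP ? /drvP ?; apply/drvP; exact: is_deriveM. Qed.
Lemma drvV f t l : f t != 0 -> drv f t l -> drv (fun u => (f u)^-1) t (- (f t) ^- 2 * l).
Proof. by move=> ? /drvP ?; apply/drvP; exact: is_deriveV. Qed.
Lemma drv_comp f g t l l' : drv f (g t) l -> drv g t l' -> drv (fun u => f (g u)) t (l * l').
Proof. by move=> /drvP ? /drvP ?; apply/drvP; exact: is_derive1_comp. Qed.

Lemma drv_derive g t l : drv g t l -> derivable g t 1 /\ derive1 g t = l.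
Proof. by move=> /drvP[? ?]; rewrite derive1E. Qed.
Lemma derive_drv g t : derivable g t 1 -> drv g t (derive1 g t).
Proof. by move=> dg; apply/drvP; split=> //; rewrite derive1E. Qed.

End Derivative1.

Section CDerivative1.
Context {R : realType}.
Local Notation C := R[i].
Local Notation re := (@complex.Re R).
Local Notation im := (@complex.Im R).
Implicit Types (f g : R -> C) (t : R) (l : C).

Lemma reD (x y : C) : re (x + y) = re x + re y. Proof. by case: x; case: y. Qed.
Lemma imD (x y : C) : im (x + y) = im x + im y. Proof. by case: x; case: y. Qed.
Lemma reN (x : C) : re (- x) = - re x. Proof. by case: x. Qed.
Lemma imN (x : C) : im (- x) = - im x. Proof. by case: x. Qed.
Lemma reB (x y : C) : re (x - y) = re x - re y. Proof. by rewrite reD reN. Qed.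
Lemma imB (x y : C) : im (x - y) = im x - im y. Proof. by rewrite imD imN. Qed.
Lemma reM (x y : C) : re (x * y) = re x * re y - im x * im y.
Proof. by case: x; case: y. Qed.
Lemma imM (x y : C) : im (x * y) = re x * im y + im x * re y.
Proof. by case: x => a b; case: y => c d. Qed.
Lemma reJ (x : C) : re (Num.conj x) = re x. Proof. by case: x. Qed.
Lemma imJ (x : C) : im (Num.conj x) = - im x. Proof. by case: x. Qed.
Lemma reim_eq (x y : C) : re x = re y -> im x = im y -> x = y.
Proof. by case: x => a b; case: y => c d /= -> ->. Qed.

Definition cdrv g t l : Prop :=
  drv (fun u => re (g u)) t (re l) /\ drv (fun u => im (g u)) t (im l).

Lemma cdrv_derive g t l : cdrv g t l -> cderivable1 g t /\ cderive1 g t = l.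
Proof.
move=> [/drv_derive[dr er] /drv_derive[di ei]]; split=> //.
by apply: reim_eq; rewrite /cderive1 /= ?er ?ei.
Qed.

Lemma derive_cdrv g t : cderivable1 g t -> cdrv g t (cderive1 g t).
Proof. by move=> [dr di]; split; exact: derive_drv. Qed.

Lemma cdrv_unique g t l l' : cdrv g t l -> cdrv g t l' -> l = l'.
Proof. by move=> /cdrv_derive[_ <-] /cdrv_derive[_ <-]. Qed.

Lemma cdrv_ext f g t l d : 0 < d -> (forall h, `|h| < d -> f (t + h) = g (t + h)) ->
  cdrv f t l -> cdrv g t l.
Proof.
by move=> d0 fg [fr fi]; split; [apply: drv_ext d0 _ fr|apply: drv_ext d0 _ fi] => h /fg ->.
Qed.

Lemma cdrv_eq f g t l : (forall u, f u = g u) -> cdrv f t l -> cdrv g t l.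
Proof. by move=> fg; apply: (cdrv_ext ltr01) => h _. Qed.

Lemma cdrv_cst k t : cdrv (fun=> k) t 0.
Proof. by split; exact: drv_cst. Qed.
Lemma cdrvD f g t l l' : cdrv f t l -> cdrv g t l' -> cdrv (fun u => f u + g u) t (l + l').
Proof.
move=> [fr fi] [gr gi]; split; rewrite ?reD ?imD.
  by have := drvD fr gr; apply: (drv_ext ltr01) => h _; rewrite reD.
by have := drvD fi gi; apply: (drv_ext ltr01) => h _; rewrite imD.
Qed.
Lemma cdrvM f g t l l' : cdrv f t l -> cdrv g t l' ->
  cdrv (fun u => f u * g u) t (f t * l' + l * g t).
Proof.
move=> [fr fi] [gr gi]; split; rewrite ?reD ?imD ?reM ?imM.
  have := drvB (drvM fr gr) (drvM fi gi).
  have -> : re (f t) * re l' + re (g t) * re l - (im (f t) * im l' + im (g t) * im l) =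
    re (f t) * re l' - im (f t) * im l' + (re l * re (g t) - im l * im (g t)) by ring.
  by apply: (drv_ext ltr01) => h _; rewrite reM.
have := drvD (drvM fr gi) (drvM fi gr).
have -> : re (f t) * im l' + im (g t) * re l + (im (f t) * re l' + re (g t) * im l) =
    re (f t) * im l' + im (f t) * re l' + (re l * im (g t) + im l * re (g t)) by ring.
by apply: (drv_ext ltr01) => h _; rewrite imM.
Qed.
Lemma cdrvJ f t l : cdrv f t l -> cdrv (fun u => Num.conj (f u)) t (Num.conj l).
Proof.
move=> [fr fi]; split; rewrite ?reJ ?imJ.
  by apply: drv_ext fr => // h _; rewrite reJ.
by have := drvN fi; apply: (drv_ext ltr01) => h _; rewrite imJ.
Qed.
Lemma cdrvR (f : R -> R) t (l : R) : drv f t l -> cdrv (fun u => (f u)%:C%C) t (l%:C)%C.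
Proof. by move=> fr; split=> //=; exact: drv_cst. Qed.
Lemma cdrvZ (k : C) f t l : cdrv f t l -> cdrv (fun u => k * f u) t (k * l).
Proof. by move=> /(cdrvM (cdrv_cst k t)); rewrite mul0r addr0. Qed.
Lemma cdrvV f t l : f t != 0 -> cdrv f t l ->
  cdrv (fun u => (f u)^-1) t (- l / (f t) ^+ 2).
Proof.
move=> f0 fd; have [fr fi] := fd.
pose q u := re (f u) ^+ 2 + im (f u) ^+ 2.
have q0 : q t != 0.
  apply: contra f0 => /eqP q0; apply/eqP/reim_eq => /=; apply/eqP; rewrite -sqrf_eq0.
    by rewrite eq_le sqr_ge0 andbT -q0 lerDl sqr_ge0.
  by rewrite eq_le sqr_ge0 andbT -q0 lerDr sqr_ge0.
have qd : drv q t (re (f t) * re l + re (f t) * re l + (im (f t) * im l + im (f t) * im l)).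
  exact: (drvD (drvM fr fr) (drvM fi fi)).
(* The formula conj f / |f|^2 serves only to show differentiability. The value of the derivative is
   found by differentiating f f^-1 = 1. *)
have E u : Num.conj (f u) * ((q u)^-1)%:C%C = (f u)^-1.
  rewrite /q; case: (f u) => a b /=; apply: reim_eq => /=; rewrite ?mulr0 ?subr0 ?add0r //=.
  by rewrite mulNr.
have := cdrvM (cdrvJ fd) (cdrvR (drvV q0 qd)) => /(cdrv_eq E) h.
move: (h); congr cdrv; set d := (X in cdrv _ _ X) in h.
have [e e0 eP] : exists2 e, 0 < e & forall x, `|x| < e -> f (t + x) != 0.
  have [|e e0 eP] := drv_cont qd (e := `|q t|); first by rewrite normr_gt0.
  exists e => // x /eP; apply: contraTneq => fx; rewrite {1}/q fx /= expr0n /= addr0 sub0r.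
  by rewrite normrN ltxx.
have h1 : cdrv (fun=> 1) t (f t * d + l * (f t)^-1).
  by apply: cdrv_ext e0 _ (cdrvM fd h) => x /eP fx; rewrite mulfV.
have /(canRL (addrK _)) := cdrv_unique h1 (cdrv_cst 1 t); rewrite sub0r => fd0.
by rewrite -[LHS](mulKf f0) fd0 expr2 invfM !mulrN !mulNr; congr (- _); ring.
Qed.

End CDerivative1.

(** * Neighbourhoods as boxes in the real coordinates *)

Section Boxes.
Context {R : realType}.
Local Notation C := R[i].
Local Notation re := (@complex.Re R).
Local Notation im := (@complex.Im R).

Lemma norm_lt_box (x : C) (e : R) : `|x| < (e%:C)%C -> `|re x| < e /\ `|im x| < e.
Proof.
rewrite normc_def ltcR; case: x => a b /= H.
by split; apply: le_lt_trans H; rewrite -sqrtr_sqr ler_wsqrtr // ?lerDl ?lerDr sqr_ge0.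
Qed.

Lemma box_norm_lt (x : C) (e : R) : 0 < e -> `|re x| < e / 2 -> `|im x| < e / 2 ->
  `|x| < (e%:C)%C.
Proof.
move=> e0; rewrite normc_def ltcR; case: x => a b /= ha hb.
rewrite -[e]gtr0_norm // -sqrtr_sqr ltr_sqrt ?exprn_gt0 //.
rewrite -[a ^+ 2]real_normK ?num_real // -[b ^+ 2]real_normK ?num_real //.
have := normr_ge0 a; have := normr_ge0 b; nra.
Qed.

Lemma gt0C (x : C) : 0 < x -> exists2 e : R, 0 < e & x = (e%:C)%C.
Proof. by case: x => a b; rewrite ltcE /= => /andP[/eqP -> a0]; exists a. Qed.

Lemma ltC0R (e : R) : 0 < e -> 0 < (e%:C)%C :> C.
Proof. by rewrite ltcR. Qed.

Definition box N (p : 'rV[C]_N) (e : R) (q : 'rV[C]_N) : Prop :=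
  forall j, `|re (q 0 j - p 0 j)| < e /\ `|im (q 0 j - p 0 j)| < e.

Lemma nbhs_box N (p : 'rV[C]_N) (U : set 'rV[C]_N) :
  nbhs p U <-> exists2 e, 0 < e & forall q, box p e q -> U q.
Proof.
rewrite nbhs_ballP; split=> [[_ /= /gt0C[e e0 ->] eU]|[e e0 eU]].
  exists (e / 2); first by rewrite divr_gt0.
  move=> q pq; apply: eU; split=> [|i j]; first exact: ltC0R.
  rewrite !ord1; have [h1 h2] := pq j.
  by rewrite /ball /= distrC; apply: box_norm_lt.
exists (e%:C)%C; first exact: ltC0R.
move=> q [_ pq]; apply: eU => j; have := pq 0 j; rewrite /ball /= distrC.
exact: norm_lt_box.
Qed.

Lemma open_box N (p : 'rV[C]_N) (U : set 'rV[C]_N) : open U -> U p ->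
  exists2 e, 0 < e & forall q, box p e q -> U q.
Proof. by move=> oU Up; apply/nbhs_box; exact: open_nbhs_nbhs. Qed.

Lemma box_le N (p q : 'rV[C]_N) e e' : e <= e' -> box p e q -> box p e' q.
Proof. by move=> ee pq j; have [? ?] := pq j; split; apply: lt_le_trans ee. Qed.

Definition bcont N (f : 'rV[C]_N -> C) (p : 'rV[C]_N) : Prop :=
  forall e, 0 < e -> exists2 d, 0 < d & forall q, box p d q ->
    `|re (f q - f p)| < e /\ `|im (f q - f p)| < e.

Lemma bcontP N (f : 'rV[C]_N -> C) p : {for p, continuous f} <-> bcont f p.
Proof.
split=> [cf e e0|H].
  have /(@cvgrPdist_lt _ _ _ (nbhs p) (nbhs_filter p)) := cf.
  move=> /(_ (e%:C)%C (ltC0R e0))/nbhs_box[d d0 dP].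
  by exists d => // q /dP; rewrite distrC; exact: norm_lt_box.
apply/(@cvgrPdist_lt _ _ _ (nbhs p) (nbhs_filter p)) => _ /gt0C[e e0 ->].
have [|d d0 dP] := H (e / 2); first by rewrite divr_gt0.
by apply/nbhs_box; exists d => // q /dP[h1 h2]; rewrite distrC; exact: box_norm_lt.
Qed.

Definition bvec N (k : 'I_N + 'I_N) : 'rV[C]_N :=
  match k with inl j => baseC j | inr j => 'i%C *: baseC j end.
Definition xco N (k : 'I_N + 'I_N) (q : 'rV[C]_N) : R :=
  match k with inl j => re (q 0 j) | inr j => im (q 0 j) end.

Lemma xcoD N k (p q : 'rV[C]_N) : xco k (p + q) = xco k p + xco k q.
Proof. by case: k => j /=; rewrite mxE ?reD ?imD. Qed.
Lemma xcoB N k (p q : 'rV[C]_N) : xco k (p - q) = xco k p - xco k q.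
Proof. by case: k => j /=; rewrite !mxE ?reB ?imB. Qed.
Lemma xcoZ N k (y : R) (p : 'rV[C]_N) : xco k ((y%:C)%C *: p) = y * xco k p.
Proof. by case: k => j /=; rewrite mxE ?reM ?imM /= mul0r ?subr0 ?addr0. Qed.
Lemma xco_bvec N (k l : 'I_N + 'I_N) : xco k (bvec l) = (k == l)%:R.
Proof.
case: k l => j [] l /=; rewrite /baseC !mxE eqxx /= ?reM ?imM /=.
- have -> : (inl j == inl l :> 'I_N + 'I_N) = (j == l) by [].
  by rewrite eq_sym; case: eqP.
- by case: (j == l); rewrite /= ?mulr1 ?mulr0 ?mul0r ?subr0.
- by case: (j == l).
have -> : (inr j == inr l :> 'I_N + 'I_N) = (j == l) by [].
by rewrite eq_sym; case: eqP => _ /=; ring.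
Qed.

Lemma xco_inj N (p q : 'rV[C]_N) : (forall k, xco k p = xco k q) -> p = q.
Proof.
move=> H; apply/rowP => j; apply: reim_eq; first exact: (H (inl j)).
exact: (H (inr j)).
Qed.

Lemma xco_sum N k (T : Type) (r : seq T) (P : pred T) (F : T -> 'rV[C]_N) :
  xco k (\sum_(i <- r | P i) F i) = \sum_(i <- r | P i) xco k (F i).
Proof.
have x0 : xco k (0 : 'rV[C]_N) = 0 by case: k => j /=; rewrite mxE.
by elim/big_rec2: _ => [|i y1 y2 _ <-]; rewrite ?x0 ?xcoD.
Qed.

Lemma xco_expand N (q : 'rV[C]_N) : q = \sum_k ((xco k q)%:C)%C *: bvec k.
Proof.
apply: xco_inj => k; rewrite xco_sum (bigD1 k) //= xcoZ xco_bvec eqxx mulr1.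
rewrite big1 ?addr0 // => l kl; rewrite xcoZ xco_bvec eq_sym (negbTE kl) mulr0 //.
Qed.

Lemma boxP N (p q : 'rV[C]_N) e :
  box p e q <-> forall k, `|xco k (q - p)| < e.
Proof.
split=> [H [] j|H j]; first by have [+ _] := H j; rewrite /= !mxE.
  by have [_] := H j; rewrite /= !mxE.
by split; [have := H (inl j)|have := H (inr j)]; rewrite /= !mxE.
Qed.

End Boxes.

Lemma common_radius {R : realType} (K : finType) (P : K -> R -> Prop) :
  (forall k, exists2 d : R, 0 < d & P k d) ->
  (forall k d d', P k d -> d' <= d -> P k d') ->
  exists2 d : R, 0 < d & forall k, P k d.
Proof.
move=> HP mon.
suff [d d1 dP] : exists2 d : R, 0 < d & forall k, k \in enum {: K} -> P k d.
  by exists d => // k; apply: dP; rewrite mem_enum.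
elim: (enum _) => [|k s [d d1 dP]]; first by exists 1.
have [d' d'0 d'P] := HP k; exists (Num.min d d'); first by rewrite lt_min d1.
move=> l; rewrite in_cons => /orP[/eqP ->|/dP H].
  by apply: mon d'P _; rewrite ge_min lexx orbT.
by apply: mon H _; rewrite ge_min lexx.
Qed.

(** * The chain rule from continuous partial derivatives *)

Section Multi.
Context {R : realType}.
Local Notation C := R[i].
Local Notation re := (@complex.Re R).
Local Notation im := (@complex.Im R).
Variable N : nat.
Implicit Types (p q v : 'rV[C]_N).

Lemma drv_shift (g : R -> R) t l : drv (fun s => g (t + s)) 0 l -> drv g t l.
Proof.
by move=> H e /H[d d0 dP]; exists d => // h /dP; rewrite add0r addr0.
Qed.

Lemma lineD q v (s t : R) : q + (s%:C)%C *: v + (t%:C)%C *: v = q + ((s + t)%:C)%C *: v.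
Proof. by rewrite -addrA -scalerDl -rmorphD. Qed.

Definition rline (u : 'rV[C]_N -> R) q v (t : R) : R := u (q + (t%:C)%C *: v).

Lemma drv_rline u q v t l : drv (rline u (q + (t%:C)%C *: v) v) 0 l -> drv (rline u q v) t l.
Proof.
move=> H; apply: drv_shift; apply: (drv_ext ltr01) H => h _.
by rewrite /rline add0r lineD.
Qed.

(* The mean value theorem along one coordinate axis after the other. *)
Lemma telescope_increment (u : 'rV[C]_N -> R) (w : 'I_N + 'I_N -> 'rV[C]_N -> R) p d e
    (s : seq ('I_N + 'I_N)) q (y : 'I_N + 'I_N -> R) :
  (forall k q, box p d q -> drv (rline u q (bvec k)) 0 (w k q)) ->
  (forall k q, box p d q -> `|w k q - w k p| <= e) ->
  uniq s -> (forall k, `|xco k (q - p)| < d) -> (forall k, k \in s -> xco k (q - p) = 0) ->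
  (forall k, `|y k| < d) ->
  `|u (q + \sum_(k <- s) ((y k)%:C)%C *: bvec k) - u q - \sum_(k <- s) y k * w k p|
    <= e * \sum_(k <- s) `|y k|.
Proof.
move=> du cw; elim: s q => [|k s IH] q /= us qd qs yd.
  by rewrite !big_nil addr0 subrr subr0 normr0 mulr0.
case/andP: us => ks us; pose q' := q + ((y k)%:C)%C *: bvec k.
have xq t l : xco l (q + (t%:C)%C *: bvec k - p) = xco l (q - p) + t * (l == k)%:R.
  by rewrite addrAC [LHS]xcoD xcoZ xco_bvec.
have bq t : `|t| <= `|y k| -> forall l, `|xco l (q + (t%:C)%C *: bvec k - p)| < d.
  move=> ty l; rewrite xq; case: eqP => [->|_]; last by rewrite mulr0 addr0.
  by rewrite qs ?mem_head // add0r mulr1 (le_lt_trans ty).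
have [c cy E] : exists2 c, `|c| <= `|y k| & u q' - u q = y k * w k (q + (c%:C)%C *: bvec k).
  have mid c : Num.min 0 (y k) <= c <= Num.max 0 (y k) -> `|c| <= `|y k|.
    by rewrite /Num.min /Num.max /Order.min /Order.max; case: ltrP => y0 /andP[h1 h2];
      rewrite ?(gtr0_norm y0) ?(ler0_norm y0) ler_norml; apply/andP; split; lra.
  have [c /mid cy|c /mid cy E] := @drv_mvt _ (rline u q (bvec k))
      (fun c => w k (q + (c%:C)%C *: bvec k)) 0 (y k).
    by apply: drv_rline; apply: du; apply/boxP; exact: bq.
  by exists c => //; move: E; rewrite /rline scale0r addr0 subr0 mulrC.
rewrite !big_cons addrA -/q'.
have -> : forall a b x z S : R, a - b - (x * z + S) = (a - u q' - S) + (u q' - b - x * z).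
  by move=> *; ring.
apply: le_trans (ler_normD _ _) _; rewrite mulrDr [e * `|y k| + _]addrC; apply: lerD.
  apply: IH => // [l|l ls]; first exact: bq.
  rewrite xq qs ?in_cons ?ls ?orbT // add0r.
  by case: eqP => [lk|_]; rewrite ?mulr0 //; move: ks; rewrite -lk ls.
rewrite E -mulrBr normrM mulrC; apply: ler_wpM2r => //.
by apply: cw; apply/boxP; exact: bq.
Qed.

(** The increment of u is split along the coordinate axes and compared with its linear part at gam
    t, where the partial derivatives are continuous; the curve is then replaced by its tangent. *)
Lemma drv_chain (u : 'rV[C]_N -> R) (w : 'I_N + 'I_N -> 'rV[C]_N -> R) (d0 : R)
    (gam : R -> 'rV[C]_N) t (c : 'I_N + 'I_N -> R) : 0 < d0 ->
  (forall k q, box (gam t) d0 q -> drv (rline u q (bvec k)) 0 (w k q)) ->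
  (forall k (e : R), 0 < e -> exists2 d : R, 0 < d &
     forall q, box (gam t) d q -> `|w k q - w k (gam t)| < e) ->
  (forall k, drv (fun s => xco k (gam s)) t (c k)) ->
  drv (fun s => u (gam s)) t (\sum_k c k * w k (gam t)).
Proof.
move=> d00 du cw dc e e0; set p := gam t.
pose K : R := \sum_k (`|c k| + 1); pose W : R := \sum_k `|w k p|.
have K0 : 0 <= K by apply: sumr_ge0 => k _; rewrite addr_ge0.
have W0 : 0 <= W by apply: sumr_ge0.
(* [e1] bounds the variation of the partial derivatives and [e2] the deviation of the curve from its
   tangent; each contributes half of e. The minimum with 1 in [e2] gives |y k| <= (|c k| + 1)
   |h|. *)
pose e1 := e / (2 * (K + 1)); have e10 : 0 < e1 by rewrite divr_gt0 // mulr_gt0 // ltr_wpDl.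
pose e2 := Num.min 1 (e / (2 * (W + 1))).
have e20 : 0 < e2 by rewrite lt_min ltr01 divr_gt0 // mulr_gt0 // ltr_wpDl.
have [d1 d10 d1P] : exists2 d, 0 < d & forall k, forall q, box p d q -> `|w k q - w k p| <= e1.
  apply: (common_radius (P := fun k d => forall q, box p d q -> `|w k q - w k p| <= e1)) => [k|k d d' H dd q /(box_le dd)/H //].
  by have [d dp dP] := cw k e1 e10; exists d => // q /dP/ltW.
have [d2 d20 d2P] : exists2 d, 0 < d & forall k, forall h, `|h| < d ->
    `|xco k (gam (t + h)) - xco k p - h * c k| <= e2 * `|h|.
  apply: (common_radius (P := fun k d => forall h, `|h| < d ->
    `|xco k (gam (t + h)) - xco k p - h * c k| <= e2 * `|h|)) => [k|k d d' H dd h hd']; first by have [d dp dP] := dc k e2 e20; exists d.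
  by apply: H; exact: lt_le_trans dd.
pose d3 := Num.min d0 d1; have d30 : 0 < d3 by rewrite lt_min d00.
exists (Num.min d2 (d3 / (K + 1))); first by rewrite lt_min d20 divr_gt0 // ltr_wpDl.
move=> h; rewrite lt_min => /andP[hd2]; rewrite ltr_pdivlMr ?ltr_wpDl // => hd3.
pose y k := xco k (gam (t + h) - p).
have y1 k : `|y k - h * c k| <= e2 * `|h| by rewrite /y xcoB; exact: d2P.
have yK k : `|y k| <= (`|c k| + 1) * `|h|.
  rewrite -(subrK (h * c k) (y k)); apply: le_trans (ler_normD _ _) _.
  rewrite mulrDl mul1r addrC normrM [`|h| * _]mulrC lerD2l.
  by apply: le_trans (y1 k) _; rewrite ler_piMl // /e2 ge_min lexx.
have cK k : `|c k| + 1 <= K.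
  by rewrite /K (bigD1 k) //= lerDl; apply: sumr_ge0 => l _; rewrite addr_ge0.
have yd k : `|y k| < d3.
  apply: le_lt_trans (yK k) _; apply: le_lt_trans hd3; rewrite [`|h| * _]mulrC.
  by apply: ler_wpM2r => //; apply: le_trans (cK k) _; rewrite lerDl.
have := @telescope_increment u w p d3 e1 (index_enum ('I_N + 'I_N)%type) p y.
have -> : p + \sum_k ((y k)%:C)%C *: bvec k = gam (t + h).
  by rewrite /y -xco_expand addrC subrK.
move=> /(_ _ _ (index_enum_uniq _)) H; have {H} H : `|u (gam (t + h)) - u p - \sum_k y k * w k p| <= e1 * \sum_k `|y k|.
  apply: H => [k q pq|k q pq|k|k _|//].
  - by apply: du; apply: box_le pq; rewrite ge_min lexx.
  - by apply: d1P; apply: box_le pq; rewrite ge_min lexx orbT.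
  - by rewrite subrr; case: k => j; rewrite /= mxE normr0.
  - by rewrite subrr; case: k => j; rewrite /= mxE.
have -> : u (gam (t + h)) - u p - h * (\sum_k c k * w k p) =
    u (gam (t + h)) - u p - \sum_k y k * w k p + \sum_k (y k - h * c k) * w k p.
  rewrite mulr_sumr -!addrA; congr (_ + (_ + _)); rewrite -!sumrN -big_split /=.
  by apply: eq_bigr => k _; ring.
apply: le_trans (ler_normD _ _) _.
have -> : e * `|h| = e / 2 * `|h| + e / 2 * `|h| by lra.
apply: lerD.
  apply: le_trans H _; apply: (@le_trans _ _ (e1 * (K * `|h|))).
    by rewrite ler_pM2l // /K mulr_suml; apply: ler_sum => k _; exact: yK.
  rewrite mulrA; apply: ler_wpM2r => //; rewrite /e1 invfM mulrA mulrAC.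
  by rewrite ler_pdivrMr ?ltr_wpDl // ler_pM2l ?divr_gt0 // lerDl.
apply: le_trans (ler_norm_sum _ _ _) _.
apply: (@le_trans _ _ (e2 * `|h| * W)).
  rewrite /W mulr_sumr; apply: ler_sum => k _; rewrite normrM.
  by apply: ler_wpM2r => //; exact: y1.
rewrite mulrAC; apply: ler_wpM2r => //.
apply: (@le_trans _ _ (e / (2 * (W + 1)) * W)).
  by apply: ler_wpM2r => //; rewrite /e2 ge_min lexx orbT.
rewrite invfM mulrA mulrAC ler_pdivrMr ?ltr_wpDl //.
by rewrite ler_pM2l ?divr_gt0 // lerDl.
Qed.

End Multi.

(** * Smooth functions and Wirtinger derivatives *)

Section SmoothClass.
Context {R : realType}.
Local Notation C := R[i].
Local Notation re := (@complex.Re R).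
Local Notation im := (@complex.Im R).
Variable N : nat.
Implicit Types (p q v w : 'rV[C]_N) (f g : 'rV[C]_N -> C) (U : set 'rV[C]_N).

(** Smoothness up to the finite order k, so that closure under products, inverses and composition
    can be proved by induction. All orders together are [smooth_on], see [smooth_onP]. *)
Fixpoint smk (k : nat) U f : Prop :=
  (forall p, U p -> {for p, continuous f} /\ forall v, cderivable1 (cline f p v) 0) /\
  if k is k'.+1 then forall v, smk k' U (dirD v f) else True.

Lemma smkS k U f : smk k.+1 U f -> smk k U f.
Proof.
elim: k f => [|k IH] f [b H]; split=> // v; apply: IH; exact: H.
Qed.

Lemma smk_le k k' U f : (k' <= k)%N -> smk k U f -> smk k' U f.
Proof.
by move=> /subnK <-; elim: (k - k')%N => // d IH; rewrite addSn => /smkS.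
Qed.

Lemma smk0 k U f : smk k U f -> smk 0 U f. Proof. exact: smk_le. Qed.

Lemma smooth_onP U f : smooth_on U f <-> forall k, smk k U f.
Proof.
split=> [H k|H vs p Up].
  elim: k f H => [|k IH] f H; split=> //; try by move=> p Up; exact: (H [::] p Up).
  move=> v; apply: IH => vs p Up; have := H (rcons vs v) p Up; rewrite foldr_rcons; apply.
suff : smk 0 U (foldr (@dirD R N) f vs) by case=> /(_ p Up).
elim/last_ind: vs f {p Up} H => [|vs v IH] f H; first exact: (H 0%N).
rewrite foldr_rcons; apply: IH => k.
by have [_] := H k.+1; apply.
Qed.

Lemma dirD_cdrv k U f p v : smk k U f -> U p -> cdrv (cline f p v) 0 (dirD v f p).
Proof. by move=> /smk0[H _] Up; apply: derive_cdrv; have [_] := H p Up; apply. Qed.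

Lemma line_open U p v : open U -> U p ->
  exists2 d : R, 0 < d & forall h, `|h| < d -> U (p + (h%:C)%C *: v).
Proof.
move=> oU Up; have [e e0 eU] := open_box oU Up.
have [||d d0 dP] := @common_radius R ('I_N + 'I_N)%type
  (fun k d => forall h, `|h| < d -> `|h * xco k v| < e).
- move=> k; exists (e / (`|xco k v| + 1)); first by rewrite divr_gt0 // ltr_wpDl.
  move=> h; rewrite ltr_pdivlMr ?ltr_wpDl // => H; apply: le_lt_trans H.
  by rewrite normrM mulrDr mulr1 lerDl.
- by move=> k d d' H dd h hd; apply: H; exact: lt_le_trans dd.
exists d => // h hd; apply: eU; apply/boxP => k.
by rewrite addrC addKr xcoZ; exact: dP.
Qed.

Lemma cline_ext U f g p v l : open U -> U p -> (forall q, U q -> f q = g q) ->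
  cdrv (cline f p v) 0 l -> cdrv (cline g p v) 0 l.
Proof.
move=> oU Up fg; have [d d0 dP] := line_open v oU Up.
by apply: (cdrv_ext d0) => h /dP Uh; rewrite /cline add0r fg.
Qed.

Lemma dirD_ext k U f g p v : open U -> U p -> (forall q, U q -> f q = g q) ->
  smk k U f -> dirD v f p = dirD v g p.
Proof.
move=> oU Up fg sf; have := cline_ext oU Up fg (dirD_cdrv v sf Up).
by move=> /cdrv_derive[_ <-].
Qed.

Lemma smk_bcont k U f p : smk k U f -> U p -> bcont f p.
Proof. by move=> /smk0[H _] Up; apply/bcontP; case: (H p Up). Qed.

Lemma bcont_ext U f g p : open U -> U p -> (forall q, U q -> f q = g q) ->
  bcont f p -> bcont g p.
Proof.
move=> oU Up fg cf e e0; have [d d0 dP] := cf e e0.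
have [d' d'0 d'P] := open_box oU Up; exists (Num.min d d'); first by rewrite lt_min d0.
move=> q pq; rewrite -!fg //; last by apply: d'P; apply: box_le pq; rewrite ge_min lexx orbT.
by apply: dP; apply: box_le pq; rewrite ge_min lexx.
Qed.

Lemma smk_ext k U f g : open U -> (forall q, U q -> f q = g q) -> smk k U f -> smk k U g.
Proof.
move=> oU; have base f1 g1 : (forall q, U q -> f1 q = g1 q) -> smk 0 U f1 -> smk 0 U g1.
  move=> fg sf; split; last by [].
  move=> p Up; split.
    by apply/bcontP; apply: (bcont_ext oU Up fg); exact: smk_bcont sf Up.
  by move=> u; have /cdrv_derive[] := cline_ext oU Up fg (dirD_cdrv u sf Up).
elim: k f g => [|k IH] f g fg sf; first exact: base sf.
split; first by have [] := base f g fg (smk0 sf).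
move=> v; apply: (IH (dirD v f)); last by case: sf => _; apply.
by move=> q Uq; exact: (dirD_ext v oU Uq fg sf).
Qed.

(** Derivatives of f are controlled on U only, so it is enough to exhibit functions f' that agree
    with them there. *)
Lemma smk_intro k U f (f' : 'rV[C]_N -> 'rV[C]_N -> C) : open U ->
  (forall p, U p -> bcont f p) ->
  (forall p v, U p -> cdrv (cline f p v) 0 (f' v p)) ->
  (forall k', k = k'.+1 -> forall v, smk k' U (f' v)) -> smk k U f.
Proof.
move=> oU cf df f'k.
have base : smk 0 U f.
  split=> // p Up; split; first exact/bcontP/cf.
  by move=> v; have /cdrv_derive[] := df p v Up.
case: k f'k => // k /(_ k erefl) f'k; split; first by case: base.
move=> v; apply: (smk_ext oU _ (f'k v)) => q Uq.
by have /cdrv_derive[_ <-] := df q v Uq.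
Qed.

Lemma smk_sub k U U' f : (forall q, U' q -> U q) -> smk k U f -> smk k U' f.
Proof.
move=> UU'; elim: k f => [|k IH] f [b fk]; split; try by move=> p /UU'/b.
  by [].
by move=> v; apply: IH; exact: fk.
Qed.

Lemma bcont_cst (c : C) p : bcont (fun=> c) p.
Proof. by move=> e e0; exists 1 => // q _; rewrite subrr /= normr0. Qed.

Lemma bcontD f g p : bcont f p -> bcont g p -> bcont (fun q => f q + g q) p.
Proof. by move=> /bcontP cf /bcontP cg; apply/bcontP; exact: (@cvgD _ _ _ (nbhs p) (nbhs_filter p) f g _ _ cf cg). Qed.

Lemma bcontM f g p : bcont f p -> bcont g p -> bcont (fun q => f q * g q) p.
Proof. by move=> /bcontP cf /bcontP cg; apply/bcontP; exact: (@cvgM _ _ (nbhs p) (nbhs_filter p) f g _ _ cf cg). Qed.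

Lemma bcontV f p : f p != 0 -> bcont f p -> bcont (fun q => (f q)^-1) p.
Proof. by move=> f0 /bcontP cf; apply/bcontP; exact: (@cvgV _ _ (nbhs p) (nbhs_filter p) f _ f0 cf). Qed.

Lemma bcontJ f p : bcont f p -> bcont (fun q => Num.conj (f q)) p.
Proof.
move=> cf e e0; have [d d0 dP] := cf e e0; exists d => // q /dP.
by rewrite -rmorphB /= reJ imJ normrN.
Qed.

Lemma bcont_coord j p : bcont (fun q => q 0 j) p.
Proof. by move=> e e0; exists e => // q pq; exact: pq. Qed.

Lemma smk_cst k U c : open U -> smk k U (fun=> c).
Proof.
move=> oU; elim: k c => [|k IH] c; apply: (smk_intro (f' := fun _ _ => 0)) => //;
  try by move=> *; exact: bcont_cst.
- by move=> p v _; apply: cdrv_eq (cdrv_cst c 0).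
- by move=> p v _; apply: cdrv_eq (cdrv_cst c 0).
by move=> k' [<-] v; exact: IH.
Qed.

Lemma cdrv_line_coord p v j t : cdrv (fun u : R => (p + (u%:C)%C *: v) 0 j) t (v 0 j).
Proof.
have := cdrvD (cdrv_cst (p 0 j) t) (cdrvM (cdrvR (drv_id t)) (cdrv_cst (v 0 j) t)).
rewrite mulr0 !add0r mul1r; apply: cdrv_eq => u; rewrite !mxE //.
Qed.

Lemma smk_coord k U j : open U -> smk k U (fun q => q 0 j).
Proof.
move=> oU; apply: (smk_intro (f' := fun v _ => v 0 j)) => //.
- by move=> p _; exact: bcont_coord.
- by move=> p v _; exact: cdrv_line_coord.
by move=> k' _ v; exact: smk_cst.
Qed.

Lemma smkD k U f g : open U -> smk k U f -> smk k U g -> smk k U (fun q => f q + g q).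
Proof.
move=> oU; elim: k f g => [|k IH] f g sf sg;
  apply: (smk_intro (f' := fun v q => dirD v f q + dirD v g q)) => //;
  try by move=> p Up; apply: bcontD; [exact: smk_bcont sf Up|exact: smk_bcont sg Up].
- by move=> p v Up; apply: cdrvD; [exact: dirD_cdrv sf Up|exact: dirD_cdrv sg Up].
- by move=> p v Up; apply: cdrvD; [exact: dirD_cdrv sf Up|exact: dirD_cdrv sg Up].
by move=> k' [<-] v; case: sf => _ sf; case: sg => _ sg; exact: (IH _ _ (sf v) (sg v)).
Qed.

Lemma cline0 f p v : cline f p v 0 = f p.
Proof. by rewrite /cline scale0r addr0. Qed.

Lemma smkM k U f g : open U -> smk k U f -> smk k U g -> smk k U (fun q => f q * g q).
Proof.
move=> oU; elim: k f g => [|k IH] f g sf sg;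
  apply: (smk_intro (f' := fun v q => f q * dirD v g q + dirD v f q * g q)) => //;
  try by move=> p Up; apply: bcontM; [exact: smk_bcont sf Up|exact: smk_bcont sg Up].
- move=> p v Up; have := cdrvM (dirD_cdrv v sf Up) (dirD_cdrv v sg Up).
  by rewrite !cline0.
- move=> p v Up; have := cdrvM (dirD_cdrv v sf Up) (dirD_cdrv v sg Up).
  by rewrite !cline0.
move=> k' [<-] v; have sf' := smkS sf; have sg' := smkS sg.
case: sf => _ sf; case: sg => _ sg.
exact: (smkD oU (IH _ _ sf' (sg v)) (IH _ _ (sf v) sg')).
Qed.

Lemma smkJ k U f : open U -> smk k U f -> smk k U (fun q => Num.conj (f q)).
Proof.
move=> oU; elim: k f => [|k IH] f sf;
  apply: (smk_intro (f' := fun v q => Num.conj (dirD v f q))) => //;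
  try by move=> p Up; apply: bcontJ; exact: smk_bcont sf Up.
- by move=> p v Up; apply: cdrvJ; exact: dirD_cdrv sf Up.
- by move=> p v Up; apply: cdrvJ; exact: dirD_cdrv sf Up.
by move=> k' [<-] v; case: sf => _ sf; exact: (IH _ (sf v)).
Qed.

Lemma smkV k U f : open U -> (forall q, U q -> f q != 0) -> smk k U f ->
  smk k U (fun q => (f q)^-1).
Proof.
move=> oU f0; elim: k => [|k IH] sf;
  apply: (smk_intro (f' := fun v q => - 1 * dirD v f q * ((f q)^-1 * (f q)^-1))) => //;
  try by move=> p Up; apply: bcontV; [exact: f0|exact: smk_bcont sf Up].
- move=> p v Up; have := cdrvV _ (dirD_cdrv v sf Up); rewrite cline0 => /(_ (f0 _ Up)).
  by rewrite expr2 invfM mulN1r.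
- move=> p v Up; have := cdrvV _ (dirD_cdrv v sf Up); rewrite cline0 => /(_ (f0 _ Up)).
  by rewrite expr2 invfM mulN1r.
move=> k' [<-] v; have sf' := IH (smkS sf); case: sf => _ sf.
exact: (smkM oU (smkM oU (smk_cst k _ oU) (sf v)) (smkM oU sf' sf')).
Qed.

Lemma smkZ k U c f : open U -> smk k U f -> smk k U (fun q => c * f q).
Proof. by move=> oU; apply: smkM => //; exact: smk_cst. Qed.

Lemma smkN k U f : open U -> smk k U f -> smk k U (fun q => - f q).
Proof.
by move=> oU /(smkZ (-1) oU); apply: smk_ext => // q _; rewrite mulN1r.
Qed.

Lemma smkB k U f g : open U -> smk k U f -> smk k U g -> smk k U (fun q => f q - g q).
Proof. by move=> oU sf sg; apply: smkD => //; exact: smkN. Qed.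

Lemma smk_sum k U (T : Type) (r : seq T) (P : pred T) (f : T -> 'rV[C]_N -> C) : open U ->
  (forall i, P i -> smk k U (f i)) -> smk k U (fun q => \sum_(i <- r | P i) f i q).
Proof.
move=> oU H; elim: r => [|a r IH].
  by apply: (smk_ext oU _ (smk_cst k 0 oU)) => q _; rewrite big_nil.
case Pa : (P a); last by apply: (smk_ext oU _ IH) => q _; rewrite big_cons Pa.
by apply: (smk_ext oU _ (smkD oU (H a Pa) IH)) => q _; rewrite big_cons Pa.
Qed.

Lemma smk_dirD k U f v : smk k.+1 U f -> smk k U (dirD v f).
Proof. by case=> _; apply. Qed.

Lemma smk_dZ k U f j : open U -> smk k.+1 U f -> smk k U (dZ j f).
Proof.
move=> oU sf; apply: (smk_ext oU (f := fun q => 2^-1 * (dirD (baseC j) f q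
    - 'i%C * dirD ('i%C *: baseC j) f q))); first by move=> q _; rewrite mulrC.
by apply: smkZ => //; apply: smkB => //; [|apply: smkZ => //]; exact: smk_dirD.
Qed.

Lemma smk_dZb k U f j : open U -> smk k.+1 U f -> smk k U (dZb j f).
Proof.
move=> oU sf; apply: (smk_ext oU (f := fun q => 2^-1 * (dirD (baseC j) f q
    + 'i%C * dirD ('i%C *: baseC j) f q))); first by move=> q _; rewrite mulrC.
by apply: smkZ => //; apply: smkD => //; [|apply: smkZ => //]; exact: smk_dirD.
Qed.

Lemma cdrv_chain U f (gam : R -> 'rV[C]_N) t (c : 'I_N -> C) : open U -> smk 1 U f ->
  U (gam t) -> (forall j, cdrv (fun s => gam s 0 j) t (c j)) ->
  cdrv (fun s => f (gam s)) t
    (\sum_j (c j * dZ j f (gam t) + Num.conj (c j) * dZb j f (gam t))).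
Proof.
move=> oU sf Ug dc; have [e e0 eU] := open_box oU Ug.
pose cc (k : 'I_N + 'I_N) := match k with inl j => re (c j) | inr j => im (c j) end.
have dcc k : drv (fun s => xco k (gam s)) t (cc k) by case: k => j; have [] := dc j.
have -> : \sum_j (c j * dZ j f (gam t) + Num.conj (c j) * dZb j f (gam t)) =
    \sum_k ((cc k)%:C)%C * dirD (bvec k) f (gam t).
  rewrite [RHS]big_sumType /= -big_split /=; apply: eq_bigr => j _ /=.
  rewrite /dZ /dZb; case: (c j) => a b /=; move: (dirD _ _ _) (dirD _ _ _) => Y X.
  have -> : Num.conj (a +i* b)%C = (a%:C - 'i%C * b%:C)%C :> C.
    by apply: reim_eq; rewrite /= ?reB ?imB ?reM ?imM /=; ring.
  have -> : (a +i* b)%C = (a%:C + 'i%C * b%:C)%C :> C.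
    by apply: reim_eq; rewrite /= ?reD ?imD ?reM ?imM /=; ring.
  have i2 : 'i%C * 'i%C = -1 :> C by apply: reim_eq; rewrite ?reM ?imM /=; ring.
  move: ('i%C : C) i2 (a%:C)%C (b%:C)%C => I i2 A B.
  have -> : (A + I * B) * ((X - I * Y) / 2) + (A - I * B) * ((X + I * Y) / 2) =
    A * X - I * I * B * Y by field.
  by rewrite i2; ring.
have reE k q : U q -> drv (rline (fun q => re (f q)) q (bvec k)) 0 (re (dirD (bvec k) f q)).
  by move=> Uq; have [] := dirD_cdrv (bvec k) sf Uq.
have imE k q : U q -> drv (rline (fun q => im (f q)) q (bvec k)) 0 (im (dirD (bvec k) f q)).
  by move=> Uq; have [] := dirD_cdrv (bvec k) sf Uq.
have cw k := smk_bcont (smk_dirD (bvec k) sf) Ug.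
split.
  have -> : re (\sum_k ((cc k)%:C)%C * dirD (bvec k) f (gam t)) =
      \sum_k cc k * re (dirD (bvec k) f (gam t)).
    elim/big_rec2: _ => // k x y _ <-; rewrite reD reM /= mul0r subr0 //.
  apply: (drv_chain (u := fun q => re (f q)) (w := fun k q => re (dirD (bvec k) f q)) e0) => //.
    by move=> k q /eU/reE.
  by move=> k e' /(cw k)[d d0 dP]; exists d => // q /dP[]; rewrite reB.
have -> : im (\sum_k ((cc k)%:C)%C * dirD (bvec k) f (gam t)) =
    \sum_k cc k * im (dirD (bvec k) f (gam t)).
  elim/big_rec2: _ => // k x y _ <-; rewrite imD imM /= mul0r addr0 //.
apply: (drv_chain (u := fun q => im (f q)) (w := fun k q => im (dirD (bvec k) f q)) e0) => //.
  by move=> k q /eU/imE.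
by move=> k e' /(cw k)[d d0 dP]; exists d => // q /dP[_]; rewrite imB.
Qed.

(** Smoothness is stated through derivatives along lines. Their linearity in the direction is a
    consequence of the chain rule, hence of the continuity of the partial derivatives. *)
Lemma dirDE U f p v : open U -> smk 1 U f -> U p ->
  dirD v f p = \sum_j (v 0 j * dZ j f p + Num.conj (v 0 j) * dZb j f p).
Proof.
move=> oU sf Up.
have := @cdrv_chain U f (fun s => p + (s%:C)%C *: v) 0 (fun j => v 0 j) oU sf.
rewrite scale0r addr0 => /(_ Up (fun j => cdrv_line_coord p v j 0)).
by move=> /cdrv_derive[_ <-].
Qed.

(** The second difference of u over a small parallelogram is evaluated by the mean value theorem in
    both orders. This makes the two mixed derivatives equal at two points near p, and continuity
    gives equality at p. *)
Lemma schwarz_real (u av aw avw awv : 'rV[C]_N -> R) p v w (e : R) : 0 < e ->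
  (forall q, box p e q -> [/\ drv (rline u q v) 0 (av q), drv (rline u q w) 0 (aw q),
     drv (rline av q w) 0 (avw q) & drv (rline aw q v) 0 (awv q)]) ->
  (forall e, 0 < e -> exists2 d, 0 < d & forall q, box p d q ->
     `|avw q - avw p| < e /\ `|awv q - awv p| < e) -> avw p = awv p.
Proof.
move=> e0 D cont.
have key (d : R) : 0 < d -> exists h : R, 0 < h /\ forall s t,
    0 <= s <= h -> 0 <= t <= h -> box p d (p + (s%:C)%C *: v + (t%:C)%C *: w).
  move=> d0; have [||h h0 hP] := @common_radius R ('I_N + 'I_N)%type
    (fun k h => forall s t, `|s| <= h -> `|t| <= h -> `|s * xco k v + t * xco k w| < d).
  - move=> k; exists (d / (`|xco k v| + `|xco k w| + 1)).
      by rewrite divr_gt0 // ltr_wpDl // addr_ge0.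
    move=> s t hs ht; set h := d / _ in hs ht.
    have h0 : 0 < h by rewrite divr_gt0 // ltr_wpDl // addr_ge0.
    apply: le_lt_trans (ler_normD _ _) _; rewrite !normrM.
    apply: (@le_lt_trans _ _ (h * (`|xco k v| + `|xco k w|))).
      by rewrite mulrDr; apply: lerD; apply: ler_wpM2r.
    rewrite /h mulrAC ltr_pdivrMr ?ltr_wpDl ?addr_ge0 // ltr_pM2l // ltrDl //.
  - by move=> k d1 d' H dd s t hs ht; apply: H; apply: le_trans dd.
  exists h; split=> // s t /andP[s0 sh] /andP[t0 th]; apply/boxP => k.
  rewrite (_ : _ - p = (s%:C)%C *: v + (t%:C)%C *: w); last first.
    by rewrite -(addrA p) [LHS]addrC addKr.
  by rewrite xcoD !xcoZ; apply: hP; rewrite ger0_norm.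
have quot d : 0 < d -> exists q q', [/\ box p d q, box p d q' & avw q = awv q'].
  move=> d0; pose d' := Num.min d e; have d'0 : 0 < d' by rewrite lt_min d0.
  have [h [h0 hP]] := key d' d'0.
  pose Q s t := p + (s%:C)%C *: v + (t%:C)%C *: w.
  have QE s t : Q s t = p + (t%:C)%C *: w + (s%:C)%C *: v by rewrite /Q addrAC.
  have be s t : 0 <= s <= h -> 0 <= t <= h -> box p e (Q s t).
    by move=> hs ht; apply: box_le (hP s t hs ht); rewrite ge_min lexx orbT.
  have bd s t : 0 <= s <= h -> 0 <= t <= h -> box p d (Q s t).
    by move=> hs ht; apply: box_le (hP s t hs ht); rewrite ge_min lexx.
  have h01 : 0 <= h <= h by rewrite lexx ltW.
  have h00 : (0 : R) <= 0 <= h by rewrite lexx ltW.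
  have mm : Num.min 0 h = 0 /\ Num.max 0 h = h by rewrite (min_idPl (ltW h0)) (max_idPr (ltW h0)).
  have ds s t : 0 <= s <= h -> 0 <= t <= h -> drv (fun s => u (Q s t)) s (av (Q s t)).
    move=> hs ht; have [+ _ _ _] := D _ (be s t hs ht); rewrite QE => /drv_rline.
    by apply: (drv_ext ltr01) => x _; rewrite /rline QE.
  have dt s t : 0 <= s <= h -> 0 <= t <= h -> drv (fun t => u (Q s t)) t (aw (Q s t)).
    by move=> hs ht; have [_ + _ _] := D _ (be s t hs ht) => /drv_rline.
  have dst s t : 0 <= s <= h -> 0 <= t <= h -> drv (fun t => av (Q s t)) t (avw (Q s t)).
    by move=> hs ht; have [_ _ + _] := D _ (be s t hs ht) => /drv_rline.
  have dts s t : 0 <= s <= h -> 0 <= t <= h -> drv (fun s => aw (Q s t)) s (awv (Q s t)).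
    move=> hs ht; have [_ _ _] := D _ (be s t hs ht); rewrite QE => /drv_rline.
    by apply: (drv_ext ltr01) => x _; rewrite /rline QE.
  have [|c1 hc1 E1] := @drv_mvt _ (fun s => u (Q s h) - u (Q s 0))
      (fun s => av (Q s h) - av (Q s 0)) 0 h.
    by move=> x; rewrite mm.1 mm.2 => hx; apply: drvB; exact: ds.
  rewrite mm.1 mm.2 in hc1.
  have [|c2 hc2 E2] := @drv_mvt _ (fun t => av (Q c1 t)) (fun t => avw (Q c1 t)) 0 h.
    by move=> x; rewrite mm.1 mm.2 => hx; exact: dst.
  rewrite mm.1 mm.2 in hc2.
  have [|c3 hc3 E3] := @drv_mvt _ (fun t => u (Q h t) - u (Q 0 t))
      (fun t => aw (Q h t) - aw (Q 0 t)) 0 h.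
    by move=> x; rewrite mm.1 mm.2 => hx; apply: drvB; exact: dt.
  rewrite mm.1 mm.2 in hc3.
  have [|c4 hc4 E4] := @drv_mvt _ (fun s => aw (Q s c3)) (fun s => awv (Q s c3)) 0 h.
    by move=> x; rewrite mm.1 mm.2 => hx; exact: dts.
  rewrite mm.1 mm.2 in hc4.
  exists (Q c1 c2), (Q c4 c3); split; [exact: bd|exact: bd|].
  have hn : h != 0 by rewrite gt_eqF.
  rewrite E2 subr0 in E1; rewrite E4 subr0 in E3.
  have sw (a b c d1 : R) : a - b - (c - d1) = a - c - (b - d1) by ring.
  by apply: (mulIf hn); apply: (mulIf hn); rewrite -E1 -E3; exact: sw.
apply/eqP; rewrite -subr_eq0 -normr_le0 leNgt; apply/negP => H.
have [|d d0 dP] := cont (`|avw p - awv p| / 2); first by rewrite divr_gt0.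
have [q [q' [/dP[h1 _] /dP[_ h2] E]]] := quot d d0.
rewrite E in h1; have : `|avw p - awv p| < `|avw p - awv p|; last by rewrite ltxx.
have -> : avw p - awv p = (awv q' - awv p) - (awv q' - avw p) by ring.
apply: le_lt_trans (ler_normB _ _) _.
have -> : (awv q' - awv p) - (awv q' - avw p) = avw p - awv p by ring.
by rewrite [ltRHS](splitr `|avw p - awv p|); exact: ltrD.
Qed.

Lemma dirDC U f p v w : open U -> smk 2 U f -> U p ->
  dirD v (dirD w f) p = dirD w (dirD v f) p.
Proof.
move=> oU sf Up; have [e e0 eU] := open_box oU Up.
have sv := smk_dirD v sf; have sw := smk_dirD w sf.
have cvw := smk_bcont (smk_dirD w sv) Up; have cwv := smk_bcont (smk_dirD v sw) Up.
have D q : box p e q -> [/\ cdrv (cline f q v) 0 (dirD v f q),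
    cdrv (cline f q w) 0 (dirD w f q),
    cdrv (cline (dirD v f) q w) 0 (dirD w (dirD v f) q) &
    cdrv (cline (dirD w f) q v) 0 (dirD v (dirD w f) q)].
  by move=> /eU Uq; split; apply: dirD_cdrv Uq; eassumption.
have cont (e1 : R) : 0 < e1 -> exists2 d, 0 < d & forall q, box p d q ->
    (`|re (dirD w (dirD v f) q - dirD w (dirD v f) p)| < e1 /\
     `|im (dirD w (dirD v f) q - dirD w (dirD v f) p)| < e1) /\
    (`|re (dirD v (dirD w f) q - dirD v (dirD w f) p)| < e1 /\
     `|im (dirD v (dirD w f) q - dirD v (dirD w f) p)| < e1).
  move=> e10; have [d d0 dP] := cvw _ e10; have [d' d'0 d'P] := cwv _ e10.
  exists (Num.min d d'); first by rewrite lt_min d0.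
  move=> q pq; split; [apply: dP|apply: d'P]; apply: box_le pq; rewrite ge_min lexx ?orbT //.
apply: reim_eq; symmetry.
  apply: (@schwarz_real (fun q => re (f q)) (fun q => re (dirD v f q))
    (fun q => re (dirD w f q)) (fun q => re (dirD w (dirD v f) q))
    (fun q => re (dirD v (dirD w f) q)) p v w e e0).
    by move=> q /D[[h1 _] [h2 _] [h3 _] [h4 _]]; split; [exact: h1|exact: h2|exact: h3|exact: h4].
  move=> e1 /cont[d d0 dP]; exists d => // q /dP[[h1 _] [h2 _]].
  by rewrite reB in h1; rewrite reB in h2; split; [exact: h1|exact: h2].
apply: (@schwarz_real (fun q => im (f q)) (fun q => im (dirD v f q))
  (fun q => im (dirD w f q)) (fun q => im (dirD w (dirD v f) q))
  (fun q => im (dirD v (dirD w f) q)) p v w e e0).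
  by move=> q /D[[_ h1] [_ h2] [_ h3] [_ h4]]; split; [exact: h1|exact: h2|exact: h3|exact: h4].
move=> e1 /cont[d d0 dP]; exists d => // q /dP[[_ h1] [_ h2]].
by rewrite imB in h1; rewrite imB in h2; split; [exact: h1|exact: h2].
Qed.

End SmoothClass.

(** * The calculus of Wirtinger derivatives *)

Section Wirtinger.
Context {R : realType}.
Local Notation C := R[i].
Variable N : nat.
Implicit Types (p q v w : 'rV[C]_N) (f g : 'rV[C]_N -> C) (U : set 'rV[C]_N).

Lemma dirDD U f g p v : smk 1 U f -> smk 1 U g -> U p ->
  dirD v (fun q => f q + g q) p = dirD v f p + dirD v g p.
Proof.
move=> sf sg Up.
by have /cdrv_derive[_] := cdrvD (dirD_cdrv v sf Up) (dirD_cdrv v sg Up).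
Qed.

Lemma dirDM U f g p v : smk 1 U f -> smk 1 U g -> U p ->
  dirD v (fun q => f q * g q) p = f p * dirD v g p + dirD v f p * g p.
Proof.
move=> sf sg Up.
have := cdrvM (dirD_cdrv v sf Up) (dirD_cdrv v sg Up); rewrite !cline0.
by move=> /cdrv_derive[_].
Qed.

Lemma dirDJ U f p v : smk 1 U f -> U p ->
  dirD v (fun q => Num.conj (f q)) p = Num.conj (dirD v f p).
Proof.
by move=> sf Up; have /cdrv_derive[_] := cdrvJ (dirD_cdrv v sf Up).
Qed.

Lemma dirD_cst (c : C) p v : dirD v (fun=> c) p = 0.
Proof. by have /cdrv_derive[_] := cdrv_eq (fun=> erefl) (cdrv_cst c 0). Qed.

Lemma dirD_coord j p v : dirD v (fun q : 'rV[C]_N => q 0 j) p = v 0 j.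
Proof. by have /cdrv_derive[_] := cdrv_line_coord p v j 0. Qed.

Definition wder (s : 'I_N + 'I_N) f : 'rV[C]_N -> C :=
  match s with inl j => dZ j f | inr j => dZb j f end.

Definition wswap (s : 'I_N + 'I_N) : 'I_N + 'I_N :=
  match s with inl j => inr j | inr j => inl j end.

Definition wsign (s : 'I_N + 'I_N) : C := if s is inl _ then - 'i%C else 'i%C.
Definition widx (s : 'I_N + 'I_N) : 'I_N := match s with inl j => j | inr j => j end.

Lemma wderE s f p : wder s f p =
  (dirD (baseC (widx s)) f p + wsign s * dirD ('i%C *: baseC (widx s)) f p) / 2.
Proof. by case: s => j //=; rewrite /dZ mulNr. Qed.

Lemma conji : Num.conj ('i%C : C) = - 'i%C.
Proof. by apply: reim_eq; rewrite ?reJ ?imJ ?reN ?imN /= ?oppr0. Qed.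

Lemma i2 : ('i%C : C) * 'i%C = -1.
Proof. by apply: reim_eq; rewrite ?reM ?imM /=; ring. Qed.

Lemma wderD s U f g p : smk 1 U f -> smk 1 U g -> U p ->
  wder s (fun q => f q + g q) p = wder s f p + wder s g p.
Proof.
move=> sf sg Up; rewrite !wderE !(dirDD _ sf sg Up).
have gen (a b c d k : C) : (a + b + k * (c + d)) / 2 = (a + k * c) / 2 + (b + k * d) / 2.
  by ring.
exact: gen.
Qed.

Lemma wderM s U f g p : smk 1 U f -> smk 1 U g -> U p ->
  wder s (fun q => f q * g q) p = wder s f p * g p + f p * wder s g p.
Proof.
move=> sf sg Up; rewrite !wderE !(dirDM _ sf sg Up).
have gen (a b c d k x y : C) : (x * a + b * y + k * (x * c + d * y)) / 2 =
  (b + k * d) / 2 * y + x * ((a + k * c) / 2) by ring.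
exact: gen.
Qed.

Lemma wder_cst s (c : C) p : wder s (fun=> c) p = 0.
Proof. by rewrite wderE !dirD_cst mulr0 addr0 mul0r. Qed.

Lemma wder_coord s j p :
  wder s (fun q : 'rV[C]_N => q 0 j) p = (s == inl j)%:R.
Proof.
rewrite wderE !dirD_coord !mxE eqxx /=; case: s => l /=.
  rewrite mulNr mulrA i2 mulN1r opprK.
  have -> : (inl l == inl j :> 'I_N + 'I_N) = (j == l) by rewrite eq_sym.
  by rewrite -mulr2n -[_ *+ 2]mulr_natr mulfK ?pnatr_eq0.
by rewrite mulrA i2 mulN1r subrr mul0r.
Qed.

Lemma wderJ s U f p : smk 1 U f -> U p ->
  wder s (fun q => Num.conj (f q)) p = Num.conj (wder (wswap s) f p).
Proof.
move=> sf Up; rewrite !wderE !(dirDJ _ sf Up).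
rewrite rmorphM rmorphD rmorphM /= fmorphV rmorph_nat.
have -> : widx (wswap s) = widx s by case: s.
have -> : Num.conj (wsign (wswap s)) = wsign s by case: s => j /=; rewrite ?rmorphN /= conji ?opprK.
by [].
Qed.

Lemma smk_wder k U f s : open U -> smk k.+1 U f -> smk k U (wder s f).
Proof. by case: s => j; [exact: smk_dZ|exact: smk_dZb]. Qed.

Lemma wder_ext k U f g s p : open U -> U p -> (forall q, U q -> f q = g q) ->
  smk k U f -> wder s f p = wder s g p.
Proof.
by move=> oU Up fg sf; rewrite !wderE !(dirD_ext _ oU Up fg sf).
Qed.

Lemma dirDZ U (k : C) f p v : open U -> smk 1 U f -> U p ->
  dirD v (fun q => k * f q) p = k * dirD v f p.
Proof.
move=> oU sf Up; rewrite (dirDM v (smk_cst 1 k oU) sf Up) dirD_cst mul0r addr0 //.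
Qed.

Lemma dirD_wder U f p v s : open U -> smk 2 U f -> U p ->
  dirD v (wder s f) p = wder s (dirD v f) p.
Proof.
move=> oU sf Up.
have s1 u := smk_dirD u sf.
rewrite [RHS]wderE.
have E q : U q -> (2^-1 * (dirD (baseC (widx s)) f q +
    wsign s * dirD ('i%C *: baseC (widx s)) f q)) = wder s f q.
  by move=> _; rewrite wderE mulrC.
have sZ := smkZ (wsign s) oU (s1 ('i%C *: baseC (widx s))).
have sD := smkD oU (s1 (baseC (widx s))) sZ.
rewrite -(dirD_ext v oU Up E (smkZ 2^-1 oU sD)).
rewrite (dirDZ _ _ oU sD Up) (dirDD _ (s1 _) sZ Up) (dirDZ _ _ oU (s1 _) Up).
rewrite -(dirDC v (baseC (widx s)) oU sf Up).
by rewrite -(dirDC v ('i%C *: baseC (widx s)) oU sf Up); exact: mulrC.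
Qed.

Lemma wderC U f p s t : open U -> smk 2 U f -> U p ->
  wder s (wder t f) p = wder t (wder s f) p.
Proof.
move=> oU sf Up.
have s1 u := smk_dirD u sf.
rewrite [LHS]wderE !(dirD_wder _ _ oU sf Up).
have E q : U q -> (2^-1 * (dirD (baseC (widx s)) f q +
    wsign s * dirD ('i%C *: baseC (widx s)) f q)) = wder s f q.
  by move=> _; rewrite wderE mulrC.
have sZ := smkZ (wsign s) oU (s1 ('i%C *: baseC (widx s))).
have sD := smkD oU (s1 (baseC (widx s))) sZ.
rewrite -(wder_ext t oU Up E (smkZ 2^-1 oU sD)).
rewrite (wderM t (smk_cst 1 _ oU) sD Up) wder_cst mul0r add0r.
rewrite (wderD t (s1 _) sZ Up) (wderM t (smk_cst 1 _ oU) (s1 _) Up) wder_cst mul0r add0r.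
by rewrite mulrC.
Qed.

Lemma dirD_W U f p v : open U -> smk 1 U f -> U p -> dirD v f p =
  \sum_s (match s with inl j => v 0 j | inr j => Num.conj (v 0 j) end) * wder s f p.
Proof.
move=> oU sf Up; rewrite (dirDE v oU sf Up) big_split [RHS]big_sumType /=; congr (_ + _).
Qed.

End Wirtinger.

(** * Composition of smooth functions with smooth maps *)

Section Composition.
Context {R : realType}.
Local Notation C := R[i].
Variables (N N' : nat).
Implicit Types (U : set 'rV[C]_N).
Implicit Types (f : 'rV[C]_N' -> C) (G : 'rV[C]_N -> 'rV[C]_N').

Lemma bcont_comp f G p : bcont f (G p) -> (forall j, bcont (fun q => G q 0 j) p) ->
  bcont (fun q => f (G q)) p.
Proof.
move=> cf cG e e0; have [d d0 dP] := cf e e0.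
have [||d' d'0 d'P] := @common_radius R 'I_N' (fun j d' => forall q, box p d' q ->
   `|complex.Re (G q 0 j - G p 0 j)| < d /\ `|complex.Im (G q 0 j - G p 0 j)| < d).
- by move=> j; have [d' d'0 d'P] := cG j d d0; exists d'.
- by move=> j d1 d2 H dd q /(box_le dd)/H.
by exists d' => // q pq; apply: dP => j; exact: d'P.
Qed.

Definition gcomp G (s : 'I_N' + 'I_N') : 'rV[C]_N -> C :=
  match s with inl j => fun q => G q 0 j | inr j => fun q => Num.conj (G q 0 j) end.

Lemma cdrv_comp U (U' : set 'rV[C]_N') f G p v : open U -> open U' -> smk 1 U' f ->
  (forall j, smk 1 U (fun q => G q 0 j)) -> U p -> U' (G p) ->
  cdrv (cline (fun q => f (G q)) p v) 0 (\sum_s wder s f (G p) * dirD v (gcomp G s) p).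
Proof.
move=> oU oU' sf sG Up Up'.
have := @cdrv_chain _ _ U' f (fun t => G (p + (t%:C)%C *: v)) 0
  (fun j => dirD v (fun q => G q 0 j) p) oU' sf.
rewrite scale0r addr0 => /(_ Up' (fun j => dirD_cdrv v (sG j) Up)).
congr cdrv; rewrite big_split [RHS]big_sumType /=; congr (_ + _); apply: eq_bigr => j _.
  by rewrite mulrC.
by rewrite mulrC (dirDJ v (sG j) Up).
Qed.

Lemma smk_gcomp k U G s : open U -> (forall j, smk k U (fun q => G q 0 j)) ->
  smk k U (gcomp G s).
Proof. by move=> oU sG; case: s => j //=; apply: smkJ. Qed.

(** One order is given away: already at k = 0 the chain rule needs continuous first derivatives. For
    functions smooth to all orders the loss is harmless. *)
Lemma smk_comp k U (U' : set 'rV[C]_N') f G : open U -> open U' -> smk k.+1 U' f ->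
  (forall j, smk k.+1 U (fun q => G q 0 j)) -> (forall q, U q -> U' (G q)) ->
  smk k U (fun q => f (G q)).
Proof.
move=> oU oU' + + UU'; elim: k f => [|k IH] f sf sG;
  apply: (smk_intro (f' := fun v q => \sum_s wder s f (G q) * dirD v (gcomp G s) q)) => //.
- move=> p Up; apply: bcont_comp; first exact: (smk_bcont sf (UU' _ Up)).
  by move=> j; exact: (smk_bcont (sG j) Up).
- by move=> p v Up; exact: (cdrv_comp v oU oU' sf sG Up (UU' _ Up)).
- move=> p Up; apply: bcont_comp; first exact: (smk_bcont sf (UU' _ Up)).
  by move=> j; exact: (smk_bcont (sG j) Up).
- move=> p v Up; apply: (cdrv_comp v oU oU' _ _ Up (UU' _ Up)).
    by apply: smk_le sf.
  by move=> j; apply: smk_le (sG j).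
move=> k' [<-] v; apply: smk_sum => // s _; apply: smkM => //.
  apply: IH; first exact: smk_wder.
  by move=> j; exact: (smkS (sG j)).
by apply: smk_dirD; apply: (smk_gcomp s oU) => j; exact: (smkS (sG j)).
Qed.

Lemma wder_comp U (U' : set 'rV[C]_N') f G p s : open U -> open U' -> smk 1 U' f ->
  (forall j, smk 1 U (fun q => G q 0 j)) -> U p -> U' (G p) ->
  wder s (fun q => f (G q)) p = \sum_t wder t f (G p) * wder s (gcomp G t) p.
Proof.
move=> oU oU' sf sG Up Up'; rewrite wderE.
have E v : dirD v (fun q => f (G q)) p = \sum_t wder t f (G p) * dirD v (gcomp G t) p.
  by have /cdrv_derive[_] := cdrv_comp v oU oU' sf sG Up Up'.
rewrite !E mulr_sumr -big_split mulr_suml; apply: eq_bigr => t _ /=.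
have gen (a k x y : C) : (a * x + k * (a * y)) / 2 = a * ((x + k * y) / 2) by ring.
by rewrite [wder s (gcomp _ _) _]wderE; exact: gen.
Qed.

End Composition.

(** * The ring of germs on a hypersurface *)

Lemma rmorph_of (A B : nzRingType) (f : A -> B) :
  (forall x y, f (x + y) = f x + f y) -> (forall x y, f (x * y) = f x * f y) ->
  f 1 = 1 -> exists e : {rmorphism A -> B}, forall x, e x = f x.
Proof.
move=> fD fM f1.
have f0 : f 0 = 0 by apply: (addIr (f 0)); rewrite -fD !add0r.
have fN x : f (- x) = - f x by apply: (addIr (f x)); rewrite -fD !addNr f0.
have fB : zmod_morphism f by move=> x y; rewrite fD fN.
have fMM : monoid_morphism f by split.
pose z := GRing.isZmodMorphism.Build A B f fB.
pose m := GRing.isMonoidMorphism.Build A B f fMM.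
pose e : {rmorphism A -> B} := HB.pack f z m.
by exists e.
Qed.

Section SmoothGerm.
Context {R : realType}.
Local Notation C := R[i].
Variable N : nat.
Implicit Types (p q v w : 'rV[C]_N) (f g : 'rV[C]_N -> C) (U : set 'rV[C]_N).

Definition Sm p f : Prop := exists U, open_nbhd p U /\ forall k, smk k U f.

Lemma open_nbhdI p U V : open_nbhd p U -> open_nbhd p V -> open_nbhd p (U `&` V).
Proof. by move=> [oU Up] [oV Vp]; split; [exact: openI|split]. Qed.

Lemma Sm2 p f g : Sm p f -> Sm p g -> exists U, [/\ open_nbhd p U,
  forall k, smk k U f & forall k, smk k U g].
Proof.
move=> [U [pU sf]] [V [pV sg]]; exists (U `&` V); split; first exact: open_nbhdI.
  by move=> k; apply: smk_sub (sf k) => q [].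
by move=> k; apply: smk_sub (sg k) => q [].
Qed.

Lemma Sm_cst p c : Sm p (fun=> c).
Proof.
by exists setT; split; [split; [exact: openT|]|move=> k; exact: smk_cst openT].
Qed.
Lemma Sm_coord p j : Sm p (fun q => q 0 j).
Proof.
by exists setT; split; [split; [exact: openT|]|move=> k; exact: smk_coord openT].
Qed.
Lemma SmD p f g : Sm p f -> Sm p g -> Sm p (fun q => f q + g q).
Proof.
move=> sf sg; have [U [[oU Up] kf kg]] := Sm2 sf sg.
by exists U; split=> // k; exact: smkD oU (kf k) (kg k).
Qed.
Lemma SmM p f g : Sm p f -> Sm p g -> Sm p (fun q => f q * g q).
Proof.
move=> sf sg; have [U [[oU Up] kf kg]] := Sm2 sf sg.
by exists U; split=> // k; exact: smkM oU (kf k) (kg k).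
Qed.
Lemma SmN p f : Sm p f -> Sm p (fun q => - f q).
Proof. by move=> [U [[oU Up] kf]]; exists U; split=> // k; exact: smkN oU (kf k). Qed.
Lemma SmB p f g : Sm p f -> Sm p g -> Sm p (fun q => f q - g q).
Proof. by move=> sf sg; exact: SmD sf (SmN sg). Qed.
Lemma SmJ p f : Sm p f -> Sm p (fun q => Num.conj (f q)).
Proof. by move=> [U [[oU Up] kf]]; exists U; split=> // k; exact: smkJ oU (kf k). Qed.
Lemma Sm_sum p (T : Type) (r : seq T) (P : pred T) (f : T -> 'rV[C]_N -> C) :
  (forall i, P i -> Sm p (f i)) -> Sm p (fun q => \sum_(i <- r | P i) f i q).
Proof.
move=> H; elim: r => [|a r IH].
  by have := Sm_cst p 0; congr Sm; apply/funext => q; rewrite big_nil.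
case Pa : (P a); last by move: IH; congr Sm; apply/funext => q; rewrite big_cons Pa.
by have := SmD (H a Pa) IH; congr Sm; apply/funext => q; rewrite big_cons Pa.
Qed.
Lemma Sm_wder p f s : Sm p f -> Sm p (wder s f).
Proof. by move=> [U [[oU Up] kf]]; exists U; split=> // k; exact: smk_wder oU (kf k.+1). Qed.

Lemma Sm_bcont p f : Sm p f -> bcont f p.
Proof. by move=> [U [[_ Up] kf]]; exact: smk_bcont (kf 0%N) Up. Qed.

Lemma bcont_neq0 f p : bcont f p -> f p != 0 ->
  exists U, open_nbhd p U /\ forall q, U q -> f q != 0.
Proof.
move=> /bcontP cf f0.
have /cvgrPdist_lt := cf; rewrite /= => H.
have {H} := @cvgrPdist_lt _ _ _ (nbhs p) (nbhs_filter p) f (f p).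
move=> [/(_ cf) + _] => /(_ `|f p|); rewrite normr_gt0 => /(_ f0).
rewrite nbhsE => -[U [oU Up] UP]; exists U; split=> // q /UP /= H.
by apply: contraTneq H => ->; rewrite subr0 ltxx.
Qed.

Lemma SmV p f : f p != 0 -> Sm p f -> Sm p (fun q => (f q)^-1).
Proof.
move=> f0 sf; have [V [pV V0]] := bcont_neq0 (Sm_bcont sf) f0.
have [U [pU kf]] := sf; exists (U `&` V); split; first exact: open_nbhdI.
have [oUV _] := open_nbhdI pU pV.
by move=> k; apply: smkV => // [q [_ /V0]//|]; apply: smk_sub (kf k) => q [].
Qed.

Lemma Sm_near p f : Sm p f -> exists U, open_nbhd p U /\ forall q, U q -> Sm q f.
Proof.
by move=> [U [[oU Up] kf]]; exists U; split=> // q Uq; exists U.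
Qed.

Definition smooth_germ p : {pred 'rV[C]_N -> C} := fun f => `[< Sm p f >].

Lemma smooth_germP p f : reflect (Sm p f) (f \in smooth_germ p).
Proof. exact: asboolP. Qed.

Lemma smooth_germ_closed p : subring_closed (smooth_germ p).
Proof.
split=> [|f g /smooth_germP sf /smooth_germP sg|f g /smooth_germP sf /smooth_germP sg];
  apply/smooth_germP; [exact: (Sm_cst p 1)|exact: (SmB sf sg)|exact: (SmM sf sg)].
Qed.

HB.instance Definition _ p := GRing.isSubringClosed.Build ('rV[C]_N -> C)
  (smooth_germ p) (smooth_germ_closed p).

Record sfun p := SFun { sfun_val :> 'rV[C]_N -> C; _ : sfun_val \in smooth_germ p }.
HB.instance Definition _ p := [isSub of sfun p for @sfun_val p].
HB.instance Definition _ p := [Choice of sfun p by <:].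
HB.instance Definition _ p := [SubChoice_isSubComNzRing of sfun p by <:].

End SmoothGerm.

Section GermRing.
Context {R : realType}.
Local Notation C := R[i].
Variables (N : nat) (M : set 'rV[C]_N) (p0 : 'rV[C]_N).
Implicit Types (f g : 'rV[C]_N -> C).

(* The point p0 is added to M so that the quotient is a nonzero ring whether or
   not p0 lies on M. *)
Definition eqM (f g : 'rV[C]_N -> C) : Prop := exists U, open_nbhd p0 U /\
  forall q, U q -> M q \/ q = p0 -> f q = g q.

Definition vanishing : {pred sfun p0} := fun u : sfun p0 => `[< eqM u (fun=> 0) >].

Lemma eqM_refl f : eqM f f.
Proof. by exists setT; split; [split; [exact: openT|]|]. Qed.

Lemma eqM2 f f' g g' (op : C -> C -> C) : eqM f f' -> eqM g g' ->
  eqM (fun q => op (f q) (g q)) (fun q => op (f' q) (g' q)).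
Proof.
move=> [U [pU ff]] [V [pV gg]]; exists (U `&` V); split; first exact: open_nbhdI.
by move=> q [Uq Vq] Mq; rewrite ff ?gg.
Qed.

Lemma eqM_trans f g h : eqM f g -> eqM g h -> eqM f h.
Proof.
move=> [U [pU ff]] [V [pV gg]]; exists (U `&` V); split; first exact: open_nbhdI.
by move=> q [Uq Vq] Mq; rewrite ff ?gg.
Qed.

Lemma eqM_sym f g : eqM f g -> eqM g f.
Proof. by move=> [U [pU fg]]; exists U; split=> // q Uq Mq; rewrite fg. Qed.

Lemma eqM_ev f g : eqM f g -> f p0 = g p0.
Proof. by move=> [U [[_ Up] fg]]; apply: fg => //; right. Qed.

Lemma vanishingP (f : sfun p0) : reflect (eqM f (fun=> 0)) (f \in vanishing).
Proof. exact: asboolP. Qed.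

Lemma vanishing_ideal : idealr_closed vanishing.
Proof.
split; first by apply/vanishingP; exact: eqM_refl.
  apply/negP => /vanishingP /eqM_ev /eqP; apply/negP; exact: oner_neq0.
move=> a u v /vanishingP hu /vanishingP hv; apply/vanishingP.
have := eqM2 +%R (eqM2 *%R (eqM_refl a) hu) hv; congr eqM.
by apply/funext => q; rewrite mulr0 addr0.
Qed.

HB.instance Definition _ := isIdealr.Build (sfun p0) vanishing vanishing_ideal.

Definition germ := {ideal_quot vanishing}.
HB.instance Definition _ := GRing.ComNzRing.on germ.

Local Open Scope quotient_scope.
Definition sgerm (f : sfun p0) : germ := \pi_germ f.
Definition grep (a : germ) : sfun p0 := repr a.

(** The germ along M of an arbitrary function, with the default 0 if the function is not smooth near
    p0. *)
Definition gm f : germ := if pselect (Sm p0 f) is left H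
  then sgerm (SFun (introT (smooth_germP p0 f) H)) else 0.

Lemma gmE f (H : f \in smooth_germ p0) : gm f = sgerm (SFun H).
Proof.
rewrite /gm; case: pselect => [h|/smooth_germP]; last by rewrite H.
by congr sgerm; apply: val_inj.
Qed.

Lemma grepS a : Sm p0 (grep a). Proof. by apply/smooth_germP; case: (grep a). Qed.
Hint Resolve grepS : core.

Lemma gm_rep a : gm (grep a) = a.
Proof.
have H := introT (smooth_germP _ _) (grepS a); rewrite (gmE H).
by rewrite -[RHS]reprK; congr (\pi_germ _); apply: val_inj.
Qed.

Lemma gm_eq f g : Sm p0 f -> Sm p0 g -> (gm f = gm g <-> eqM f g).
Proof.
move=> /smooth_germP Hf /smooth_germP Hg; rewrite !gmE.
split=> [/eqP|h].
  rewrite /sgerm -(Quotient.idealrBE) => /vanishingP h.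
  have := eqM2 +%R h (eqM_refl g); congr eqM; apply/funext => q /=.
    by rewrite subrK.
  by rewrite add0r.
apply/eqP; rewrite /sgerm -(Quotient.idealrBE); apply/vanishingP.
have := eqM2 (fun x y => x - y) h (eqM_refl g); congr eqM.
by apply/funext => q; rewrite subrr.
Qed.

Lemma gmD f g : Sm p0 f -> Sm p0 g -> gm (fun q => f q + g q) = gm f + gm g.
Proof.
move=> sf sg; have := SmD sf sg; move/smooth_germP: (sf) (sg) => Hf /smooth_germP Hg.
move=> /smooth_germP H; rewrite !gmE /sgerm -rmorphD; congr (\pi_germ _).
exact: val_inj.
Qed.

Lemma gmM f g : Sm p0 f -> Sm p0 g -> gm (fun q => f q * g q) = gm f * gm g.
Proof.
move=> sf sg; have := SmM sf sg; move/smooth_germP: (sf) (sg) => Hf /smooth_germP Hg.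
move=> /smooth_germP H; rewrite !gmE /sgerm -rmorphM; congr (\pi_germ _).
exact: val_inj.
Qed.

Lemma gm1 : gm (fun=> 1) = 1.
Proof.
have /smooth_germP H := Sm_cst p0 1; rewrite gmE /sgerm -(rmorph1 (\pi_germ)).
by congr (\pi_germ _); apply: val_inj.
Qed.

Lemma rep_gm f : Sm p0 f -> eqM (grep (gm f)) f.
Proof. by move=> sf; apply/gm_eq; rewrite ?gm_rep. Qed.

Lemma gm_ind (P : germ -> Prop) : (forall f, Sm p0 f -> P (gm f)) -> forall a, P a.
Proof. by move=> H a; rewrite -[a]gm_rep; apply: H. Qed.

Lemma gm_surj a : exists2 f, Sm p0 f & a = gm f.
Proof. by exists (grep a); rewrite ?gm_rep. Qed.

Lemma gmB f g : Sm p0 f -> Sm p0 g -> gm (fun q => f q - g q) = gm f - gm g.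
Proof.
move=> sf sg; apply: (addIr (gm g)); rewrite subrK -gmD //; last exact: SmB.
by congr gm; apply/funext => q; rewrite subrK.
Qed.

Definition gev (a : germ) : C := grep a p0.

Lemma gev_gm f : Sm p0 f -> gev (gm f) = f p0.
Proof. by move=> sf; exact: eqM_ev (rep_gm sf). Qed.

Lemma gev_is_zmod_morphism : zmod_morphism gev.
Proof.
elim/gm_ind=> f sf; elim/gm_ind=> g sg.
rewrite -gmB //; rewrite !gev_gm //; exact: SmB.
Qed.

Lemma gev_is_monoid_morphism : monoid_morphism gev.
Proof.
split; first by rewrite -gm1 gev_gm //; exact: Sm_cst.
by elim/gm_ind=> f sf; elim/gm_ind=> g sg; rewrite -gmM // !gev_gm //; exact: SmM.
Qed.

HB.instance Definition _ := GRing.isZmodMorphism.Build germ C gev gev_is_zmod_morphism.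
HB.instance Definition _ := GRing.isMonoidMorphism.Build germ C gev gev_is_monoid_morphism.

Definition gcst (c : C) : germ := gm (fun=> c).

Lemma gcst_is_zmod_morphism : zmod_morphism gcst.
Proof.
move=> x y; apply: (addIr (gcst y)); rewrite subrK -gmD //; try exact: Sm_cst.
by congr gm; apply/funext => q; rewrite subrK.
Qed.

Lemma gcst_is_monoid_morphism : monoid_morphism gcst.
Proof. by split; [exact: gm1|move=> x y; rewrite -gmM //; exact: Sm_cst]. Qed.

HB.instance Definition _ := GRing.isZmodMorphism.Build C germ gcst gcst_is_zmod_morphism.
HB.instance Definition _ := GRing.isMonoidMorphism.Build C germ gcst gcst_is_monoid_morphism.

Lemma gev_cst c : gev (gcst c) = c.
Proof. by rewrite gev_gm //; exact: Sm_cst. Qed.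

Definition gconj (a : germ) : germ := gm (fun q => Num.conj (grep a q)).

Lemma gconj_gm f : Sm p0 f -> gconj (gm f) = gm (fun q => Num.conj (f q)).
Proof.
move=> sf; apply/gm_eq; [exact: SmJ|exact: SmJ|].
by have [U [pU H]] := rep_gm sf; exists U; split=> // q Uq Mq; rewrite H.
Qed.

Lemma gconj_is_zmod_morphism : zmod_morphism gconj.
Proof.
elim/gm_ind=> f sf; elim/gm_ind=> g sg.
rewrite -gmB // !gconj_gm //; last exact: SmB.
rewrite -gmB; [|exact: SmJ|exact: SmJ].
by congr gm; apply/funext => q; rewrite rmorphB.
Qed.

Lemma gconj_is_monoid_morphism : monoid_morphism gconj.
Proof.
split.
  rewrite -gm1 gconj_gm; last exact: Sm_cst.
  by congr gm; apply/funext => q; rewrite rmorph1.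
elim/gm_ind=> f sf; elim/gm_ind=> g sg; rewrite -gmM // !gconj_gm //; last exact: SmM.
by rewrite -gmM; [congr gm; apply/funext => q; rewrite rmorphM|exact: SmJ|exact: SmJ].
Qed.

HB.instance Definition _ := GRing.isZmodMorphism.Build germ germ gconj gconj_is_zmod_morphism.
HB.instance Definition _ := GRing.isMonoidMorphism.Build germ germ gconj gconj_is_monoid_morphism.

Lemma gconjK : involutive gconj.
Proof.
elim/gm_ind=> f sf; rewrite !gconj_gm //; last exact: SmJ.
by congr gm; apply/funext => q; rewrite conjCK.
Qed.

Lemma gev_conj a : gev (gconj a) = Num.conj (gev a).
Proof.
by elim/gm_ind: a => f sf; rewrite gconj_gm // !gev_gm //; exact: SmJ.
Qed.

Lemma gm_local a : gev a != 0 -> exists b, a * b = 1.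
Proof.
elim/gm_ind: a => f sf; rewrite gev_gm // => f0.
exists (gm (fun q => (f q)^-1)); rewrite -gmM -?gm1 //; last exact: SmV.
apply/gm_eq; [by apply: SmM => //; exact: SmV|exact: Sm_cst|].
have [U [pU U0]] := bcont_neq0 (Sm_bcont sf) f0; exists U; split=> // q /U0 fq _.
by rewrite mulfV.
Qed.

(* On germs along M this is well defined only for fields tangent to M, see
   good_field. *)
Definition vop (a : 'I_N + 'I_N -> 'rV[C]_N -> C) f : 'rV[C]_N -> C :=
  fun q => \sum_s a s q * wder s f q.

Definition good_field (a : 'I_N + 'I_N -> 'rV[C]_N -> C) : Prop :=
  (forall s, Sm p0 (a s)) /\
  (forall f, Sm p0 f -> eqM f (fun=> 0) -> eqM (vop a f) (fun=> 0)).

Definition gop a (x : germ) : germ := gm (vop a (grep x)).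

Lemma Sm_vop a f : (forall s, Sm p0 (a s)) -> Sm p0 f -> Sm p0 (vop a f).
Proof. by move=> sa sf; apply: Sm_sum => s _; apply: SmM => //; exact: Sm_wder. Qed.

Lemma vopD a f g : Sm p0 f -> Sm p0 g ->
  eqM (vop a (fun q => f q + g q)) (fun q => vop a f q + vop a g q).
Proof.
move=> sf sg; have [U [pU kf kg]] := Sm2 sf sg; exists U; split=> // q Uq _.
rewrite /vop -big_split /=; apply: eq_bigr => s _.
by rewrite (wderD s (kf 1%N) (kg 1%N) Uq) mulrDr.
Qed.

Lemma vopM a f g : Sm p0 f -> Sm p0 g ->
  eqM (vop a (fun q => f q * g q)) (fun q => vop a f q * g q + f q * vop a g q).
Proof.
move=> sf sg; have [U [pU kf kg]] := Sm2 sf sg; exists U; split=> // q Uq _.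
rewrite /vop mulr_suml mulr_sumr -big_split /=; apply: eq_bigr => s _.
rewrite (wderM s (kf 1%N) (kg 1%N) Uq).
have gen (x y z t u : C) : x * (y * z + t * u) = x * y * z + t * (x * u) by ring.
exact: gen.
Qed.

Lemma vop_cst a (c : C) q : vop a (fun=> c) q = 0.
Proof. by rewrite /vop big1 // => s _; rewrite wder_cst mulr0. Qed.

Lemma gopE a f : good_field a -> Sm p0 f -> gop a (gm f) = gm (vop a f).
Proof.
move=> [sa ha] sf; apply/gm_eq; try exact: Sm_vop.
have sg : Sm p0 (grep (gm f)) by [].
have /ha H : eqM (fun q => grep (gm f) q + - 1 * f q) (fun=> 0).
  have := eqM2 (fun x y => x + -1 * y) (rep_gm sf) (eqM_refl f).
  by congr eqM; apply/funext => q; rewrite mulN1r subrr.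
have sNf : Sm p0 (fun q => -1 * f q) by apply: SmM => //; exact: Sm_cst.
have {}H := H (SmD sg sNf).
have H1 := vopD a sg sNf; have H2 := vopM a (Sm_cst p0 (-1)) sf.
have H3 := eqM_trans (eqM_sym H1) H.
have := eqM_trans (eqM2 +%R (eqM_refl (vop a (grep (gm f)))) (eqM_sym H2)) H3.
move=> /(fun h => eqM2 +%R h (eqM_refl (vop a f))); congr eqM; apply/funext => q.
  by rewrite vop_cst mul0r add0r mulN1r subrK.
by rewrite add0r.
Qed.

Lemma gop_derivation a : good_field a -> derivation (gop a).
Proof.
move=> ga; have [sa _] := ga.
split; elim/gm_ind=> f sf; elim/gm_ind=> g sg.
  rewrite -gmD // !gopE //; last exact: SmD.
  rewrite -gmD; try exact: Sm_vop.
  apply/gm_eq; [by apply: Sm_vop => //; exact: SmD| |exact: vopD].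
  by apply: SmD; exact: Sm_vop.
rewrite -gmM // !gopE //; last exact: SmM.
rewrite -!gmM -?gmD //; try (by apply: SmM => //; exact: Sm_vop); try exact: Sm_vop.
apply/gm_eq; [by apply: Sm_vop => //; exact: SmM| |exact: vopM].
by apply: SmD; apply: SmM => //; exact: Sm_vop.
Qed.

Lemma gop_cst a c : good_field a -> gop a (gcst c) = 0.
Proof.
move=> ga; rewrite /gcst gopE //; last exact: Sm_cst.
have -> : vop a (fun=> c) = (fun=> 0) by apply/funext => q; rewrite vop_cst.
exact: (rmorph0 gcst).
Qed.

Lemma gm_sum (T : Type) (r : seq T) (P : pred T) (f : T -> 'rV[C]_N -> C) :
  (forall i, P i -> Sm p0 (f i)) ->
  gm (fun q => \sum_(i <- r | P i) f i q) = \sum_(i <- r | P i) gm (f i).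
Proof.
move=> H; elim: r => [|x r IH].
  rewrite big_nil -(rmorph0 gcst); congr gm; apply/funext => q; rewrite big_nil //.
rewrite big_cons -IH; case Px : (P x).
  rewrite -gmD; [|exact: H|exact: Sm_sum].
  by congr gm; apply/funext => q; rewrite big_cons Px.
by congr gm; apply/funext => q; rewrite big_cons Px.
Qed.

End GermRing.

(** * Pullback of germs along a smooth map *)

Section Pullback.
Context {R : realType}.
Local Notation C := R[i].
Variables (N N' : nat) (M : set 'rV[C]_N) (p0 : 'rV[C]_N).
Variables (G : 'rV[C]_N -> 'rV[C]_N').
Hypothesis sG : forall j, Sm p0 (fun q => G q 0 j).

Lemma Sm_map_open (V : set 'rV[C]_N') : open_nbhd (G p0) V ->
  exists U, [/\ open_nbhd p0 U, forall j k, smk k U (fun q => G q 0 j) &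
    forall q, U q -> V (G q)].
Proof.
move=> [oV Vp].
have [W [pW WG]] : exists W, open_nbhd p0 W /\ forall q, W q -> V (G q).
  have [e e0 eV] := open_box oV Vp.
  have [||d d0 dP] := @common_radius R 'I_N' (fun j d => forall q, box p0 d q ->
     `|complex.Re (G q 0 j - G p0 0 j)| < e /\ `|complex.Im (G q 0 j - G p0 0 j)| < e).
  - by move=> j; have [d d0 dP] := Sm_bcont (sG j) e0; exists d.
  - by move=> j d1 d2 H dd q /(box_le dd)/H.
  have : nbhs p0 [set q | V (G q)].
    by apply/nbhs_box; exists d => // q pq; apply: eV => j; exact: dP.
  by rewrite nbhsE => -[W [oW Wp] WP]; exists W.
have [U [pU kG]] : exists U, open_nbhd p0 U /\ forall j k, smk k U (fun q => G q 0 j).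
  suff H (s : seq 'I_N') : exists U, open_nbhd p0 U /\
      forall j, j \in s -> forall k, smk k U (fun q => G q 0 j).
    have [U [pU H']] := H (enum 'I_N'); exists U; split=> // j k.
    by apply: H'; rewrite mem_enum.
  elim: s => [|j s [U [pU IH]]]; first by exists setT; split; [split; [exact: openT|]|].
  have [V' [pV' kV]] := sG j; exists (U `&` V'); split; first exact: open_nbhdI.
  move=> l; rewrite in_cons => /orP[/eqP -> k|/IH H k].
    by apply: smk_sub (kV k) => q [].
  by apply: smk_sub (H k) => q [].
exists (U `&` W); split; first exact: open_nbhdI.
  by move=> j k; apply: smk_sub (kG j k) => q [].
by move=> q [_ /WG].
Qed.

Lemma Sm_comp f : Sm (G p0) f -> Sm p0 (fun q => f (G q)).
Proof.
move=> [V [pV kf]]; have [U [pU kG UV]] := Sm_map_open pV.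
have [oU _] := pU; have [oV _] := pV.
exists U; split=> // k; apply: (smk_comp oU oV (kf k.+1)) => // j; exact: kG.
Qed.

Local Notation B := (germ (@setT 'rV[C]_N') (G p0)).
Local Notation A := (germ M p0).

(** The source consists of ambient germs at G p0, not of germs along M': the Wirtinger derivatives
    of rho', which are transverse to M', must act on it before it is pulled back to M. *)
Definition gpull (b : B) : A := gm M p0 (fun q => grep b (G q)).

Lemma gpull_gm f : Sm (G p0) f -> gpull (gm setT (G p0) f) = gm M p0 (fun q => f (G q)).
Proof.
move=> sf; apply/gm_eq; [by apply: Sm_comp; exact: grepS|exact: Sm_comp|].
have [V [pV H]] := rep_gm setT sf; have [U [pU _ UV]] := Sm_map_open pV.
by exists U; split=> // q /UV Vq _; apply: H => //; left.
Qed.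

Lemma gpull_rmorph : exists e : {rmorphism B -> A}, forall b, e b = gpull b.
Proof.
apply: rmorph_of.
- move=> x y; rewrite -(gm_rep x) -(gm_rep y);
  move: (grep x) (grep y) (grepS x) (grepS y) => f g sf sg; rewrite -gmD // !gpull_gm //; last exact: SmD.
  by rewrite -gmD //; exact: Sm_comp.
- move=> x y; rewrite -(gm_rep x) -(gm_rep y);
  move: (grep x) (grep y) (grepS x) (grepS y) => f g sf sg; rewrite -gmM // !gpull_gm //; last exact: SmM.
  by rewrite -gmM //; exact: Sm_comp.
by rewrite -gm1 gpull_gm ?gm1 //; exact: Sm_cst.
Qed.

End Pullback.

Notation germ_of := gm (only parsing).
Notation smooth_at := Sm (only parsing).

(** * Curves in a hypersurface *)

Section SmoothCurves.
Context {R : realType}.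
Local Notation C := R[i].
Implicit Types (g h : R -> C) (t d : R).

(* k + 1 times differentiable on the interval (-d, d) *)
Fixpoint csm d (k : nat) g : Prop :=
  (forall t, `|t| < d -> cderivable1 g t) /\
  if k is k'.+1 then csm d k' (cderive1 g) else True.

Lemma csmS d k g : csm d k.+1 g -> csm d k g.
Proof. by elim: k g => [|k IH] g [b H]; split=> //; apply: IH. Qed.

Lemma csm_cdrv d k g t : csm d k g -> `|t| < d -> cdrv g t (cderive1 g t).
Proof. by case: k => [|k] [H _] td; apply: derive_cdrv; exact: H. Qed.

Lemma near_in d t : `|t| < d -> exists2 e, 0 < e & forall s, `|s| < e -> `|t + s| < d.
Proof.
move=> td; exists (d - `|t|); rewrite ?subr_gt0 // => s sd.
by apply: le_lt_trans (ler_normD _ _) _; rewrite -ltrBrDl.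
Qed.

Lemma cderive1_ext d g h t : (forall t, `|t| < d -> g t = h t) -> `|t| < d ->
  cderivable1 g t -> cderivable1 h t /\ cderive1 g t = cderive1 h t.
Proof.
move=> gh td /derive_cdrv H; have [e e0 eP] := near_in td.
have := cdrv_ext e0 (fun s se => gh _ (eP s se)) H.
by move=> /cdrv_derive[? ->].
Qed.

Lemma csm_ext d k g h : (forall t, `|t| < d -> g t = h t) -> csm d k g -> csm d k h.
Proof.
elim: k g h => [|k IH] g h gh [b H].
  by split; [move=> t td; have [] := cderive1_ext gh td (b t td)|].
split; first by move=> t td; have [] := cderive1_ext gh td (b t td).
by apply: (IH _ _ _ H) => t td; have [] := cderive1_ext gh td (b t td).
Qed.

Lemma csm_intro d k g g' : (forall t, `|t| < d -> cdrv g t (g' t)) ->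
  (forall k', k = k'.+1 -> csm d k' g') -> csm d k g.
Proof.
move=> dg; case: k => [|k] H; split=> //.
- by move=> t /dg/cdrv_derive[].
- by move=> t /dg/cdrv_derive[].
by apply: csm_ext (H k erefl) => t /dg/cdrv_derive[_ ->].
Qed.

Lemma csm_cst d k (c : C) : csm d k (fun=> c).
Proof.
elim: k c => [|k IH] c; apply: (csm_intro (g' := fun=> 0)) => //; try by move=> t _; exact: cdrv_cst.
by move=> k' [<-]; exact: IH.
Qed.

Lemma csmD d k g h : csm d k g -> csm d k h -> csm d k (fun t => g t + h t).
Proof.
elim: k g h => [|k IH] g h sg sh;
  apply: (csm_intro (g' := fun t => cderive1 g t + cderive1 h t)) => //;
  try by move=> t td; apply: cdrvD; [exact: csm_cdrv sg td|exact: csm_cdrv sh td].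
by move=> k' [<-]; case: sg => _ sg; case: sh => _ sh; exact: (IH _ _ sg sh).
Qed.

Lemma csmM d k g h : csm d k g -> csm d k h -> csm d k (fun t => g t * h t).
Proof.
elim: k g h => [|k IH] g h sg sh;
  apply: (csm_intro (g' := fun t => g t * cderive1 h t + cderive1 g t * h t)) => //;
  try by move=> t td; apply: cdrvM; [exact: csm_cdrv sg td|exact: csm_cdrv sh td].
move=> k' [<-]; have sg' := csmS sg; have sh' := csmS sh.
by case: sg => _ sg; case: sh => _ sh; apply: csmD; [exact: (IH _ _ sg' sh)|exact: (IH _ _ sg sh')].
Qed.

Lemma csmJ d k g : csm d k g -> csm d k (fun t => Num.conj (g t)).
Proof.
elim: k g => [|k IH] g sg;
  apply: (csm_intro (g' := fun t => Num.conj (cderive1 g t))) => //;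
  try by move=> t td; apply: cdrvJ; exact: csm_cdrv sg td.
by move=> k' [<-]; case: sg => _ sg; exact: (IH _ sg).
Qed.

Lemma csm_sum d k (T : Type) (r : seq T) (P : pred T) (f : T -> R -> C) :
  (forall i, P i -> csm d k (f i)) -> csm d k (fun t => \sum_(i <- r | P i) f i t).
Proof.
move=> H; elim: r => [|a r IH].
  by apply: csm_ext (csm_cst d k 0) => t _; rewrite big_nil.
case Pa : (P a); last by apply: csm_ext IH => t _; rewrite big_cons Pa.
by apply: csm_ext (csmD (H a Pa) IH) => t _; rewrite big_cons Pa.
Qed.

Lemma csm_le d d' k g : d' <= d -> csm d k g -> csm d' k g.
Proof.
move=> dd; elim: k g => [|k IH] g [b H]; split=> //; try by move=> t td; apply: b; exact: lt_le_trans dd.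
exact: IH.
Qed.

Lemma csm_comp N d k U (f : 'rV[C]_N -> C) (gam : R -> 'rV[C]_N) : open U ->
  smk k.+1 U f -> (forall j, csm d k (fun t => gam t 0 j)) ->
  (forall t, `|t| < d -> U (gam t)) -> csm d k (fun t => f (gam t)).
Proof.
move=> oU + + gU; elim: k f => [|k IH] f sf sg;
  apply: (csm_intro (g' := fun t => \sum_j (cderive1 (fun t => gam t 0 j) t * dZ j f (gam t)
     + Num.conj (cderive1 (fun t => gam t 0 j) t) * dZb j f (gam t)))) => //.
- move=> t td; apply: (cdrv_chain oU (smk_le _ sf) (gU t td)) => // j.
  exact: csm_cdrv (sg j) td.
- move=> t td; apply: (cdrv_chain oU (smk_le _ sf) (gU t td)) => // j.
  exact: csm_cdrv (sg j) td.
move=> k' [<-]; have sg' j := csmS (sg j).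
apply: csm_sum => j _; have [_ sgj] := sg j; apply: csmD; apply: csmM => //.
- by apply: IH sg'; exact: smk_dZ.
- exact: csmJ.
- by apply: IH sg'; exact: smk_dZb.
Qed.

Lemma smooth_curve_csm N (gam : R -> 'rV[C]_N) :
  smooth_curve gam <-> forall j d k, csm d k (fun t => gam t 0 j).
Proof.
split=> [H j d k|H n j t].
  have: forall n t, cderivable1 (iter n cderive1 (fun t => gam t 0 j)) t by move=> n t; exact: H.
  elim: k (fun t => gam t 0 j) => [|k IH] g Hg; split=> //; try by move=> t _; exact: (Hg 0%N).
  by apply: IH => n t; rewrite -iterSr; exact: Hg.
have {}H k := H j (`|t| + 1) k.
suff : csm (`|t| + 1) 0 (iter n cderive1 (fun t => gam t 0 j)).
  by case=> /(_ t); rewrite ltrDl ltr01 => /(_ isT).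
elim: n (fun t => gam t 0 j) H => [|n IH] g Hg; first exact: Hg.
by rewrite iterSr; apply: IH => k; have [_] := Hg k.+1.
Qed.

Lemma csm_sin d k (a b : C) : csm d k (fun t => a * (sin t)%:C%C + b * (cos t)%:C%C).
Proof.
have D (a1 b1 : C) t : cdrv (fun t => a1 * (sin t)%:C%C + b1 * (cos t)%:C%C) t
    (- b1 * (sin t)%:C%C + a1 * (cos t)%:C%C).
  have ds : drv sin t (cos t) by apply/drvP; exact: is_derive_sin.
  have dc : drv cos t (- sin t) by apply/drvP; exact: is_derive_cos.
  have := cdrvD (cdrvZ a1 (cdrvR ds)) (cdrvZ b1 (cdrvR dc)).
  by rewrite rmorphN mulrN addrC mulNr.
elim: k a b => [|k IH] a b;
  apply: (csm_intro (g' := fun t => - b * (sin t)%:C%C + a * (cos t)%:C%C)) => //.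
by move=> k' [<-]; exact: IH.
Qed.

End SmoothCurves.

Lemma norm_lt_ge0 {R : realType} (a b c : R) : `|a - b| < c -> c <= b -> 0 <= a.
Proof. by rewrite ltr_norml => /andP[? _] ?; lra. Qed.

Lemma norm_lt_le0 {R : realType} (a b c : R) : `|a - b| < c -> b <= - c -> a <= 0.
Proof. by rewrite ltr_norml => /andP[_ ?] ?; lra. Qed.

Lemma between_le {R : realType} (a b c B : R) : `|a| <= B -> `|b| <= B ->
  Num.min a b <= c <= Num.max a b -> `|c| <= B.
Proof.
rewrite !ler_norml => /andP[a1 a2] /andP[b1 b2].
by rewrite /Num.min /Num.max /Order.min /Order.max; case: ltP => _ /andP[h1 h2];
  apply/andP; split; lra.
Qed.

Lemma between_dist {R : realType} (u w z : R) :
  Num.min u w <= z <= Num.max u w -> `|z - u| <= `|w - u|.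
Proof.
rewrite /Num.min /Num.max /Order.min /Order.max; case: ltP => uw /andP[z1 z2].
  by rewrite !ger0_norm ?subr_ge0 ?lerD2r // ltW.
by rewrite !ler0_norm ?subr_le0 // lerN2 lerD2r.
Qed.

Lemma quotient_diff {R : realType} (A A' B B' h : R) : B != 0 -> B' != 0 ->
  - (A' / B') * h - h * - (A / B) = - ((A' - A) / B' + A * (B - B') / (B' * B)) * h.
Proof. by move=> n1 n2; field; rewrite n1 n2. Qed.

Lemma two_steps {R : realType} (r1 r2 r3 u w : R) :
  r1 = 0 -> r2 = 0 -> r3 - r1 = u -> r2 - r3 = w -> u = - w.
Proof. by move=> -> -> <- <-; rewrite subr0 sub0r opprK. Qed.

(** * The implicit function theorem in the plane spanned by two directions *)

Section ImplicitFunction.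
Context {R : realType}.
Local Notation C := R[i].
Local Notation re := (@complex.Re R).
Variable N : nat.
Variables (rho Dv Dn : 'rV[C]_N -> R) (p v nu : 'rV[C]_N) (e K c0 : R).
Hypothesis e0 : 0 < e.
Hypothesis c00 : 0 < c0.
Hypothesis K0 : 0 <= K.
Hypothesis dv : forall q, box p e q -> drv (rline rho q v) 0 (Dv q).
Hypothesis dn : forall q, box p e q -> drv (rline rho q nu) 0 (Dn q).
Hypothesis bv : forall q, box p e q -> `|Dv q| <= K.
Hypothesis bn : forall q, box p e q -> c0 <= Dn q.
Hypothesis contv : forall q, box p e q -> forall eps : R, 0 < eps ->
  exists2 d : R, 0 < d & forall q', box q d q' -> `|Dv q' - Dv q| < eps.
Hypothesis contn : forall q, box p e q -> forall eps : R, 0 < eps ->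
  exists2 d : R, 0 < d & forall q', box q d q' -> `|Dn q' - Dn q| < eps.
Hypothesis rho0 : rho p = 0.

Let Q (x y : R) := p + (x%:C)%C *: v + (y%:C)%C *: nu.

Lemma Q_near (x y : R) (eps : R) : 0 < eps -> exists2 d : R, 0 < d & forall x' y',
  `|x' - x| <= d -> `|y' - y| <= d -> box (Q x y) eps (Q x' y').
Proof.
move=> eps0; have [||d d0 dP] := @common_radius R ('I_N + 'I_N)%type
  (fun k d => forall x' y', `|x' - x| <= d -> `|y' - y| <= d ->
     `|(x' - x) * xco k v + (y' - y) * xco k nu| < eps).
- move=> k; exists (eps / (`|xco k v| + `|xco k nu| + 1)).
    by rewrite divr_gt0 // ltr_wpDl // addr_ge0.
  move=> x' y' hx hy; set h := eps / _ in hx hy.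
  apply: le_lt_trans (ler_normD _ _) _; rewrite !normrM.
  apply: (@le_lt_trans _ _ (h * (`|xco k v| + `|xco k nu|))).
    by rewrite mulrDr; apply: lerD; apply: ler_wpM2r.
  by rewrite /h mulrAC ltr_pdivrMr ?ltr_wpDl ?addr_ge0 // ltr_pM2l // ltrDl.
- by move=> k d1 d' H dd x' y' hx hy; apply: H; apply: le_trans dd.
exists d => // x' y' hx hy; apply/boxP => k.
suff -> : xco k (Q x' y' - Q x y) = (x' - x) * xco k v + (y' - y) * xco k nu by exact: dP.
by rewrite xcoB /Q !xcoD !xcoZ; ring.
Qed.

(** On the segments in the direction nu the function is strictly increasing, by [bn], and changes
    sign; the intermediate value theorem gives the unique zero Y x. Its derivative comes from
    comparing two zeros by the mean value theorem in each direction. *)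
Lemma implicit_function : exists2 eta : R, 0 < eta & exists Y : R -> R, Y 0 = 0 /\
  forall x, `|x| < eta -> [/\ box p e (Q x (Y x)), rho (Q x (Y x)) = 0 &
     drv Y x (- (Dv (Q x (Y x)) / Dn (Q x (Y x))))].
Proof.
have Q00 : Q 0 0 = p by rewrite /Q !scale0r !addr0.
have [d d0 dP] := Q_near 0 0 e0; rewrite Q00 in dP.
have {}dP x y : `|x| <= d -> `|y| <= d -> box p e (Q x y).
  by move=> hx hy; apply: dP; rewrite subr0.
have dx x y : `|x| <= d -> `|y| <= d -> drv (fun x => rho (Q x y)) x (Dv (Q x y)).
  move=> hx hy; have := dv (dP _ _ hx hy); rewrite /Q addrAC => /drv_rline.
  by apply: (drv_ext ltr01) => s _; rewrite /rline addrAC.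
have dy x y : `|x| <= d -> `|y| <= d -> drv (fun y => rho (Q x y)) y (Dn (Q x y)).
  by move=> hx hy; have := dn (dP _ _ hx hy) => /drv_rline.
have between := @between_le R.
have mvx x x' y : `|x| <= d -> `|x'| <= d -> `|y| <= d -> exists2 c,
    Num.min x x' <= c <= Num.max x x' & rho (Q x' y) - rho (Q x y) = Dv (Q c y) * (x' - x).
  move=> hx hx' hy; apply: (@drv_mvt _ (fun x => rho (Q x y)) (fun x => Dv (Q x y))).
  by move=> c /(between _ _ _ _ hx hx') hc; exact: dx.
have mvy x y y' : `|x| <= d -> `|y| <= d -> `|y'| <= d -> exists2 c,
    Num.min y y' <= c <= Num.max y y' & rho (Q x y') - rho (Q x y) = Dn (Q x c) * (y' - y).
  move=> hx hy hy'; apply: (@drv_mvt _ (fun y => rho (Q x y)) (fun y => Dn (Q x y))).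
  by move=> c /(between _ _ _ _ hy hy') hc; exact: dy.
(* For |x| < eta a move along v changes rho by less than c0 * d, while a move by d or - d along nu
   from p changes it by at least c0 * d with opposite signs. The + 1 keeps the divisor positive. *)
pose eta := Num.min d (c0 * d / (K + 1)).
have K1 : 0 < K + 1 by rewrite ltr_wpDl.
have eta0 : 0 < eta by rewrite lt_min d0 divr_gt0 // mulr_gt0.
have z0 : `|0 : R| <= d by rewrite normr0 ltW.
have dd : `|d| <= d by rewrite gtr0_norm.
have ddN : `|- d| <= d by rewrite normrN.
have rK x y : `|x| < eta -> `|y| <= d -> `|rho (Q x y) - rho (Q 0 y)| < c0 * d.
  rewrite lt_min ltr_pdivlMr // => /andP[/ltW xd xK] yd.
  have [c cb ->] := mvx 0 x y z0 xd yd.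
  have cd := between _ _ _ _ z0 xd cb; rewrite subr0 normrM.
  apply: le_lt_trans xK; rewrite mulrC mulrDr mulr1; apply: (@le_trans _ _ (`|x| * K)).
    by apply: ler_wpM2l => //; exact: bv (dP _ _ cd yd).
  by rewrite lerDl.
have rp : c0 * d <= rho (Q 0 d).
  have [c cb] := mvy 0 0 d z0 z0 dd; rewrite Q00 rho0 !subr0 => ->.
  by rewrite ler_pM2r //; apply: bn; apply: dP => //; exact: between cb.
have rn : rho (Q 0 (- d)) <= - (c0 * d).
  have [c cb] := mvy 0 0 (- d) z0 z0 ddN; rewrite Q00 rho0 !subr0 => ->.
  rewrite mulrN lerN2 ler_pM2r //; apply: bn; apply: dP => //; exact: between cb.
have ex x : exists y, `|x| < eta -> `|y| <= d /\ rho (Q x y) = 0.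
  have [xe|_] := ltP `|x| eta; last by exists 0.
  have xd : `|x| <= d by move: xe; rewrite lt_min => /andP[/ltW].
  have dle : - d <= d by rewrite ge0_cp // ltW.
  have [||y] := @IVT R (fun y => rho (Q x y)) (- d) d 0 dle.
  - apply: derivable_within_continuous => y; rewrite in_itv /= -ler_norml => yd.
    by have /drvP[] := dy x y xd yd.
  - rewrite ge_min le_max (norm_lt_le0 (rK x (- d) xe ddN) rn) /=.
    by rewrite (norm_lt_ge0 (rK x d xe dd) rp) orbT.
  by rewrite in_itv /= -ler_norml => yd ry; exists y.
have [Y YP] := choice ex.
have uniq x y y' : `|x| <= d -> `|y| <= d -> `|y'| <= d -> rho (Q x y) = 0 ->
    rho (Q x y') = 0 -> y = y'.
  move=> hx hy hy' ry ry'; have [c cb] := mvy x y y' hx hy hy'.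
  rewrite ry ry' subrr => /esym/eqP; rewrite mulf_eq0 subr_eq0 => /orP[/eqP D0|/eqP -> //].
  have := bn (dP x c hx (between _ _ _ _ hy hy' cb)); rewrite D0 => H.
  by have := lt_le_trans c00 H; rewrite ltxx.
exists eta => //; exists Y; split.
  have [|hy ry] := YP 0; first by rewrite normr0.
  by apply: (uniq 0 _ _ z0 hy z0 ry); rewrite Q00.
move=> x xe; have [yd ry] := YP x xe.
have xd : `|x| <= d by move: xe; rewrite lt_min => /andP[/ltW].
split=> //; first exact: dP.
set q := Q x (Y x); set A := Dv q; set B := Dn q.
have bq : box p e q by exact: dP.
have AK : `|A| <= K := bv bq; have Bc : c0 <= B := bn bq.
have B0 : 0 < B := lt_le_trans c00 Bc.
have step x' : `|x'| < eta -> exists a b, [/\ Num.min x x' <= a <= Num.max x x',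
   Num.min (Y x) (Y x') <= b <= Num.max (Y x) (Y x'),
   Dn (Q x b) * (Y x' - Y x) = - (Dv (Q a (Y x')) * (x' - x)),
   box p e (Q x b) & box p e (Q a (Y x'))].
  move=> xe'; have [yd' ry'] := YP x' xe'.
  have xd' : `|x'| <= d by move: xe'; rewrite lt_min => /andP[/ltW].
  have [a ab Ea] := mvx x x' (Y x') xd xd' yd'.
  have [b bb Eb] := mvy x (Y x) (Y x') xd yd yd'.
  exists a, b; split; [exact: ab|exact: bb| | |].
  - exact: two_steps ry ry' Eb Ea.
  - exact: dP xd (between _ _ _ _ yd yd' bb).
  - exact: dP (between _ _ _ _ xd xd' ab) yd'.
have lip x' : `|x'| < eta -> `|Y x' - Y x| <= K / c0 * `|x' - x|.
  move=> xe'; have [a [b [_ _ E ba bb]]] := step x' xe'.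
  have h1 : c0 * `|Y x' - Y x| <= K * `|x' - x|.
    apply: (@le_trans _ _ `|Dn (Q x b) * (Y x' - Y x)|).
      rewrite normrM; apply: ler_wpM2r => //; apply: le_trans (bn ba) _; exact: ler_norm.
    by rewrite E normrN normrM; apply: ler_wpM2r; [exact: normr_ge0|exact: bv].
  by rewrite mulrAC ler_pdivlMr // mulrC.
move=> eps eps0.
(* Chosen so that the two terms of [quotient_diff] are at most eps / 2 each: the denominators are at
   least c0 and c0 * c0, and |A| is at most K. *)
pose eps1 := eps * c0 / 2 ; pose eps2 := eps * (c0 * c0) / (2 * (K + 1)).
have eps10 : 0 < eps1 by rewrite divr_gt0 // mulr_gt0.
have eps20 : 0 < eps2 by rewrite divr_gt0 // !mulr_gt0.
have [d1 d10 d1P] := contv bq eps10; have [d2 d20 d2P] := contn bq eps20.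
have [d3 d30 d3P] := Q_near x (Y x) d10; have [d4 d40 d4P] := Q_near x (Y x) d20.
have L0 : 0 < K / c0 + 1 by rewrite ltr_wpDl // divr_ge0 // ltW.
have [d5 d50 d5P] := near_in xe.
exists (Num.min d5 (Num.min (d3 / (K / c0 + 1)) (d4 / (K / c0 + 1)))).
  by rewrite !lt_min d50 !divr_gt0.
move=> h; rewrite !lt_min !ltr_pdivlMr // => /andP[/d5P xe'] /andP[h3 h4].
have [a [b [ab bb E ba1 ba2]]] := step _ xe'.
have hL : `|Y (x + h) - Y x| <= `|h| * (K / c0 + 1).
  apply: le_trans (lip _ xe') _; rewrite [x + h]addrC addrK mulrDr mulr1 mulrC lerDl //.
have hh : `|h| <= `|h| * (K / c0 + 1).
  by rewrite mulrDr mulr1 lerDr mulr_ge0 // divr_ge0 // ltW.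
have hb := @between_dist R.
have ha : `|a - x| <= `|h| by have := hb _ _ _ ab; rewrite [x + h]addrC addrK.
have hbb : `|b - Y x| <= `|h| * (K / c0 + 1) by apply: le_trans (hb _ _ _ bb) hL.
have A1 : `|Dv (Q a (Y (x + h))) - A| < eps1.
  apply: d1P; apply: d3P; apply: ltW; apply: le_lt_trans h3 => //.
  exact: le_trans ha hh.
have B1 : `|Dn (Q x b) - B| < eps2.
  apply: d2P; apply: d4P; first by rewrite subrr normr0 ltW.
  by apply: ltW; apply: le_lt_trans h4.
set A' := Dv _ in A1 E; set B' := Dn _ in B1 E.
have Bc' : c0 <= B' := bn ba1; have B0' : 0 < B' := lt_le_trans c00 Bc'.
have E' : Y (x + h) - Y x = - (A' / B') * h.
  apply: (mulfI (lt0r_neq0 B0')); rewrite E [x + h]addrC addrK.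
  by rewrite !mulNr mulrN; congr (- _); rewrite mulrA mulrCA mulfV ?mulr1 // lt0r_neq0.
have -> : Y (x + h) - Y x - h * - (A / B) = - ((A' - A) / B' + A * (B - B') / (B' * B)) * h.
  by rewrite E'; exact: quotient_diff (lt0r_neq0 B0) (lt0r_neq0 B0').
rewrite normrM normrN; apply: ler_wpM2r => //.
apply: le_trans (ler_normD _ _) _; rewrite [leRHS](splitr eps); apply: lerD.
  rewrite normrM normfV (gtr0_norm B0') ler_pdivrMr //; apply: le_trans (ltW A1) _.
  by rewrite /eps1 mulrAC; apply: ler_wpM2l => //; rewrite ltW // divr_gt0.
rewrite !normrM normfV (gtr0_norm (mulr_gt0 B0' B0)) (ler_pdivrMr _ _ (mulr_gt0 B0' B0)).
rewrite distrC; apply: (@le_trans _ _ ((K + 1) * eps2)).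
  by apply: ler_pM => //; [apply: le_trans AK _; rewrite lerDl|exact: ltW].
have -> : (K + 1) * eps2 = eps / 2 * (c0 * c0).
  by rewrite /eps2; field; rewrite lt0r_neq0.
apply: ler_wpM2l; first by rewrite ltW // divr_gt0.
by apply: ler_pM (ltW c00) (ltW c00) Bc' Bc.
Qed.

End ImplicitFunction.

(** * Curves in M and tangential derivatives *)

Section CurvesInM.
Context {R : realType}.
Local Notation C := R[i].
Local Notation re := (@complex.Re R).
Local Notation im := (@complex.Im R).
Variable N : nat.
Implicit Types (p q v : 'rV[C]_N) (U : set 'rV[C]_N) (rho : 'rV[C]_N -> R).

Lemma cdrv_val (f : R -> C) t l l' : l = l' -> cdrv f t l -> cdrv f t l'.
Proof. by move=> ->. Qed.

Lemma dirD_toC k U rho p v : smk k U (toC rho) -> U p ->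
  dirD v (toC rho) p = (re (dirD v (toC rho) p))%:C%C.
Proof.
move=> sf Up; apply: reim_eq => //=; have [_ H] := dirD_cdrv v sf Up.
exact: drv_unique H (drv_cst 0 0).
Qed.

Lemma dirD_oppv U (f : 'rV[C]_N -> C) p v : open U -> smk 1 U f -> U p ->
  dirD (- v) f p = - dirD v f p.
Proof.
move=> oU sf Up; rewrite (dirDE _ oU sf Up) (dirDE _ oU sf Up) -sumrN.
by apply: eq_bigr => j _; rewrite mxE rmorphN !mulNr opprD.
Qed.

Lemma defining_smk M p U rho : defining M p U rho -> forall k, smk k U (toC rho).
Proof. by move=> [_ /smooth_onP]. Qed.

Lemma defining_dir M p U rho : defining M p U rho ->
  exists nu, 0 < re (dirD nu (toC rho) p).
Proof.
move=> D; have [[oU Up] _ grad _] := D; have sf := defining_smk D.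
suff [b b0] : exists b, dirD b (toC rho) p != 0.
  move: b0; rewrite (dirD_toC b (sf 1%N) Up) => b0.
  have r0 : re (dirD b (toC rho) p) != 0 by apply: contraNneq b0 => ->.
  case/lt_total/orP: r0 => r0; last by exists b.
  by exists (- b); rewrite (dirD_oppv b oU (sf 1%N) Up) reN oppr_gt0.
apply: contrapT => H; have /negP := grad p Up; apply.
apply/eqP/rowP => j; rewrite !mxE /dZ.
have H' b : dirD b (toC rho) p = 0.
  by apply/eqP; apply: contrapT => /negP b0; apply: H; exists b.
by rewrite !H' mulr0 subrr mul0r.
Qed.

(** The curve is sought in the plane through p spanned by v and a direction nu transverse to M. Its
    initial velocity is only a positive multiple of v, because of the reparametrization that makes
    it exist for all times. *)
Lemma curve_in_hypersurface M p U rho v : defining M p U rho -> M p ->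
  dirD v (toC rho) p = 0 -> exists gam (eta : R), [/\ smooth_curve gam, gam 0 = p,
    forall t, M (gam t), 0 < eta & forall j, cdrv (fun t => gam t 0 j) 0 (eta%:C%C * v 0 j)].
Proof.
move=> D Mp v0; have [[oU Up] _ _ MU] := D; have sf := defining_smk D.
have [nu nu0] := defining_dir D; set f := toC rho in sf v0 nu0 *.
pose Dv q := re (dirD v f q); pose Dn q := re (dirD nu f q).
have sv := smk_dirD v (sf 1%N); have sn := smk_dirD nu (sf 1%N).
pose c0 := Dn p / 2; have c00 : 0 < c0 by rewrite divr_gt0.
have [e1 e10 e1P] := open_box oU Up.
have [e2 e20 e2P] := smk_bcont sv Up ltr01.
have [e3 e30 e3P] := smk_bcont sn Up c00.
pose e := Num.min e1 (Num.min e2 e3); have e0 : 0 < e by rewrite !lt_min e10 e20.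
have eU q : box p e q -> U q by move=> h; apply: e1P; apply: box_le h; rewrite !ge_min lexx.
have bv q : box p e q -> `|Dv q| <= 1.
  move=> h; have [|+ _] := e2P q; first by apply: box_le h; rewrite !ge_min lexx !orbT.
  by rewrite v0 subr0 => /ltW.
have bn q : box p e q -> c0 <= Dn q.
  move=> h; have [|+ _] := e3P q; first by apply: box_le h; rewrite !ge_min lexx !orbT.
  rewrite reB ltr_norml => /andP[+ _]; rewrite -/(Dn p) -/(Dn q) /c0.
  move: (Dn p) (Dn q) => x y; lra.
have cont (u : 'rV[C]_N) q : box p e q -> forall eps : R, 0 < eps ->
    exists2 d : R, 0 < d & forall q', box q d q' ->
      `|re (dirD u f q') - re (dirD u f q)| < eps.
  move=> /eU Uq eps eps0; have [d d0 dP] := smk_bcont (smk_dirD u (sf 1%N)) Uq eps0.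
  by exists d => // q' /dP[]; rewrite reB.
have dd (u : 'rV[C]_N) q : box p e q -> drv (rline rho q u) 0 (re (dirD u f q)).
  by move=> /eU Uq; have [] := dirD_cdrv u (sf 0%N) Uq.
have rho0 : rho p = 0 by apply/(MU p Up).
have [eta eta0 [Y [Y0 YP]]] := implicit_function e0 c00 ler01 (dd v) (dd nu) bv bn
  (cont v) (cont nu) rho0.
(* [smooth_curve] and the definition of [same_jet] require curves that stay in M for all real times;
   the sine keeps the parameter inside (- eta, eta). *)
pose psi t : R := eta / 2 * sin t.
have psiP t : `|psi t| < eta.
  rewrite normrM gtr0_norm ?divr_gt0 //; apply: (@le_lt_trans _ _ (eta / 2)).
    apply: ler_piMr; first by rewrite ltW // divr_gt0.
    by rewrite ler_norml sin_geN1 sin_le1.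
  by rewrite ltr_pdivrMr // ltr_pMr // ltr1n.
pose gam t := p + ((psi t)%:C)%C *: v + ((Y (psi t))%:C)%C *: nu.
pose W q : C := - (dirD v f q / dirD nu f q).
have We q : U q -> W q = ((- (Dv q / Dn q))%:C)%C.
  move=> Uq; rewrite /W (dirD_toC v (sf 0%N) Uq) (dirD_toC nu (sf 0%N) Uq).
  by rewrite rmorphN rmorphM fmorphV.
have dpsi t : drv psi t (eta / 2 * cos t).
  have := drvM (drv_cst (eta / 2) t) ((drvP _ _ _).2 (is_derive_sin t)).
  by rewrite mulr0 addr0.
have gU t : box p e (gam t) by have [] := YP _ (psiP t).
have dgam t j : cdrv (fun t => gam t 0 j) t
    ((eta / 2)%:C%C * (cos t)%:C%C * (v 0 j + W (gam t) * nu 0 j)).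
  have [_ _ dY] := YP _ (psiP t).
  have H := cdrvD (cdrvD (cdrv_cst (p 0 j) t) (cdrvM (cdrvR (dpsi t)) (cdrv_cst (v 0 j) t)))
    (cdrvM (cdrvR (drv_comp dY (dpsi t))) (cdrv_cst (nu 0 j) t)).
  refine (cdrv_val _ (cdrv_eq _ H)); last by move=> u; rewrite /gam !mxE.
  rewrite (We _ (eU _ (gU t))) !mulr0 !add0r -/(gam t) -/(Dv (gam t)) -/(Dn (gam t)).
  move: (- (Dv (gam t) / Dn (gam t))) (nu 0 j) (v 0 j) => w x y.
  have RM (a b : R) : ((a * b)%:C)%C = (a%:C * b%:C)%C :> C by exact: rmorphM.
  rewrite (RM w) !(RM (eta / 2)).
  by move: (w%:C)%C ((eta / 2)%:C)%C ((cos t)%:C)%C => a b c; ring.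
exists gam, (eta / 2); split.
- apply/smooth_curve_csm => j d k.
  pose V := [set q | U q /\ dirD nu f q != 0].
  have oV : open V.
    rewrite openE => q [Uq q0]; have [V' [[oV' V'q] V'P]] := bcont_neq0 (smk_bcont sn Uq) q0.
    have : nbhs q (U `&` V') by apply: open_nbhs_nbhs; split; [exact: openI|].
    by apply: filterS => q' [? /V'P].
  have sW k' : smk k' V W.
    have sub k'' g : smk k'' U g -> smk k'' V g by apply: smk_sub => q [].
    apply: smkN => //; apply: smkM => //; first exact: sub (smk_dirD v (sf k'.+1)).
    by apply: smkV => // [q []//|]; exact: sub (smk_dirD nu (sf k'.+1)).
  have gV t : V (gam t).
    split; first exact: eU.
    rewrite (dirD_toC nu (sf 0%N) (eU _ (gU t))); apply/eqP => H0.
    have H : Dn (gam t) = 0 := congr1 re H0.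
    by have := lt_le_trans c00 (bn _ (gU t)); rewrite H ltxx.
  (* Bootstrapping: the velocity of gam is a smooth function of gam times a cosine, so each order of
     smoothness yields the next. *)
  elim: k j => [|k IH] j; apply: csm_intro (fun t _ => dgam t j) _ => // k' [<-].
  have cs := csm_sin d k 0 1.
  apply: csmM; first apply: csmM; [exact: csm_cst| |].
    by apply: csm_ext cs => t _; rewrite mul0r add0r mul1r.
  apply: csmD; first exact: csm_cst.
  apply: csmM; last exact: csm_cst.
  by apply: (csm_comp oV (sW _)) => // t _; exact: gV.
- by rewrite /gam /psi sin0 mulr0 Y0 !scale0r !addr0.
- by move=> t; have [_ + _] := YP _ (psiP t); apply/(MU _ (eU _ (gU t))).2.
- by rewrite divr_gt0.
move=> j; have := dgam 0 j; congr cdrv.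
have -> : gam 0 = p by rewrite /gam /psi sin0 mulr0 Y0 !scale0r !addr0.
by rewrite /W v0 mul0r oppr0 mul0r addr0 cos0 mulr1.
Qed.

Definition wvec (v : 'rV[C]_N) (s : 'I_N + 'I_N) : C :=
  match s with inl j => v 0 j | inr j => Num.conj (v 0 j) end.

Lemma dirD_wvec U f p v : open U -> smk 1 U f -> U p ->
  dirD v f p = \sum_s wvec v s * wder s f p.
Proof. exact: dirD_W. Qed.

Lemma wvec_split (a : 'I_N + 'I_N -> C) : exists u u', forall s,
  a s = wvec u s + 'i%C * wvec u' s.
Proof.
exists (\row_j ((a (inl j) + Num.conj (a (inr j))) / 2)).
exists (\row_j (- 'i%C * ((a (inl j) - Num.conj (a (inr j))) / 2))).
have ii (z : C) : 'i%C * ('i%C * z) = - z by rewrite mulrA i2 mulN1r.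
have conj2 : Num.conj (2^-1 : C) = 2^-1 by rewrite fmorphV rmorph_nat.
move=> [] j; rewrite /= !mxE.
  rewrite mulNr mulrN ii opprK.
  by move: (a (inl j)) (Num.conj _) => x y; field.
rewrite !rmorphM rmorphN rmorphD rmorphB /= conji opprK !conjCK conj2 ii.
by move: (a (inr j)) (Num.conj _) => x y; field.
Qed.

(** A complex tangent vector is u + i u' with u and u' real; both are tangent since rho is
    real-valued. Each is, up to a positive factor, the velocity of a curve in M, along which f
    vanishes. *)
Lemma tangent_vanish M p U rho f (a : 'I_N + 'I_N -> C) : defining M p U rho -> M p ->
  \sum_s a s * wder s (toC rho) p = 0 -> Sm p f ->
  (exists V, open_nbhd p V /\ forall q, V q -> M q -> f q = 0) ->
  \sum_s a s * wder s f p = 0.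
Proof.
move=> D Mp a0 [V [[oV Vp] kf]] [W [[oW Wp] WP]].
have [[oU Up] _ _ _] := D; have sr := defining_smk D.
have real_case u : dirD u (toC rho) p = 0 -> dirD u f p = 0.
  move=> u0; have [gam [eta [sg g0 gM eta0 dg]]] := curve_in_hypersurface D Mp u0.
  have Vg : V (gam 0) by rewrite g0.
  have := cdrv_chain oV (kf 1%N) Vg dg; rewrite g0 => H.
  have E : \sum_j (eta%:C%C * u 0 j * dZ j f p +
      Num.conj (eta%:C%C * u 0 j) * dZb j f p) = eta%:C%C * dirD u f p.
    rewrite (dirDE _ oV (kf 1%N) Vp) mulr_sumr; apply: eq_bigr => j _.
    have cr : Num.conj (eta%:C%C : C) = eta%:C%C.
      by apply: reim_eq; rewrite ?reJ ?imJ //= oppr0.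
    have -> : Num.conj (eta%:C%C * u 0 j) = eta%:C%C * Num.conj (u 0 j).
      by rewrite rmorphM; congr (_ * _); exact: cr.
    by ring.
  rewrite E in H.
  have Wg : nbhs (gam 0) W by rewrite g0; exact: open_nbhs_nbhs.
  have [e e0 eP] : exists2 e : R, 0 < e & forall t, `|t| < e -> W (gam t).
    have /nbhs_box[d d0 dP] := Wg.
    have [||e e0 eP] := @common_radius R 'I_N (fun j e => forall t, `|t| < e ->
        `|re (gam t 0 j - gam 0 0 j)| < d /\ `|im (gam t 0 j - gam 0 0 j)| < d).
    - move=> j; have [dr di] := dg j.
      have [e1 e10 e1P] := drv_cont dr d0; have [e2 e20 e2P] := drv_cont di d0.
      exists (Num.min e1 e2); first by rewrite lt_min e10.
      move=> t; rewrite lt_min => /andP[/e1P + /e2P]; rewrite !add0r reB imB.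
      by split.
    - by move=> j d1 d2 HH dd t td; apply: HH; exact: lt_le_trans dd.
    by exists e => // t /eP H'; apply: dP => j.
  have /(cdrv_unique H) E0 : cdrv (fun t => f (gam t)) 0 0.
    apply: cdrv_ext e0 _ (cdrv_cst 0 0) => t te; rewrite add0r WP //; exact: eP.
  move/eqP: E0; rewrite mulf_eq0 => /orP[/eqP e00|/eqP //].
  by move: eta0; have := congr1 re e00 => /= ->; rewrite ltxx.
have [u [u' uE]] := wvec_split a.
have lin (g : 'rV[C]_N -> C) V' : open V' -> V' p -> smk 1 V' g ->
    \sum_s a s * wder s g p = dirD u g p + 'i%C * dirD u' g p.
  move=> oV' Vp' sg; rewrite !(dirD_wvec _ oV' sg Vp') mulr_sumr -big_split /=.
  by apply: eq_bigr => s _; rewrite uE mulrDl mulrA.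
rewrite (lin _ _ oV Vp (kf 1%N)).
move: a0; rewrite (lin _ _ oU Up (sr 1%N)) => a0.
have r1 := dirD_toC u (sr 1%N) Up; have r2 := dirD_toC u' (sr 1%N) Up.
rewrite r1 r2 in a0.
have h1 : re (dirD u (toC rho) p) = 0.
  by have := congr1 re a0; rewrite reD reM /= mul0r mulr0 subr0 addr0.
have h2 : re (dirD u' (toC rho) p) = 0.
  by have := congr1 im a0; rewrite imD imM /= mulr0 !add0r mul1r.
rewrite h1 in r1; rewrite h2 in r2.
by rewrite (real_case _ r1) (real_case _ r2) mulr0 addr0.
Qed.

End CurvesInM.

(** * Commuting tangential vector fields *)

Section CommutingFrame.
Variables (B : comNzRingType) (I : eqType) (W : I -> B -> B) (rho iv : B) (m : I).
Hypothesis dW : forall s, derivation (W s).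
Hypothesis WW : forall s t x, W s (W t x) = W t (W s x).
Hypothesis ivP : W m rho * iv = 1.

Definition level_field (t : I) (x : B) : B := W t x - W t rho * iv * W m x.

(** These are the coordinate fields in coordinates where rho replaces the one indexed by m; hence
    they commute. *)
Lemma level_fieldC t u x : level_field t (level_field u x) = level_field u (level_field t x).
Proof.
have Wiv s : W s iv = - (iv * iv * W s (W m rho)).
  have := congr1 (W s) ivP; rewrite (dW s).2 derivation1 // => h.
  have : iv * (W s (W m rho) * iv + W m rho * W s iv) = 0 by rewrite h mulr0.
  rewrite mulrDr mulrA mulrA [iv * W m rho]mulrC ivP mul1r addrC => /eqP.
  by rewrite addr_eq0 => /eqP ->; ring.
have WL v y z w : W v (y - z * iv * w) = W v y -
    (W v z * iv * w - z * (iv * iv * W v (W m rho)) * w + z * iv * W v w).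
  by rewrite (derivationB _ _ (dW v)) !(dW v).2 Wiv; ring.
rewrite /level_field !WL (WW u t rho) (WW u t x) (WW m u x) (WW m t x) (WW m u rho) (WW m t rho).
move: (W t (W u rho)) (W t (W u x)) (W u (W m x)) (W t (W m x)) (W u (W m rho)) (W t (W m rho))
  (W m (W m x)) (W m (W m rho)) (W m x) (W t rho) (W u rho) => *.
by ring.
Qed.

End CommutingFrame.

Lemma ratio_field (F : fieldType) (x1 x2 x3 y1 y2 y3 : F) : x2 != 0 -> x3 != 0 ->
  y1 - x1 / x2 * y2 = y1 - x1 / x3 * y3 + - (x1 / x2) * (y2 - x2 / x3 * y3).
Proof. by move=> n2 n3; field; rewrite n2 n3. Qed.

(** * The commuting frame P, L on M and its conjugate *)

Section MFrame.
Context {R : realType}.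
Local Notation C := R[i].
Variables (N : nat) (M : set 'rV[C]_N) (p0 : 'rV[C]_N).
Variables (U : set 'rV[C]_N) (rho : 'rV[C]_N -> R) (m : 'I_N).
Hypothesis D : defining M p0 U rho.
Hypothesis Mp0 : M p0.
Let r (s : 'I_N + 'I_N) : 'rV[C]_N -> C := wder s (toC rho).
Hypothesis rm0 : r (inl m) p0 != 0.
Implicit Types (f : 'rV[C]_N -> C) (s t : 'I_N + 'I_N).

Local Notation A := (germ M p0).
Local Notation gm := (gm M p0).
Local Notation Sm := (Sm p0).

Lemma Sm_rho : Sm (toC rho).
Proof. by exists U; split; [case: D|exact: defining_smk D]. Qed.

Lemma Sm_r s : Sm (r s). Proof. exact: Sm_wder Sm_rho. Qed.

Lemma toC_conj (u : 'rV[C]_N -> R) : (fun q => Num.conj (toC u q)) = toC u.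
Proof.
by apply/funext => q; apply: reim_eq; rewrite ?reJ ?imJ //= oppr0.
Qed.

Lemma r_conj s q : U q -> r (wswap s) q = Num.conj (r s q).
Proof.
move=> Uq; have sr := defining_smk D.
rewrite /r -[in LHS](toC_conj rho) (wderJ _ (sr 1%N) Uq).
by case: s.
Qed.

Lemma r_conjl j q : U q -> Num.conj (r (inl j) q) = r (inr j) q.
Proof. by move=> Uq; rewrite -(r_conj _ Uq). Qed.

Lemma r_conjr j q : U q -> Num.conj (r (inr j) q) = r (inl j) q.
Proof. by move=> Uq; rewrite -(r_conj _ Uq). Qed.

Lemma rmb0 : r (inr m) p0 != 0.
Proof.
have [[_ Up] _ _ _] := D.
by rewrite -[inr m]/(wswap (inl m)) (r_conj _ Up) conjC_eq0.
Qed.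

Definition kappa t : 'rV[C]_N -> C := fun q => r t q / r (inr m) q.
Lemma Sm_kappa t : Sm (kappa t).
Proof. by apply: SmM; [exact: Sm_r|apply: SmV; [exact: rmb0|exact: Sm_r]]. Qed.

(* With rho_s the Wirtinger derivatives of a defining function, fT (inl k) is
   P_k = d/dZ_k - (rho_k / rho_mbar) d/dZbar_m and fT (inr k) is
   L_k = d/dZbar_k - (rho_kbar / rho_mbar) d/dZbar_m, so that L_m = 0. *)
Definition fT t : 'I_N + 'I_N -> 'rV[C]_N -> C :=
  fun s q => (s == t)%:R - (s == inr m)%:R * kappa t q.

Definition tangent_to (a : 'I_N + 'I_N -> 'rV[C]_N -> C) : Prop :=
  (forall s, Sm (a s)) /\ exists V, open_nbhd p0 V /\
    forall q, V q -> M q -> \sum_s a s q * r s q = 0.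

Lemma defining_at q : U q -> defining M q U rho.
Proof. by case: D => [[oU _] ? ? ?] Uq; split. Qed.

Lemma tangent_good a : tangent_to a -> good_field M p0 a.
Proof.
move=> [sa [V [pV aV]]]; split=> // f sf [W [pW fW]].
have [V' [pV' sfq]] := Sm_near sf.
have pU : open_nbhd p0 U by case: D.
exists ((V `&` W) `&` (V' `&` U)).
split; first by apply: open_nbhdI; exact: open_nbhdI.
move=> q [[Vq Wq] [Vq' Uq]] Mq0.
have Mq : M q by case: Mq0 => [//|->].
apply: (tangent_vanish (defining_at Uq) Mq (aV q Vq Mq) (sfq q Vq')).
exists W; split; first by case: pW.
by move=> q' Wq' Mq'; apply: fW => //; left.
Qed.

Lemma sum_delta (s : 'I_N + 'I_N) (F : 'I_N + 'I_N -> C) : \sum_t (t == s)%:R * F t = F s.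
Proof.
rewrite (bigD1 s) //= eqxx mul1r big1 ?addr0 // => t /negbTE ->; exact: mul0r.
Qed.

Lemma fT_tangent t : tangent_to (fT t).
Proof.
split=> [s|].
  apply: SmB; first exact: Sm_cst.
  by apply: SmM; [exact: Sm_cst|exact: Sm_kappa].
have [V [pV V0]] := bcont_neq0 (Sm_bcont (Sm_r (inr m))) rmb0.
exists V; split=> // q /V0 q0 _; rewrite /fT.
under eq_bigr do rewrite mulrBl -mulrA.
by rewrite sumrB !sum_delta /kappa divfK // subrr.
Qed.

Definition tT t : A -> A := gop (fT t).
Lemma tT_deriv t : derivation (tT t).
Proof. exact: gop_derivation (tangent_good (fT_tangent t)). Qed.
Lemma tT_gm t f : Sm f -> tT t (gm f) = gm (vop (fT t) f).
Proof. exact: gopE (tangent_good (fT_tangent t)). Qed.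

Lemma vop_fT t f q : vop (fT t) f q = wder t f q - kappa t q * wder (inr m) f q.
Proof.
rewrite /vop /fT; under eq_bigr do rewrite mulrBl -mulrA.
by rewrite sumrB !sum_delta.
Qed.

Lemma vop_fT_fun t f : vop (fT t) f = fun q => wder t f q - kappa t q * wder (inr m) f q.
Proof. by apply/funext => q; rewrite vop_fT. Qed.

Lemma Sm_fT t f : Sm f -> Sm (vop (fT t) f).
Proof. by move=> sf; apply: Sm_vop => //; case: (fT_tangent t). Qed.

(** The coefficients are those of a itself: the corrections in d/dZbar_m add up to a multiple of the
    derivative of rho along a, which vanishes on M. *)
Lemma tangent_expand a x : tangent_to a -> gop a x = \sum_s gm (a s) * tT s x.
Proof.
move=> ta; have ga := tangent_good ta; have [sa [V [pV aV]]] := ta.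
have [f sf ->] := gm_surj x; rewrite gopE //.
transitivity (gm (fun q => \sum_s a s q * vop (fT s) f q)); last first.
  rewrite gm_sum; last by move=> s _; apply: SmM => //; exact: Sm_fT.
  by apply: eq_bigr => s _; rewrite tT_gm // gmM //; exact: Sm_fT.
apply/gm_eq; [exact: Sm_vop| |].
  by apply: Sm_sum => s _; apply: SmM => //; exact: Sm_fT.
exists V; split=> // q Vq Mq0; have Mq : M q by case: Mq0 => [//|->].
under [RHS]eq_bigr do rewrite vop_fT mulrBr.
rewrite sumrB /vop [X in _ = _ - X](_ : _ = 0) ?subr0 //.
rewrite (eq_bigr (fun s => a s q * r s q * ((r (inr m) q)^-1 * wder (inr m) f q))); last first.
  by move=> s _; rewrite /kappa !mulrA.
by rewrite -mulr_suml aV // mul0r.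
Qed.

Lemma eqM_setT f g : eqM setT p0 f g -> eqM M p0 f g.
Proof. by move=> [V [pV fg]]; exists V; split=> // q Vq _; apply: fg => //; left. Qed.

Lemma unit_good (s : 'I_N + 'I_N) : good_field setT p0 (fun t _ => (t == s)%:R).
Proof.
split=> [t|f sf [V [[oV Vp] f0]]]; first exact: Sm_cst.
exists V; split=> // q Vq _; rewrite /vop sum_delta.
have E q' : V q' -> (fun=> 0) q' = f q' by move=> Vq'; rewrite f0 //; left.
by rewrite -(wder_ext s oV Vq E (smk_cst 0 0 oV)) wder_cst.
Qed.

Local Notation B0 := (germ (@setT 'rV[C]_N) p0).
Definition gW (s : 'I_N + 'I_N) : B0 -> B0 := gop (fun t _ => (t == s)%:R).

Lemma gW_gm s f : Sm f -> gW s (germ_of setT p0 f) = germ_of setT p0 (wder s f).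
Proof.
move=> sf; rewrite /gW (gopE (unit_good s)) //; congr germ_of.
by apply/funext => q; rewrite /vop sum_delta.
Qed.

Lemma gWC s t x : gW s (gW t x) = gW t (gW s x).
Proof.
have [f sf ->] := gm_surj x.
rewrite (gW_gm t sf) (gW_gm s sf) (gW_gm s (Sm_wder t sf)) (gW_gm t (Sm_wder s sf)).
apply/gm_eq; [exact: Sm_wder (Sm_wder _ sf)|exact: Sm_wder (Sm_wder _ sf)|].
have [V [[oV Vp] kf]] := sf; exists V; split=> // q Vq _.
exact: wderC oV (kf 2%N) Vq.
Qed.

Lemma tTC t u x : tT t (tT u x) = tT u (tT t x).
Proof.
have [f sf ->] := gm_surj x.
have sT v := Sm_fT v sf.
rewrite (tT_gm t sf) (tT_gm u sf) (tT_gm u (sT t)) (tT_gm t (sT u)).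
apply/gm_eq; [exact: Sm_fT (sT _)|exact: Sm_fT (sT _)|].
(* The Wirtinger derivatives are not tangent to M and do not act on germs along M; the commutation
   is proved in the ambient ring and then restricted. *)
apply: eqM_setT.
apply/(gm_eq setT); [exact: Sm_fT (sT _)|exact: Sm_fT (sT _)|].
pose rB := germ_of setT p0 (toC rho).
have sV : Sm (fun q => (r (inr m) q)^-1) by apply: SmV; [exact: rmb0|exact: Sm_r].
pose iv := germ_of setT p0 (fun q => (r (inr m) q)^-1).
have ivP : gW (inr m) rB * iv = 1.
  rewrite /rB (gW_gm _ Sm_rho) -(gmM setT (Sm_r (inr m)) sV) -gm1.
  apply/gm_eq; [exact: SmM (Sm_r _) sV|exact: Sm_cst|].
  have [V [pV V0]] := bcont_neq0 (Sm_bcont (Sm_r (inr m))) rmb0.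
  by exists V; split=> // q /V0 q0 _; rewrite mulfV.
have LF v g : Sm g -> germ_of setT p0 (vop (fT v) g) =
    level_field gW rB iv (inr m) v (germ_of setT p0 g).
  move=> sg; rewrite /level_field /rB !(gW_gm _ Sm_rho) !(gW_gm _ sg).
  rewrite -(gmM setT (Sm_r v) sV) -(gmM setT (Sm_kappa v) (Sm_wder _ sg)).
  rewrite -(gmB setT (Sm_wder _ sg) (SmM (Sm_kappa v) (Sm_wder _ sg))).
  by rewrite vop_fT_fun.
rewrite (LF t _ (sT u)) (LF u _ (sT t)) (LF u _ sf) (LF t _ sf).
exact (level_fieldC (fun s => gop_derivation (unit_good s)) gWC ivP t u _).
Qed.

Lemma tT_cst t c : tT t (gcst M p0 c) = 0.
Proof. exact: gop_cst (tangent_good (fT_tangent t)). Qed.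

Definition gZ (k : 'I_N) : A := gm (fun q => q 0 k).
Definition gZb (k : 'I_N) : A := gm (fun q => Num.conj (q 0 k)).

Lemma wder_conj_coord s j q :
  wder s (fun q : 'rV[C]_N => Num.conj (q 0 j)) q = (s == inr j)%:R.
Proof.
rewrite (wderJ s (smk_coord 1 j openT) I) wder_coord rmorph_nat.
by case: s.
Qed.

Lemma gop_gZ a k : tangent_to a -> gop a (gZ k) = gm (a (inl k)).
Proof.
move=> ta; rewrite /gZ (gopE (tangent_good ta)); last exact: Sm_coord.
congr gm; apply/funext => q; rewrite /vop.
under eq_bigr do rewrite wder_coord mulrC; exact: sum_delta.
Qed.

Lemma gop_gZb a k : tangent_to a -> gop a (gZb k) = gm (a (inr k)).
Proof.
move=> ta; rewrite /gZb (gopE (tangent_good ta)); last exact: SmJ (Sm_coord _ _).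
congr gm; apply/funext => q; rewrite /vop.
under eq_bigr do rewrite wder_conj_coord mulrC; exact: sum_delta.
Qed.

Lemma tT_gZ t k : tT t (gZ k) = (t == inl k)%:R.
Proof.
rewrite /tT (gop_gZ _ (fT_tangent t)) -(rmorph_nat (gcst M p0)); congr gm.
by apply/funext => q; rewrite /fT mul0r subr0 eq_sym.
Qed.

Definition tP k : A -> A := tT (inl k).
Definition tL k : A -> A := tT (inr k).
Local Notation c := (@gconj R N M p0).
Definition tS k (x : A) : A := c (tP k (c x)).
Definition tLb k (x : A) : A := c (tL k (c x)).
Definition lam k : A := gm (fun q => - (r (inl k) q / r (inl m) q)).

Lemma tang_tT j : tang tP tL j = tT j. Proof. by case: j. Qed.

Lemma conj_field (X : A -> A) : derivation X -> derivation (fun x => c (X (c x))).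
Proof.
move=> [XD XM]; split=> f g; first by rewrite rmorphD XD rmorphD.
by rewrite rmorphM XM rmorphD !rmorphM /= !gconjK.
Qed.

Lemma conj_tT t f : Sm f -> c (tT t (c (gm f))) =
  gm (fun q => wder (wswap t) f q - Num.conj (kappa t q) * wder (inl m) f q).
Proof.
move=> sf; have [V [[oV Vp] kf]] := sf.
rewrite (gconj_gm M sf) (tT_gm t (SmJ sf)) (gconj_gm M (Sm_fT t (SmJ sf))).
have s1 : Sm (fun q => Num.conj (kappa t q) * wder (inl m) f q).
  by apply: SmM; [exact: SmJ (Sm_kappa _)|exact: Sm_wder].
apply/gm_eq; [exact: SmJ (Sm_fT t (SmJ sf))|exact: SmB (Sm_wder _ sf) s1|].
exists V; split=> // q Vq _; rewrite vop_fT !(wderJ _ (kf 1%N) Vq).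
by rewrite rmorphB rmorphM /= !conjCK.
Qed.

Lemma tS_comb k : combination (tang tP tL) (tS k).
Proof.
pose a s := fun q => (s == inr k)%:R - (s == inl m)%:R * Num.conj (kappa (inl k) q).
have sa s : Sm (a s).
  apply: SmB; [exact: Sm_cst|apply: SmM; [exact: Sm_cst|exact: SmJ (Sm_kappa _)]].
have pU : open_nbhd p0 U by case: D.
have ta : tangent_to a.
  split=> //; have [V [pV V0]] := bcont_neq0 (Sm_bcont (Sm_r (inr m))) rmb0.
  exists (V `&` U); split; first exact: open_nbhdI.
  move=> q [/V0 q0 Uq] _; rewrite /a.
  under eq_bigr do rewrite mulrBl -mulrA.
  have E : Num.conj (kappa (inl k) q) = r (inr k) q / r (inl m) q.
    by rewrite /kappa fmorph_div /= (r_conjl k Uq) (r_conjr m Uq).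
  rewrite sumrB !sum_delta E divfK ?subrr //.
  by rewrite -(r_conjr m Uq) conjC_eq0.
exists (fun s => gm (a s)) => x; under eq_bigr do rewrite tang_tT.
rewrite -tangent_expand //.
have [f sf ->] := gm_surj x; rewrite /tS /tP conj_tT // (gopE (tangent_good ta)) //.
congr gm; apply/funext => q; rewrite /vop /a.
by under eq_bigr do rewrite mulrBl -mulrA; rewrite sumrB !sum_delta.
Qed.

Lemma tLbE k x : tLb k x = tP k x + lam k * tP m x.
Proof.
have [f sf ->] := gm_surj x; rewrite /tLb /tL conj_tT // /tP.
have sl : Sm (fun q => - (r (inl k) q / r (inl m) q)).
  by apply: SmN; apply: SmM; [exact: Sm_r|apply: SmV; [exact: rm0|exact: Sm_r]].
have s1 : Sm (fun q => Num.conj (kappa (inr k) q) * wder (inl m) f q).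
  by apply: SmM; [exact: SmJ (Sm_kappa _)|exact: Sm_wder].
have pU : open_nbhd p0 U by case: D.
have sk t : Sm (fun q => wder t f q - kappa t q * wder (inr m) f q).
  exact: SmB (Sm_wder _ sf) (SmM (Sm_kappa _) (Sm_wder _ sf)).
have T t : tT t (gm f) = gm (fun q => wder t f q - kappa t q * wder (inr m) f q).
  by rewrite (tT_gm t sf) vop_fT_fun.
rewrite (T (inl k)) (T (inl m)) /lam -(gmM M sl (sk (inl m))).
rewrite -(gmD M (sk (inl k)) (SmM sl (sk (inl m)))).
apply/gm_eq; [exact: SmB (Sm_wder _ sf) s1|exact: SmD (sk _) (SmM sl (sk _))|].
have [V [pV V0]] := bcont_neq0 (Sm_bcont (Sm_r (inr m))) rmb0.
have [V' [pV' V0']] := bcont_neq0 (Sm_bcont (Sm_r (inl m))) rm0.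
exists ((V `&` V') `&` U); split; first by apply: open_nbhdI => //; exact: open_nbhdI.
move=> q [[Vq Vq'] Uq] _.
have q0 := V0 q Vq; have q0' := V0' q Vq'.
have E : Num.conj (kappa (inr k) q) = r (inl k) q / r (inl m) q.
  by rewrite /kappa fmorph_div; exact: (congr2 (fun a b => a / b) (r_conjr k Uq) (r_conjr m Uq)).
rewrite E; exact: (ratio_field _ _ _ _ q0' q0).
Qed.

Lemma lam_m : lam m = -1.
Proof.
have -> : -1 = gcst M p0 (-1) by rewrite rmorphN rmorph1.
apply/gm_eq; [|exact: Sm_cst|].
  by apply: SmN; apply: SmM; [exact: Sm_r|apply: SmV; [exact: rm0|exact: Sm_r]].
have [V' [pV' V0']] := bcont_neq0 (Sm_bcont (Sm_r (inl m))) rm0.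
by exists V'; split=> // q /V0' q0 _; rewrite mulfV.
Qed.

End MFrame.

(** * Jets along curves and flat germs *)

Local Opaque dirD.
Local Arguments wder : simpl never.

Section Polarization.
Variables (F : numFieldType) (A : comNzRingType) (ev : {rmorphism A -> F}).
Variables (cst : {rmorphism F -> A}) (I : finType) (P : I -> A -> A).
Hypothesis dP : forall i, derivation (P i).
Hypothesis PP : forall i j x, P i (P j x) = P j (P i x).
Hypothesis Pcst : forall i x, P i (cst x) = 0.
Hypothesis evcst : forall x, ev (cst x) = x.
Implicit Types (u v : I -> F) (x y : A).

Definition dirP v y : A := \sum_i cst (v i) * P i y.

Lemma dirPD v x y : dirP v (x + y) = dirP v x + dirP v y.
Proof. by rewrite -big_split /=; apply: eq_bigr => i _; rewrite (dP i).1 mulrDr. Qed.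

Lemma dirPZ v c y : dirP v (cst c * y) = cst c * dirP v y.
Proof.
rewrite mulr_sumr; apply: eq_bigr => i _.
by rewrite (dP i).2 Pcst mul0r add0r mulrCA.
Qed.

Lemma dirP_sum v (r : seq I) (Q : pred I) (h : I -> A) :
  dirP v (\sum_(i <- r | Q i) h i) = \sum_(i <- r | Q i) dirP v (h i).
Proof.
elim/big_rec2: _ => [|i x y _ <-]; last exact: dirPD.
by rewrite /dirP big1 // => i _; rewrite derivation0 ?mulr0.
Qed.

Lemma dirP_P v i y : dirP v (P i y) = P i (dirP v y).
Proof.
rewrite derivation_sum //; apply: eq_bigr => j _.
by rewrite (dP i).2 Pcst mul0r add0r PP.
Qed.

Lemma dirPC u v y : dirP u (dirP v y) = dirP v (dirP u y).
Proof.
rewrite {2}/dirP dirP_sum; apply: eq_bigr => i _.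
by rewrite dirPZ dirP_P.
Qed.

(** The derivative along v + t u, iterated l times, is polynomial in t; its coefficient at t is l
    times a mixed derivative with exactly one u. *)
Lemma dirP_poly u v l y : exists p : {poly F},
  [/\ forall t, ev (iter l (dirP (fun i => v i + t * u i)) y) = p.[t],
      p`_0 = ev (iter l (dirP v) y) &
      p`_1 = l%:R * ev (iter l.-1 (dirP v) (dirP u y))].
Proof.
elim: l y => [|l IH] y.
  exists (ev y)%:P; split=> [t||]; rewrite ?hornerC ?coefC ?mul0r //.
have [p1 [h1 a1 b1]] := IH (dirP v y); have [p2 [h2 a2 b2]] := IH (dirP u y).
exists (p1 + 'X * p2); split.
- move=> t; rewrite iterSr; set D := dirP (fun i => _).
  have -> : D y = dirP v y + cst t * dirP u y.
    rewrite mulr_sumr -big_split /=; apply: eq_bigr => i _.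
    by rewrite rmorphD rmorphM mulrDl mulrA.
  have itD k a b : iter k D (a + cst t * b) = iter k D a + cst t * iter k D b.
    by elim: k => //= k ->; rewrite {1}/D dirPD dirPZ.
  by rewrite itD rmorphD rmorphM /= evcst h1 h2 hornerD hornerM hornerX.
- by rewrite coefD coefXM /= addr0 a1 -iterS iterSr.
rewrite coefD coefXM /= b1 a2 dirPC.
case: l {IH h1 a1 b1 h2 a2 b2} => [|l] /=; first by rewrite mul0r add0r mul1r.
by rewrite -iterS iterSr -[in RHS]natr1 mulrDl mul1r.
Qed.

Lemma poly_zero (p : {poly F}) : (forall t, p.[t] = 0) -> p = 0.
Proof.
move=> p0; apply/eqP; apply: contraT => pn0.
have := @max_poly_roots _ p [seq i%:R | i <- iota 0 (size p)] pn0.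
rewrite size_map size_iota ltnn; apply=> //.
  by apply/allP => t _; rewrite /root p0.
by rewrite map_inj_uniq ?iota_uniq // => i j /eqP; rewrite eqr_nat => /eqP.
Qed.

(** A polynomial vanishing for all t has zero linear coefficient. This splits off one prescribed
    field [P i], and the remaining l - 1 directions are handled by induction. *)
Lemma polarization l y : (forall v, ev (iter l (dirP v) y) = 0) ->
  forall w, size w = l -> ev (word P w y) = 0.
Proof.
elim: l y => [|l IH] y H w; first by move=> /size0nil ->; exact: (H (fun=> 0)).
case: w => // i w [wl] /=.
rewrite (word_commr (Y := P i)); last by move=> j g; exact: PP.
apply: IH => // v.
pose u j : F := (j == i)%:R.
have [p [h _ p1]] := dirP_poly u v l.+1 y.
have p0 : p = 0 by apply: poly_zero => t; rewrite -h; exact: H.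
move/esym/eqP: p1; rewrite p0 coef0 mulf_eq0 pnatr_eq0 /= => /eqP.
suff -> : dirP u y = P i y by [].
rewrite /dirP (bigD1 i) //= /u eqxx rmorph1 mul1r big1 ?addr0 // => j /negbTE ->.
by rewrite rmorph0 mul0r.
Qed.

End Polarization.

Section IterDerive.
Context {R : realType}.
Local Notation C := R[i].
Implicit Types (d : R) (g h : R -> C).

Lemma iter_cderive1_ext d l g h : csm d l g -> (forall t, `|t| < d -> g t = h t) ->
  forall t, `|t| < d -> iter l cderive1 g t = iter l cderive1 h t.
Proof.
elim: l g h => [|l IH] g h; first by move=> _ gh t /gh.
move=> [b H] gh t td; rewrite !iterSr; apply: IH => // s sd.
by have [] := cderive1_ext gh sd (b s sd).
Qed.

Lemma csm_iterD d l g h : csm d l g -> csm d l h -> forall t, `|t| < d ->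
  iter l cderive1 (fun t => g t + h t) t = iter l cderive1 g t + iter l cderive1 h t.
Proof.
elim: l g h => [|l IH] g h sg sh t td //; rewrite !iterSr.
have E s : `|s| < d -> cderive1 (fun t => g t + h t) s = cderive1 g s + cderive1 h s.
  move=> sd; have := cdrvD (csm_cdrv sg sd) (csm_cdrv sh sd).
  by move=> /cdrv_derive[].
case: (sg) (sh) (csmD sg sh) => _ sg' [_ sh'] [_ sgh'].
by rewrite (iter_cderive1_ext sgh' E td) IH.
Qed.

Lemma iter_cderive1_0 l t : iter l cderive1 (fun=> 0 : C) t = 0.
Proof.
suff : iter l cderive1 (fun=> 0 : C) = fun=> 0 by move=> ->.
elim: l => //= l ->; apply/funext => s.
by have := cdrv_cst (0 : C) s => /cdrv_derive[].
Qed.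

Lemma csm_iter_sum d l (T : Type) (r : seq T) (f : T -> R -> C) :
  (forall i, csm d l (f i)) -> forall t, `|t| < d ->
  iter l cderive1 (fun t => \sum_(i <- r) f i t) t = \sum_(i <- r) iter l cderive1 (f i) t.
Proof.
move=> sf t td; elim: r => [|a r IH].
  rewrite big_nil -[RHS](iter_cderive1_0 l t); congr (iter _ _ _ _).
  by apply/funext => s; rewrite big_nil.
have ss : csm d l (fun t => \sum_(i <- r) f i t) by apply: csm_sum => i _.
rewrite big_cons -IH -(csm_iterD (sf a) ss td).
by congr (iter _ _ _ _); apply/funext => s; rewrite big_cons.
Qed.

Lemma csm_derive d g : (forall k, csm d k g) -> forall k, csm d k (cderive1 g).
Proof. by move=> sg k; case: (sg k.+1). Qed.

End IterDerive.

Section JetsFlat.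
Context {R : realType}.
Local Notation C := R[i].
Variables (N : nat) (M : set 'rV[C]_N) (p0 : 'rV[C]_N).
Variables (U : set 'rV[C]_N) (rho : 'rV[C]_N -> R) (m : 'I_N).
Hypothesis D : defining M p0 U rho.
Hypothesis Mp0 : M p0.
Let r (s : 'I_N + 'I_N) : 'rV[C]_N -> C := wder s (toC rho).
Hypothesis rm0 : r (inl m) p0 != 0.
Local Notation re := (@complex.Re R).
Local Notation im := (@complex.Im R).
Local Notation A := (germ M p0).
Local Notation gm := (gm M p0).
Local Notation Sm := (Sm p0).
Local Notation ev := (@gev R N M p0).
Local Notation tT := (@tT R N M p0 rho m).
Local Notation tP := (@tP R N M p0 rho m).
Local Notation tL := (@tL R N M p0 rho m).
Local Notation fT := (@fT R N rho m).
Local Notation kappa := (@kappa R N rho m).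
Local Notation flat := (flat ev tP tL).

Lemma curve_near (V : set 'rV[C]_N) (gam : R -> 'rV[C]_N) : smooth_curve gam ->
  gam 0 = p0 -> open_nbhd p0 V -> exists2 e : R, 0 < e & forall t, `|t| < e -> V (gam t).
Proof.
move=> sg g0 [oV Vp].
have Wg : nbhs (gam 0) V by rewrite g0; exact: open_nbhs_nbhs.
have /nbhs_box[d d0 dP] := Wg.
have [||e e0 eP] := @common_radius R 'I_N (fun j e => forall t, `|t| < e ->
    `|re (gam t 0 j - gam 0 0 j)| < d /\ `|im (gam t 0 j - gam 0 0 j)| < d).
- move=> j; have [dr di] := derive_cdrv (sg 0%N j 0).
  have [e1 e10 e1P] := drv_cont dr d0; have [e2 e20 e2P] := drv_cont di d0.
  exists (Num.min e1 e2); first by rewrite lt_min e10.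
  move=> t; rewrite lt_min => /andP[/e1P + /e2P]; rewrite !add0r reB imB.
  by split.
- by move=> j d1 d2 HH dd t td; apply: HH; exact: lt_le_trans dd.
by exists e => // t /eP H'; apply: dP => j.
Qed.

Definition velocity (gam : R -> 'rV[C]_N) (t : R) : 'rV[C]_N :=
  \row_j cderive1 (fun u => gam u 0 j) t.

Lemma curve_wder (V : set 'rV[C]_N) gam f t : smooth_curve gam -> open V -> smk 1 V f ->
  V (gam t) -> cdrv (fun u => f (gam u)) t (\sum_s wvec (velocity gam t) s * wder s f (gam t)).
Proof.
move=> sg oV sf Vt.
have dg j : cdrv (fun s => gam s 0 j) t (velocity gam t 0 j).
  by rewrite mxE; exact: derive_cdrv (sg 0%N j t).
have := cdrv_chain oV sf Vt dg; congr cdrv.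
by rewrite big_sumType /= big_split /=.
Qed.

Lemma curve_field V gam f t : smooth_curve gam -> (forall t, M (gam t)) -> open V ->
  smk 1 V f -> V (gam t) -> V `<=` U -> r (inr m) (gam t) != 0 ->
  (exists2 e : R, 0 < e & forall s, `|s| < e -> V (gam (t + s))) ->
  cdrv (fun u => f (gam u)) t (\sum_s wvec (velocity gam t) s * vop (fT s) f (gam t)).
Proof.
move=> sg gM oV sf Vt VU rt [e e0 eV].
have [[oU _] _ _ MU] := D.
have H := curve_wder sg oV sf Vt; move: (H); congr cdrv.
have r0 : \sum_s wvec (velocity gam t) s * r s (gam t) = 0.
  apply: cdrv_unique (curve_wder sg oU (defining_smk D 1%N) (VU _ Vt)) _.
  apply: cdrv_ext e0 _ (cdrv_cst 0 t) => h /eV/VU Uh.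
  by have /(MU _ Uh) := gM (t + h); rewrite /toC => ->.
under [RHS]eq_bigr do rewrite vop_fT mulrBr.
rewrite sumrB [X in _ = _ - X](_ : _ = 0) ?subr0 //.
rewrite (eq_bigr (fun s => wvec (velocity gam t) s * r s (gam t) *
  ((r (inr m) (gam t))^-1 * wder (inr m) f (gam t)))).
  by rewrite -mulr_suml r0 mul0r.
by move=> s _; rewrite /kappa -!mulrA.
Qed.

Definition fieldX (c : 'I_N + 'I_N -> C) (x : A) : A := dirP (gcst M p0) tT c x.

Lemma flat_fieldX c k K x : flat (K + k) x -> flat K (iter k (fieldX c) x).
Proof.
elim: k K x => [|k IHk] K x; first by rewrite addn0.
rewrite addnS -addSn => /IHk h; apply: dflat_comb h => //.
- by move=> j; rewrite tang_tT; exact: (tT_deriv D Mp0 rm0).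
- exact: rmorph0.
- by move=> x' y' hx hy; rewrite rmorphD hx hy addr0.
- by move=> x' y' hy; rewrite rmorphM hy mulr0.
exists (fun s => gcst M p0 (c s)) => y.
by apply: eq_bigr => s _; rewrite tang_tT.
Qed.

(** The terms in which a derivative hits a coefficient contain fewer than l derivatives of f and
    vanish by flatness; what remains depends on the curve through its velocity at 0 only. The factor
    [a] absorbs the varying velocity in the induction. *)
Lemma jet_word gam : smooth_curve gam -> gam 0 = p0 -> (forall t, M (gam t)) ->
  forall l f a (d : R), 0 < d -> Sm f -> flat l (gm f) -> (forall k, csm d k a) ->
  iter l cderive1 (fun t => a t * f (gam t)) 0 =
    a 0 * ev (iter l (fieldX (wvec (velocity gam 0))) (gm f)).
Proof.
move=> sg g0 gM; have /smooth_curve_csm cg := sg.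
have sT s f : Sm f -> Sm (vop (fT s) f) by exact: (Sm_fT D rm0).
elim=> [|l IH] f a d d0 sf ff sa; first by rewrite /= g0 gev_gm.
have pU : open_nbhd p0 U by case: D.
have [V1 [pV1 V10]] := bcont_neq0 (Sm_bcont (Sm_r D (inr m))) (rmb0 D rm0).
have [V2 [pV2 kf]] := sf.
pose V := (V1 `&` U) `&` V2.
have pV : open_nbhd p0 V by apply: open_nbhdI => //; exact: open_nbhdI.
have [oV _] := pV.
have kfV k : smk k V f by apply: smk_sub (kf k) => q [].
have VU : V `<=` U by move=> q [[]].
have [e1 e10 e1P] := curve_near sg g0 pV.
have [e2 e20 [e2d e2e1]] : exists2 e : R, 0 < e & e <= d /\ e <= e1.
  exists (Num.min d e1); first by rewrite lt_min d0.
  by rewrite !ge_min !lexx orbT.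
pose c s t := wvec (velocity gam t) s.
have csc s k dd : csm dd k (c s).
  have Hj j : csm dd k (fun t => velocity gam t 0 j).
    by apply: csm_ext (csm_derive (fun k => cg j dd k) k) => t _; rewrite mxE.
  by case: s => j; [exact: Hj|exact: csmJ].
have cf g k : Sm g -> (forall l, smk l V g) -> csm e2 k (fun t => g (gam t)).
  move=> sg' kg; apply: (csm_comp oV (kg k.+1)) => [j|t te]; first exact: cg.
  by apply: e1P; exact: lt_le_trans e2e1.
have sa2 k : csm e2 k a by exact: csm_le e2d (sa k).
have E t : `|t| < e2 -> cderive1 (fun t => a t * f (gam t)) t =
    cderive1 a t * f (gam t) + \sum_s (a t * c s t) * vop (fT s) f (gam t).
  move=> te; have te1 := lt_le_trans te e2e1.
  have Vt : V (gam t) by exact: e1P.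
  have H1 : cdrv (fun u => f (gam u)) t (\sum_s c s t * vop (fT s) f (gam t)).
    apply: (curve_field sg gM oV (kfV 1%N) Vt VU).
      by case: Vt => -[/V10].
    by have [e e0 eP] := near_in te1; exists e => // s /eP/e1P.
  have /cdrv_derive[_ ->] := cdrvM (csm_cdrv (sa2 0%N) te) H1.
  rewrite addrC; congr (_ + _); rewrite mulr_sumr; apply: eq_bigr => s _.
  by rewrite mulrA.
have [e3 e30 [e3e2 cT]] : exists2 e : R, 0 < e & e <= e2 /\
    forall s k, csm e k (fun t => vop (fT s) f (gam t)).
  have [||e e0 eP] := @common_radius R ('I_N + 'I_N)%type (fun s e => e <= e2 /\
     forall k, csm e k (fun t => vop (fT s) f (gam t))).
  - move=> s; have [W [pW kW]] := sT s f sf; have [oW _] := pW.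
    have [e e0 eP] := curve_near sg g0 pW.
    exists (Num.min e2 e); first by rewrite lt_min e20.
    split; first by rewrite ge_min lexx.
    move=> k; apply: (csm_comp oW (kW k.+1)) => [j|t te]; first exact: cg.
    by apply: eP; apply: lt_le_trans te _; rewrite ge_min lexx orbT.
  - move=> s d1 d2 [h1 h2] dd; split; first exact: le_trans h1.
    by move=> k; exact: csm_le (h2 k).
  exists (Num.min e e2); first by rewrite lt_min e0.
  split; first by rewrite ge_min lexx orbT.
  by move=> s k; have [_ h] := eP s; apply: csm_le (h k); rewrite ge_min lexx.
have z3 : `|0 : R| < e3 by rewrite normr0.
have sa3 k : csm e3 k a by exact: csm_le e3e2 (sa2 k).
have cf3 k : csm e3 k (fun t => f (gam t)) by exact: csm_le e3e2 (cf _ k sf kfV).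
rewrite iterSr.
have C1 : csm e3 l (fun t => cderive1 a t * f (gam t)).
  by apply: csmM; [exact: csm_derive|].
have Cs s : csm e3 l (fun t => (a t * c s t) * vop (fT s) f (gam t)).
  by apply: csmM; [apply: csmM; [|exact: csc]|exact: cT].
have C2 : csm e3 l (fun t => \sum_s (a t * c s t) * vop (fT s) f (gam t)).
  by apply: csm_sum => s _.
have C0 : csm e3 l (cderive1 (fun t => a t * f (gam t))).
  by apply: csm_derive => k; apply: csmM.
rewrite (iter_cderive1_ext C0 (fun t te => E t (lt_le_trans te e3e2)) z3).
rewrite (csm_iterD C1 C2 z3) (csm_iter_sum _ Cs z3).
have fl : flat l (gm f) by apply: dflatS ff => // j; rewrite tang_tT; exact: (tT_deriv D Mp0 rm0).
have ffT s : flat l (gm (vop (fT s) f)).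
  by case: ff => _ /(_ s); rewrite tang_tT (tT_gm D Mp0 rm0).
rewrite (IH _ _ _ e30 sf fl (csm_derive sa3)).
under eq_bigr => s _ do rewrite (IH _ _ _ e30 (sT s f sf) (ffT s) (fun k => csmM (sa3 k) (csc s k e3))).
have itf : ev (iter l (fieldX (wvec (velocity gam 0))) (gm f)) = 0.
  by have [] : flat 1 (iter l (fieldX (wvec (velocity gam 0))) (gm f)) by exact: flat_fieldX.
rewrite itf mulr0 add0r iterSr /fieldX.
have lin k (h : 'I_N + 'I_N -> A) : iter k (dirP (gcst M p0) tT (wvec (velocity gam 0)))
   (\sum_s gcst M p0 (c s 0) * h s) = \sum_s gcst M p0 (c s 0) *
      iter k (dirP (gcst M p0) tT (wvec (velocity gam 0))) (h s).
  elim: k => //= k ->; rewrite dirP_sum; last exact: (tT_deriv D Mp0 rm0).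
  apply: eq_bigr => s _; rewrite dirPZ //; first exact: (tT_deriv D Mp0 rm0).
  by move=> t y; exact: (tT_cst D Mp0 rm0).
rewrite [X in iter l _ X]/dirP lin rmorph_sum mulr_sumr; apply: eq_bigr => s _.
by rewrite rmorphM /= gev_cst mulrA (tT_gm D Mp0 rm0).
Qed.

Lemma flat_curve K l f gam : smooth_curve gam -> gam 0 = p0 -> (forall t, M (gam t)) ->
  Sm f -> flat K (gm f) -> (l < K)%N -> iter l cderive1 (fun t => f (gam t)) 0 = 0.
Proof.
move=> sg g0 gM sf ff lK.
have dT j : derivation (tang tP tL j) by rewrite tang_tT; exact: (tT_deriv D Mp0 rm0).
have fl : flat l.+1 (gm f) by exact: dflat_le lK ff.
have := jet_word sg g0 gM ltr01 sf (dflatS fl) (fun k => csm_cst 1 k 1).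
have [-> _] : flat 1 (iter l (fieldX (wvec (velocity gam 0))) (gm f)).
  by apply: flat_fieldX; rewrite add1n.
by rewrite mulr0 => <-; congr (iter _ _ _ _); apply/funext => t; rewrite mul1r.
Qed.

Lemma conj_r s : Num.conj (r s p0) = r (wswap s) p0.
Proof.
have [[_ Up] _ _ _] := D.
by case: s => j; [exact: (r_conjl D j Up)|exact: (r_conjr D j Up)].
Qed.

(* Multiplication by i conj(w) turns any v into a real tangent vector, w being
   the derivative of rho along v. *)
Lemma rotate_tangent (v : 'rV[C]_N) : exists2 u : C, u != 0 & dirD (u *: v) (toC rho) p0 = 0.
Proof.
have [[oU Up] _ _ _] := D; have sr := defining_smk D 1%N.
pose w := \sum_j v 0 j * r (inl j) p0.
have E u : dirD (u *: v) (toC rho) p0 = u * w + Num.conj (u * w).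
  rewrite (dirD_wvec _ oU sr Up) big_sumType /= mulr_sumr rmorph_sum.
  congr (_ + _); apply: eq_bigr => j _; rewrite mxE; first by rewrite mulrA.
  have e : Num.conj (u * (v 0 j * r (inl j) p0)) = Num.conj (u * v 0 j) * r (inr j) p0.
    have := conj_r (inl j) => /= <-; rewrite mulrA; exact: rmorphM.
  exact: esym e.
case: (eqVneq w 0) => w0.
  by exists 1; rewrite ?oner_eq0 // E w0 mulr0 rmorph0 addr0.
exists ('i%C * Num.conj w); last first.
  have ci : Num.conj ('i%C : C) = - 'i%C by apply: reim_eq; rewrite ?reJ ?imJ /= ?oppr0.
  have e : Num.conj ('i%C * Num.conj w * w) = - 'i%C * w * Num.conj w.
    by rewrite !rmorphM /= conjCK ci.
  by rewrite E e; ring.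
have i0 : 'i%C != 0 :> C.
  by apply/eqP => h; have := congr1 (fun z : C => z * z) h; rewrite i2 mul0r => /eqP; rewrite oppr_eq0 oner_eq0.
by rewrite mulf_neq0 // conjC_eq0.
Qed.

(** Since L f = 0, only words in P matter, and these are found one order at a time: by [jet_word]
    curves give the pure derivatives in each direction, and polarization gives the mixed ones. *)
Lemma curve_flat k f : Sm f -> (forall j, tL j (gm f) = 0) ->
  (forall gam, smooth_curve gam -> gam 0 = p0 -> (forall t, M (gam t)) ->
    forall l, (l <= k)%N -> iter l cderive1 (fun t => f (gam t)) 0 = 0) ->
  flat k.+1 (gm f).
Proof.
move=> sf Lf H; set x := gm f in Lf *.
have dT j : derivation (tT j) by exact: (tT_deriv D Mp0 rm0).
have dtg j : derivation (tang tP tL j) by rewrite tang_tT.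
have TC := tTC D Mp0 rm0; have Tc := tT_cst D Mp0 rm0.
have gD (v : 'I_N -> C) K : forall y, (forall j, tL j y = 0) ->
   forall c : 'I_N + 'I_N -> C, (forall j, c (inl j) = v j) ->
   iter K (fieldX c) y = iter K (dirP (gcst M p0) tP v) y.
  move=> + + c cv; elim: K => // K IH y Ly; rewrite !iterSr.
  have -> : fieldX c y = dirP (gcst M p0) tP v y.
    rewrite /fieldX /dirP big_sumType /= [X in _ + X]big1 ?addr0.
      by apply: eq_bigr => j _; rewrite cv.
    by move=> j _; rewrite -/(tL j) Ly mulr0.
  apply: IH => j; rewrite /dirP derivation_sum; last exact: dT.
  rewrite big1 // => i _.
  rewrite -[tL _ _]/(tT (inr _) _) (dT _).2 Tc mul0r add0r.
  have -> : tT (inr j) (tP i y) = tT (inl i) (tL j y) by exact: TC.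
  by rewrite Ly derivation0 ?mulr0.
have wP w y : word (tang tP tL) (map inl w) y = word tP w y.
  by elim: w => [|i w IHw]; [reflexivity|exact: (congr1 (tP i) IHw)].
have words K y : (forall j, tL j y = 0) ->
    (forall w, (size w < K)%N -> ev (word tP w y) = 0) -> flat K y.
  elim: K y => //= K IH y Ly Hy; split; first exact: (Hy [::]).
  case=> j /=; last by rewrite Ly; apply: dflat0 => //; exact: rmorph0.
  apply: IH => [i|w wK].
    have -> : tL i (tP j y) = tT (inl j) (tL i y) by exact: TC.
    by rewrite Ly derivation0.
  by have := Hy (rcons w j); rewrite size_rcons /word foldr_rcons; apply.
suff : forall K, (K <= k.+1)%N -> flat K x by exact.
elim=> // K IH Kk; have fK := IH (ltnW Kk).
apply: words => // w; rewrite ltnS leq_eqVlt => /orP[/eqP wK|wK]; last first.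
  rewrite -wP; by move/dflatP: fK; apply; rewrite size_map.
apply: (polarization (cst := gcst M p0) (fun j => dT (inl j))
  (fun i j => TC (inl i) (inl j)) (fun j => Tc (inl j)) (@gev_cst _ _ _ _) _ wK) => v.
(* The direction v is arbitrary in C^N, whereas velocities are tangent to M. Rotating v by u makes
   it tangent, and as only P acts on the CR germ, the derivative of order K changes by the nonzero
   factor (eta u)^K. *)
have [u u0 du] := rotate_tangent (\row_j v j).
have [gam [eta [sg g0 gM eta0 dg]]] := curve_in_hypersurface D Mp0 du.
have vel j : velocity gam 0 0 j = eta%:C%C * u * v j.
  by rewrite mxE; have /cdrv_derive[_ ->] := dg j; rewrite !mxE mulrA.
have := jet_word sg g0 gM ltr01 sf fK (fun k => csm_cst 1 k 1).
under [fun t => 1 * _]funext do rewrite mul1r.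
rewrite (H gam sg g0 gM K Kk) mul1r -/x => /esym.
rewrite (gD (fun j => eta%:C%C * u * v j) K x Lf (wvec (velocity gam 0)) vel).
have scale K' : iter K' (dirP (gcst M p0) tP (fun j => eta%:C%C * u * v j)) x =
   gcst M p0 ((eta%:C%C * u) ^+ K') * iter K' (dirP (gcst M p0) tP v) x.
  elim: K' => [|K' IHK]; first by rewrite expr0 rmorph1 mul1r.
  rewrite !iterS IHK exprSr rmorphM.
  rewrite (dirPZ (fun j => dT (inl j)) (fun j => Tc (inl j))) -mulrA.
  congr (_ * _); rewrite mulr_sumr; apply: eq_bigr => j _.
  by rewrite !rmorphM !mulrA.
rewrite scale.
rewrite rmorphM /= gev_cst => /eqP; rewrite mulf_eq0 expf_eq0 mulf_eq0 (negbTE u0) orbF.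
case/orP=> [/andP[_ /eqP e0]|/eqP //].
by move: eta0; have := congr1 re e0 => /= ->; rewrite ltxx.
Qed.

End JetsFlat.

(** * Finite type *)

Local Opaque gconj gm gop gpull gev tT.

Section FieldBracket.
Variables (B : comNzRingType) (I : finType) (W : I -> B -> B).
Hypothesis dW : forall s, derivation (W s).
Hypothesis WW : forall s t x, W s (W t x) = W t (W s x).

Definition field_op (a : I -> B) (x : B) : B := \sum_s a s * W s x.

Lemma field_op_bracket a b x : field_op a (field_op b x) - field_op b (field_op a x) =
  field_op (fun t => field_op a (b t) - field_op b (a t)) x.
Proof.
have E u v : field_op u (field_op v x) = \sum_t field_op u (v t) * W t x +
    \sum_s \sum_t u s * v t * W s (W t x).
  transitivity (\sum_s \sum_t (u s * W s (v t) * W t x + u s * v t * W s (W t x))).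
    apply: eq_bigr => s _; rewrite /field_op derivation_sum // mulr_sumr.
    by apply: eq_bigr => t _; rewrite (dW s).2; ring.
  under eq_bigr do rewrite big_split /=; rewrite big_split /=; congr (_ + _).
  by rewrite exchange_big /=; apply: eq_bigr => t _; rewrite mulr_suml.
rewrite !E [\sum_s \sum_t b s * a t * _]exchange_big /=.
rewrite [X in _ - (_ + X)](eq_bigr (fun s => \sum_t a s * b t * W s (W t x))); last first.
  by move=> s _; apply: eq_bigr => t _; rewrite WW [b t * _]mulrC.
rewrite /field_op; under [RHS]eq_bigr do rewrite mulrBl.
rewrite sumrB; set u := \sum_(s in I) \sum_(t in I) _.
have gen (p q r : B) : p + r - (q + r) = p - q by ring.
exact: gen.
Qed.

End FieldBracket.

Section FrameLaws.
Context {R : realType}.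
Local Notation C := R[i].
Variables (N : nat) (M : set 'rV[C]_N) (p0 : 'rV[C]_N).
Variables (U : set 'rV[C]_N) (rho : 'rV[C]_N -> R) (m : 'I_N).
Hypothesis D : defining M p0 U rho.
Hypothesis Mp0 : M p0.
Let r (s : 'I_N + 'I_N) : 'rV[C]_N -> C := wder s (toC rho).
Hypothesis rm0 : r (inl m) p0 != 0.
Local Notation A := (germ M p0).
Local Notation gm := (gm M p0).
Local Notation Sm := (Sm p0).
Local Notation ev := (@gev R N M p0).
Local Notation tT := (@tT R N M p0 rho m).
Local Notation tP := (@tP R N M p0 rho m).
Local Notation tL := (@tL R N M p0 rho m).
Local Notation tS := (@tS R N M p0 rho m).
Local Notation tLb := (@tLb R N M p0 rho m).
Local Notation lam := (@lam R N M p0 rho m).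
Local Notation gZ := (@gZ R N M p0).
Local Notation gZb := (@gZb R N M p0).
Local Notation fT := (@fT R N rho m).
Local Notation kappa := (@kappa R N rho m).
Local Notation tangent_to := (tangent_to M p0 rho).
Local Notation B0 := (germ (@setT 'rV[C]_N) p0).
Local Notation gmT := (germ_of (@setT 'rV[C]_N) p0).

Lemma tP_deriv k : derivation (tP k). Proof. exact: (tT_deriv D Mp0 rm0). Qed.
Lemma tL_deriv k : derivation (tL k). Proof. exact: (tT_deriv D Mp0 rm0). Qed.
Lemma tLb_deriv k : derivation (tLb k). Proof. exact: (conj_field (tL_deriv k)). Qed.
Lemma tPP j k x : tP j (tP k x) = tP k (tP j x). Proof. exact: (tTC D Mp0 rm0). Qed.
Lemma tLL j k x : tL j (tL k x) = tL k (tL j x). Proof. exact: (tTC D Mp0 rm0). Qed.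
Lemma tPL j k x : tL j (tP k x) = tP k (tL j x). Proof. exact: (tTC D Mp0 rm0). Qed.
Lemma tLbLb j k x : tLb j (tLb k x) = tLb k (tLb j x).
Proof.
have e1 := congr1 (fun z => gconj (tL j z)) (gconjK (tL k (gconj x))).
have e2 := congr1 (fun z => gconj (tL k z)) (gconjK (tL j (gconj x))).
exact: (etrans e1 (etrans (congr1 (@gconj R N M p0) (tLL j k (gconj x))) (esym e2))).
Qed.
Lemma tP_gZ j k : tP j (gZ k) = (j == k)%:R. Proof. exact: (tT_gZ D Mp0 rm0). Qed.
Lemma tL_gZ j k : tL j (gZ k) = 0. Proof. exact: (tT_gZ D Mp0 rm0). Qed.

Lemma tT_val t f : Sm f ->
  tT t (gm f) = gm (fun q => wder t f q - kappa t q * wder (inr m) f q).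
Proof. by move=> sf; rewrite (tT_gm D Mp0 rm0) // vop_fT_fun. Qed.

Lemma tT_gm_wder t f : Sm f ->
  tT t (gm f) = gm (wder t f) - gm (kappa t) * gm (wder (inr m) f).
Proof.
move=> sf; rewrite tT_val //.
have sk := Sm_kappa D rm0 t; have sw s := Sm_wder s sf.
by rewrite (gmB M (sw t) (SmM sk (sw (inr m)))) (gmM M sk (sw (inr m))).
Qed.

Section Chain.
Variables (N' : nat) (G : 'rV[C]_N -> 'rV[C]_N').
Hypothesis sG : forall j, Sm (fun q => G q 0 j).

Definition map_germ (i : 'I_N' + 'I_N') : A :=
  match i with inl j => gm (fun q => G q 0 j) | inr j => gconj (gm (fun q => G q 0 j)) end.

Lemma Sm_gcomp i : Sm (gcomp G i).
Proof. by case: i => j; [exact: sG|exact: SmJ]. Qed.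

Lemma map_germE i : map_germ i = gm (gcomp G i).
Proof. by case: i => j //=; rewrite gconj_gm. Qed.

Lemma wder_gcomp s f : smooth_at (G p0) f ->
  gm (wder s (fun q => f (G q))) = \sum_i gm (fun q => wder i f (G q)) * gm (wder s (gcomp G i)).
Proof.
move=> sf; have [V [pV kf]] := sf.
have [U1 [pU1 kG UV]] := Sm_map_open sG pV; have [oV _] := pV; have [oU1 _] := pU1.
have sfi i : Sm (fun q => wder i f (G q)) by exact: (Sm_comp sG (Sm_wder i sf)).
have sg i : Sm (wder s (gcomp G i)) by exact: (Sm_wder s (Sm_gcomp i)).
transitivity (gm (fun q => \sum_i wder i f (G q) * wder s (gcomp G i) q)).
  apply/gm_eq; [exact: (Sm_wder s (Sm_comp sG sf))|by apply: Sm_sum => i _; apply: SmM|].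
  exists U1; split=> // q Uq _.
  exact: (wder_comp s oU1 oV (kf 1%N) (fun j => kG j 1%N) Uq (UV q Uq)).
rewrite gm_sum => [|i _]; last exact: SmM.
by apply: eq_bigr => i _; rewrite (gmM M (sfi i) (sg i)).
Qed.

Lemma tT_pull t x : tT t (gpull M (G := G) x) =
  \sum_i gpull M (gW i x) * tT t (map_germ i).
Proof.
have [f sf ->] := gm_surj x.
rewrite (gpull_gm M sG sf) (tT_gm_wder t (Sm_comp sG sf)) !(wder_gcomp _ sf).
rewrite mulr_sumr -sumrB; apply: eq_bigr => i _.
rewrite (gW_gm i sf) (gpull_gm M sG (Sm_wder i sf)) map_germE (tT_gm_wder t (Sm_gcomp i)).
by rewrite mulrBr mulrCA.
Qed.

End Chain.

Definition vcoef (X : vfield N) (s : 'I_N + 'I_N) (q : 'rV[C]_N) : C :=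
  match s with inl j => (X q).1 0 j | inr j => (X q).2 0 j end.

Lemma vact_vcoef X f q : vact (X q) f q = vop (vcoef X) f q.
Proof. by rewrite /vact /vop big_sumType /= big_split. Qed.

Lemma smooth_vfield_Sm (V : set 'rV[C]_N) X s : open_nbhd p0 V -> smooth_vfield V X ->
  Sm (vcoef X s).
Proof.
by move=> pV [s1 s2]; exists V; split=> //; apply/smooth_onP; case: s => j; [exact: s1|exact: s2].
Qed.

Lemma ctangent_defining q V rho1 X : defining M q V rho1 -> M q -> ctangent M q (X q) ->
  \sum_s vcoef X s q * wder s (toC rho1) q = 0.
Proof.
move=> D1 Mq [V2 [rho2 [D2 v0]]]; rewrite vact_vcoef in v0.
have [[oV Vq] _ _ MV] := D1.
apply: (tangent_vanish D2 Mq v0); first by exists V; split; [|exact: defining_smk D1].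
by exists V; split=> // q' Vq' /(MV _ Vq') H; rewrite /toC H.
Qed.

Lemma field_tangent (V : set 'rV[C]_N) X : open_nbhd p0 V -> smooth_vfield V X ->
  (forall q, M q -> V q -> ctangent M q (X q)) -> tangent_to (vcoef X).
Proof.
move=> pV sX tX; split=> [s|]; first exact: smooth_vfield_Sm sX.
have pU : open_nbhd p0 U by case: D.
exists (V `&` U); split; first exact: open_nbhdI.
move=> q [Vq Uq] Mq; apply: (ctangent_defining (defining_at D Uq) Mq).
exact: tX.
Qed.

Lemma gop_expansion a : tangent_to a -> tangent_expansion tP tL gZ gZb (gop (M := M) (p0 := p0) a).
Proof.
move=> ta; split; first exact: (gop_derivation (tangent_good D Mp0 ta)).
move=> x; rewrite (tangent_expand D Mp0 rm0 x ta) big_sumType /=; congr (_ + _);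
  by apply: eq_bigr => k _; rewrite ?(gop_gZ D Mp0 k ta) ?(gop_gZb D Mp0 k ta).
Qed.

Lemma gmT_vop a f : (forall s, Sm (a s)) -> Sm f ->
  gmT (vop a f) = field_op (@gW R N p0) (fun s => gmT (a s)) (gmT f).
Proof.
move=> sa sf; rewrite /vop gm_sum => [|s _]; last exact: (SmM (sa s) (Sm_wder s sf)).
by apply: eq_bigr => s _; rewrite (gmM setT (sa s) (Sm_wder s sf)) (gW_gm s sf).
Qed.

Lemma vcoef_bracket X Y s q : vcoef (bracket X Y) s q =
  vop (vcoef X) (vcoef Y s) q - vop (vcoef Y) (vcoef X s) q.
Proof. by case: s => j; rewrite /= mxE /vfapp !vact_vcoef. Qed.

(** The coefficients of a bracket involve derivatives off M, so the identity is first proved for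
    ambient germs, where the Wirtinger derivatives commute. *)
Lemma bracket_vop X Y f : (forall s, Sm (vcoef X s)) -> (forall s, Sm (vcoef Y s)) -> Sm f ->
  gm (vop (vcoef (bracket X Y)) f) =
  gm (vop (vcoef X) (vop (vcoef Y) f)) - gm (vop (vcoef Y) (vop (vcoef X) f)).
Proof.
move=> sX sY sf.
have sXY s : Sm (vcoef (bracket X Y) s).
  have -> : vcoef (bracket X Y) s = fun q => vop (vcoef X) (vcoef Y s) q - vop (vcoef Y) (vcoef X s) q.
    by apply/funext => q; rewrite vcoef_bracket.
  exact: (SmB (Sm_vop sX (sY s)) (Sm_vop sY (sX s))).
have s1 := Sm_vop sX (Sm_vop sY sf); have s2 := Sm_vop sY (Sm_vop sX sf).
rewrite -(gmB M s1 s2); apply/gm_eq; [exact: (Sm_vop sXY sf)|exact: (SmB s1 s2)|].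
apply: eqM_setT; apply/(gm_eq setT); [exact: (Sm_vop sXY sf)|exact: (SmB s1 s2)|].
rewrite (gmB setT s1 s2) (gmT_vop sX (Sm_vop sY sf)) (gmT_vop sY (Sm_vop sX sf)).
rewrite (gmT_vop sX sf) (gmT_vop sY sf).
rewrite (field_op_bracket (fun s => gop_derivation (unit_good p0 s)) (@gWC R N p0)).
rewrite (gmT_vop sXY sf); apply: eq_bigr => s _; congr (_ * _).
rewrite -(gmT_vop sX (sY s)) -(gmT_vop sY (sX s)) -(gmB setT (Sm_vop sX (sY s)) (Sm_vop sY (sX s))).
by congr gmT; apply/funext => q; rewrite vcoef_bracket.
Qed.

(** The germ of rho along M is zero, so X Y - Y X sends it to zero as well. *)
Lemma bracket_tangent X Y : tangent_to (vcoef X) -> tangent_to (vcoef Y) ->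
  tangent_to (vcoef (bracket X Y)).
Proof.
move=> tX tY; have [sX _] := tX; have [sY _] := tY.
have sXY s : Sm (vcoef (bracket X Y) s).
  have -> : vcoef (bracket X Y) s = fun q => vop (vcoef X) (vcoef Y s) q - vop (vcoef Y) (vcoef X s) q.
    by apply/funext => q; rewrite vcoef_bracket.
  exact: (SmB (Sm_vop sX (sY s)) (Sm_vop sY (sX s))).
split=> //; have sr := Sm_rho D.
have rho0 : gm (toC rho) = 0.
  rewrite -(rmorph0 (gcst M p0)); apply/gm_eq; [exact: sr|exact: Sm_cst|].
  have [pU _ _ MU] := D; exists U; split=> // q Uq Mq0.
  have Mq : M q by case: Mq0 => [//|->].
  by rewrite /toC; have /(MU _ Uq) -> := Mq.
have gX := tangent_good D Mp0 tX; have gY := tangent_good D Mp0 tY.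
have : gm (vop (vcoef (bracket X Y)) (toC rho)) = gm (fun=> 0).
  rewrite (bracket_vop sX sY sr) -(gopE gX (Sm_vop sY sr)) -(gopE gY (Sm_vop sX sr)).
  rewrite -(gopE gY sr) -(gopE gX sr) rho0.
  have zX := derivation0 (gop_derivation gX); have zY := derivation0 (gop_derivation gY).
  rewrite zX zY zX subrr; exact: (esym (rmorph0 (gcst M p0))).
move/(gm_eq M (Sm_vop sXY sr) (Sm_cst p0 0)) => [V [pV V0]].
by exists V; split=> // q Vq Mq; apply: V0 => //; left.
Qed.

Hypothesis deg : segre_degenerate ev m tL tLb gZ.

(** For CR fields all X(Z_k) vanish on M; for conjugate CR fields theta(X) is X(rho) up to a factor,
    hence zero on M. [theta_bracket] handles the brackets. *)
Lemma commutator_null V X : open_nbhd p0 V -> CR_commutator M V X -> tangent_to (vcoef X) /\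
  segre_null ev tL tLb (theta lam gZ (gop (M := M) (p0 := p0) (vcoef X))).
Proof.
move=> pV.
have null0 : segre_null ev tL tLb 0.
  by move=> a g; rewrite !word0 ?rmorph0 //; [exact: tL_deriv|exact: tLb_deriv].
have sl k : Sm (fun q => - (r (inl k) q / r (inl m) q)).
  by apply: SmN; apply: SmM; [exact: (Sm_r D _)|apply: SmV; [exact: rm0|exact: (Sm_r D _)]].
elim=> [{}X [sX H]|{}X [sX H]|{}X Y _ [tX nX] _ [tY nY]].
- have tX : tangent_to (vcoef X) by apply: (field_tangent pV sX) => q Mq /(H q Mq)[].
  split=> //; rewrite (_ : theta _ _ _ = 0) //; apply: big1 => k _.
  rewrite (gop_gZ D Mp0 k tX) (_ : gm _ = 0) ?mulr0 //.
  have [sX' _] := tX; rewrite -(rmorph0 (gcst M p0)).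
  apply/gm_eq; [exact: sX'|exact: Sm_cst|].
  exists V; split=> // q Vq Mq0; have Mq : M q by case: Mq0 => [//|->].
  by have [E _] := H q Mq Vq; rewrite /vcoef E mxE.
- have tX : tangent_to (vcoef X) by apply: (field_tangent pV sX) => q Mq /(H q Mq)[].
  split=> //; rewrite (_ : theta _ _ _ = 0) //.
  have [sX' [V1 [pV1 V10]]] := tX.
  transitivity (gm (fun q => \sum_k - (r (inl k) q / r (inl m) q) * vcoef X (inl k) q)).
    rewrite gm_sum => [|k _]; last exact: (SmM (sl k) (sX' _)).
    by apply: eq_bigr => k _; rewrite (gop_gZ D Mp0 k tX) -(gmM M (sl k) (sX' _)).
  rewrite -(rmorph0 (gcst M p0)); apply/gm_eq; [|exact: Sm_cst|].
    by apply: Sm_sum => k _; exact: (SmM (sl k) (sX' _)).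
  exists (V `&` V1); split; first exact: open_nbhdI.
  move=> q [Vq V1q] Mq0; have Mq : M q by case: Mq0 => [//|->].
  have [E _] := H q Mq Vq; have := V10 q V1q Mq; rewrite big_sumType /=.
  rewrite [X in _ + X]big1 ?addr0 => [e|k _]; last by rewrite /vcoef E mxE mul0r.
  transitivity (- (r (inl m) q)^-1 * \sum_k vcoef X (inl k) q * wder (inl k) (toC rho) q).
    have gen (a b v : C) : - (a / b) * v = - b^-1 * (v * a) by ring.
    by rewrite mulr_sumr; apply: eq_bigr => k _; exact: gen.
  by rewrite e mulr0.
split; first exact: bracket_tangent.
have [sX _] := tX; have [sY _] := tY.
rewrite (_ : theta _ _ _ = theta lam gZ (fun x =>
  gop (M := M) (p0 := p0) (vcoef X) (gop (vcoef Y) x) - gop (vcoef Y) (gop (vcoef X) x))).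
  apply: (theta_bracket (Zb := gZb) tP_deriv tL_deriv tLb_deriv tPP tLL tPL tLbLb (tLbE D Mp0 rm0) tP_gZ
    tL_gZ deg (gop_expansion tX) (gop_expansion tY) nX nY).
apply: eq_bigr => k _; congr (_ * _).
rewrite (gop_gZ D Mp0 k (bracket_tangent tX tY)) (gop_gZ D Mp0 k tX) (gop_gZ D Mp0 k tY).
rewrite (gopE (tangent_good D Mp0 tX) (sY _)) (gopE (tangent_good D Mp0 tY) (sX _)).
rewrite -(gmB M (Sm_vop sX (sY _)) (Sm_vop sY (sX _))); congr gm.
by apply/funext => q; rewrite vcoef_bracket.
Qed.

End FrameLaws.

Section FiniteType.
Context {R : realType}.
Local Notation C := R[i].
Variables (N : nat) (M : set 'rV[C]_N) (p0 : 'rV[C]_N).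
Variables (U : set 'rV[C]_N) (rho : 'rV[C]_N -> R) (m : 'I_N).
Hypothesis D : defining M p0 U rho.
Hypothesis Mp0 : M p0.
Hypothesis rm0 : wder (inl m) (toC rho) p0 != 0.

Lemma finite_type_segre : finite_type M p0 -> ~ segre_degenerate (@gev R N M p0) m
  (@tL R N M p0 rho m) (@tLb R N M p0 rho m) (@gZ R N M p0).
Proof.
move=> [V pV H] deg.
pose x k := - (wder (inl k) (toC rho) p0 / wder (inl m) (toC rho) p0).
(* The value of P_m at p0: it is tangent to M, but theta takes the value [lam m] = -1 on it. *)
pose v : cvect N := (baseC m, (- (wder (inl m) (toC rho) p0 / wder (inr m) (toC rho) p0)) *: baseC m).
have tv : ctangent M p0 v.
  exists U, rho; split=> //; rewrite /vact (bigD1 m) //= big1 ?addr0 => [|j /negbTE jm].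
    rewrite !mxE !eqxx mulr1 mul1r mulNr -[dZ m _ _]/(wder (inl m) (toC rho) p0).
    by rewrite -[dZb m _ _]/(wder (inr m) (toC rho) p0) divfK ?subrr //; exact: (rmb0 D rm0).
  by rewrite !mxE eqxx jm mulr0 !mul0r addr0.
have [n [X [c [cX vE]]]] := H v tv.
have x0 i : \sum_k x k * (X i p0).1 0 k = 0.
  have [tX nX] := commutator_null D Mp0 rm0 deg pV (cX i).
  apply: (etrans _ (nX [::] [::])); rewrite [RHS]rmorph_sum; apply: eq_bigr => k _.
  rewrite rmorphM (gop_gZ D Mp0 k tX) /= gev_gm; last by case: tX.
  congr (_ * _); rewrite gev_gm //; apply: SmN; apply: SmM; first exact: (Sm_r D _).
  by apply: SmV; [exact: rm0|exact: (Sm_r D _)].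
have : \sum_k x k * v.1 0 k = 0.
  have E1 k : v.1 0 k = \sum_i c i * (X i p0).1 0 k.
    rewrite vE; elim/big_rec2: _ => [|i y1 y2 _ <-]; rewrite ?mxE //.
  under eq_bigr do rewrite E1 mulr_sumr.
  rewrite exchange_big /= big1 // => i _.
  transitivity (c i * \sum_k x k * (X i p0).1 0 k); last by rewrite x0 mulr0.
  by rewrite mulr_sumr; apply: eq_bigr => k _; rewrite mulrCA.
rewrite (bigD1 m) //= big1 ?addr0 => [|j /negbTE jm]; last by rewrite !mxE eqxx jm mulr0.
by rewrite !mxE !eqxx mulr1 /x divff // => /eqP; rewrite oppr_eq0 oner_eq0.
Qed.

End FiniteType.

(** * Degeneracy data *)

Section Multiindices.
Variable n : nat.

Lemma mem_mindices d (a : mindex n) : (a \in mindices n d) = (mdeg a <= d)%N.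
Proof.
rewrite mem_filter; case: leqP => // ad /=; apply/mapP.
have ai i : (a i < d.+1)%N.
  by rewrite ltnS (leq_trans _ ad) // /mdeg (bigD1 i) //= leq_addr.
exists [ffun i => Ordinal (ai i)]; first by rewrite mem_enum.
by apply/ffunP => i; rewrite !ffunE.
Qed.

Lemma uniq_mindices d : uniq (mindices n d).
Proof.
apply: filter_uniq.
apply/(injectiveP (fun b : {ffun 'I_n -> 'I_d.+1} => [ffun i => val (b i)] : mindex n)) => f g fg.
by apply/ffunP => i; apply: val_inj; have := congr1 (fun h : mindex n => h i) fg; rewrite !ffunE.
Qed.

End Multiindices.

(** * Change of CR basis and normal ordering of derivatives *)

Section Generated.
Variables (A : comNzRingType) (J : Type).

Definition generated (I : eqType) (X : I -> A -> A) (phi : J -> A) k (v : J -> A) : Prop :=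
  exists2 s : seq (A * seq I), all (fun x => (size x.2 <= k)%N) s &
    forall j, v j = \sum_(x <- s) x.1 * word X x.2 (phi j).

Section One.
Variables (I : finType) (X : I -> A -> A) (phi : J -> A).
Hypothesis dX : forall i, derivation (X i).
Implicit Types v u : J -> A.
Local Notation gen := (generated X phi).

Lemma generated_ext k v u : v =1 u -> gen k v -> gen k u.
Proof. by move=> vu [s sk E]; exists s => // j; rewrite -vu. Qed.

Lemma generated0 k : gen k (fun=> 0).
Proof. by exists [::] => // j; rewrite big_nil. Qed.

Lemma generatedD k v u : gen k v -> gen k u -> gen k (fun j => v j + u j).
Proof.
move=> [s sk E] [s' sk' E']; exists (s ++ s'); first by rewrite all_cat sk.
by move=> j; rewrite big_cat /= E E'.
Qed.

Lemma generatedZ k a v : gen k v -> gen k (fun j => a * v j).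
Proof.
move=> [s sk E]; exists [seq (a * x.1, x.2) | x <- s]; first by rewrite all_map.
by move=> j; rewrite big_map E mulr_sumr; apply: eq_bigr => x _; rewrite mulrA.
Qed.

Lemma generated_sum k (T : Type) (r : seq T) (P : pred T) (v : T -> J -> A) :
  (forall t, P t -> gen k (v t)) -> gen k (fun j => \sum_(t <- r | P t) v t j).
Proof.
move=> H; elim: r => [|t r IH].
  by apply: generated_ext (generated0 k) => j; rewrite big_nil.
case Pt : (P t); last by apply: generated_ext IH => j; rewrite big_cons Pt.
by apply: generated_ext (generatedD (H t Pt) IH) => j; rewrite big_cons Pt.
Qed.

Lemma generated_le k k' v : (k <= k')%N -> gen k v -> gen k' v.
Proof.
move=> kk [s sk E]; exists s => //; apply: sub_all sk => x xk; exact: leq_trans kk.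
Qed.

Lemma generated_word w : gen (size w) (fun j => word X w (phi j)).
Proof.
by exists [:: (1, w)]; rewrite /= ?leqnn // => j; rewrite big_seq1 mul1r.
Qed.

Lemma generated_deriv k i v : gen k v -> gen k.+1 (fun j => X i (v j)).
Proof.
move=> [s sk E].
pose u (x : A * seq I) j := X i x.1 * word X x.2 (phi j) + x.1 * word X (i :: x.2) (phi j).
suff H : gen k.+1 (fun j => \sum_(x <- s) u x j).
  apply: generated_ext H => j; rewrite E derivation_sum //.
  by apply: eq_bigr => x _; rewrite (dX i).2.
elim: s sk {E v} => [|x s IH] /=.
  by move=> _; apply: generated_ext (generated0 _) => j; rewrite big_nil.
move=> /andP[xk /IH H]; apply: (generated_ext (v := fun j => u x j + \sum_(y <- s) u y j)).
  by move=> j; rewrite big_cons.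
apply: generatedD H; apply: generatedD; apply: generatedZ.
  by apply: generated_le (generated_word _); exact: leqW.
exact: (generated_le (k := (size x.2).+1) _ (generated_word (i :: x.2))).
Qed.

End One.

(** Expanding each field and differentiating the coefficients by the Leibniz rule only produces
    words that are no longer than the given one; the same holds for the scalar factor u. *)
Lemma generated_change (I I' : finType) (X : I -> A -> A) (Y : I' -> A -> A)
    (c : I -> I' -> A) (phi psi : J -> A) (u : A) k v :
  (forall i, derivation (Y i)) -> (forall i x, X i x = \sum_l c i l * Y l x) ->
  (forall j, phi j = u * psi j) -> generated X phi k v -> generated Y psi k v.
Proof.
move=> dY XY phE [s sk E].
suff W w : generated Y psi (size w) (fun j => word X w (phi j)).
  elim: s sk v E => [|x s IH] /= sk v E.
    by apply: generated_ext (generated0 _ _ _) => j; rewrite E big_nil.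
  case/andP: sk => xk /IH H; have {}H := H _ (fun j => erefl).
  apply: (generated_ext (v := fun j => x.1 * word X x.2 (phi j) +
      \sum_(y <- s) y.1 * word X y.2 (phi j))); first by move=> j; rewrite E big_cons.
  exact: (generatedD (generatedZ x.1 (generated_le xk (W x.2))) H).
elim: w => [|i w IH] /=.
  by apply: generated_ext (generatedZ u (generated_word Y psi [::])) => j; rewrite phE.
apply: (generated_ext (v := fun j => \sum_l c i l * Y l (word X w (phi j)))).
  by move=> j; rewrite XY.
by apply: generated_sum => l _; apply/generatedZ/generated_deriv.
Qed.

Section Involutive.
Variables (n : nat) (Q : 'I_n -> A -> A) (phi : J -> A) (c : 'I_n -> 'I_n -> 'I_n -> A).
Hypothesis dQ : forall i, derivation (Q i).
Hypothesis QQ : forall i j x, Q i (Q j x) - Q j (Q i x) = \sum_l c i j l * Q l x.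
Local Notation gen := (generated Q phi).
Local Notation qw w := (fun j => word Q w (phi j)).

Lemma word_insert u i v : gen (size u + size v)
  (fun j => word Q (u ++ i :: v) (phi j) - word Q (i :: u ++ v) (phi j)).
Proof.
elim: u => [|a u IH] /=.
  by apply: generated_ext (generated0 _ _ _) => j; rewrite subrr.
apply: (generated_ext (v := fun j =>
    Q a (word Q (u ++ i :: v) (phi j) - word Q (i :: u ++ v) (phi j)) +
    \sum_l c a i l * word Q (l :: u ++ v) (phi j))).
  by move=> j; rewrite derivationB //= -QQ addrA subrK.
apply: generatedD; first exact: generated_deriv.
apply: generated_sum => l _; apply: generatedZ.
by apply: generated_le (generated_word _ _ _); rewrite /= size_cat.
Qed.

(** Exchanging two neighbouring fields costs a commutator, which is again a combination of the
    fields and therefore shortens the word by one letter. *)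
Lemma word_perm_generated w w' : perm_eq w w' ->
  gen (size w).-1 (fun j => word Q w (phi j) - word Q w' (phi j)).
Proof.
elim: w w' => [|i w IH] w' pw.
  have /size0nil -> : size w' = 0%N by rewrite -(perm_size pw).
  by apply: generated_ext (generated0 _ _ _) => j; rewrite subrr.
have iw : i \in w' by rewrite -(perm_mem pw) mem_head.
case/splitPr: iw pw => u v pw.
have {}pw : perm_eq w (u ++ v).
  by rewrite -(perm_cons i) (permPl pw) perm_sym -cat1s perm_catCA.
have sz : size w = (size u + size v)%N by rewrite (perm_size pw) size_cat.
apply: (generated_ext (v := fun j => Q i (word Q w (phi j) - word Q (u ++ v) (phi j)) +
   -1 * (word Q (u ++ i :: v) (phi j) - word Q (i :: u ++ v) (phi j)))).
  by move=> j; rewrite derivationB //= mulN1r opprB addrA subrK.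
apply: generatedD; last by apply: generatedZ; rewrite /= sz; exact: word_insert.
case: w IH pw sz => [|a w] IH pw sz.
  have /size0nil -> : size (u ++ v) = 0%N by rewrite -(perm_size pw).
  by apply: generated_ext (generated0 _ _ _) => j; rewrite subrr derivation0.
exact: generated_deriv (IH _ pw).
Qed.

Definition normal_word (a : mindex n) : seq 'I_n := flatten [seq nseq (a i) i | i <- enum 'I_n].

Lemma word_normal a x : word Q (normal_word a) x = miter Q a x.
Proof.
rewrite /normal_word /miter; elim: (enum 'I_n) => //= i s <-.
by rewrite word_cat; elim: (a i) => //= k ->.
Qed.

Lemma count_normal a j : count_mem j (normal_word a) = a j.
Proof.
rewrite /normal_word count_flatten -map_comp sumnE big_map big_enum /=.
rewrite (bigD1 j) //= big1 ?addn0 ?count_nseq /= ?eqxx ?mul1n // => i ij.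
by rewrite count_nseq /= (negbTE ij).
Qed.

Lemma size_normal a : size (normal_word a) = mdeg a.
Proof.
rewrite /normal_word size_flatten /shape -map_comp sumnE big_map big_enum /=.
by apply: eq_bigr => i _; rewrite /= size_nseq.
Qed.

(** [Espace] admits only the monomials L^alpha with factors in a fixed order, while a change of
    basis produces all words. As in the Poincare-Birkhoff-Witt theorem, reordering costs shorter
    words, which are treated by induction. *)
Lemma generated_normal k v : gen k v -> exists b : mindex n -> A,
  forall j, v j = \sum_(a <- mindices n k) b a * miter Q a (phi j).
Proof.
pose nrm k v := exists2 s : seq (A * mindex n), all (fun x => (mdeg x.2 <= k)%N) s &
  forall j, v j = \sum_(x <- s) x.1 * miter Q x.2 (phi j).
have nrmD k1 v1 v2 : nrm k1 v1 -> nrm k1 v2 -> nrm k1 (fun j => v1 j + v2 j).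
  move=> [s sk E] [s' sk' E']; exists (s ++ s'); first by rewrite all_cat sk.
  by move=> j; rewrite big_cat /= E E'.
have nrmZ k1 a v1 : nrm k1 v1 -> nrm k1 (fun j => a * v1 j).
  move=> [s sk E]; exists [seq (a * x.1, x.2) | x <- s]; first by rewrite all_map.
  by move=> j; rewrite big_map E mulr_sumr; apply: eq_bigr => x _; rewrite mulrA.
have nrm_le k1 k2 v1 : (k1 <= k2)%N -> nrm k1 v1 -> nrm k2 v1.
  by move=> kk [s sk E]; exists s => //; apply: sub_all sk => x xk; exact: leq_trans kk.
have nrm_gen k1 : forall v1, (forall w, (size w <= k1)%N -> nrm k1 (qw w)) -> gen k1 v1 -> nrm k1 v1.
  move=> v1 H [s + E]; elim: s v1 E => [|x s IH] v1 E /=.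
    by move=> _; exists [::] => // j; rewrite E !big_nil.
  case/andP=> xk /(IH _ (fun j => erefl)) H1.
  have [s' sk' E'] := nrmD _ _ _ (nrmZ _ x.1 _ (H _ xk)) H1.
  by exists s' => // j; rewrite E big_cons E'.
have words k1 : forall w, (size w <= k1)%N -> nrm k1 (qw w).
  elim: k1 => [|k1 IH] w wk.
    have {wk} -> : w = [::] by case: w wk.
    exists [:: (1, [ffun=> 0%N])]; first by rewrite /= /mdeg big1 // => i _; rewrite ffunE.
    move=> j; rewrite big_seq1 mul1r -word_normal.
    suff -> : normal_word [ffun=> 0%N] = [::] by [].
    by apply: size0nil; rewrite size_normal /mdeg big1 // => i _; rewrite ffunE.
  move: wk; rewrite leq_eqVlt => /orP[/eqP wk|]; last first.
    by rewrite ltnS => /IH; apply: nrm_le.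
  pose a : mindex n := [ffun i => count_mem i w].
  have pw : perm_eq w (normal_word a).
    by apply/allP => i _ /=; rewrite count_normal ffunE.
  have Ha : nrm k1.+1 (fun j => word Q (normal_word a) (phi j)).
    exists [:: (1, a)] => /=; first by rewrite -size_normal -(perm_size pw) wk leqnn.
    by move=> j; rewrite big_seq1 mul1r word_normal.
  have := word_perm_generated pw; rewrite wk /= => /(nrm_gen _ _ IH)/(nrm_le _ k1.+1 _ (leqnSn _)).
  move=> /(nrmD _ _ _ Ha)[s sk E]; exists s => // j; rewrite -E addrC subrK //.
move=> /(nrm_gen _ _ (words k))[s sk E].
exists (fun a => \sum_(x <- s | x.2 == a) x.1) => j; rewrite E.
under [RHS]eq_bigr do rewrite mulr_suml.
rewrite (exchange_big_dep predT) //= big_seq [RHS]big_seq; apply: eq_bigr => x xs.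
rewrite (eq_bigr (fun=> x.1 * miter Q x.2 (phi j))) => [|a /eqP -> //].
rewrite -big_filter (_ : [seq a <- mindices n k | x.2 == a] = [:: x.2]) ?big_seq1 //.
have u := uniq_mindices n k.
have xm : x.2 \in mindices n k by rewrite mem_mindices; have /allP/(_ _ xs) := sk.
apply: perm_small_eq => //; apply: uniq_perm => [||a]; [exact: filter_uniq|by []|].
by rewrite mem_filter inE eq_sym; case: eqVneq => // ->; rewrite xm.
Qed.

End Involutive.

End Generated.

Section RankDim.
Variables (K : fieldType) (n : nat).

Lemma rank_le_dim (V : {vspace 'rV[K]_n}) k (X : 'M[K]_(k, n)) :
  (forall i, row i X \in V) -> (\rank X <= \dim V)%N.
Proof.
move=> XV; pose e := vbasis V.
have -> : X = (\matrix_(i, j) coord e j (row i X)) *m (\matrix_(j < \dim V) e`_j).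
  apply/row_matrixP => i; rewrite row_mul mulmx_sum_row [LHS](coord_vbasis (XV i)).
  by apply: eq_bigr => j _; rewrite !rowK !mxE.
by rewrite (leq_trans (mulmx_max_rank _ _)).
Qed.

Lemma dim_le_rank (s : seq 'rV[K]_n) k (X : 'M[K]_(k, n)) :
  (forall v, v \in s -> (v <= X)%MS) -> (\dim << s >>%VS <= \rank X)%N.
Proof.
move=> sX; set V := << s >>%VS; pose e := vbasis V.
have VX v : v \in V -> (v <= X)%MS.
  move=> vV; have -> := coord_span (X := in_tuple s) vV.
  apply: summx_sub => i _; apply: scalemx_sub; apply: sX; exact: mem_nth.
pose E := \matrix_(j < \dim V) e`_j.
have EX : (E <= X)%MS.
  apply/row_subP => j; rewrite rowK; apply: VX.
  by apply: vbasis_mem; rewrite mem_nth // size_tuple.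
have Ef : row_free E.
  apply/row_freeP; exists (\matrix_(i, j) coord e j (delta_mx 0 i)).
  apply/row_matrixP => i; rewrite row_mul rowK row1; apply/rowP => j.
  have := @coord_free _ _ _ e i j (basis_free (vbasisP V)).
  rewrite {1}[e`_i]row_sum_delta linear_sum => ce.
  rewrite !mxE eqxx /= [j == i]eq_sym -ce.
  by apply: eq_bigr => k0 _; rewrite linearZ mxE.
by rewrite -(eqP Ef) mxrankS.
Qed.

End RankDim.

(** * Dimensions of the spaces E'_k *)

Section Degeneracy.
Context {R : realType}.
Local Notation C := R[i].
Variables (N N' : nat) (G : 'rV[C]_N -> 'rV[C]_N') (rho' : 'rV[C]_N' -> R).
Variable L : 'I_N.-1 -> @vfield R N.

Lemma dim_rV n (V : {vspace 'rV[C]_n}) : (\dim V <= n)%N.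
Proof. by have := dimvS (subvf V); rewrite dimvf /dim /= mul1n. Qed.

Let maxdim p := \max_(d < N'.+1 | `[< exists k, \dim (Espace G rho' L k p) = d >]) d.

Lemma maxdim_le p : (maxdim p <= N')%N.
Proof. by apply/bigmax_leqP => d _; rewrite -ltnS. Qed.

Lemma dim_Espace_le k p : (\dim (Espace G rho' L k p) <= N' - degeneracy G rho' L p)%N.
Proof.
rewrite /degeneracy subKn; last exact: maxdim_le.
have dk : (\dim (Espace G rho' L k p) < N'.+1)%N by rewrite ltnS dim_rV.
rewrite -[X in (X <= _)%N]/(val (Ordinal dk)).
by apply: (leq_bigmax_cond (F := fun d : 'I_N'.+1 => val d)); apply/asboolP; exists k.
Qed.

Lemma Espace_le k k' p : (k <= k')%N -> (Espace G rho' L k p <= Espace G rho' L k' p)%VS.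
Proof.
move=> kk; apply: sub_span => v /mapP[a ak ->]; apply: map_f.
by move: ak; rewrite !mem_mindices => /leq_trans; apply.
Qed.

(** The spaces increase with k and are stationary from k0 on, so the one at k0 attains the maximal
    dimension. *)
Lemma dim_Espace_degenerate k0 s p : degenerate_for G rho' L p k0 s ->
  (N' - s <= \dim (Espace G rho' L k0 p))%N.
Proof.
move=> [-> st _]; rewrite /degeneracy subKn; last exact: maxdim_le.
apply/bigmax_leqP => d /asboolP[k <-]; apply: dimvS.
case: (leqP k0 k) => [/st -> //|/ltnW]; exact: Espace_le.
Qed.

End Degeneracy.

Section NearM.
Context {R : realType}.
Local Notation C := R[i].
Variables (N : nat) (M : set 'rV[C]_N) (p0 : 'rV[C]_N).
Local Notation A := (germ M p0).
Local Notation gm := (gm M p0).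
Local Notation Sm := (Sm p0).

Definition nearM (P : 'rV[C]_N -> Prop) : Prop := exists V, open_nbhd p0 V /\
  forall q, V q -> M q -> P q.

Lemma nearM_and P Q : nearM P -> nearM Q -> nearM (fun q => P q /\ Q q).
Proof.
move=> [V [pV PV]] [W [pW QW]]; exists (V `&` W); split; first exact: open_nbhdI.
by move=> q [Vq Wq] Mq; split; [exact: PV|exact: QW].
Qed.

Lemma nearM_imp P Q : (forall q, P q -> Q q) -> nearM P -> nearM Q.
Proof. by move=> PQ [V [pV PV]]; exists V; split=> // q Vq Mq; apply/PQ/PV. Qed.

Lemma nearM_all (I : finType) (P : I -> 'rV[C]_N -> Prop) :
  (forall i, nearM (P i)) -> nearM (fun q => forall i, P i q).
Proof.
move=> H; suff : nearM (fun q => forall i, i \in enum I -> P i q).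
  by apply: nearM_imp => q Hq i; apply: Hq; rewrite mem_enum.
elim: (enum I) => [|i s IH]; first by exists setT; split=> //; split=> //; exact: openT.
apply: nearM_imp (nearM_and (H i) IH) => q [Hi Hs] j.
by rewrite in_cons => /orP[/eqP ->|/Hs].
Qed.

Lemma nearM_rep f : Sm f -> nearM (fun q => grep (gm f) q = f q).
Proof. by move=> /(rep_gm M)[V [pV H]]; exists V; split=> // q Vq Mq; apply: H => //; left. Qed.

Lemma nearM_eq x f : Sm f -> x = gm f -> nearM (fun q => grep x q = f q).
Proof. by move=> sf ->; exact: nearM_rep. Qed.

Lemma gm_sum_mul (I : Type) (s : seq I) (x y : I -> A) :
  \sum_(i <- s) x i * y i = gm (fun q => \sum_(i <- s) grep (x i) q * grep (y i) q).
Proof.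
rewrite gm_sum => [|i _]; last by apply: SmM; exact: grepS.
by apply: eq_bigr => i _; rewrite (gmM M (grepS (x i)) (grepS (y i))) !gm_rep.
Qed.

Lemma nearM_mulmx a b c (X : 'M[A]_(a, b)) (Y : 'M[A]_(b, c)) :
  nearM (fun q => map_mx (fun x : A => grep x q : C) (X *m Y) =
    map_mx (fun x : A => grep x q : C) X *m map_mx (fun x : A => grep x q : C) Y).
Proof.
have H i : nearM (fun q => forall j, grep ((X *m Y) i j) q =
    \sum_k grep (X i k) q * grep (Y k j) q).
  apply: nearM_all => j; apply: nearM_eq; last by rewrite mxE gm_sum_mul.
  by apply: Sm_sum => k _; apply: SmM; exact: grepS.
apply: nearM_imp (nearM_all H) => q Hq; apply/matrixP => i j; rewrite [LHS]mxE Hq [RHS]mxE.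
by apply: eq_bigr => k _; rewrite [X in _ = X * _]mxE [X in _ = _ * X]mxE.
Qed.

Lemma nearM1 n : nearM (fun q => map_mx (fun x : A => grep x q : C) (1%:M : 'M[A]_n) = 1%:M).
Proof.
have H (k : nat) : nearM (fun q => grep (k%:R : A) q = k%:R).
  by apply: nearM_eq (Sm_cst _ _) _; rewrite -(rmorph_nat (gcst M p0)).
apply: nearM_imp (nearM_and (H 0%N) (H 1%N)) => q [q0 q1]; apply/matrixP => i j.
by rewrite !mxE; case: (i == j).
Qed.

End NearM.

Section Gradient.
Context {R : realType}.
Local Notation C := R[i].
Variables (N : nat) (M : set 'rV[C]_N) (q : 'rV[C]_N).
Variables (U1 U2 : set 'rV[C]_N) (rho1 rho2 : 'rV[C]_N -> R) (j : 'I_N).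
Hypothesis D1 : defining M q U1 rho1.
Hypothesis D2 : defining M q U2 rho2.
Hypothesis Mq : M q.
Hypothesis r0 : wder (inl j) (toC rho1) q != 0.

(** The second defining function vanishes on M, so it is killed by the tangent vectors that the
    first one determines. *)
Lemma gradient_ratio s : wder s (toC rho2) q =
  wder (inl j) (toC rho2) q / wder (inl j) (toC rho1) q * wder s (toC rho1) q.
Proof.
pose a t := (t == s)%:R - (t == inl j)%:R * (wder s (toC rho1) q / wder (inl j) (toC rho1) q).
have E f : \sum_t a t * wder t f q = wder s f q -
    wder s (toC rho1) q / wder (inl j) (toC rho1) q * wder (inl j) f q.
  under eq_bigr do rewrite mulrBl -mulrA.
  by rewrite sumrB !sum_delta.
have a1 : \sum_t a t * wder t (toC rho1) q = 0 by rewrite E divfK // subrr.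
have /eqP : \sum_t a t * wder t (toC rho2) q = 0.
  apply: (tangent_vanish D1 Mq a1 (Sm_rho D2)).
  have [pU _ _ MU] := D2; exists U2; split=> // q' Uq' /(MU _ Uq') e; by rewrite /toC e.
have gen (x y z : C) : x / y * z = z / y * x by ring.
by rewrite E subr_eq0 => /eqP ->; exact: gen.
Qed.

Lemma gradient_ratio_neq0 : wder (inl j) (toC rho2) q != 0.
Proof.
apply/eqP => e; have [[_ Uq] _ grad _] := D2; apply: (elimN eqP (grad q Uq)).
apply/rowP => k; rewrite mxE [RHS]mxE -[dZ k _ _]/(wder (inl k) (toC rho2) q).
by rewrite gradient_ratio e mul0r mul0r.
Qed.

End Gradient.

(** * Comparison of an arbitrary CR basis with the frame *)

Section DataFrame.
Context {R : realType}.
Local Notation C := R[i].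
Variables (N N' : nat) (M : set 'rV[C]_N) (M' : set 'rV[C]_N') (p0 : 'rV[C]_N).
Variables (U : set 'rV[C]_N) (rho : 'rV[C]_N -> R) (m : 'I_N).
Hypothesis D : defining M p0 U rho.
Hypothesis Mp0 : M p0.
Let r (s : 'I_N + 'I_N) : 'rV[C]_N -> C := wder s (toC rho).
Hypothesis rm0 : r (inl m) p0 != 0.
Local Notation A := (germ M p0).
Local Notation gm := (gm M p0).
Local Notation Sm := (Sm p0).
Local Notation ev := (@gev R N M p0).
Local Notation tL := (@tL R N M p0 rho m).
Local Notation tP := (@tP R N M p0 rho m).
Local Notation tangent_to := (tangent_to M p0 rho).
Local Notation nearM := (nearM M p0).

Section CRBasis.
Variables (Ud : set 'rV[C]_N) (Ld : 'I_N.-1 -> @vfield R N).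
Hypothesis pUd : open_nbhd p0 Ud.
Hypothesis basis : CR_basis M Ud Ld.

Definition basis_op i : A -> A := gop (vcoef (Ld i)).
Local Notation Q := basis_op.
Definition basis_coef i l : A := gm (vcoef (Ld i) (inr l)).

Lemma basis_tangent i : tangent_to (vcoef (Ld i)).
Proof.
have [/(_ i)[sX H] _] := basis.
by apply: (field_tangent D pUd sX) => q Mq /(H q Mq)[].
Qed.

Lemma basis_deriv i : derivation (Q i).
Proof. exact: (gop_derivation (tangent_good D Mp0 (basis_tangent i))). Qed.

Lemma Sm_basis i s : Sm (vcoef (Ld i) s).
Proof. by have [] := basis_tangent i. Qed.

Lemma basis_expand i x : Q i x = \sum_l basis_coef i l * tL l x.
Proof.
rewrite /basis_op (tangent_expand D Mp0 rm0 x (basis_tangent i)) big_sumType /=.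
rewrite [X in X + _]big1 ?add0r // => k _.
rewrite (_ : gm _ = 0) ?mul0r // -(rmorph0 (gcst M p0)).
apply/gm_eq; [exact: Sm_basis|exact: Sm_cst|].
exists Ud; split=> // q Uq Mq0; have Mq : M q by case: Mq0 => [//|->].
by have [/(_ i)[_ /(_ q Mq Uq)[E _]] _] := basis; rewrite /vcoef E mxE.
Qed.

Lemma tL_m x : tL m x = 0.
Proof.
have [f sf ->] := gm_surj x; apply: (etrans (tT_gm_wder D Mp0 rm0 (inr m) sf)).
have sk := Sm_kappa D rm0 (inr m).
have -> : gm (kappa rho m (inr m)) = 1.
  rewrite -(rmorph1 (gcst M p0)); apply/gm_eq; [exact: sk|exact: Sm_cst|].
  have [V [pV V0]] := bcont_neq0 (Sm_bcont (Sm_r D (inr m))) (rmb0 D rm0).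
  by exists V; split=> // q /V0 q0 _; rewrite /kappa divff.
by rewrite mul1r subrr.
Qed.

(** Tangency determines the coefficient at index m of a CR vector from the other ones. Hence the
    coefficient matrix of the basis stays invertible at p0 when column m is deleted, while [tL m] is
    zero. *)
Lemma basis_invert : exists b : 'I_N -> 'I_N.-1 -> A,
  forall l x, tL l x = \sum_i b l i * Q i x.
Proof.
pose Am : 'M[A]_(N.-1, N) := \matrix_(i, l) basis_coef i l.
have evE i l : ev (Am i l) = (Ld i p0).2 0 l.
  by rewrite mxE gev_gm //; exact: Sm_basis.
have [Minv [Minv1 Minv2]] : exists Y, col' m Am *m Y = 1%:M /\ Y *m col' m Am = 1%:M.
  apply: (local_invmx (ev := @gev R N M p0)); first exact: gm_local.
  have [_ /(_ p0 Mp0 pUd.2) rf] := basis.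
  rewrite -row_free_unit -kermx_eq0; apply/eqP/row_matrixP => i; rewrite row0.
  set x := row i _.
  have x0 : x *m map_mx ev (col' m Am) = 0.
    by apply/sub_kermxP; rewrite row_sub.
  have tan k : \sum_l (Ld k p0).2 0 l * r (inr l) p0 = 0.
    have [/(_ k)[_ /(_ p0 Mp0 pUd.2)[E ct]] _] := basis.
    have := ctangent_defining D Mp0 ct; rewrite big_sumType /= [X in X + _]big1 ?add0r //.
    by move=> l _; rewrite /vcoef E mxE mul0r.
  pose X := \matrix_(i < N.-1) (Ld i p0).2.
  have y0 l : l != m -> (x *m X) 0 l = 0.
    case: (unliftP m l) => [l' -> _|->]; last by rewrite eqxx.
    have := congr1 (fun M : 'rV_N.-1 => M 0 l') x0; rewrite [LHS]mxE [RHS]mxE => e.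
    rewrite mxE; apply: etrans e; apply: eq_bigr => k _; congr (_ * _).
    have -> : map_mx ev (col' m Am) k l' = ev (Am k (lift m l')) by rewrite mxE; congr ev; rewrite mxE.
    by rewrite evE mxE.
  have ym : (x *m X) 0 m = 0.
    have : \sum_l (x *m X) 0 l * r (inr l) p0 = 0.
      under eq_bigr do rewrite mxE mulr_suml.
      rewrite exchange_big /= big1 // => k _.
      transitivity (x 0 k * \sum_l (Ld k p0).2 0 l * r (inr l) p0).
        by rewrite mulr_sumr; apply: eq_bigr => l _; rewrite -mulrA; congr (_ * (_ * _)); rewrite mxE.
      by rewrite tan mulr0.
    rewrite (bigD1 m) //= big1 ?addr0 => [|l /y0 ->]; last by rewrite mul0r.
    by move/eqP; rewrite mulf_eq0 => /orP[/eqP //|]; rewrite (negbTE (rmb0 D rm0)).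
  apply: (row_free_inj rf); rewrite mul0mx; apply/rowP => l; rewrite [RHS]mxE.
  by case: (eqVneq l m) => [->|/y0].
have colE' i l : col' m Am i l = basis_coef i (lift m l) by rewrite mxE mxE.
exists (fun l i => if unlift m l is Some l' then Minv l' i else 0) => l x.
case: (unliftP m l) => [l' ->|->]; last first.
  by rewrite tL_m big1 // => i _; rewrite mul0r.
transitivity (\sum_l0 \sum_i Minv l' i * basis_coef i l0 * tL l0 x); last first.
  rewrite exchange_big /=; apply: eq_bigr => i _; rewrite basis_expand mulr_sumr.
  by apply: eq_bigr => l0 _; rewrite mulrA.
rewrite (bigD1 (lift m l')) //= [X in X + _](_ : _ = tL (lift m l') x).
  rewrite big1 ?addr0 // => l0 l0n; rewrite -mulr_suml.
  case: (unliftP m l0) l0n => [l1 -> l1n|-> _]; last by rewrite tL_m mulr0.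
  have := congr1 (fun Y : 'M[A]_(N.-1, N.-1) => Y l' l1) Minv2; rewrite [LHS]mxE [RHS]mxE.
  under eq_bigr do rewrite colE'.
  by move=> ->; rewrite (_ : (l' == l1) = false) ?mul0r //; apply/eqP => e; rewrite e eqxx in l1n.
rewrite -mulr_suml; have := congr1 (fun Y : 'M[A]_(N.-1, N.-1) => Y l' l') Minv2; rewrite [LHS]mxE [RHS]mxE.
under eq_bigr do rewrite colE'.
by move=> ->; rewrite eqxx mul1r.
Qed.

(** In the commuting frame a bracket of two CR fields only differentiates coefficients, so it is
    again a combination of the [tL], and these are combinations of the basis. *)
Lemma basis_involutive : exists c : 'I_N.-1 -> 'I_N.-1 -> 'I_N.-1 -> A,
  forall i j x, Q i (Q j x) - Q j (Q i x) = \sum_l c i j l * Q l x.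
Proof.
have [b bE] := basis_invert.
pose e i j l := field_op tL (basis_coef i) (basis_coef j l) - field_op tL (basis_coef j) (basis_coef i l).
exists (fun i j k => \sum_l e i j l * b l k) => i j x.
have QE k y : Q k y = field_op tL (basis_coef k) y by exact: basis_expand.
rewrite !QE (field_op_bracket (tL_deriv D Mp0 rm0) (tLL D Mp0 rm0)).
under [RHS]eq_bigr do rewrite mulr_suml.
rewrite exchange_big /=; apply: eq_bigr => l _; rewrite bE mulr_sumr.
by apply: eq_bigr => k _; rewrite mulrA.
Qed.

Lemma miter_germ a f : Sm f -> Sm (miter (fun i => vfapp (Ld i)) a f) /\
  gm (miter (fun i => vfapp (Ld i)) a f) = miter Q a (gm f).
Proof.
move=> sf; rewrite /miter; elim: (enum 'I_N.-1) => //= i s [sg gE].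
elim: (a i) => //= k [sh hE].
have -> : vfapp (Ld i) (iter k (vfapp (Ld i)) (foldr (fun i0 => iter (a i0) (vfapp (Ld i0))) f s)) =
    vop (vcoef (Ld i)) (iter k (vfapp (Ld i)) (foldr (fun i0 => iter (a i0) (vfapp (Ld i0))) f s)).
  by apply/funext => q; rewrite /vfapp vact_vcoef.
split; first exact: (Sm_vop (Sm_basis i) sh).
by rewrite -(gopE (tangent_good D Mp0 (basis_tangent i)) sh) hE.
Qed.

End CRBasis.

End DataFrame.

(** * Selecting derivatives of the gradient that span it near p0 *)

Section Rows.
Context {R : realType}.
Local Notation C := R[i].
Variables (N N' : nat) (M : set 'rV[C]_N) (M' : set 'rV[C]_N') (p0 : 'rV[C]_N).
Variables (U : set 'rV[C]_N) (rho : 'rV[C]_N -> R) (m : 'I_N).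
Hypothesis D : defining M p0 U rho.
Hypothesis Mp0 : M p0.
Let r (s : 'I_N + 'I_N) : 'rV[C]_N -> C := wder s (toC rho).
Hypothesis rm0 : r (inl m) p0 != 0.
Variables (q0 : 'rV[C]_N') (U1 : set 'rV[C]_N') (rho1 : 'rV[C]_N' -> R) (jm : 'I_N').
Hypothesis D1 : defining M' q0 U1 rho1.
Hypothesis rj0 : wder (inl jm) (toC rho1) q0 != 0.
Variables (Ud : set 'rV[C]_N) (H G : 'rV[C]_N -> 'rV[C]_N').
Hypothesis extG : local_ext M p0 H Ud G.
Hypothesis Gq0 : G p0 = q0.
Hypothesis HM : forall q, M q -> M' (H q).
Local Notation A := (germ M p0).
Local Notation gm := (gm M p0).
Local Notation Sm := (Sm p0).
Local Notation ev := (@gev R N M p0).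
Local Notation tL := (@tL R N M p0 rho m).
Local Notation nearM := (nearM M p0).

Lemma ext_Sm j : Sm (fun q => G q 0 j).
Proof. by have [pU sG _] := extG; exists Ud; split=> //; apply/smooth_onP; exact: sG. Qed.

Lemma ext_comp_Sm f : smooth_at q0 f -> Sm (fun q => f (G q)).
Proof. by rewrite -Gq0; exact: (Sm_comp ext_Sm). Qed.

Lemma ext_near (V : set 'rV[C]_N') : open_nbhd q0 V -> nearM (fun q => V (G q) /\ M' (G q)).
Proof.
rewrite -Gq0 => pV; have [U2 [pU2 _ UV]] := Sm_map_open ext_Sm pV.
have [pU _ GH] := extG; exists (U2 `&` Ud); split; first exact: open_nbhdI.
by move=> q [U2q Uq] Mq; split; [exact: UV|rewrite (GH q Uq Mq); exact: HM].
Qed.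

Definition grad_germ (rho2 : 'rV[C]_N' -> R) (i : 'I_N') : A :=
  gm (fun q => wder (inl i) (toC rho2) (G q)).
Local Notation psi := (grad_germ rho1).

Section Data.
Variables (U2 : set 'rV[C]_N') (rho2 : 'rV[C]_N' -> R) (Ld : 'I_N.-1 -> @vfield R N).
Hypothesis D2 : defining M' q0 U2 rho2.
Hypothesis basis : CR_basis M Ud Ld.
Local Notation phi := (grad_germ rho2).
Local Notation Q := (@basis_op R N M p0 Ld).
Let pUd : open_nbhd p0 Ud. Proof. by case: extG. Qed.

(** The degeneracy data of the two maps may use different defining functions of M'. The factor u
    lets both maps be treated with the same rho1. *)
Lemma grad_germ_ratio : exists u u' : A, u * u' = 1 /\ forall i, phi i = u * psi i.
Proof.
have sr s : smooth_at q0 (wder s (toC rho1)) by exact: (Sm_r D1).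
have sr2 s : smooth_at q0 (wder s (toC rho2)) by exact: (Sm_r D2).
pose f z := wder (inl jm) (toC rho2) z / wder (inl jm) (toC rho1) z.
have sf : smooth_at q0 f by apply: SmM; [exact: sr2|apply: SmV; [exact: rj0|exact: sr]].
have [pU1 _ _ _] := D1; have [pU2 _ _ _] := D2.
have Mq0 : M' q0 by have [_ _ GH] := extG; rewrite -Gq0 (GH p0 pUd.2 Mp0); exact: HM.
have f0 : f q0 != 0.
  by apply: mulf_neq0; [exact: (gradient_ratio_neq0 D1 D2 Mq0 rj0)|rewrite invr_eq0; exact: rj0].
have [|u' uu'] := @gm_local R N M p0 (gm (fun q => f (G q))).
  by rewrite (gev_gm M (ext_comp_Sm sf)) Gq0.
exists (gm (fun q => f (G q))), u'; split=> // i.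
rewrite /grad_germ -(gmM M (ext_comp_Sm sf) (ext_comp_Sm (sr (inl i)))).
apply/gm_eq; [exact: (ext_comp_Sm (sr2 _))|exact: (SmM (ext_comp_Sm sf) (ext_comp_Sm (sr _)))|].
have [V [pV V0]] := bcont_neq0 (Sm_bcont (sr (inl jm))) rj0.
have [W [pW HW]] := ext_near (open_nbhdI (open_nbhdI pU1 pU2) pV).
exists W; split=> // q Wq Mq0'; have Mq : M q by case: Mq0' => [//|->].
have [[[U1q U2q] Vq] M'q] := HW q Wq Mq.
exact: (gradient_ratio (defining_at D1 U1q) (defining_at D2 U2q) M'q (V0 _ Vq)).
Qed.

(** The passage from words in the frame applied to the gradient of rho1 to the ordered monomials of
    the given basis and rho2 is an identity of germs; so it holds at every point of M near p0. *)
Lemma word_Espace w : nearM (fun q =>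
  \row_i grep (word tL w (psi i)) q \in Espace G rho2 Ld (size w) q).
Proof.
have [u [u' [uu' phiE]]] := grad_germ_ratio.
have psiE i : psi i = u' * phi i by rewrite phiE mulrA [u' * u]mulrC uu' mul1r.
have [b bE] := basis_invert D Mp0 rm0 pUd basis.
have [c cE] := basis_involutive D Mp0 rm0 pUd basis.
have dQ := basis_deriv D Mp0 pUd basis.
have [e eE] := generated_normal dQ cE (generated_change dQ bE psiE (generated_word tL psi w)).
have sphi i : Sm (fun z => wder (inl i) (toC rho2) (G z)) by exact: (ext_comp_Sm (Sm_r D2 _)).
have mG a i := miter_germ D Mp0 pUd basis a (sphi i).
have near i : nearM (fun q => grep (word tL w (psi i)) q = \sum_(a <- mindices N.-1 (size w))
    grep (e a) q * miter (fun i => vfapp (Ld i)) a (fun z => wder (inl i) (toC rho2) (G z)) q).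
  have se a : Sm (fun q => grep (e a) q *
      miter (fun i => vfapp (Ld i)) a (fun z => wder (inl i) (toC rho2) (G z)) q).
    by apply: SmM; [exact: grepS|case: (mG a i)].
  apply: nearM_eq; first by apply: Sm_sum => a _; exact: se.
  rewrite eE gm_sum => [|a _]; last exact: se.
  apply: eq_bigr => a _; have [s1 E1] := mG a i.
  by rewrite (gmM M (grepS (e a)) s1) gm_rep E1.
apply: nearM_imp (nearM_all near) => q Hq.
rewrite (_ : \row_i _ = \sum_(a <- mindices N.-1 (size w)) grep (e a) q *:
    \row_i miter (fun i => vfapp (Ld i)) a (fun z => wder (inl i) (toC rho2) (G z)) q).
  rewrite big_seq; apply: memv_suml => a am; apply: memvZ; apply: memv_span.
  exact: (map_f (fun a => \row_j miter (fun i => vfapp (Ld i)) a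
                  (fun z => dZ j (toC rho2) (G z)) q)).
apply/rowP => i; rewrite mxE Hq summxE; apply: eq_bigr => a _.
by rewrite !mxE.
Qed.

Lemma Espace_rows k k1 (X : 'M[C]_(k1, N')) :
  (forall w, (size w <= k)%N -> ((\row_i ev (word tL w (psi i))) <= X)%MS) ->
  (\dim (Espace G rho2 Ld k p0) <= \rank X)%N.
Proof.
move=> HX; apply: dim_le_rank => v /mapP[a ak ->].
have [u [u' [uu' phiE]]] := grad_germ_ratio.
have dL := tL_deriv D Mp0 rm0.
have bE := basis_expand D Mp0 rm0 pUd basis.
have dQ := basis_deriv D Mp0 pUd basis.
have sphi i : Sm (fun z => wder (inl i) (toC rho2) (G z)) by exact: (ext_comp_Sm (Sm_r D2 _)).
have [s sk sE] := generated_change dL bE phiE (generated_word Q phi (normal_word a)).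
have -> : \row_j miter (fun i => vfapp (Ld i)) a (fun z => dZ j (toC rho2) (G z)) p0 =
    \sum_(x <- s) ev x.1 *: \row_i ev (word tL x.2 (psi i)).
  apply/rowP => i; have [s1 E1] := miter_germ D Mp0 pUd basis a (sphi i).
  rewrite mxE -[LHS](gev_gm M s1) E1 -word_normal -/(phi i) sE rmorph_sum summxE.
  by apply: eq_bigr => x _; rewrite rmorphM !mxE.
rewrite big_seq; apply: summx_sub => x xs; apply: scalemx_sub; apply: HX.
have /allP/(_ x xs) := sk; rewrite size_normal => /leq_trans; apply.
by move: ak; rewrite mem_mindices.
Qed.

(** By the definition of k0, the words of length at most k0 already span a space of the maximal
    dimension N' - s at p0; a maximal independent set is selected among them. *)
Lemma choose_rows k0 s : degenerate_for G rho2 Ld p0 k0 s ->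
  exists n (al : 'I_n -> seq 'I_N), [/\ forall t, (size (al t) <= k0)%N, (N' - s <= n)%N &
    row_free (\matrix_(t, i) ev (word tL (al t) (psi i)))].
Proof.
move=> deg; pose T : finType := {bseq k0 of 'I_N}.
pose X := \matrix_(t < #|T|, i < N') ev (word tL (enum_val t : T) (psi i)).
exists (\rank X), (fun t => enum_val (maxrankfun X t) : seq 'I_N); split.
- by move=> t; exact: size_bseq.
- apply: leq_trans (dim_Espace_degenerate deg) _; apply: Espace_rows => w wk.
  pose t : T := Bseq wk.
  rewrite (_ : \row_i _ = row (enum_rank t) X); first exact: row_sub.
  by apply/rowP => i; rewrite !mxE enum_rankK.
have := maxrowsub_free X; congr (is_true (row_free _)).
by apply/matrixP => t i; rewrite !mxE.
Qed.

(** Here the degeneracy must be constant: the chosen rows stay independent near p0, and the rank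
    never exceeds N' - s there. Hence every other row is pointwise in their span, and a fixed right
    inverse makes the coefficients smooth. *)
Lemma rows_generate n (al : 'I_n -> seq 'I_N) s : (N' - s <= n)%N ->
  row_free (\matrix_(t, i) ev (word tL (al t) (psi i))) ->
  nearM (fun q => degeneracy G rho2 Ld q = s) ->
  forall w, exists b : 'rV[A]_n, forall i,
    word tL w (psi i) = \sum_t b 0 t * word tL (al t) (psi i).
Proof.
move=> sn rf degs w.
pose X : 'M[A]_(n, N') := \matrix_(t, i) word tL (al t) (psi i).
pose x : 'rV[A]_N' := \row_i word tL w (psi i).
have evX : map_mx ev X = \matrix_(t, i) ev (word tL (al t) (psi i)).
  by apply/matrixP => t i; rewrite mxE mxE mxE.
have /row_freeP[Y XY] := rf.
pose Yc : 'M[A]_(N', n) := map_mx (gcst M p0) Y.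
have [Z [Z1 Z2]] : exists Z, X *m Yc *m Z = 1%:M /\ Z *m (X *m Yc) = 1%:M.
  apply: (local_invmx (ev := @gev R N M p0)); first exact: gm_local.
  have -> : map_mx ev (X *m Yc) = 1%:M.
    rewrite map_mxM evX -[RHS]XY; congr (_ *m _).
    by apply/matrixP => i t; rewrite mxE [Yc i t]mxE; exact: gev_cst.
  exact: unitmx1.
suff E : x = x *m Yc *m Z *m X.
  exists (x *m Yc *m Z) => i; have := congr1 (fun y : 'rV[A]_N' => y 0 i) E.
  by rewrite [LHS]mxE [RHS]mxE => ->; apply: eq_bigr => t _; congr (_ * _); rewrite mxE.
pose at_ q a b (B : 'M[A]_(a, b)) := map_mx (fun x : A => grep x q : C) B.
pose K := \max_t size (al t) + size w.
have nearX : nearM (fun q => forall t, row t (at_ q _ _ X) \in Espace G rho2 Ld K q).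
  apply: nearM_all => t; apply: nearM_imp (word_Espace (al t)) => q Hq.
  have -> : row t (at_ q _ _ X) = \row_i grep (word tL (al t) (psi i)) q.
    by apply/rowP => i; rewrite mxE mxE [in LHS]mxE mxE.
  apply: subvP Hq; apply: Espace_le.
  by apply: leq_trans (leq_addr _ _); exact: (leq_bigmax t).
have nearx : nearM (fun q => at_ q _ _ x \in Espace G rho2 Ld K q).
  apply: nearM_imp (word_Espace w) => q Hq.
  have -> : at_ q _ _ x = \row_i grep (word tL w (psi i)) q.
    by apply/rowP => i; rewrite mxE [in LHS]mxE mxE.
  by apply: subvP Hq; apply: Espace_le; exact: leq_addl.
have H1 := nearM_and (nearM_and nearX nearx) degs.
have H2 := nearM_and (nearM_mulmx X Yc) (nearM_and (nearM_mulmx (X *m Yc) Z) (nearM1 M p0 n)).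
have H3 := nearM_and (nearM_mulmx x Yc) (nearM_and (nearM_mulmx (x *m Yc) Z)
  (nearM_mulmx (x *m Yc *m Z) X)).
have key : nearM (fun q => at_ q _ _ x = at_ q _ _ (x *m Yc *m Z *m X)).
  apply: nearM_imp (nearM_and H1 (nearM_and H2 H3)).
  move=> q [[[HX Hx] dq] [[E1 [E2 E3]] [E4 [E5 E6]]]].
  rewrite /at_ E6 E5 E4 -/(at_ q _ _ x) -/(at_ q _ _ X) -/(at_ q _ _ Yc) -/(at_ q _ _ Z).
  have inv : at_ q _ _ X *m at_ q _ _ Yc *m at_ q _ _ Z = 1%:M.
    by move: E2; rewrite Z1 E3 E1.
  have rX : \rank (at_ q _ _ X) = n.
    by apply/eqP/row_freeP; exists (at_ q _ _ Yc *m at_ q _ _ Z); rewrite mulmxA.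
  have sub : (at_ q _ _ x <= at_ q _ _ X)%MS.
    (* The chosen rows together with x still lie in a space E'_K of dimension at most N' - s, so
       adding x cannot raise the rank above n. *)
    have le1 : (\rank (col_mx (at_ q _ _ X) (at_ q _ _ x)) <= n)%N.
      apply: leq_trans sn; rewrite -dq; apply: leq_trans (dim_Espace_le G rho2 Ld K q).
      apply: rank_le_dim => t; case: (split_ordP t) => j ->; first by rewrite rowKu.
      by rewrite rowKd row_id.
    have sX : (at_ q _ _ X <= col_mx (at_ q _ _ X) (at_ q _ _ x))%MS by rewrite -addsmxE addsmxSl.
    have := mxrank_leqif_sup sX; rewrite rX => /geq_leqif; rewrite le1 => /esym.
    apply: submx_trans; rewrite -addsmxE; exact: addsmxSr.
  have /submxP[z ->] := sub.
  by rewrite -[z *m _ *m _]mulmxA -[z *m _ *m _]mulmxA inv mulmx1.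
apply/rowP => i; have [V [pV HV]] := key.
rewrite -[LHS]gm_rep -[RHS]gm_rep; apply/gm_eq; [exact: grepS|exact: grepS|].
exists V; split=> // q Vq Mq0; have Mq : M q by case: Mq0 => [//|->].
have := congr1 (fun y : 'rV[C]_N' => y 0 i) (HV q Vq Mq).
by rewrite [LHS]mxE [RHS]mxE.
Qed.

End Data.

End Rows.

(** * The Levi form *)

Lemma sum_rearrange (K : comNzRingType) (I : finType) (v W X Y Z : I -> K) (c1 c2 : K) :
  (forall i, W i = X i - (Y i * c1 + c2 * Z i)) -> \sum_i v i * W i = 0 ->
  \sum_i v i * X i = (\sum_i v i * Y i) * c1 + c2 * \sum_i v i * Z i.
Proof.
move=> E W0; transitivity (\sum_i (v i * X i - v i * W i)).
  by rewrite sumrB W0 subr0.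
rewrite mulr_suml mulr_sumr -big_split /=.
by apply: eq_bigr => i _; rewrite E; ring.
Qed.

Lemma sum_rearrange2 (K : comNzRingType) (I : finType) (T S c u : I -> K) (a f : K) :
  (forall k, T k = a * c k + f * S k) -> \sum_k c k * u k = 0 ->
  \sum_k T k * u k = f * \sum_k S k * u k.
Proof.
move=> E u0; transitivity (a * (\sum_k c k * u k) + f * \sum_k S k * u k); last first.
  by rewrite u0 mulr0 add0r.
rewrite !mulr_sumr -big_split /=.
by apply: eq_bigr => k _; rewrite E; ring.
Qed.

Lemma mulr_rearrange (K : comNzRingType) (x y z t : K) : x * y + z * (x * t) = (y + z * t) * x.
Proof. by ring. Qed.

Lemma mulr_rot (K : comNzRingType) (x y z : K) : x * y * z = y * z * x.
Proof. by ring. Qed.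

Lemma move_term (K : comNzRingType) (x y z t : K) : x + (y * z + t) = 0 -> - y * z = x + t.
Proof.
rewrite addrA addrAC => /eqP; rewrite addr_eq0 => /eqP ->; ring.
Qed.

Definition sesq (K : numClosedFieldType) n (Q : 'M[K]_n) (v w : 'rV[K]_n) : K :=
  (v *m Q *m (map_mx Num.conj w)^T) 0 0.

Lemma sesqE (K : numClosedFieldType) n (Q : 'M[K]_n) v w :
  sesq Q v w = \sum_i \sum_l Q i l * v 0 i * Num.conj (w 0 l).
Proof.
rewrite /sesq mxE exchange_big /=; apply: eq_bigr => l _; rewrite !mxE mulr_suml.
by apply: eq_bigr => i _; rewrite [v 0 i * _]mulrC.
Qed.

Lemma sesq_rows (K : numClosedFieldType) n p p' (Q : 'M[K]_n) (X : 'M[K]_(p, n)) (Y : 'M[K]_(p', n)) k j :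
  (X *m Q *m (map_mx Num.conj Y)^T) k j = sesq Q (row k X) (row j Y).
Proof. by rewrite /sesq mxE [RHS]mxE; apply: eq_bigr => l _; rewrite -row_mul !mxE. Qed.

Section LeviChange.
Context {R : realType}.
Local Notation C := R[i].
Variables (N : nat) (M : set 'rV[C]_N) (q : 'rV[C]_N).
Variables (U1 U2 : set 'rV[C]_N) (rho1 rho2 : 'rV[C]_N -> R) (j : 'I_N).
Hypothesis D1 : defining M q U1 rho1.
Hypothesis D2 : defining M q U2 rho2.
Hypothesis Mq : M q.
Hypothesis r0 : wder (inl j) (toC rho1) q != 0.

Lemma leviE (rho : 'rV[C]_N -> R) p v w : levi rho p v w =
  \sum_k (\sum_i v 0 i * wder (inl i) (wder (inr k) (toC rho)) p) * Num.conj (w 0 k).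
Proof.
rewrite /levi exchange_big /=; apply: eq_bigr => k _; rewrite mulr_suml.
by apply: eq_bigr => i _; rewrite [v 0 i * _]mulrC.
Qed.

Lemma holo_tangent_change v : holo_tangent rho1 q v -> holo_tangent rho2 q v.
Proof.
rewrite /holo_tangent => v0.
transitivity (wder (inl j) (toC rho2) q / wder (inl j) (toC rho1) q *
   \sum_i v 0 i * dZ i (toC rho1) q); last by rewrite v0 mulr0.
rewrite mulr_sumr; apply: eq_bigr => i _.
by rewrite [dZ i _ _](gradient_ratio D1 D2 Mq r0 (inl i)) mulrCA.
Qed.

(** The gradient of rho2 equals f times that of rho1 along M. Differentiating this in the direction
    v gives an extra term in the derivative of f, which is killed because w is tangent. *)
Lemma levi_change v w : holo_tangent rho1 q v -> holo_tangent rho1 q w ->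
  levi rho2 q v w =
  wder (inl j) (toC rho2) q / wder (inl j) (toC rho1) q * levi rho1 q v w.
Proof.
move=> v0 w0; have s1 := Sm_rho D1; have s2 := Sm_rho D2.
pose f z := wder (inl j) (toC rho2) z / wder (inl j) (toC rho1) z.
have sf : Sm q f.
  by apply: SmM; [exact: (Sm_wder _ s2)|apply: SmV; [exact: r0|exact: (Sm_wder _ s1)]].
pose a (s : 'I_N + 'I_N) : C := if s is inl i then v 0 i else 0.
have aE (g : 'rV[C]_N -> C) : \sum_s a s * wder s g q = \sum_i v 0 i * wder (inl i) g q.
  by rewrite big_sumType /= [X in _ + X]big1 ?addr0 // => i _; rewrite mul0r.
have H k : \sum_i v 0 i * wder (inl i) (wder (inr k) (toC rho2)) q =
    (\sum_i v 0 i * wder (inl i) f q) * wder (inr k) (toC rho1) q +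
    f q * \sum_i v 0 i * wder (inl i) (wder (inr k) (toC rho1)) q.
  pose F z := wder (inr k) (toC rho2) z - f z * wder (inr k) (toC rho1) z.
  have sF : Sm q F by exact: (SmB (Sm_wder _ s2) (SmM sf (Sm_wder _ s1))).
  have : \sum_s a s * wder s F q = 0.
    apply: (tangent_vanish D1 Mq _ sF); first by rewrite aE; exact: v0.
    have [pU1 _ _ _] := D1; have [pU2 _ _ _] := D2.
    have [V [pV V0]] := bcont_neq0 (Sm_bcont (Sm_wder (inl j) s1)) r0.
    exists ((U1 `&` U2) `&` V); split; first by apply: open_nbhdI => //; exact: open_nbhdI.
    move=> z [[U1z U2z] Vz] Mz; rewrite /F.
    by rewrite (gradient_ratio (defining_at D1 U1z) (defining_at D2 U2z) Mz (V0 z Vz) (inr k)) subrr.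
  have [V1 [[oV V1q] k1 k2]] := Sm2 (Sm_wder (inr k) s2) (SmM sf (Sm_wder (inr k) s1)).
  have [V2 [[_ V2q] k3 k4]] := Sm2 sf (Sm_wder (inr k) s1).
  have E s : wder s F q = wder s (wder (inr k) (toC rho2)) q -
     (wder s f q * wder (inr k) (toC rho1) q + f q * wder s (wder (inr k) (toC rho1)) q).
    rewrite -(wderM s (k3 1%N) (k4 1%N) V2q).
    have := wderD s (k1 1%N) (smkN oV (k2 1%N)) V1q; rewrite -/(F) => e.
    have e2 := wderM s (smk_cst 1 (-1) oV) (k2 1%N) V1q.
    rewrite wder_cst mul0r add0r mulN1r in e2.
    apply: (etrans e); congr (_ + _); apply: (etrans _ e2).
    by congr (wder s _ q); apply/funext => z; rewrite mulN1r.
  move=> W0; exact: (@sum_rearrange C 'I_N (fun i => v 0 i) (fun i => wder (inl i) F q)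
    (fun i => wder (inl i) (wder (inr k) (toC rho2)) q) (fun i => wder (inl i) f q)
    (fun i => wder (inl i) (wder (inr k) (toC rho1)) q) (wder (inr k) (toC rho1) q) (f q)
    (fun i => E (inl i)) (etrans (esym (aE F)) W0)).
rewrite (leviE rho2 q v w) (leviE rho1 q v w).
apply: (@sum_rearrange2 C 'I_N (fun k => \sum_i v 0 i * wder (inl i) (wder (inr k) (toC rho2)) q)
  (fun k => \sum_i v 0 i * wder (inl i) (wder (inr k) (toC rho1)) q)
  (fun k => wder (inr k) (toC rho1) q) (fun k => Num.conj (w 0 k)) _ (f q) H).
have [[_ U1q] _ _ _] := D1.
have w1 : \sum_k w 0 k * wder (inl k) (toC rho1) q = 0 := w0.
transitivity (Num.conj (\sum_k w 0 k * wder (inl k) (toC rho1) q)); last by rewrite w1 rmorph0.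
rewrite rmorph_sum.
apply: eq_bigr => k _; rewrite -(r_conjl D1 k U1q) mulrC; exact: (esym (rmorphM _ _ _)).
Qed.

End LeviChange.

(** * The Levi form pulled back by a CR map *)

Section AbstractLevi.
Variables (A : comNzRingType) (n n' : nat) (m : 'I_n).
Variables (P L Lb : 'I_n -> A -> A) (lam : 'I_n -> A) (c : {rmorphism A -> A}).
Hypothesis dP : forall k, derivation (P k).
Hypothesis dL : forall k, derivation (L k).
Hypothesis PL : forall j k f, L j (P k f) = P k (L j f).
Hypothesis LbE : forall k f, Lb k f = P k f + lam k * P m f.
Hypothesis cK : involutive c.
Hypothesis LbcL : forall k f, Lb k f = c (L k (c f)).
Variables (B : comNzRingType) (del : 'I_n' + 'I_n' -> B -> B) (e : {rmorphism B -> A}).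
Variable H : 'I_n' -> A.
Let h i := match i with inl k => H k | inr k => c (H k) end.
Hypothesis delC : forall i j f, del i (del j f) = del j (del i f).
Hypothesis chain : forall t f, tang P L t (e f) = \sum_i e (del i f) * tang P L t (h i).
Hypothesis LH : forall i j, L j (H i) = 0.
Variable b : B.
Hypothesis eb : e b = 0.
Local Notation psi i := (e (del (inl i) b)).

(** This is [Lb k] applied to rho'(H, conj H) = 0, where the derivatives of conj H drop out since H
    is CR. *)
Lemma abs_Lb_tangent k : \sum_i psi i * Lb k (H i) = 0.
Proof.
have Lbc i : Lb k (c (H i)) = 0 by rewrite LbcL cK LH rmorph0.
have P0 j : P j (e b) = 0 by rewrite eb derivation0.
have E : P k (e b) + lam k * P m (e b) = 0 by rewrite !P0 mulr0 addr0.
have ch j : P j (e b) = \sum_i e (del i b) * P j (h i) by exact: (chain (inl j)).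
move: E; rewrite !ch mulr_sumr -big_split big_sumType /=.
rewrite [X in _ + X]big1 ?addr0 => [E|i _].
  by apply: (etrans _ E); apply: eq_bigr => i _; rewrite LbE mulrDr; congr (_ + _); rewrite mulrCA.
have := Lbc i; rewrite LbE => /(congr1 (fun y => e (del (inr i) b) * y)); rewrite mulr0 => E.
by apply: (etrans _ E); rewrite mulrDr; congr (_ + _); rewrite mulrCA.
Qed.

Lemma abs_L_psi j i : L j (psi i) =
  \sum_l e (del (inl i) (del (inr l) b)) * c (Lb j (H l)).
Proof.
have := chain (inr j) (del (inl i) b); rewrite big_sumType /= => ->.
rewrite big1 ?add0r => [|l _]; last by rewrite LH mulr0.
by apply: eq_bigr => l _; rewrite delC LbcL cK.
Qed.

(** Obtained by applying [L j] to the tangency relation: as L H = 0, the field [L j] acts on Lb_k H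
    only through the commutator of L_j and Lb_k, which is a multiple of P_m. Up to factors both
    sides are Levi forms, that of M' at the image vectors and that of M. *)
Lemma abs_L_psi_Lb j k : \sum_i L j (psi i) * Lb k (H i) =
  - (L j (lam k) * \sum_i psi i * P m (H i)).
Proof.
have E : L j (\sum_i psi i * Lb k (H i)) = 0 by rewrite abs_Lb_tangent derivation0.
have LLb i : L j (Lb k (H i)) = L j (lam k) * P m (H i).
  by rewrite LbE (dL j).1 (dL j).2 !PL LH (derivation0 (dP k)) (derivation0 (dP m)) mulr0 addr0 add0r.
move/eqP: E; rewrite (derivation_sum _ _ _ (dL j)).
under eq_bigr do rewrite (dL j).2 LLb.
rewrite big_split /= addr_eq0 => /eqP ->; congr (- _).
by rewrite mulr_sumr; apply: eq_bigr => i _; rewrite mulrCA.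
Qed.

End AbstractLevi.

Section LeviPull.
Context {R : realType}.
Local Notation C := R[i].
Variables (N N' : nat) (M : set 'rV[C]_N) (p0 : 'rV[C]_N).
Variables (U : set 'rV[C]_N) (rho : 'rV[C]_N -> R) (m : 'I_N).
Hypothesis D : defining M p0 U rho.
Hypothesis Mp0 : M p0.
Let r (s : 'I_N + 'I_N) : 'rV[C]_N -> C := wder s (toC rho).
Hypothesis rm0 : r (inl m) p0 != 0.
Local Notation A := (germ M p0).
Local Notation gm := (gm M p0).
Local Notation Sm := (Sm p0).
Local Notation ev := (@gev R N M p0).
Local Notation tT := (@tT R N M p0 rho m).
Local Notation tL := (@tL R N M p0 rho m).
Local Notation tP := (@tP R N M p0 rho m).
Local Notation tLb := (@tLb R N M p0 rho m).
Local Notation lam := (@lam R N M p0 rho m).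
Variables (B : comNzRingType) (del : 'I_N' + 'I_N' -> B -> B) (e : {rmorphism B -> A}).
Variable H : 'I_N' -> A.
Let h i := match i with inl k => H k | inr k => gconj (H k) end.
Hypothesis delC : forall i j f, del i (del j f) = del j (del i f).
Hypothesis chain : forall t f, tang tP tL t (e f) = \sum_i e (del i f) * tang tP tL t (h i).
Hypothesis LH : forall i j, tL j (H i) = 0.
Variable b : B.
Hypothesis eb : e b = 0.
Local Notation psi i := (e (del (inl i) b)).

(** The transverse derivative of rho'(H) in its first set of variables. Divided by rho_m at p0 it is
    the factor between the Levi forms; transversality makes it nonzero. *)
Definition transverse_factor : A := \sum_i psi i * tP m (H i).

Lemma tLb_tangent k : \sum_i psi i * tLb k (H i) = 0.
Proof.
exact: (abs_Lb_tangent (tP_deriv D Mp0 rm0) (tLbE D Mp0 rm0) (@gconjK R N M p0)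
  (fun k x => erefl : tLb k x = gconj (tL k (gconj x))) chain LH eb k).
Qed.

Lemma tL_psi j i : tL j (psi i) =
  \sum_l e (del (inl i) (del (inr l) b)) * gconj (tLb j (H l)).
Proof.
exact: (abs_L_psi (@gconjK R N M p0)
  (fun k x => erefl : tLb k x = gconj (tL k (gconj x))) delC chain LH b j i).
Qed.

Lemma tL_psi_tLb j k : \sum_i tL j (psi i) * tLb k (H i) = - (tL j (lam k) * transverse_factor).
Proof.
exact: (abs_L_psi_Lb (tP_deriv D Mp0 rm0) (tL_deriv D Mp0 rm0) (tPL D Mp0 rm0)
  (tLbE D Mp0 rm0) (@gconjK R N M p0)
  (fun k x => erefl : tLb k x = gconj (tL k (gconj x))) chain LH eb j k).
Qed.

Lemma ev_mul_conj (x y : A) : ev (x * gconj y) = ev x * Num.conj (ev y).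
Proof. exact: (etrans (rmorphM _ _ _) (congr1 (fun z => ev x * z) (gev_conj y))). Qed.

(** The value of Lb_k at p0 as a (1,0)-vector: the d/dZbar_m terms of P_k and P_m cancel. *)
Definition Rvec k : 'rV[C]_N := baseC k + ev (lam k) *: baseC m.

Lemma RvecE k i : Rvec k 0 i = (i == k)%:R + ev (lam k) * (i == m)%:R.
Proof. by rewrite !mxE !eqxx. Qed.

Lemma Rvec_sum k (F : 'I_N -> C) : \sum_i Rvec k 0 i * F i = F k + ev (lam k) * F m.
Proof.
have sd (s : 'I_N) (F' : 'I_N -> C) : \sum_t (t == s)%:R * F' t = F' s.
  by rewrite (bigD1 s) //= eqxx mul1r big1 ?addr0 // => t /negbTE ->; exact: mul0r.
under eq_bigr do rewrite RvecE mulrDl -mulrA.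
by rewrite big_split /= -mulr_sumr !sd.
Qed.

Lemma Sm_lam k : Sm (fun q => - (r (inl k) q / r (inl m) q)).
Proof.
by apply: SmN; apply: SmM; [exact: (Sm_r D _)|apply: SmV; [exact: rm0|exact: (Sm_r D _)]].
Qed.

Lemma ev_lam k : ev (lam k) = - (r (inl k) p0 / r (inl m) p0).
Proof. exact: (gev_gm M (Sm_lam k)). Qed.

Lemma ev_tL j f : Sm f -> ev (tL j (gm f)) = \sum_l Num.conj (Rvec j 0 l) * wder (inr l) f p0.
Proof.
move=> sf; have [[_ Up] _ _ _] := D.
have E0 : ev (tL j (gm f)) = wder (inr j) f p0 - kappa rho m (inr j) p0 * wder (inr m) f p0.
  apply: (etrans (congr1 ev (tT_gm_wder D Mp0 rm0 (inr j) sf))); rewrite rmorphB rmorphM.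
  exact: (congr2 (fun x y => x - y) (gev_gm M (Sm_wder (inr j) sf)) (congr2 (fun x y => x * y)
    (gev_gm M (Sm_kappa D rm0 (inr j))) (gev_gm M (Sm_wder (inr m) sf)))).
rewrite E0.
have E l : Num.conj (Rvec j 0 l) = (l == j)%:R - (l == m)%:R * kappa rho m (inr j) p0.
  have Er k : Num.conj (ev (lam k)) = - (r (inr k) p0 / r (inr m) p0).
    rewrite ev_lam rmorphN fmorph_div.
    exact: (congr2 (fun x y => - (x / y)) (r_conjl D k Up) (r_conjl D m Up)).
  rewrite RvecE rmorphD rmorphM !rmorph_nat; move: (Er j) => /= ->.
  by rewrite mulrC mulrN.
under eq_bigr do rewrite E mulrBl -mulrA.
have sd (s : 'I_N) (F : 'I_N -> C) : \sum_t (t == s)%:R * F t = F s.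
  by rewrite (bigD1 s) //= eqxx mul1r big1 ?addr0 // => t /negbTE ->; exact: mul0r.
by rewrite sumrB !sd.
Qed.

(** Obtained by differentiating rho_k + lam_k rho_m = 0 along L_j: the commutators of the frame
    carry the Levi form of M. *)
Lemma tL_lam j k : - ev (tL j (lam k)) * r (inl m) p0 = levi rho p0 (Rvec k) (Rvec j).
Proof.
have dL := tL_deriv D Mp0 rm0; have sr s := Sm_r D s.
have E : gm (r (inl k)) + lam k * gm (r (inl m)) = 0.
  rewrite -(gmM M (Sm_lam k) (sr _)) -(gmD M (sr _) (SmM (Sm_lam k) (sr _))).
  rewrite -(rmorph0 (gcst M p0)); apply/gm_eq; [exact: (SmD (sr _) (SmM (Sm_lam k) (sr _)))|exact: Sm_cst|].
  have [V [pV V0]] := bcont_neq0 (Sm_bcont (sr (inl m))) rm0.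
  by exists V; split=> // q /V0 q0 _; rewrite mulNr divfK // subrr.
have L0 x : x = 0 -> tL j x = 0 by move=> ->; exact: (derivation0 (dL j)).
have E1 : ev (tL j (gm (r (inl k)))) + (ev (tL j (lam k)) * r (inl m) p0 +
    ev (lam k) * ev (tL j (gm (r (inl m))))) = 0.
  transitivity (ev (tL j (gm (r (inl k)) + lam k * gm (r (inl m))))); last first.
    by apply: (etrans (congr1 ev (L0 _ E))); rewrite rmorph0.
  rewrite (dL j).1 (dL j).2 !rmorphD !rmorphM; congr (_ + (_ * _ + _)).
  exact: (esym (gev_gm M (sr (inl m)))).
apply: (etrans (move_term E1)).
apply: (etrans (congr2 (fun x y => x + ev (lam k) * y) (ev_tL j (sr (inl k))) (ev_tL j (sr (inl m))))).
rewrite (leviE rho p0 (Rvec k) (Rvec j)).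
rewrite mulr_sumr -big_split /=; apply: eq_bigr => l _.
have [V [[oV Vp] kV]] := Sm_rho D.
have sw i : wder (inl i) (wder (inr l) (toC rho)) p0 = wder (inr l) (r (inl i)) p0.
  exact: (wderC _ _ oV (kV 2%N) Vp).
have RS : \sum_i Rvec k 0 i * wder (inl i) (wder (inr l) (toC rho)) p0 =
    wder (inr l) (r (inl k)) p0 + ev (lam k) * wder (inr l) (r (inl m)) p0.
  by rewrite Rvec_sum (sw k) (sw m).
apply: (etrans _ (esym (congr1 (fun z => z * Num.conj (Rvec j 0 l)) RS))).
exact: mulr_rearrange.
Qed.

Definition dmx : 'M[C]_(N, N') := \matrix_(k, i) ev (tLb k (H i)).
Definition levimx' : 'M[C]_N' := \matrix_(i, l) ev (e (del (inl i) (del (inr l) b))).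
Definition levimx : 'M[C]_N := \matrix_(i, l) dZ i (dZb l (toC rho)) p0.
Definition Rmx : 'M[C]_N := \matrix_k Rvec k.

Lemma levi_sesq v w : levi rho p0 v w = sesq levimx v w.
Proof. by rewrite sesqE; apply: eq_bigr => i _; apply: eq_bigr => l _; rewrite mxE. Qed.

Lemma levi_dmx : r (inl m) p0 *: (dmx *m levimx' *m (map_mx Num.conj dmx)^T) =
  ev transverse_factor *: (Rmx *m levimx *m (map_mx Num.conj Rmx)^T).
Proof.
apply/matrixP => k j; rewrite mxE [RHS]mxE.
have -> : (Rmx *m levimx *m (map_mx Num.conj Rmx)^T) k j = levi rho p0 (Rvec k) (Rvec j).
  by rewrite levi_sesq sesq_rows !rowK.
rewrite -tL_lam; have := congr1 (fun x => ev x) (tL_psi_tLb j k).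
rewrite rmorph_sum rmorphN rmorphM => E.
transitivity (r (inl m) p0 * - (ev (tL j (lam k)) * ev transverse_factor)); last by ring.
congr (_ * _); rewrite -E mxE.
transitivity (\sum_i \sum_l dmx k i * levimx' i l * Num.conj (dmx j l)).
  rewrite exchange_big /=; apply: eq_bigr => l _; rewrite !mxE mulr_suml.
  by apply: eq_bigr => i _; rewrite !mxE.
apply: eq_bigr => i _; rewrite rmorphM tL_psi rmorph_sum mulr_suml.
apply: eq_bigr => l _; rewrite [dmx k i]mxE [levimx' i l]mxE [dmx j l]mxE.
apply: (etrans (mulr_rot _ _ _)); exact: (esym (congr1 (fun z => z * _) (ev_mul_conj _ _))).
Qed.

(** For tangent v the sum of the v_k lam_k vanishes, so the contributions at index m cancel. Thus
    the vectors [Rvec k] reach all holomorphic tangent vectors. *)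
Lemma Rmx_tangent v : holo_tangent rho p0 v -> v *m Rmx = v.
Proof.
move=> v0; apply/rowP => i; rewrite mxE.
under eq_bigr do rewrite mxE RvecE ev_lam mulrDr.
rewrite big_split /= (bigD1 i) //= eqxx mulr1 big1 ?addr0 => [|k]; last first.
  by rewrite eq_sym => /negbTE ->; rewrite mulr0.
rewrite -[RHS]addr0; congr (_ + _).
transitivity (- ((i == m)%:R / r (inl m) p0) * \sum_k v 0 k * dZ k (toC rho) p0).
  by rewrite mulr_sumr; apply: eq_bigr => k _; rewrite -[dZ k _ _]/(r (inl k) p0); ring.
by rewrite v0 mulr0.
Qed.

Lemma levi'_dmx v w : holo_tangent rho p0 v -> holo_tangent rho p0 w ->
  r (inl m) p0 * sesq levimx' (v *m dmx) (w *m dmx) = ev transverse_factor * levi rho p0 v w.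
Proof.
move=> v0 w0; rewrite levi_sesq -{2}(Rmx_tangent v0) -{2}(Rmx_tangent w0) /sesq.
rewrite !map_mxM !trmx_mul.
have E (X : 'M[C]_N) (c : C) : c * (v *m X *m (map_mx Num.conj w)^T) 0 0 =
    (v *m (c *: X) *m (map_mx Num.conj w)^T) 0 0.
  by rewrite -scalemxAr -scalemxAl [RHS]mxE.
have := E (dmx *m levimx' *m (map_mx Num.conj dmx)^T) (r (inl m) p0).
by rewrite levi_dmx -E !mulmxA => <-; rewrite ?mulmxA.
Qed.

Lemma dmx_tangent (v : 'rV[C]_N) : \sum_i (v *m dmx) 0 i * ev (psi i) = 0.
Proof.
under eq_bigr do rewrite mxE mulr_suml.
rewrite exchange_big /= big1 // => k _.
have := congr1 (fun x => ev x) (tLb_tangent k); rewrite rmorph_sum rmorph0 => E.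
transitivity (v 0 k * \sum_i ev (psi i * tLb k (H i))); last by rewrite E mulr0.
rewrite mulr_sumr; apply: eq_bigr => i _; rewrite [dmx k i]mxE -mulrA; congr (_ * _).
by rewrite mulrC; exact: (esym (rmorphM _ _ _)).
Qed.

(** The words of length one suffice: L_k rho'_Z' is the Levi form of M' paired with the conjugate of
    Lb_k H, see [tL_psi]. *)
Lemma kernel_orthogonal (x : 'rV[C]_N') (v : 'rV[C]_N) : (forall w, \sum_i ev (word tL w (psi i)) * x 0 i = 0) ->
  sesq levimx' x (v *m dmx) = 0.
Proof.
move=> x0.
have base k : (x *m levimx' *m (map_mx Num.conj dmx)^T) 0 k = 0.
  rewrite -[RHS](x0 [:: k]) mxE.
  transitivity (\sum_i \sum_l x 0 i * levimx' i l * Num.conj (dmx k l)).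
    rewrite exchange_big /=; apply: eq_bigr => l _; rewrite !mxE mulr_suml.
    by apply: eq_bigr => i _.
  apply: eq_bigr => i _; rewrite [word _ _ _]tL_psi rmorph_sum mulr_suml.
  apply: eq_bigr => l _; rewrite [levimx' i l]mxE [dmx k l]mxE.
  apply: (etrans (mulr_rot _ _ _)); exact: (esym (congr1 (fun z => z * _) (ev_mul_conj _ _))).
rewrite /sesq map_mxM trmx_mul mulmxA (_ : x *m _ *m _ = 0) ?mul0mx ?mxE //.
by apply/rowP => k; rewrite base mxE.
Qed.

End LeviPull.

(** * Anisotropy of the Levi form on the kernel *)

Section Anisotropic.
Variables (K : numClosedFieldType) (n : nat).

(** The vectors orthogonal to x form a linear subspace, the kernel of this column; the conjugation
    turns the antilinear condition into a linear one. *)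
Definition sesq_col k (Q : 'M[K]_k) (x : 'rV[K]_k) : 'cV[K]_k := (map_mx Num.conj (x *m Q))^T.

Lemma sesq_colP k (Q : 'M[K]_k) x t : sesq Q x t = 0 <-> t *m sesq_col Q x = 0.
Proof.
have E : (t *m sesq_col Q x) 0 0 = Num.conj (sesq Q x t).
  rewrite /sesq mxE [in RHS]mxE rmorph_sum; apply: eq_bigr => i _.
  have e1 : sesq_col Q x i 0 = Num.conj ((x *m Q) 0 i) by rewrite mxE mxE.
  have e2 : Num.conj ((map_mx Num.conj t)^T i 0) = t 0 i by rewrite mxE mxE conjCK.
  by rewrite rmorphM /= e1 e2 mulrC.
split=> [h|h]; last by apply/eqP; rewrite -conjC_eq0 -E h mxE.
by apply/matrixP => i j; rewrite !ord1 E h rmorph0 mxE.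
Qed.

Lemma rank_cV k (t : 'cV[K]_k) : t != 0 -> \rank t = 1%N.
Proof.
move=> t0; apply/eqP; rewrite eqn_leq rank_leq_col lt0n mxrank_eq0; exact: t0.
Qed.

(** The image W of the tangent space of M is nondegenerate for the Levi form of M' and has dimension
    n - 1 in a tangent space of dimension n. If x were nonzero, W and x would span that space; as x
    is orthogonal to W and to itself, it would be in the radical. *)
Lemma nondegenerate_aniso (t : 'cV[K]_n) (t' : 'cV[K]_n.+1) (Dh : 'M[K]_(n, n.+1))
    (Q : 'M[K]_n) (Q' : 'M[K]_n.+1) (a b : K) x :
  t != 0 -> t' != 0 -> b != 0 ->
  (forall v w, v *m t = 0 -> w *m t = 0 -> a * sesq Q' (v *m Dh) (w *m Dh) = b * sesq Q v w) ->
  (forall v : 'rV[K]_n, v *m t = 0 -> v *m Dh *m t' = 0) ->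
  (forall v, v *m t = 0 -> (forall w, w *m t = 0 -> sesq Q v w = 0) -> v = 0) ->
  (forall v, v *m t' = 0 -> (forall w, w *m t' = 0 -> sesq Q' v w = 0) -> v = 0) ->
  x *m t' = 0 -> (forall w, w *m t = 0 -> sesq Q' x (w *m Dh) = 0) -> sesq Q' x x = 0 -> x = 0.
Proof.
move=> t0 t'0 b0 QQ TT ndQ ndQ' xt xW xx; apply/eqP; apply: contraT => xn0.
pose W := kermx t *m Dh; pose y := sesq_col Q' x.
have kt (v : 'rV[K]_n) : (v <= kermx t)%MS -> v *m t = 0 by move/sub_kermxP.
have inj v : v *m t = 0 -> (forall w, w *m t = 0 -> sesq Q' (v *m Dh) (w *m Dh) = 0) -> v = 0.
  move=> vt H; apply: ndQ => // w wt; apply/eqP.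
  have := QQ v w vt wt; rewrite H // mulr0 => /esym/eqP; rewrite mulf_eq0 (negbTE b0) //.
have sesq0l v : sesq Q' 0 v = 0 by rewrite /sesq !mul0mx mxE.
(* The map Dh is injective on the tangent space, since a tangent vector in its kernel would be in
   the radical of the Levi form of M. *)
have rW : \rank W = n.-1.
  have := mxrank_mul_ker (kermx t) Dh; rewrite (_ : (kermx t :&: kermx Dh)%MS = 0).
    by rewrite mxrank0 addn0 -/W mxrank_ker rank_cV // subn1.
  apply/eqP; rewrite -submx0; apply/rV_subP => v; rewrite sub_capmx => /andP[/kt vt /sub_kermxP vD].
  by rewrite (inj v vt) ?sub0mx // => w _; rewrite vD sesq0l.
(* An element of W that is orthogonal to W is zero by nondegeneracy of M. *)
have cap : (W :&: x)%MS = 0.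
  apply/eqP; rewrite -mxrank_eq0 -leqn0 leqNgt; apply/negP => c0.
  have xc : (x <= W :&: x)%MS.
    have := mxrank_leqif_sup (capmxSr W x); rewrite rank_rV xn0 => /geq_leqif <-.
    exact: c0.
  have /submxP[z xE] : (x <= W)%MS by exact: submx_trans xc (capmxSl _ _).
  case/negP: xn0; have vt : z *m kermx t *m t = 0 by rewrite -mulmxA mulmx_ker mulmx0.
  have := inj _ vt; rewrite -mulmxA -/W -xE => /(_ xW) v0.
  by rewrite xE /W mulmxA v0 mul0mx.
have n0 : (0 < n)%N.
  rewrite lt0n; apply: contra t0 => /eqP n0; apply/eqP/matrixP => i.
  by have := ltn_ord i; rewrite {2}n0.
have rWx : \rank (W + x)%MS = n.
  have := mxrank_sum_cap W x; rewrite cap mxrank0 addn0 rW rank_rV xn0 => ->.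
  by rewrite addn1 prednK.
have Wx' : (W + x <= kermx t')%MS.
  rewrite addsmx_sub; apply/andP; split; last by apply/sub_kermxP.
  apply/row_subP => i; apply/sub_kermxP; rewrite row_mul; apply: TT.
  by apply: kt; exact: row_sub.
have Wy : (W + x <= kermx y)%MS.
  rewrite addsmx_sub; apply/andP; split; last by apply/sub_kermxP/sesq_colP.
  apply/row_subP => i; apply/sub_kermxP/sesq_colP; rewrite row_mul; apply: xW.
  by apply: kt; exact: row_sub.
suff x0 : x = 0 by rewrite x0 eqxx in xn0.
apply: ndQ' => // w wt'; apply/sesq_colP/sub_kermxP.
apply: submx_trans Wy; have := mxrank_leqif_sup Wx'.
rewrite rWx mxrank_ker rank_cV // subSS subn0 => /geq_leqif; rewrite leqnn => /esym.
by apply: submx_trans; apply/sub_kermxP.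
Qed.

End Anisotropic.

(** * Germs of CR maps and their contact *)

Section Maps.
Context {R : realType}.
Local Notation C := R[i].
Variables (N N' : nat) (M : set 'rV[C]_N) (M' : set 'rV[C]_N') (p0 : 'rV[C]_N).
Variables (U : set 'rV[C]_N) (rho : 'rV[C]_N -> R) (m : 'I_N).
Hypothesis D : defining M p0 U rho.
Hypothesis Mp0 : M p0.
Let r (s : 'I_N + 'I_N) : 'rV[C]_N -> C := wder s (toC rho).
Hypothesis rm0 : r (inl m) p0 != 0.
Local Notation A := (germ M p0).
Local Notation gm := (gm M p0).
Local Notation Sm := (Sm p0).
Local Notation ev := (@gev R N M p0).
Local Notation tT := (@tT R N M p0 rho m).
Local Notation tL := (@tL R N M p0 rho m).
Local Notation tP := (@tP R N M p0 rho m).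
Local Notation flat := (flat ev tP tL).

Lemma csm_near f gam : Sm f -> smooth_curve gam -> gam 0 = p0 ->
  exists2 d : R, 0 < d & forall k, csm d k (fun t => f (gam t)).
Proof.
move=> [V [pV kV]] sg g0; have [oV _] := pV; have /smooth_curve_csm cg := sg.
have [d d0 dP] := curve_near sg g0 pV.
by exists d => // k; apply: (csm_comp oV (kV k.+1)).
Qed.

Lemma jet_sub l f1 f2 gam : Sm f1 -> Sm f2 -> smooth_curve gam -> gam 0 = p0 ->
  iter l cderive1 (fun t => f1 (gam t) - f2 (gam t)) 0 =
  iter l cderive1 (fun t => f1 (gam t)) 0 - iter l cderive1 (fun t => f2 (gam t)) 0.
Proof.
move=> s1 s2 sg g0.
have [d1 d10 c1] := csm_near (SmB s1 s2) sg g0; have [d2 d20 c2] := csm_near s2 sg g0.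
have z : `|0 : R| < Num.min d1 d2 by rewrite normr0 lt_min d10.
have c1' : csm (Num.min d1 d2) l (fun t => f1 (gam t) - f2 (gam t)).
  by apply: csm_le (c1 l); rewrite ge_min lexx.
have c2' : csm (Num.min d1 d2) l (fun t => f2 (gam t)).
  by apply: csm_le (c2 l); rewrite ge_min lexx orbT.
have E := csm_iterD c1' c2' z.
apply/eqP; rewrite eq_sym subr_eq; apply/eqP; apply: (etrans _ E).
by congr (iter _ _ _ _); apply/funext => t; rewrite subrK.
Qed.

Lemma contact_flat k f1 f2 : Sm f1 -> Sm f2 ->
  (forall j, tL j (gm f1) = 0) -> (forall j, tL j (gm f2) = 0) ->
  (forall gam, smooth_curve gam -> gam 0 = p0 -> (forall t, M (gam t)) ->
    forall l, (l <= k)%N -> iter l cderive1 (fun t => f1 (gam t)) 0 =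
      iter l cderive1 (fun t => f2 (gam t)) 0) ->
  flat k.+1 (gm f1 - gm f2).
Proof.
move=> s1 s2 L1 L2 H; rewrite -(gmB M s1 s2); apply: (curve_flat D Mp0 rm0).
- exact: (SmB s1 s2).
- move=> j; rewrite (gmB M s1 s2) (derivationB _ _ (tL_deriv D Mp0 rm0 j)) L1 L2; exact: subrr.
move=> gam sg g0 gM l lk.
by rewrite (jet_sub l s1 s2 sg g0) (H gam sg g0 gM l lk) subrr.
Qed.

Lemma ext_jet (H G : 'rV[C]_N -> 'rV[C]_N') V l j gam : local_ext M p0 H V G ->
  smooth_curve gam -> gam 0 = p0 -> (forall t, M (gam t)) ->
  iter l cderive1 (fun t => G (gam t) 0 j) 0 = iter l cderive1 (fun t => H (gam t) 0 j) 0.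
Proof.
move=> extG sg g0 gM; have [pV _ GH] := extG.
have [d1 d10 c1] := csm_near (ext_Sm extG j) sg g0.
have [d2 d20 d2V] := curve_near sg g0 pV.
have z : `|0 : R| < Num.min d1 d2 by rewrite normr0 lt_min d10.
have c1' : csm (Num.min d1 d2) l (fun t => G (gam t) 0 j).
  by apply: csm_le (c1 l); rewrite ge_min lexx.
apply: (iter_cderive1_ext c1' _ z) => t td; rewrite GH //; apply: d2V.
by apply: lt_le_trans td _; rewrite ge_min lexx orbT.
Qed.

(** [CR_map] provides an extension for each point separately. Near q it agrees on M with the fixed
    extension G, so tangential derivatives of the two coincide. *)
Lemma CR_germ (H G : 'rV[C]_N -> 'rV[C]_N') V j i : CR_map M M' H ->
  local_ext M p0 H V G -> tL j (gm (fun q => G q 0 i)) = 0.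
Proof.
move=> [_ crH] extG; have sG := ext_Sm extG i; have [pV sGV GH] := extG.
apply: (etrans (tT_gm D Mp0 rm0 (inr j) sG)); rewrite -(rmorph0 (gcst M p0)).
apply/gm_eq; [exact: (Sm_fT D rm0 (inr j) sG)|exact: Sm_cst|].
have [_ [V1 [pV1 tV1]]] := fT_tangent D rm0 (inr j).
have pU : open_nbhd p0 U by case: D.
exists ((V `&` V1) `&` U); split; first by apply: open_nbhdI => //; exact: open_nbhdI.
move=> q [[Vq V1q] Uq] Mq0; have Mq : M q by case: Mq0 => [//|->].
have [W [G1 [[pW sG1 G1H] cr1]]] := crH q Mq.
pose a s := fT rho m (inr j) s q.
pose v : cvect N := (\row_k a (inl k), \row_k a (inr k)).
have vE f : vact v f q = \sum_s a s * wder s f q.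
  rewrite /vact big_split big_sumType /=.
  by congr (_ + _); apply: eq_bigr => k _; rewrite mxE.
have a0 : \sum_s a s * wder s (toC rho) q = 0 by exact: (tV1 q V1q Mq).
have v1 : v.1 = 0 by apply/rowP => k; rewrite !mxE /a /fT /= !mul0r subr0.
have tv : ctangent M q v.
  by exists U, rho; split; [exact: (defining_at D Uq)|rewrite vE].
have e1 := cr1 v v1 tv i; rewrite vE in e1.
have oV : open V by case: pV.
have sq : smooth_at q (fun z => G z 0 i) by exists V; split=> //; apply/smooth_onP; exact: sGV.
have sq1 : smooth_at q (fun z => G1 z 0 i) by exists W; split=> //; apply/smooth_onP; exact: sG1.
have e2 : \sum_s a s * wder s (fun z => G z 0 i - G1 z 0 i) q = 0.
  apply: (tangent_vanish (defining_at D Uq) Mq a0 (SmB sq sq1)).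
  exists (V `&` W); split; first exact: (open_nbhdI (conj oV Vq) pW).
  by move=> z [Vz Wz] Mz; rewrite (GH z Vz Mz) (G1H z Wz Mz) subrr.
have [V2 [[oV2 V2q] k1 k2]] := Sm2 (SmB sq sq1) sq1.
have E s : wder s (fun z => G z 0 i) q =
    wder s (fun z => G z 0 i - G1 z 0 i) q + wder s (fun z => G1 z 0 i) q.
  rewrite -(wderD s (k1 1%N) (k2 1%N) V2q); congr (wder s _ q).
  by apply/funext => z; rewrite subrK.
have S : \sum_s a s * wder s (fun z => G z 0 i) q = 0; last exact: S.
have e3 s : a s * wder s (fun z => G z 0 i) q = a s * wder s (fun z => G z 0 i - G1 z 0 i) q +
    a s * wder s (fun z => G1 z 0 i) q by rewrite -mulrDr -E.
apply: (etrans (eq_bigr _ (fun s _ => e3 s))); rewrite big_split /= e2 add0r; exact: e1.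
Qed.

Lemma pull_exists (q0 : 'rV[C]_N') (G : 'rV[C]_N -> 'rV[C]_N') :
  (forall j, Sm (fun q => G q 0 j)) -> G p0 = q0 ->
  exists e : {rmorphism germ (@setT 'rV[C]_N') q0 -> A},
    (forall f, smooth_at q0 f -> e (germ_of setT q0 f) = gm (fun q => f (G q))) /\
    forall t x, tT t (e x) = \sum_i e (gW i x) * tT t (map_germ M p0 G i).
Proof.
move=> sG <-; have [e eE] := gpull_rmorph M sG; exists e; split=> [f sf|t x].
  by rewrite eE; exact: gpull_gm.
rewrite eE; apply: (etrans (tT_pull D Mp0 rm0 sG t x)).
by apply: eq_bigr => i _; rewrite eE.
Qed.

End Maps.

(** * Transversality *)

Section LinearTerms.
Context {R : realType}.
Local Notation C := R[i].

Definition unit_index n (i : 'I_n) : mindex n := [ffun k => (k == i : nat)].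
Definition zero_index n : mindex n := [ffun=> 0%N].

Lemma mdeg_zero n : mdeg (zero_index n) = 0%N.
Proof. by rewrite /mdeg big1 // => i _; rewrite ffunE. Qed.

Lemma mdeg_unit n (i : 'I_n) : mdeg (unit_index i) = 1%N.
Proof.
by rewrite /mdeg (bigD1 i) //= ffunE eqxx big1 // => k /negbTE ki; rewrite ffunE ki.
Qed.

Lemma mdeg_eq0 n (a : mindex n) : (mdeg a == 0%N) = (a == zero_index n).
Proof.
apply/eqP/eqP => [|->]; last exact: mdeg_zero.
move=> /eqP; rewrite /mdeg sum_nat_eq0 => /forallP a0.
by apply/ffunP => i; rewrite ffunE; apply/eqP; exact: (a0 i).
Qed.

Lemma mdeg_le1 n (a : mindex n) : (mdeg a <= 1)%N =
  (a \in zero_index n :: [seq unit_index i | i <- enum 'I_n]).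
Proof.
rewrite in_cons -mdeg_eq0; case: eqP => [-> //|/eqP a0] /=.
apply/idP/mapP => [a1|[i _ ->]]; last by rewrite mdeg_unit.
have {a1} aE : mdeg a = 1%N by apply/eqP; rewrite eqn_leq a1 lt0n.
have [i ai] : exists i, a i != 0%N.
  apply/existsP; rewrite -negb_forall; apply: contra a0 => /forallP H.
  by rewrite /mdeg big1 // => i _; apply/eqP; exact: H.
exists i; first by rewrite mem_enum.
move: aE; rewrite /mdeg (bigD1 i) //= => aE.
have ai1 : a i = 1%N by move: ai aE; case: (a i) => [|[|k]].
have /eqP : (\sum_(k | k != i) a k = 0)%N by move: aE; rewrite ai1 add1n => -[].
rewrite sum_nat_eq0 => /forallP H; apply/ffunP => k; rewrite ffunE.
by case: eqVneq => [->|/(implyP (H k))/eqP].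
Qed.

Lemma sum_mindices1 n (X : mindex n -> C) :
  \sum_(a <- mindices n 1) X a = X (zero_index n) + \sum_i X (unit_index i).
Proof.
have uinj : injective (@unit_index n).
  move=> i j /(congr1 (fun a : mindex n => a i)); rewrite !ffunE eqxx.
  by case: eqP.
have p : perm_eq (mindices n 1) (zero_index n :: [seq unit_index i | i <- enum 'I_n]).
  apply: uniq_perm => [||a]; first exact: uniq_mindices.
    rewrite /= map_inj_uniq ?enum_uniq // andbT; apply/mapP => -[i _ e].
    by have := congr1 (@mdeg n) e; rewrite mdeg_zero mdeg_unit.
  by rewrite mem_mindices mdeg_le1.
by rewrite (perm_big _ p) big_cons big_map big_enum.
Qed.

Lemma sum_mindices0 n (X : mindex n -> C) : \sum_(a <- mindices n 0) X a = X (zero_index n).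
Proof.
have p : perm_eq (mindices n 0) [:: zero_index n].
  apply: uniq_perm => [||a] //; first exact: uniq_mindices.
  by rewrite mem_mindices leqn0 mdeg_eq0 inE.
by rewrite (perm_big _ p) big_seq1.
Qed.

Lemma fps_mul0 n (f g : fps (R := R) n) :
  fps_mul f g (zero_index n) = f (zero_index n) * g (zero_index n).
Proof.
rewrite /fps_mul mdeg_zero big_mkcond sum_mindices0 ifT.
  by congr (_ * g _); apply/ffunP => k; rewrite !ffunE.
by apply/forallP => k; rewrite !ffunE.
Qed.

Lemma fps_mul1 n (f g : fps (R := R) n) i : fps_mul f g (unit_index i) =
  f (zero_index n) * g (unit_index i) + f (unit_index i) * g (zero_index n).
Proof.
rewrite /fps_mul mdeg_unit big_mkcond sum_mindices1 ifT; last first.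
  by apply/forallP => k; rewrite !ffunE.
congr (_ * g _ + _); first by apply/ffunP => k; rewrite !ffunE subn0.
rewrite (bigD1 i) //= big1 ?addr0 => [|k ki].
  rewrite ifT; last by apply/forallP => k.
  by congr (_ * g _); apply/ffunP => k; rewrite !ffunE subnn.
rewrite ifF //; apply/negP => /forallP /(_ k); rewrite !ffunE eqxx.
by rewrite (negbTE ki).
Qed.

Lemma fps_one0 n : fps_one (R := R) (zero_index n) = 1.
Proof. by rewrite /fps_one mdeg_zero. Qed.

Lemma fps_one1 n (i : 'I_n) : fps_one (R := R) (unit_index i) = 0.
Proof. by rewrite /fps_one mdeg_unit. Qed.

Lemma fps_mul1f n (f : fps (R := R) n) : fps_mul (@fps_one R n) f = f.
Proof.
apply/funext => c; rewrite /fps_mul.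
have z : zero_index n \in mindices n (mdeg c) by rewrite mem_mindices mdeg_zero.
rewrite big_mkcond (bigD1_seq (zero_index n)) ?uniq_mindices //= ifT; last first.
  by apply/forallP => k; rewrite ffunE.
rewrite fps_one0 mul1r big1 => [|a a0].
  by rewrite addr0; congr f; apply/ffunP => k; rewrite !ffunE subn0.
by case: ifP => // _; rewrite /fps_one mdeg_eq0 (negbTE a0) mul0r.
Qed.

Lemma fps_subst0 m' n (F : fps (R := R) m') (G : 'I_m' -> fps (R := R) n) :
  F (zero_index m') = 0 -> fps_subst F G (zero_index n) = 0.
Proof. by move=> F0; rewrite /fps_subst mdeg_zero sum_mindices0 F0 mul0r. Qed.

(** Only the linear part of F contributes to degree one, because its constant term vanishes and
    [fps_subst] truncates at the degree of the coefficient. *)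
Lemma fps_subst1 m' n (F : fps (R := R) m') (G : 'I_m' -> fps (R := R) n) i :
  F (zero_index m') = 0 ->
  fps_subst F G (unit_index i) = \sum_k F (unit_index k) * G k (unit_index i).
Proof.
move=> F0; rewrite /fps_subst mdeg_unit sum_mindices1 F0 mul0r add0r.
apply: eq_bigr => k _; congr (_ * _).
pose T l := iter (unit_index k l) (fps_mul (G l)) (@fps_one R n).
have Tk : T k (zero_index n) = G k (zero_index n) /\ T k (unit_index i) = G k (unit_index i).
  rewrite /T ffunE eqxx /= fps_mul0 fps_mul1 fps_one0 fps_one1.
  by rewrite !mulr1 mulr0 add0r.
suff H (s : seq 'I_m') : uniq s -> let P := \big[@fps_mul R n/@fps_one R n]_(l <- s) T l in
    P (zero_index n) = (if k \in s then G k (zero_index n) else 1) /\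
    P (unit_index i) = if k \in s then G k (unit_index i) else 0.
  by have [_] := H (index_enum _) (index_enum_uniq _); rewrite mem_index_enum.
elim: s => [|l s IH] /=; first by rewrite big_nil fps_one0 fps_one1.
case/andP=> ls /IH[h0 h1]; rewrite big_cons fps_mul0 fps_mul1 h0 h1 in_cons.
case: (eqVneq k l) => [kl|kl] /=.
  by move: ls; rewrite -kl => ls; have [-> ->] := Tk; rewrite (negbTE ls) !mulr1 mulr0 add0r.
have -> : T l = @fps_one R n by rewrite /T ffunE eq_sym (negbTE kl).
by rewrite fps_one0 fps_one1 !mul1r mul0r addr0.
Qed.

Lemma miter_unit n T (Dd : 'I_n -> T -> T) i f : miter Dd (unit_index i) f = Dd i f.
Proof.
rewrite /miter; suff H s : uniq s -> foldr (fun k g => iter (unit_index i k) (Dd k) g) f s =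
    if i \in s then Dd i f else f by rewrite H ?enum_uniq // mem_enum.
elim: s => //= l s IH /andP[ls /IH ->]; rewrite in_cons ffunE.
case: (eqVneq l i) => [li|] //=.
by rewrite -li (negbTE ls).
Qed.

Lemma taylor0 n (f : 'rV[C]_n -> C) p : taylor f p (zero_index _) = f p.
Proof.
rewrite /taylor /miter (_ : mfact _ = 1%N) ?divr1; last first.
  by rewrite /mfact big1 // => k _; rewrite ffunE.
congr (_ p); elim: (enum _) => //= k s ->; by rewrite ffunE.
Qed.

Lemma taylor1 n (f : 'rV[C]_n -> C) p j : taylor f p (unit_index (lshift n j)) = dZ j f p.
Proof.
rewrite /taylor (_ : mfact _ = 1%N) ?divr1; last first.
  by rewrite /mfact big1 // => k _; rewrite ffunE; case: (_ == _).
by rewrite miter_unit (unsplitK (inl j)).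
Qed.

Lemma fps_Z1 n (h : fps (R := R) n) j : fps_Z h (unit_index (lshift n j)) = h (unit_index j).
Proof.
rewrite /fps_Z ifT; last by apply/forallP => k; rewrite ffunE eq_rlshift.
by congr h; apply/ffunP => k; rewrite !ffunE eq_lshift.
Qed.

Lemma fps_zeta1 n (h : fps (R := R) n) j : fps_zeta h (unit_index (lshift n j)) = 0.
Proof. by rewrite /fps_zeta ifF //; apply/negP => /forallP /(_ j); rewrite ffunE eqxx. Qed.

Lemma pullback1 n n' (rho' : 'rV[C]_n' -> R) q (h : 'I_n' -> fps (R := R) n) j : rho' q = 0 ->
  fps_pullback rho' q h (zero_index _) = 0 /\
  fps_pullback rho' q h (unit_index (lshift n j)) =
    \sum_i dZ i (toC rho') q * h i (unit_index j).
Proof.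
move=> q0; have F0 : taylor (toC rho') q (zero_index _) = 0 by rewrite taylor0 /toC q0.
split; first exact: fps_subst0.
rewrite /fps_pullback fps_subst1 // big_split_ord /= [X in _ + X]big1 ?addr0 => [|i _].
  by apply: eq_bigr => i _; rewrite taylor1 (unsplitK (inl i)) fps_Z1.
by rewrite (unsplitK (inr i)) fps_zeta1 mulr0.
Qed.

End LinearTerms.

Section TransversalFactor.
Context {R : realType}.
Local Notation C := R[i].
Variables (N N' : nat) (M : set 'rV[C]_N) (M' : set 'rV[C]_N') (p0 : 'rV[C]_N).
Variables (U : set 'rV[C]_N) (rho : 'rV[C]_N -> R) (m : 'I_N).
Hypothesis D : defining M p0 U rho.
Hypothesis Mp0 : M p0.
Hypothesis rm0 : wder (inl m) (toC rho) p0 != 0.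
Variables (H G : 'rV[C]_N -> 'rV[C]_N') (V : set 'rV[C]_N).
Hypothesis crH : CR_map M M' H.
Hypothesis extG : local_ext M p0 H V G.
Variables (U1 : set 'rV[C]_N') (rho1 : 'rV[C]_N' -> R) (jm : 'I_N').
Hypothesis D1 : defining M' (H p0) U1 rho1.
Hypothesis rj0 : wder (inl jm) (toC rho1) (H p0) != 0.
Local Notation gm := (gm M p0).
Local Notation ev := (@gev R N M p0).
Local Notation tP := (@tP R N M p0 rho m).
Local Notation tL := (@tL R N M p0 rho m).

(** The affine part of the formal map is a CR function with the same 1-jet at p0 along curves in M.
    By [contact_flat] the difference is flat to order 2, so both have the same P_m-derivative, and
    P_m Z_k is 1 for k = m and 0 otherwise. *)
Lemma formal_map_linear h i : formal_map M p0 H h ->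
  ev (tP m (gm (fun q => G q 0 i))) = h i (unit_index m).
Proof.
move=> [h0 /(_ 1%N) jet].
pose x : germ M p0 := gcst M p0 (H p0 0 i) +
  \sum_k gcst M p0 (h i (unit_index k)) * (gZ M p0 k - gcst M p0 (p0 0 k)).
pose f2 (z : 'rV[C]_N) : C := H p0 0 i + \sum_k h i (unit_index k) * (z 0 k - p0 0 k).
have sk k : Sm p0 (fun z : 'rV[C]_N => z 0 k - p0 0 k) by exact: (SmB (Sm_coord _ _) (Sm_cst _ _)).
have st k : Sm p0 (fun z : 'rV[C]_N => h i (unit_index k) * (z 0 k - p0 0 k)).
  exact: (SmM (Sm_cst _ _) (sk k)).
have ss : Sm p0 (fun z : 'rV[C]_N => \sum_k h i (unit_index k) * (z 0 k - p0 0 k)).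
  by apply: Sm_sum => k _; exact: st.
have s2 : Sm p0 f2 by exact: (SmD (Sm_cst _ _) ss).
have xE : gm f2 = x.
  rewrite /f2 (gmD M (Sm_cst _ _) ss) gm_sum => [|k _]; last exact: st.
  congr (_ + _); apply: eq_bigr => k _.
  by rewrite (gmM M (Sm_cst _ _) (sk k)) (gmB M (Sm_coord _ _) (Sm_cst _ _)).
have Tx t : tT (M := M) (p0 := p0) rho m t x = \sum_k gcst M p0 (h i (unit_index k)) * (t == inl k)%:R.
  have dt := tT_deriv D Mp0 rm0 t; have tc := tT_cst D Mp0 rm0 t.
  rewrite /x dt.1 tc add0r (derivation_sum _ _ _ dt); apply: eq_bigr => k _.
  rewrite dt.2 tc mul0r add0r (derivationB _ _ dt) tc subr0; congr (_ * _).
  exact: (tT_gZ D Mp0 rm0).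
have Lx j : tL j (gm f2) = 0.
  by rewrite xE; apply: (etrans (Tx (inr j))); rewrite big1 // => k _; rewrite mulr0.
have sG := ext_Sm extG i.
have fl : flat ev tP tL 2 (gm (fun q => G q 0 i) - gm f2).
  apply: (contact_flat D Mp0 rm0 sG s2 (fun j => CR_germ D Mp0 rm0 j i crH extG) Lx).
  move=> gam sg g0 gM l lk; rewrite (ext_jet l i extG sg g0 gM) (jet gam sg g0 gM l i lk).
  congr (iter _ _ _ _); apply/funext => t.
  rewrite !mxE sum_mindices1 h0 mul0r add0r; congr (_ + _); apply: eq_bigr => k _; congr (_ * _).
  rewrite (bigD1 k) //= ffunE eqxx expr1 big1 ?mulr1 // => k1 /negbTE k1k.
  by rewrite ffunE k1k expr0.
have [_ /(_ (inl m)) [E _]] := fl.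
have dP := tP_deriv D Mp0 rm0 m.
move: E; rewrite /= (derivationB _ _ dP) rmorphB => /eqP; rewrite subr_eq0 => /eqP ->.
rewrite xE; apply: (etrans (congr1 ev (Tx (inl m)))).
rewrite (bigD1 m) //= eqxx mulr1 big1 ?addr0 => [|k]; first exact: gev_cst.
by rewrite eq_sym => /negbTE km; rewrite (_ : (_ == _) = false) ?mulr0.
Qed.

(** The Taylor series of a defining function of M is a multiple of the pulled-back series, which has
    no constant term. So at Z_m its linear coefficient is a multiple of the factor; were the factor
    zero, the derivative of the defining function in Z_m would vanish. *)
Lemma transversal_factor : CR_transversal M M' H p0 ->
  \sum_i wder (inl i) (toC rho1) (H p0) * ev (tP m (gm (fun q => G q 0 i))) != 0.
Proof.
move=> [U3 [rho3 [U4 [rho4 [h [D3 D4 fm ideal]]]]]].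
have M'q : M' (H p0) by exact: crH.1.
have [[_ U4q] _ _ MU4] := D4; have q40 : rho4 (H p0) = 0 by apply/(MU4 _ U4q).
have [g0 g1] := pullback1 h m q40.
have : fps_ideal (taylor (toC rho3) p0) (taylor (toC rho3) p0).
  by exists (@fps_one R _); rewrite fps_mul1f.
rewrite -ideal => -[b bE].
have := congr1 (fun f : fps (N + N) => f (unit_index (lshift N m))) bE.
rewrite taylor1 fps_mul1 g0 mulr0 addr0 g1 => E.
apply/eqP => H0; have := gradient_ratio_neq0 D D3 Mp0 rm0.
rewrite -[wder _ _ _]/(dZ m (toC rho3) p0) E; apply/negP; rewrite negbK.
rewrite (_ : \sum_i _ = 0) ?mulr0 //.
transitivity (wder (inl jm) (toC rho4) (H p0) / wder (inl jm) (toC rho1) (H p0) *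
  \sum_i wder (inl i) (toC rho1) (H p0) * ev (tP m (gm (fun q => G q 0 i)))); last by rewrite H0 mulr0.
rewrite mulr_sumr; apply: eq_bigr => i _.
rewrite (formal_map_linear i fm) mulrA; congr (_ * _).
exact: (gradient_ratio D1 D4 M'q rj0 (inl i)).
Qed.

End TransversalFactor.

Section ChangeOfDefiningFunction.
Context {R : realType}.
Local Notation C := R[i].
Variables (N : nat) (M : set 'rV[C]_N) (q : 'rV[C]_N).
Variables (U : set 'rV[C]_N) (rho : 'rV[C]_N -> R) (j : 'I_N).
Hypothesis D : defining M q U rho.
Hypothesis Mq : M q.
Hypothesis r0 : wder (inl j) (toC rho) q != 0.

Lemma levi_nondegenerate_change : levi_nondegenerate M q ->
  forall v, holo_tangent rho q v ->
    (forall w, holo_tangent rho q w -> levi rho q v w = 0) -> v = 0.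
Proof.
move=> [U2 [rho2 [D2 nd]]] v v0 H; apply: nd.
  exact: (holo_tangent_change D D2 Mq r0 v0).
have r2 := gradient_ratio_neq0 D D2 Mq r0.
move=> w w2; have w0 := holo_tangent_change D2 D Mq r2 w2.
by rewrite (levi_change D D2 Mq r0 v0 w0) (H w w0) mulr0.
Qed.

Lemma pseudoconvex_change : strictly_pseudoconvex M q ->
  forall v, holo_tangent rho q v -> levi rho q v v = 0 -> v = 0.
Proof.
move=> [U2 [rho2 [D2 pos]]] v v0 vv; apply/eqP; apply: contraT => vn0.
have := pos v vn0 (holo_tangent_change D D2 Mq r0 v0).
by rewrite (levi_change D D2 Mq r0 v0 v0) vv mulr0 ltxx.
Qed.

Definition grad_col : 'cV[C]_N := \col_k wder (inl k) (toC rho) q.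

Lemma holo_tangentE v : holo_tangent rho q v <-> v *m grad_col = 0.
Proof.
have E : (v *m grad_col) 0 0 = \sum_k v 0 k * dZ k (toC rho) q.
  by rewrite mxE; apply: eq_bigr => k _; rewrite mxE.
split=> [v0|v0]; last by rewrite /holo_tangent -E v0 mxE.
by apply/matrixP => a b; rewrite !ord1 E v0 mxE.
Qed.

Lemma grad_col_neq0 : grad_col != 0.
Proof. by apply: contra r0 => /eqP /colP /(_ j); rewrite !mxE => ->. Qed.

End ChangeOfDefiningFunction.

Lemma defining_grad (R : realType) N (M : set 'rV[R[i]]_N) p U rho : defining M p U rho ->
  exists j, wder (inl j) (toC rho) p != 0.
Proof.
move=> [[_ Up] _ grad _]; apply: contrapT => H; apply: (elimN eqP (grad p Up)).
apply/rowP => j; rewrite mxE [RHS]mxE; apply/eqP; apply: contraT => h.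
by exfalso; apply: H; exists j.
Qed.

(** * The pullback homomorphism and anisotropy for the given maps *)

Section PulledFunction.
Context {R : realType}.
Local Notation C := R[i].
Variables (N N' : nat) (M : set 'rV[C]_N) (M' : set 'rV[C]_N') (p0 : 'rV[C]_N).
Variables (U : set 'rV[C]_N) (rho : 'rV[C]_N -> R) (m : 'I_N).
Hypothesis D : defining M p0 U rho.
Hypothesis Mp0 : M p0.
Hypothesis rm0 : wder (inl m) (toC rho) p0 != 0.
Variables (H G : 'rV[C]_N -> 'rV[C]_N') (V : set 'rV[C]_N) (q0 : 'rV[C]_N').
Hypothesis crH : CR_map M M' H.
Hypothesis extG : local_ext M p0 H V G.
Hypothesis Hq0 : H p0 = q0.
Variables (U1 : set 'rV[C]_N') (rho1 : 'rV[C]_N' -> R).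
Hypothesis D1 : defining M' q0 U1 rho1.
Local Notation gm := (gm M p0).
Local Notation ev := (@gev R N M p0).
Local Notation tP := (@tP R N M p0 rho m).
Local Notation tL := (@tL R N M p0 rho m).

Definition rho_germ : germ (@setT 'rV[C]_N') q0 := germ_of setT q0 (toC rho1).
Definition comp_germ i := gm (fun q => G q 0 i).

Lemma ext_base : G p0 = q0.
Proof. by have [[_ Vp] _ GH] := extG; rewrite (GH p0 Vp Mp0). Qed.

Lemma pulled_function : exists e : {rmorphism germ (@setT 'rV[C]_N') q0 -> germ M p0},
  [/\ forall t f, tang tP tL t (e f) = \sum_i e (gW i f) * tang tP tL t
        (match i with inl k => comp_germ k | inr k => gconj (comp_germ k) end),
      forall i, e (gW (inl i) rho_germ) = grad_germ M p0 G rho1 i, e rho_germ = 0,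
      forall i, gconj (e (gW (inl i) rho_germ)) = e (gW (inr i) rho_germ) &
      forall x, ev (e x) = gev x].
Proof.
have [e [eE ch]] := pull_exists D Mp0 rm0 (ext_Sm extG) ext_base.
have s1 := Sm_rho D1; have sw s := Sm_wder s s1.
have gWE s : gW s rho_germ = germ_of setT q0 (wder s (toC rho1)) by exact: (gW_gm s s1).
have sc f : smooth_at q0 f -> Sm p0 (fun q => f (G q)) by exact: (ext_comp_Sm extG ext_base).
have near := ext_near extG ext_base (fun q => @crH.1 q).
have [pU1 _ _ MU] := D1.
exists e; split.
- by move=> [k|k] f; [exact: (ch (inl k) f)|exact: (ch (inr k) f)].
- by move=> i; rewrite gWE eE //; exact: sw.
- rewrite /rho_germ (eE _ s1) -(rmorph0 (gcst M p0)).
  apply/gm_eq; [exact: sc|exact: Sm_cst|].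
  have [W [pW HW]] := near U1 pU1; exists W; split=> // q Wq Mq0.
  have Mq : M q by case: Mq0 => [//|->].
  have [U1q M'q] := HW q Wq Mq; rewrite /toC; have /(MU _ U1q) -> := M'q; exact: erefl.
- move=> i; rewrite !gWE (eE _ (sw (inl i))) (eE _ (sw (inr i))).
  apply: (etrans (gconj_gm M (sc _ (sw (inl i))))).
  apply/gm_eq; [exact: (SmJ (sc _ (sw _)))|exact: (sc _ (sw _))|].
  have [W [pW HW]] := near U1 pU1; exists W; split=> // q Wq Mq0.
  have Mq : M q by case: Mq0 => [//|->].
  have [U1q _] := HW q Wq Mq; exact: (r_conjl D1 i U1q).
move=> x; have [f sf ->] := gm_surj x.
by rewrite (eE f sf) (gev_gm M (sc f sf)) ext_base; exact: (esym (gev_gm setT sf)).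
Qed.

Lemma gev_hessian i l : gev (gW (inl i) (gW (inr l) rho_germ)) = dZ i (dZb l (toC rho1)) q0.
Proof.
have s1 := Sm_rho D1.
have -> : gW (inr l) rho_germ = germ_of setT q0 (wder (inr l) (toC rho1)) by exact: (gW_gm _ s1).
rewrite (gW_gm (inl i) (Sm_wder (inr l) s1)); exact: (gev_gm setT (Sm_wder _ (Sm_wder _ s1))).
Qed.

Lemma gev_gradient i : gev (gW (inl i) rho_germ) = wder (inl i) (toC rho1) q0.
Proof.
rewrite /rho_germ (gW_gm (inl i) (Sm_rho D1)); exact: (gev_gm setT (Sm_wder _ (Sm_rho D1))).
Qed.

End PulledFunction.

(** The empty word in the hypothesis on x gives tangency to M'. Then strict pseudoconvexity applies
    directly; in the other case the remaining words give orthogonality to the image of dH, and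
    [nondegenerate_aniso] applies with the transverse factor as b. *)
Lemma levi_anisotropic (R : realType) (N N' : nat) (M : set 'rV[R[i]]_N) (M' : set 'rV[R[i]]_N')
    (p0 : 'rV[R[i]]_N) (U : set 'rV[R[i]]_N) (rho : 'rV[R[i]]_N -> R) (m : 'I_N)
    (H G : 'rV[R[i]]_N -> 'rV[R[i]]_N') (V : set 'rV[R[i]]_N)
    (U1 : set 'rV[R[i]]_N') (rho1 : 'rV[R[i]]_N' -> R) (jm : 'I_N')
    (e : {rmorphism germ (@setT 'rV[R[i]]_N') (H p0) -> germ M p0}) (x : 'rV[R[i]]_N') :
  defining M p0 U rho -> M p0 -> wder (inl m) (toC rho) p0 != 0 ->
  CR_map M M' H -> local_ext M p0 H V G -> defining M' (H p0) U1 rho1 ->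
  wder (inl jm) (toC rho1) (H p0) != 0 ->
  (forall t f, tang (tP rho m) (tL rho m) t (e f) = \sum_i e (gW i f) * tang (tP rho m) (tL rho m) t
     (match i with inl k => comp_germ M p0 G k | inr k => gconj (comp_germ M p0 G k) end)) ->
  e (rho_germ (H p0) rho1) = 0 -> (forall y, gev (e y) = gev y) ->
  strictly_pseudoconvex M' (H p0) \/
    [/\ N' = N.+1, levi_nondegenerate M p0, levi_nondegenerate M' (H p0) & CR_transversal M M' H p0] ->
  (forall w, \sum_i gev (word (tL rho m) w (e (gW (inl i) (rho_germ (H p0) rho1)))) * x 0 i = 0) ->
  \sum_i \sum_l gev (e (gW (inl i) (gW (inr l) (rho_germ (H p0) rho1)))) * x 0 i *
    Num.conj (x 0 l) = 0 -> x = 0.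
Proof.
move=> D Mp0 rm0 crH extG D1 rj0 chain eb eve P12 xk xx.
have M'q : M' (H p0) by exact: crH.1.
have xt : holo_tangent rho1 (H p0) x.
  rewrite /holo_tangent -[RHS](xk [::]); apply: eq_bigr => i _.
  by rewrite /= eve (gev_gradient D1) mulrC.
have levi_e v w : levi rho1 (H p0) v w =
    sesq (levimx' (@gW R N' (H p0)) e (rho_germ (H p0) rho1)) v w.
  rewrite sesqE; apply: eq_bigr => i _; apply: eq_bigr => l _.
  by rewrite mxE eve (gev_hessian D1).
have lxx : levi rho1 (H p0) x x = 0.
  rewrite levi_e sesqE -[RHS]xx; apply: eq_bigr => i _; apply: eq_bigr => l _.
  by rewrite mxE.
case: P12 => [sp|[EN nd nd' tr]]; first exact: (pseudoconvex_change D1 M'q rj0 sp xt lxx).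
subst N'.
have LH i j : tL rho m j (comp_germ M p0 G i) = 0 by exact: (CR_germ D Mp0 rm0 j i crH extG).
have delC := @gWC R N.+1 (H p0).
pose b := rho_germ (H p0) rho1.
have fE : gev (transverse_factor rho m (@gW R N.+1 (H p0)) e (comp_germ M p0 G) b) =
    \sum_i wder (inl i) (toC rho1) (H p0) * gev (tP rho m m (comp_germ M p0 G i)).
  rewrite rmorph_sum; apply: eq_bigr => i _; apply: (etrans (rmorphM _ _ _)).
  by congr (_ * _); apply: (etrans (eve _)); exact: (gev_gradient D1).
apply: (@nondegenerate_aniso R[i] N (grad_col p0 rho) (grad_col (H p0) rho1)
  (dmx rho m (comp_germ M p0 G)) (levimx p0 rho) (levimx' (@gW R N.+1 (H p0)) e b)
  (wder (inl m) (toC rho) p0)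
  (gev (transverse_factor rho m (@gW R N.+1 (H p0)) e (comp_germ M p0 G) b)) x).
- exact: (grad_col_neq0 rm0).
- exact: (grad_col_neq0 rj0).
- by rewrite fE; exact: (transversal_factor D Mp0 rm0 crH extG D1 rj0 tr).
- move=> v w /holo_tangentE v0 /holo_tangentE w0; rewrite -levi_sesq.
  exact: (levi'_dmx D Mp0 rm0 delC chain LH eb v0 w0).
- move=> v _; apply/holo_tangentE.
  rewrite /holo_tangent -[RHS](dmx_tangent D Mp0 rm0 chain LH eb v).
  by apply: eq_bigr => i _; rewrite eve (gev_gradient D1).
- move=> v /holo_tangentE v0 Hw; apply: (levi_nondegenerate_change D Mp0 rm0 nd v0).
  by move=> w /holo_tangentE w0; rewrite levi_sesq; exact: Hw.
- move=> v /holo_tangentE v0 Hw; apply: (levi_nondegenerate_change D1 M'q rj0 nd' v0).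
  by move=> w /holo_tangentE w0; rewrite levi_e; exact: Hw.
- by apply/holo_tangentE.
- by move=> w _; exact: (kernel_orthogonal delC chain LH w xk).
- by rewrite -levi_e.
Qed.

Lemma CR_words_flat (F : numFieldType) (A : comNzRingType) (ev : {rmorphism A -> F}) n
    (P L : 'I_n -> A -> A) K f :
  (forall j, derivation (P j)) -> (forall j, derivation (L j)) ->
  (forall j k x, L j (P k x) = P k (L j x)) -> (forall j, L j f = 0) ->
  (forall w, ev (word P w f) = 0) -> flat ev P L K f.
Proof.
move=> dP dL PL; elim: K f => //= K IH f Lf H; split; first exact: (H [::]).
case=> j /=; last by rewrite Lf; apply: dflat0; [exact: d_tang|exact: rmorph0].
apply: IH => [i|w]; first by rewrite PL Lf derivation0.
by have := H (rcons w j); rewrite /word foldr_rcons.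
Qed.

Lemma rows_annihilating (A B : comNzRingType) n p r (L : 'I_n -> A -> A)
    (del : 'I_p + 'I_p -> B -> B) (b : B) (al : 'I_r -> seq 'I_n) (E : B -> A) :
  (forall w, exists c : 'rV[A]_r, forall i,
     word L w (E (del (inl i) b)) = \sum_t c 0 t * word L (al t) (E (del (inl i) b))) ->
  annihilating L del b al E.
Proof.
move=> gen y y0 w; have [c cE] := gen w.
under eq_bigr do rewrite cE mulr_suml.
rewrite exchange_big /= big1 // => t _.
have e : (rowsmx L del b al E *m y) t 0 = 0 by rewrite y0 mxE.
transitivity (c 0 t * (rowsmx L del b al E *m y) t 0); last by rewrite e mulr0.
by rewrite mxE mulr_sumr; apply: eq_bigr => i _; rewrite mxE mulrA.
Qed.

Lemma rows_kernel (F : fieldType) (A B : comNzRingType) (ev : {rmorphism A -> F}) n p r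
    (L : 'I_n -> A -> A) (del : 'I_p + 'I_p -> B -> B) (b : B) (al : 'I_r -> seq 'I_n)
    (E : B -> A) (x : 'cV[F]_p) :
  (forall w, exists c : 'rV[A]_r, forall i,
     word L w (E (del (inl i) b)) = \sum_t c 0 t * word L (al t) (E (del (inl i) b))) ->
  map_mx ev (rowsmx L del b al E) *m x = 0 ->
  forall w, \sum_i ev (word L w (E (del (inl i) b))) * x i 0 = 0.
Proof.
move=> gen x0 w; have [c cE] := gen w.
under eq_bigr do rewrite cE rmorph_sum mulr_suml.
rewrite exchange_big /= big1 // => t _.
have e : (map_mx ev (rowsmx L del b al E) *m x) t 0 = 0 by rewrite x0 mxE.
transitivity (ev (c 0 t) * (map_mx ev (rowsmx L del b al E) *m x) t 0); last by rewrite e mulr0.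
rewrite mxE mulr_sumr; apply: eq_bigr => i _; rewrite rmorphM -mulrA; congr (_ * (_ * _)).
by rewrite !mxE.
Qed.

Lemma nearM_nbhs (R : realType) N (M : set 'rV[R[i]]_N) p (Q : 'rV[R[i]]_N -> Prop) :
  (\forall q \near p, M q -> Q q) -> nearM M p Q.
Proof.
move=> h; have : nbhs p [set q | M q -> Q q] by exact: h.
by rewrite nbhsE => -[W pW HW]; exists W; split=> // q Wq Mq; exact: HW.
Qed.

Lemma same_jet_value (R : realType) N N' (M : set 'rV[R[i]]_N) p k
    (H H' : 'rV[R[i]]_N -> 'rV[R[i]]_N') : M p -> same_jet M p k H H' -> H p = H' p.
Proof.
move=> Mp jet; apply/rowP => j.
have sc : smooth_curve (fun=> p) by apply/smooth_curve_csm => i d n; exact: csm_cst.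
exact: (jet (fun=> p) sc erefl (fun=> Mp) 0%N j (leq0n _)).
Qed.

Theorem theorem7 (R : realType) (N N' : nat)
    (M : set 'rV[R[i]]_N) (M' : set 'rV[R[i]]_N') (p0 : 'rV[R[i]]_N)
    (H H' : 'rV[R[i]]_N -> 'rV[R[i]]_N') (k0 s : nat)
    (M_hyp : real_hypersurface M) (M_conn : connected M)
    (M'_hyp : real_hypersurface M') (M'_conn : connected M')
    (p0_in : M p0) (M_ft : finite_type M p0)
    (H_CR : CR_map M M' H) (H'_CR : CR_map M M' H')
    (H_deg : constantly_degenerate M M' H p0 k0 s)
    (H'_deg : constantly_degenerate M M' H' p0 k0 s)
    (jets : same_jet M p0 (2 * k0) H H')
    (P12 : strictly_pseudoconvex M' (H p0) \/
           [/\ N' = N.+1, levi_nondegenerate M p0,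
               levi_nondegenerate M' (H p0) & CR_transversal M M' H p0]) :
  forall l : nat, same_jet M p0 l H H'.
Proof.
have HH' : H' p0 = H p0 := esym (same_jet_value p0_in jets).
have [U [rho D]] := M_hyp p0 p0_in.
have [m rm0] := defining_grad D.
have [V [G [U1 [rho1 [Ld [[extG D1 _ basis] deg near_deg]]]]]] := H_deg.
have [V2 [G2 [U2 [rho2 [Ld2 [[extG2 D2 _ basis2] _ near_deg2]]]]]] := H'_deg.
rewrite HH' in D2.
have [jm rj0] := defining_grad D1.
have Gq := ext_base p0_in extG erefl; have Gq2 := ext_base p0_in extG2 HH'.
(* The defining function belonging to H is used for both maps; this is possible since they have the
   same value at p0. *)
pose b := rho_germ (H p0) rho1.
have [e [chain egrad eb ce eve]] := pulled_function D p0_in rm0 H_CR extG erefl D1.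
have [e2 [chain2 egrad2 eb2 ce2 eve2]] := pulled_function D p0_in rm0 H'_CR extG2 HH' D1.
set P := tP rho m in chain chain2; set L := tL rho m in chain chain2.
have HM q : M q -> M' (H q) by exact: H_CR.1.
have HM2 q : M q -> M' (H' q) by exact: H'_CR.1.
have dP := tP_deriv D p0_in rm0; have dL := tL_deriv D p0_in rm0.
have dLb := tLb_deriv D p0_in rm0; have PL := tPL D p0_in rm0.
have LbE := tLbE D p0_in rm0.
have Tcst t x : tang P L t (gcst M p0 x) = 0.
  by case: t => k; exact: (tT_cst D p0_in rm0).
have LH i j : L j (comp_germ M p0 G i) = 0 by exact: (CR_germ D p0_in rm0 j i H_CR extG).
have LH2 i j : L j (comp_germ M p0 G2 i) = 0 by exact: (CR_germ D p0_in rm0 j i H'_CR extG2).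
have contact l : same_jet M p0 l H H' -> forall i,
    flat (@gev R N M p0) P L l.+1 (comp_germ M p0 G i - comp_germ M p0 G2 i).
  move=> jet i; apply: (contact_flat D p0_in rm0 (ext_Sm extG i) (ext_Sm extG2 i)
    (LH i) (LH2 i)) => gam sg g0 gM k kl.
  by rewrite (ext_jet k i extG sg g0 gM) (ext_jet k i extG2 sg g0 gM); exact: jet.
(* Agreement of the 2 k0-jets is flatness to order 2 k0 + 1. *)
have fD : forall i, flat (@gev R N M p0) P L (k0 + k0).+1 (comp_germ M p0 G i - comp_germ M p0 G2 i).
  by rewrite addnn -mul2n; exact: contact.
have [n [al [al_size sn rf]]] := choose_rows D p0_in rm0 D1 rj0 extG Gq HM D1 basis deg.
have gen := rows_generate D p0_in rm0 D1 rj0 extG Gq HM D1 basis sn rf.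
have rowsE (E : germ (@setT 'rV[R[i]]_N') (H p0) -> germ M p0) Gx :
    (forall i, E (gW (inl i) b) = grad_germ M p0 Gx rho1 i) ->
    map_mx (@gev R N M p0) (rowsmx L (@gW R N' (H p0)) b al E) =
    \matrix_(t, i) gev (word L (al t) (grad_germ M p0 Gx rho1 i)).
  by move=> eg; apply/matrixP => t i; rewrite mxE mxE mxE eg.
have rows_free : row_free (map_mx (@gev R N M p0) (rowsmx L (@gW R N' (H p0)) b al e)).
  by rewrite (rowsE _ G egrad).
have evec x : gev (e x) = gev (e2 x) by rewrite eve eve2.
have evc := @gev_conj R N M p0.
(* The rows selected for H remain independent for H': at p0 they involve at most k0 derivatives of
   germs that agree to order 2 k0. *)
have rows_eq := ev_rows (cF := Num.conj) dP dL LbE (@gconjK R N M p0) evc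
  (fun k f => erefl : tLb rho m k f = gconj (L k (gconj f)))
  (fun k f => erefl : tS rho m k f = gconj (P k (gconj f)))
  (tS_comb D p0_in rm0) Tcst (@gWC R N' (H p0)) chain chain2 evec fD al_size rows_free.
have rf2 : row_free (\matrix_(t, i) gev (word L (al t) (grad_germ M p0 G2 rho1 i))).
  by rewrite -(rowsE _ G2 egrad2) rows_eq.
have near1 : nearM M p0 (fun q => degeneracy G rho1 Ld q = s).
  exact: nearM_nbhs near_deg.
have near2 : nearM M p0 (fun q => degeneracy G2 rho2 Ld2 q = s).
  exact: nearM_nbhs near_deg2.
have gen1 w : exists c : 'rV_n, forall i, word L w (e (gW (inl i) b)) =
    \sum_t c 0 t * word L (al t) (e (gW (inl i) b)).
  have [c cE] := gen near1 w; exists c => i; rewrite (egrad i); exact: cE.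
have gen2 w : exists c : 'rV_n, forall i, word L w (e2 (gW (inl i) b)) =
    \sum_t c 0 t * word L (al t) (e2 (gW (inl i) b)).
  have [c cE] := rows_generate D p0_in rm0 D1 rj0 extG2 Gq2 HM2 D2 basis2 sn rf2 near2 w.
  by exists c => i; rewrite (egrad2 i); exact: cE.
have aniso (x : 'cV[R[i]]_N') : map_mx (@gev R N M p0) (rowsmx L (@gW R N' (H p0)) b al e) *m x = 0 ->
    \sum_i \sum_l gev (e (gW (inl i) (gW (inr l) b))) * x i 0 * Num.conj (x l 0) = 0 -> x = 0.
  move=> x0 xx; apply: trmx_inj; rewrite trmx0.
  apply: (levi_anisotropic D p0_in rm0 H_CR extG D1 rj0 chain eb eve P12).
    by move=> w; rewrite -[RHS](rows_kernel gen1 x0 w); apply: eq_bigr => i _; rewrite mxE.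
  by rewrite -[RHS]xx; apply: eq_bigr => i _; apply: eq_bigr => l _; rewrite !mxE.
have null := reflection (cF := Num.conj) dP dL dLb PL LbE (@gconjK R N M p0) evc
  (fun k f => erefl : tLb rho m k f = gconj (L k (gconj f)))
  (fun k f => erefl : tS rho m k f = gconj (P k (gconj f)))
  (tS_comb D p0_in rm0) (@gev_cst R N M p0) Tcst (@gm_local R N M p0) (@gWC R N' (H p0))
  chain chain2 evec eb eb2 ce ce2 LH LH2 fD al_size rows_free (rows_annihilating gen1)
  (rows_annihilating gen2) aniso.
have LD i j : L j (comp_germ M p0 G i - comp_germ M p0 G2 i) = 0.
  exact: (etrans (derivationB _ _ (dL j))
    (etrans (congr2 (fun x y => x - y) (LH i j) (LH2 i j)) (subrr 0))).
(* D is CR and vanishes on the second Segre set, which is nondegenerate by finite type; therefore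
   all its P-words vanish at p0, and so do all its tangential derivatives. *)
have all_flat K i : flat (@gev R N M p0) P L K (comp_germ M p0 G i - comp_germ M p0 G2 i).
  apply: (CR_words_flat _ dP dL PL (LD i)); apply: (segre_flat dP dL dLb (tPP D p0_in rm0)
    (tLL D p0_in rm0) PL (tLbLb D p0_in rm0) LbE (tP_gZ D p0_in rm0) (tL_gZ D p0_in rm0) (LD i)
    (finite_type_segre D p0_in rm0 M_ft) (null i)).
move=> l gam sg g0 gM k j _.
have s1 := ext_Sm extG j; have s2 := ext_Sm extG2 j.
have fl := all_flat k.+1 j; rewrite /comp_germ -(gmB M s1 s2) in fl.
have := flat_curve D p0_in rm0 sg g0 gM (SmB s1 s2) fl (ltnSn k).
rewrite (jet_sub k s1 s2 sg g0) (ext_jet k j extG sg g0 gM) (ext_jet k j extG2 sg g0 gM).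
by move=> /eqP; rewrite subr_eq0 => /eqP.
Qed.
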